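(* Let $\mathbb{G}$ be a locally compact quantum group and let $(N,\Delta_N)$ be a quantum homogeneous space of $\mathbb{G}$. Then the $C^*$-algebraic version $\mathbb{D}$ of $(N,\Delta_N)$ is $\mathbb{G}$-simple, i.e. for any (nonzero) $\mathbb{G}$-$C^*$-algebra $\mathbb{B}$ and any $\mathbb{G}$-morphism $\pi\in\mathrm{Mor}_{\mathbb{G}}(\mathbb{D},\mathbb{B})$ we have $\ker\pi=\{0\}$.
   Context: Conventions. $\mathbb{G}$ is a locally compact quantum group in the sense of Kustermans–Vaes: a von Neumann algebra $L^\infty(\mathbb{G})$ with a normal unital coassociative $*$-homomorphism $\Delta_{\mathbb{G}}:L^\infty(\mathbb{G})\to L^\infty(\mathbb{G})\bar\otimes L^\infty(\mathbb{G})$ admitting left and right invariant normal semifinite faithful weights. $L^2(\mathbb{G})$ is the GNS space of the left invariant weight, and $C_0(\mathbb{G})\subset L^\infty(\mathbb{G})\subset B(L^2(\mathbb{G}))$ is the associated (reduced) $C^*$-algebra. $\mathcal{K}(L^2(\mathbb{G}))$ denotes the compact operators, $\otimes$ is the minimal tensor product of $C^*$-algebras, $\mathrm{M}(A)$ is the multiplier algebra, $\mathrm{Mor}(A,B)$ is the set of nondegenerate $*$-homomorphisms $A\to \mathrm{M}(B)$, and $[\,\cdot\,]$ denotes closed linear span. For a $C^*$-algebra $D$, $\mathcal{L}(L^2(\mathbb{G})\otimes D)$ is the algebra of adjointable operators on the Hilbert $D$-module $L^2(\mathbb{G})\otimes D$, identified with $\mathrm{M}(\mathcal{K}(L^2(\mathbb{G}))\otimes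 D)$. Coaction on a von Neumann algebra. A (left) coaction of $\mathbb{G}$ on $N$ is an injective normal unital $*$-homomorphism $\Delta_N:N\to L^\infty(\mathbb{G})\bar\otimes N$ with $(\iota\otimes\Delta_N)\circ\Delta_N=(\Delta_{\mathbb{G}}\otimes\iota)\circ\Delta_N$. It is ergodic if $\{x\in N:\Delta_N(x)=1\otimes x\}=\mathbb{C}1$. $\mathbb{G}$-$C^*$-algebra. A pair $\mathbb{D}=(C_0(\mathbb{D}),\Delta_{\mathbb{D}})$ where $C_0(\mathbb{D})$ is a $C^*$-algebra and $\Delta_{\mathbb{D}}\in\mathrm{Mor}(C_0(\mathbb{D}),C_0(\mathbb{G})\otimes C_0(\mathbb{D}))$ is injective, satisfies $(\iota\otimes\Delta_{\mathbb{D}})\circ\Delta_{\mathbb{D}}=(\Delta_{\mathbb{G}}\otimes\iota)\circ\Delta_{\mathbb{D}}$, and is continuous: $[\Delta_{\mathbb{D}}(C_0(\mathbb{D}))(C_0(\mathbb{G})\otimes 1)]=C_0(\mathbb{G})\otimes C_0(\mathbb{D})$. A $\mathbb{G}$-morphism $\pi\in\mathrm{Mor}_{\mathbb{G}}(\mathbb{D},\mathbb{B})$ is a $\pi\in\mathrm{Mor}(C_0(\mathbb{D}),C_0(\mathbb{B}))$ with $\Delta_{\mathbb{B}}\circ\pi=(\iota\otimes\pi)\circ\Delta_{\mathbb{D}}$. Strictness. A unital $*$-homomorphism $\pi:N\to\mathcal{L}(\mathcal{E})$ ($\mathcal{E}$ a Hilbert $C^*$-module) is strict if it is $*$-strongly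 continuous on the unit ball of $N$: for every uniformly bounded $*$-strongly convergent net $x_i\in N$ and every $v\in\mathcal{E}$, the nets $\pi(x_i)v$ and $\pi(x_i^* )v$ converge in norm (to the values at the limit). Quantum homogeneous space (QHS). A von Neumann algebra $N$ with an ergodic coaction $\Delta_N:N\to L^\infty(\mathbb{G})\bar\otimes N$ is a quantum homogeneous space of $\mathbb{G}$ if there exists a $\mathbb{G}$-$C^*$-algebra $\mathbb{D}$ such that: (1) $C_0(\mathbb{D})$ is a strongly dense $C^*$-subalgebra of $N$; (2) $\Delta_{\mathbb{D}}$ is the restriction of $\Delta_N$ to $C_0(\mathbb{D})$; (3) $\Delta_N(N)\subset \mathrm{M}(\mathcal{K}(L^2(\mathbb{G}))\otimes C_0(\mathbb{D}))$ and the map $\Delta_N:N\to\mathcal{L}(L^2(\mathbb{G})\otimes C_0(\mathbb{D}))$ is strict. Such a $\mathbb{D}$ is unique and is called the $C^*$-algebraic version of $(N,\Delta_N)$. *)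

(* Defs.v *)
From HB Require Import structures.
From mathcomp Require Import all_boot all_order all_algebra.
From mathcomp Require Import all_classical all_reals all_analysis.
From mathcomp Require Import complex sesquilinear.

Set Implicit Arguments.
Unset Strict Implicit.
Unset Printing Implicit Defensive.

Import Order.TTheory GRing.Theory Num.Theory numFieldNormedType.Exports.

Local Open Scope ring_scope.
Local Open Scope complex_scope.
Local Open Scope classical_set_scope.

(* Operator algebras are represented concretely: a von Neumann algebra acts on
   a Hilbert space and equals its bicommutant, and a C*-algebra is a norm
   closed *-algebra of operators acting nondegenerately on a Hilbert space.
   Every abstract one has such a faithful representation, and multiplier
   algebras and minimal tensor products do not depend on its choice.
   Operators are plain functions; the linear structure on [H -> K] is the
   pointwise one, the product is [\o] and the unit is [idfun]. A morphism
   defined on an algebra is a total function of which only the values on that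
   algebra matter. *)

(* The inner product is linear in its first argument. *)
Record hilbert (R : realType) := Hilbert {
  hcar :> completeNormedModType R[i];
  hdot : {dot hcar for @Num.conj R[i]};
  hnormE : forall x : hcar, `|x| ^+ 2 = hdot x x }.

Notation "''[' x , y ]" := (hdot _ x y) : ring_scope.

Section Operators.
Context {R : realType}.
Implicit Types H K : hilbert R.

Local Notation op H K := (hcar H -> hcar K).

Definition lspan (V : lmodType R[i]) (A : set V) : set V :=
  smallest (fun B => B 0 /\ forall c u v, B u -> B v -> B (c *: u + v)) A.

Definition opnorm_le H K (T : op H K) (M : R[i]) :=
  forall x, `|T x| <= M * `|x|.

Definition bounded_op H K (T : op H K) :=
  linear T /\ exists M, opnorm_le T M.

Definition adj H K (T : op H K) : op K H :=
  xget 0 [set S | forall x y, '[T x, y] = '[x, S y]].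

Definition opclosure H K (A : set (op H K)) : set (op H K) :=
  [set T | bounded_op T /\
           forall e, 0 < e -> exists2 S, A S & opnorm_le (T - S) e].

(* closed linear span, written [ A ] with square brackets in the literature *)
Definition cspan H K (A : set (op H K)) : set (op H K) := opclosure (lspan A).

(* The strong operator topology is the topology of pointwise convergence. *)
Definition strong_closure H (A : set (op H H)) : set (op H H) :=
  closure (A : set {ptws hcar H -> hcar H}).

Definition compact_op H : set (op H H) :=
  [set T | bounded_op T /\ precompact (T @` [set x | `|x| <= 1])].

Definition commutant H (A : set (op H H)) : set (op H H) :=
  [set T | bounded_op T /\ forall S, A S -> T \o S = S \o T].

Record star_alg H (A : set (op H H)) : Prop := {
  star_alg_bounded : A `<=` @bounded_op H H;
  star_alg_0 : A 0;
  star_alg_lin : forall c x y, A x -> A y -> A (c *: x + y);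
  star_alg_mul : forall x y, A x -> A y -> A (x \o y);
  star_alg_adj : forall x, A x -> A (adj x) }.

Definition vn_alg H (M : set (op H H)) :=
  star_alg M /\ commutant (commutant M) = M.

Record cstar_alg H (A : set (op H H)) : Prop := {
  cstar_star : star_alg A;
  cstar_closed : opclosure A `<=` A;
  cstar_nondegenerate :
    closure (lspan [set a h | a in A & h in [set: H]]) = setT }.

(* multiplier algebra of a nondegenerate C*-algebra of operators *)
Definition mult H (A : set (op H H)) : set (op H H) :=
  [set T | bounded_op T /\ forall a, A a -> A (T \o a) /\ A (a \o T)].

Record star_hom H K (A : set (op H H)) (f : op H H -> op K K) : Prop := {
  star_hom_bounded : forall x, A x -> bounded_op (f x);
  star_hom_lin : forall c x y, A x -> A y -> f (c *: x + y) = c *: f x + f y;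
  star_hom_mul : forall x y, A x -> A y -> f (x \o y) = f x \o f y;
  star_hom_adj : forall x, A x -> f (adj x) = adj (f x) }.

(* [mor A B] is the set of morphisms Mor(A, B). *)
Record mor H K (A : set (op H H)) (B : set (op K K))
    (f : op H H -> op K K) : Prop := {
  mor_star_hom : star_hom A f;
  mor_mult : f @` A `<=` mult B;
  mor_nondegenerate : cspan [set f a \o b | a in A & b in B] = B }.

(* the unique extension of a morphism defined on A to the multipliers of A,
   which is used to compose morphisms *)
Definition mult_ext H K (A : set (op H H)) (f : op H H -> op K K) :
    op H H -> op K K :=
  xget f [set F | star_hom (mult A) F /\ forall a, A a -> F a = f a].

Definition ople H (S T : op H H) := forall x, '[S x, x] <= '[T x, x].

Definition positive_part H (M : set (op H H)) : set (op H H) :=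
  [set x | M x /\ ople 0 x].

(* D is an upward directed set of positive elements of M with supremum s *)
Record directed_sup H (M D : set (op H H)) (s : op H H) : Prop := {
  directed_sup_pos : D `<=` positive_part M;
  directed_sup_nonempty : D !=set0;
  directed_sup_dir : forall x y, D x -> D y ->
    exists z, [/\ D z, ople x z & ople y z];
  directed_sup_bounded : bounded_op s;
  directed_sup_ub : forall x, D x -> ople x s;
  directed_sup_least : forall t,
    bounded_op t -> (forall x, D x -> ople x t) -> ople s t }.

Definition normal_map H K (M : set (op H H)) (f : op H H -> op K K) :=
  forall D s, directed_sup M D s ->
    [/\ bounded_op (f s), forall x, D x -> ople (f x) (f s) &
        forall t, bounded_op t -> (forall x, D x -> ople (f x) t) ->
          ople (f s) t].

(* the positive cone of the predual of M *)
Record normal_functional H (M : set (op H H)) (w : op H H -> R[i]) : Prop := {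
  normal_functional_lin : forall c x y, M x -> M y ->
    w (c *: x + y) = c * w x + w y;
  normal_functional_ge0 : forall x, positive_part M x -> 0 <= w x;
  normal_functional_sup : forall D s, directed_sup M D s ->
    (forall x, D x -> w x <= w s) /\
    (forall t, (forall x, D x -> w x <= t) -> w s <= t) }.

(* left ideal of square integrable elements of a weight *)
Definition sq_integrable H (M : set (op H H)) (phi : op H H -> \bar R) :
    set (op H H) :=
  [set x | M x /\ (phi (adj x \o x) < +oo)%E].

(* Only the values on the positive part of M matter. Since square integrable
   elements form a left ideal, strong density is the same as sigma-weak
   density. *)
Record nsf_weight H (M : set (op H H)) (phi : op H H -> \bar R) : Prop := {
  weight_ge0 : forall x, positive_part M x -> (0 <= phi x)%E;
  weight_add : forall x y, positive_part M x -> positive_part M y ->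
    phi (x + y) = (phi x + phi y)%E;
  weight_scale : forall (c : R) x, 0 <= c -> positive_part M x ->
    phi (c%:C *: x) = (c%:E * phi x)%E;
  weight_normal : forall D s, directed_sup M D s ->
    phi s = ereal_sup (phi @` D);
  weight_semifinite : M `<=` strong_closure (sq_integrable M phi);
  weight_faithful : forall x, positive_part M x -> phi x = 0%E -> x = 0 }.

(* GNS map of a weight, for an algebra M acting on the GNS space itself; the
   formula (Lambda x, Lambda y) = phi(y^* x) is polarized from x = y *)
Record gns_map H (M : set (op H H)) (phi : op H H -> \bar R)
    (Lambda : op H H -> H) : Prop := {
  gns_lin : forall c x y, sq_integrable M phi x -> sq_integrable M phi y ->
    Lambda (c *: x + y) = c *: Lambda x + Lambda y;
  gns_norm : forall x, sq_integrable M phi x ->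
    (complex.Re '[Lambda x, Lambda x])%:E = phi (adj x \o x);
  gns_mul : forall x y, M x -> sq_integrable M phi y ->
    Lambda (x \o y) = x (Lambda y);
  gns_dense : closure (Lambda @` sq_integrable M phi) = setT }.

(* A Hilbert space tensor product of H and K. The first field forces
   [tens] to be bilinear, and the two fields determine the space up to a unique
   unitary compatible with [tens]. *)
Record htensor H K := HTensor {
  tsp :> hilbert R;
  tens : H -> K -> tsp;
  tens_dot : forall h k h' k',
    '[tens h k, tens h' k'] = '[h, h'] * '[k, k'];
  tens_dense :
    closure (lspan [set tens h k | h in [set: H] & k in [set: K]]) = setT }.

End Operators.

(* Results are stated for every choice of tensor products; they do not depend
   on the choice, since any two are compatibly unitarily equivalent. *)
Definition tensor_choice (R : realType) := forall H K : hilbert R, htensor H K.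

Section Tensor.
Context {R : realType} (tp : tensor_choice R).
Implicit Types H K L : hilbert R.

Local Notation op H K := (hcar H -> hcar K).
Local Notation "h @ox k" := (tens (tp _ _) h k) (at level 40).

Definition optens H K H' K' (x : op H H') (y : op K K') :
    op (tp H K) (tp H' K') :=
  xget 0 [set T | bounded_op T /\ forall h k, T (h @ox k) = x h @ox y k].

Local Notation "x \ox y" := (optens x y) (at level 40).

Definition assoc H K L : op (tp (tp H K) L) (tp H (tp K L)) :=
  xget 0 [set T | bounded_op T /\
    forall h k l, T ((h @ox k) @ox l) = h @ox (k @ox l)].

Definition min_tensor H K (A : set (op H H)) (B : set (op K K)) :
    set (op (tp H K) (tp H K)) :=
  cspan [set a \ox b | a in A & b in B].

Definition vn_tensor H K (M : set (op H H)) (N : set (op K K)) :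
    set (op (tp H K) (tp H K)) :=
  commutant (commutant [set x \ox y | x in M & y in N]).

(* the unique normal *-homomorphism f tensor g *)
Definition vn_tensor_hom H K H' K' (M : set (op H H)) (N : set (op K K))
    (f : op H H -> op H' H') (g : op K K -> op K' K') :
    op (tp H K) (tp H K) -> op (tp H' K') (tp H' K') :=
  xget 0 [set F | [/\ star_hom (vn_tensor M N) F,
    normal_map (vn_tensor M N) F &
    forall x y, M x -> N y -> F (x \ox y) = f x \ox g y]].

(* the tensor product of two morphisms, as the unique *-homomorphism on the
   multipliers of the minimal tensor product *)
Definition cstar_tensor_hom H K H' K' (A : set (op H H)) (B : set (op K K))
    (f : op H H -> op H' H') (g : op K K -> op K' K') :
    op (tp H K) (tp H K) -> op (tp H' K') (tp H' K') :=
  xget 0 [set F | star_hom (mult (min_tensor A B)) F /\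
    forall a b, A a -> B b -> F (a \ox b) = f a \ox g b].

(* slices by vector functionals: with w_(k,k')(y) = (y k, k'), these are
   (w_(h,h') tensor id)(X) and (id tensor w_(k,k'))(X) *)
Definition vslice_l H K (h h' : H) (X : op (tp H K) (tp H K)) : op K K :=
  xget 0 [set Y | forall k k', '[Y k, k'] = '[X (h @ox k), h' @ox k']].

Definition vslice_r H K (k k' : K) (X : op (tp H K) (tp H K)) : op H H :=
  xget 0 [set Y | forall h h', '[Y h, h'] = '[X (h @ox k), h' @ox k']].

(* slices (w tensor id)(X) and (id tensor w)(X) by a normal functional w *)
Definition slice_l H K (w : op H H -> R[i]) (X : op (tp H K) (tp H K)) :
    op K K :=
  xget 0 [set Y | forall k k', '[Y k, k'] = w (vslice_r k k' X)].

Definition slice_r H K (w : op K K -> R[i]) (X : op (tp H K) (tp H K)) :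
    op H H :=
  xget 0 [set Y | forall h h', '[Y h, h'] = w (vslice_l h h' X)].

Definition left_invariant H (M : set (op H H))
    (D : op H H -> op (tp H H) (tp H H)) (phi : op H H -> \bar R) :=
  forall w x, normal_functional M w -> positive_part M x ->
    (phi x < +oo)%E ->
    phi (slice_l w (D x)) = ((complex.Re (w idfun))%:E * phi x)%E.

Definition right_invariant H (M : set (op H H))
    (D : op H H -> op (tp H H) (tp H H)) (psi : op H H -> \bar R) :=
  forall w x, normal_functional M w -> positive_part M x ->
    (psi x < +oo)%E ->
    psi (slice_r w (D x)) = ((complex.Re (w idfun))%:E * psi x)%E.

(* The von Neumann algebra acts on the GNS space l2 of the left invariant
   weight. *)
Record lcqg := LCQG {
  l2 : hilbert R;
  linf : set (op l2 l2);
  comul : op l2 l2 -> op (tp l2 l2) (tp l2 l2);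
  haar : op l2 l2 -> \bar R;
  gns : op l2 l2 -> l2;
  linf_vn : vn_alg linf;
  comul_star_hom : star_hom linf comul;
  comul_normal : normal_map linf comul;
  comul_unital : comul idfun = idfun;
  comul_image : comul @` linf `<=` vn_tensor linf linf;
  comul_coassoc : forall x, linf x ->
    @assoc l2 l2 l2 \o vn_tensor_hom linf linf comul idfun (comul x) =
    vn_tensor_hom linf linf idfun comul (comul x) \o @assoc l2 l2 l2;
  haar_nsf : nsf_weight linf haar;
  haar_left : left_invariant linf comul haar;
  gns_haar : gns_map linf haar gns;
  right_haar : exists psi,
    nsf_weight linf psi /\ right_invariant linf comul psi }.

(* W is the left regular representation of G:
   (w tensor id)(W^* ) Lambda(x) = Lambda((w tensor id)(comul x)), which is
   the sliced form of
   W^* (Lambda(x) tensor Lambda(y))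
     = (Lambda tensor Lambda)(comul(y) (x tensor 1)) *)
Definition left_regular (G : lcqg)
    (W : op (tp (l2 G) (l2 G)) (tp (l2 G) (l2 G))) :=
  bounded_op W /\ forall x h h' k, sq_integrable (@linf G) (@haar G) x ->
    '[adj W (h @ox gns x), h' @ox k] = '[gns (vslice_l h h' (comul x)), k].

(* the reduced C*-algebra of G: the closed span of the right slices of W *)
Definition c0 (G : lcqg) : set (op (l2 G) (l2 G)) :=
  cspan [set a | exists W k k', left_regular W /\ a = vslice_r k k' W].

Record vn_coaction (G : lcqg) H (N : set (op H H))
    (D : op H H -> op (tp (l2 G) H) (tp (l2 G) H)) : Prop := {
  coact_vn : vn_alg N;
  coact_star_hom : star_hom N D;
  coact_normal : normal_map N D;
  coact_unital : D idfun = idfun;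
  coact_inj : {in N &, injective D};
  coact_image : D @` N `<=` vn_tensor (@linf G) N;
  coact_coassoc : forall x, N x ->
    @assoc (l2 G) (l2 G) H \o
      vn_tensor_hom (@linf G) N (@comul G) idfun (D x) =
    vn_tensor_hom (@linf G) N idfun D (D x) \o @assoc (l2 G) (l2 G) H }.

Definition ergodic (G : lcqg) H (N : set (op H H))
    (D : op H H -> op (tp (l2 G) H) (tp (l2 G) H)) :=
  [set x | N x /\ D x = (idfun : op (l2 G) (l2 G)) \ox x] =
  [set c *: (idfun : op H H) | c in [set: R[i]]].

Record gcstar_alg (G : lcqg) H (A : set (op H H))
    (D : op H H -> op (tp (l2 G) H) (tp (l2 G) H)) : Prop := {
  gcstar_cstar : cstar_alg A;
  gcstar_mor : mor A (min_tensor (@c0 G) A) D;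
  gcstar_inj : {in A &, injective D};
  gcstar_coassoc : forall a, A a ->
    @assoc (l2 G) (l2 G) H \o
      cstar_tensor_hom (@c0 G) A (@comul G) idfun (D a) =
    cstar_tensor_hom (@c0 G) A idfun D (D a) \o @assoc (l2 G) (l2 G) H;
  gcstar_continuous :
    cspan [set D a \o (c \ox (idfun : op H H)) | a in A & c in @c0 G] =
    min_tensor (@c0 G) A }.

Definition gmor (G : lcqg) H K
    (A : set (op H H)) (DA : op H H -> op (tp (l2 G) H) (tp (l2 G) H))
    (B : set (op K K)) (DB : op K K -> op (tp (l2 G) K) (tp (l2 G) K))
    (f : op H H -> op K K) :=
  mor A B f /\
  forall a, A a ->
    mult_ext B DB (f a) = cstar_tensor_hom (@c0 G) A idfun f (DA a).

(* The Hilbert A-module (tensor product of L and A), as the closed span in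
   B(H, L tensor H) of the operators k |-> h tensor (a k). Its norm is the
   operator norm, and an adjointable operator on it, being a multiplier of
   (compacts of L) tensor A, acts by composition on the left. *)
Definition hilbert_module L H (A : set (op H H)) : set (op H (tp L H)) :=
  cspan [set (fun k => h @ox a k) | h in [set: L] & a in A].

(* Nets are rendered as proper filters on the set of operators. *)
Definition strict L H (N : set (op H H)) (E : set (op H (tp L H)))
    (f : op H H -> op (tp L H) (tp L H)) :=
  forall (F : set_system (op H H)) (M : R[i]) (x : op H H),
    ProperFilter F -> N x ->
    F [set y | N y /\ opnorm_le y M] ->
    (forall h, y h @[y --> F] --> x h) ->
    (forall h, adj y h @[y --> F] --> adj x h) ->
    forall v, E v -> forall e, 0 < e ->
      \forall y \near F,
        opnorm_le ((f y \o v) - (f x \o v)) e /\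
        opnorm_le ((f (adj y) \o v) - (f (adj x) \o v)) e.

(* The coaction of the C*-algebraic version is the restriction of D to A, hence
   is given by the same function. *)
Record cstar_version (G : lcqg) H (N : set (op H H))
    (D : op H H -> op (tp (l2 G) H) (tp (l2 G) H)) (A : set (op H H)) :
    Prop := {
  version_gcstar : gcstar_alg A D;
  version_sub : A `<=` N;
  version_dense : N `<=` strong_closure A;
  version_mult : D @` N `<=` mult (min_tensor (@compact_op R (l2 G)) A);
  version_strict : strict N (@hilbert_module (l2 G) H A) D }.

Record qhs (G : lcqg) H (N : set (op H H))
    (D : op H H -> op (tp (l2 G) H) (tp (l2 G) H)) : Prop := {
  qhs_coaction : vn_coaction N D;
  qhs_ergodic : ergodic N D;
  qhs_version : exists A, cstar_version N D A }.

Definition gsimple (G : lcqg) H (A : set (op H H))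
    (DA : op H H -> op (tp (l2 G) H) (tp (l2 G) H)) :=
  forall K (B : set (op K K))
    (DB : op K K -> op (tp (l2 G) K) (tp (l2 G) K)) (f : op H H -> op K K),
    gcstar_alg B DB -> B <> [set 0] -> gmor A DA B DB f ->
    [set a | A a /\ f a = 0] = [set 0].

End Tensor.

(* Main.v *)
(** The kernel of pi is a norm closed invariant ideal J of C0(D). Its support projection p lies in
    N, and slicing Delta(J)(C0(G) tensor C0(D)) shows that (1 tensor p) Delta(p) = Delta(p). By the
    coaction identity and a column estimate for the right Haar weight, this inequality forces
    (Delta tensor id) Delta(p) = 1 tensor Delta(p); the left side is (id tensor Delta) Delta(p), so
    Delta(p) = 1 tensor p because Delta is injective. Ergodicity
    gives p = 0, in which case J = 0, or p = 1. If p = 1, an approximate unit of J tends to 1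
    strongly, by strictness its image under Delta converges in norm on the Hilbert module
    L2(G) tensor C0(D), and slicing gives J = C0(D), so that pi = 0. This contradicts the
    nondegeneracy of pi. *)
From HB Require Import structures.
From mathcomp Require Import all_boot all_order all_algebra.
From mathcomp Require Import all_classical all_reals all_analysis.
From mathcomp Require Import complex sesquilinear ring lra.
Require Import Defs.

Set Implicit Arguments.
Unset Strict Implicit.
Unset Printing Implicit Defensive.

Import Order.TTheory GRing.Theory Num.Theory numFieldNormedType.Exports.

Local Open Scope ring_scope.
Local Open Scope complex_scope.
Local Open Scope classical_set_scope.

(** Write q = Delta(p), Theta = Delta tensor id. The coaction identity gives Theta(q) <= 1 tensor q;
    the reverse inequality is the crux. The adjoint W^* of the regular representation intertwines 1
    tensor x with Delta(x), so the crux reads (1 tensor q) W^*_12 (1 tensor (1 - q)) = 0. It rests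
    on right invariance: for orthonormal e the columns Delta(x_e)(1 tensor e) are orthogonal for the
    right weight psi, so if their sum vanishes then every x_e does. The relation Theta(q)(1 tensor
    (1 - q)) = 0 is brought into this shape with W^*; vectors Lam(adj n y), n square integrable for
    psi, make the x_e square integrable; the pentagon equation carries the conclusion back to W^*.
    The sum is infinite and psi is not norm continuous, whence increments decaying like 8^-n and
    tails replaced by transforms k / (1 + k). Homomorphisms on tensor products are given by
    normality and their values on elementary tensors; a uniqueness theorem for normal functionals
    makes them computable. C0 is a closed span of slices of W, and its stability under adjoints
    comes from the closability of Lam x |-> Lam(adj x). *)

Local Notation Re := complex.Re.
Local Notation Im := complex.Im.

(** * Inner products and sequences in a Hilbert space *)

Section InnerProduct.
Context {R : realType}.
Implicit Types H K L : hilbert R.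

Lemma ipDl H (x y z : H) : '[x + y, z] = '[x, z] + '[y, z].
Proof. exact: linearDl. Qed.
Lemma ipBl H (x y z : H) : '[x - y, z] = '[x, z] - '[y, z].
Proof. exact: linearBl. Qed.
Lemma ipNl H (x z : H) : '[- x, z] = - '[x, z].
Proof. exact: linearNl. Qed.
Lemma ip0l H (z : H) : '[0, z] = 0.
Proof. exact: linear0l. Qed.
Lemma ipZl H a (x z : H) : '[a *: x, z] = a * '[x, z].
Proof. exact: linearZl_LR. Qed.
Lemma ip_suml H I (r : seq I) (E : I -> H) z :
  '[\sum_(i <- r) E i, z] = \sum_(i <- r) '[E i, z].
Proof. exact: linear_sumlz. Qed.
Lemma ipDr H (x y z : H) : '[z, x + y] = '[z, x] + '[z, y].
Proof. exact: linearDr. Qed.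
Lemma ipBr H (x y z : H) : '[z, x - y] = '[z, x] - '[z, y].
Proof. exact: linearBr. Qed.
Lemma ipNr H (x z : H) : '[z, - x] = - '[z, x].
Proof. exact: linearNr. Qed.
Lemma ip0r H (z : H) : '[z, 0] = 0.
Proof. exact: linear0r. Qed.
(** Multiplied by z both conjugates give |z|^2, which settles every nonzero z. *)
Lemma conjCE (z : R[i]) : Num.conj z = z^*%C.
Proof.
apply: (mulfI (oner_neq0 _)); rewrite !mul1r.
have [->|z0] := eqVneq z 0; first by rewrite !rmorph0.
by apply: (mulfI z0); rewrite -normCK sqr_normc.
Qed.
Lemma ipZr H a (x z : H) : '[z, a *: x] = a^*%C * '[z, x].
Proof. by rewrite -conjCE; exact: linearZr_LR. Qed.
Lemma ip_sumr H I (r : seq I) (E : I -> H) z :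
  '[z, \sum_(i <- r) E i] = \sum_(i <- r) '[z, E i].
Proof. exact: linear_sumr. Qed.
Lemma ipC H (x y : H) : '[x, y] = '[y, x]^*%C.
Proof. by rewrite -conjCE (hermC (hdot H) x y) expr0 mul1r. Qed.

(** Estimates are carried out between real numbers; the complex inner product is recovered from its
    real part through multiplication by i. *)
Definition nm H (x : H) : R := Re `|x|.
Definition rip H (x y : H) : R := Re '[x, y].

Lemma normE H (x : H) : `|x| = (nm x)%:C.
Proof. by rewrite /nm RRe_real// ger0_real. Qed.

Lemma nm_ge0 H (x : H) : 0 <= nm x.
Proof. by rewrite -ler0c -normE. Qed.

Lemma ipxx H (x : H) : '[x, x] = (nm x ^+ 2)%:C.
Proof. by rewrite -hnormE normE rmorphXn. Qed.

Lemma ripxx H (x : H) : rip x x = nm x ^+ 2.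
Proof. by rewrite /rip ipxx. Qed.

Lemma nm0 H : nm (0 : H) = 0.
Proof. by rewrite /nm normr0. Qed.

Lemma nm_eq0 H (x : H) : (nm x == 0) = (x == 0).
Proof. by rewrite -(inj_eq (@complexI R)) -normE normr_eq0. Qed.

Lemma nm0_eq0 H (x : H) : nm x = 0 -> x = 0.
Proof. by move/eqP; rewrite nm_eq0 => /eqP. Qed.

Lemma nm_le0 H (x : H) : nm x <= 0 -> x = 0.
Proof. by move=> h; apply: nm0_eq0; apply/eqP; rewrite eq_le h nm_ge0. Qed.

Lemma nmD H (x y : H) : nm (x + y) <= nm x + nm y.
Proof. by rewrite -lecR rmorphD/= -!normE ler_normD. Qed.

Lemma nmN H (x : H) : nm (- x) = nm x.
Proof. by rewrite /nm normrN. Qed.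

Lemma nmB H (x y : H) : nm (x - y) <= nm x + nm y.
Proof. by rewrite -(nmN y) nmD. Qed.

Lemma nmBC H (x y : H) : nm (x - y) = nm (y - x).
Proof. by rewrite -nmN opprB. Qed.

Lemma nmZ H a (x : H) : nm (a *: x) = Re `|a| * nm x.
Proof.
apply: complexI; rewrite -normE normrZ normE [in RHS]rmorphM/= RRe_real//.
Qed.

Lemma Re_norm_ge0 (a : R[i]) : 0 <= Re `|a|.
Proof. by have := normr_ge0 a; rewrite lecE => /andP[]. Qed.

Lemma Re_norm_real (a : R) : Re `|a%:C| = `|a|.
Proof. by rewrite normc_def /= expr0n addr0 sqrtr_sqr. Qed.

Lemma Re_norm_eq0 (a : R[i]) : Re `|a| = 0 -> a = 0.
Proof.
by move=> h; apply/eqP; rewrite -normr_eq0 -[`|a|]RRe_real ?h.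
Qed.

Lemma nmZr H (a : R) (x : H) : nm (a%:C *: x) = `|a| * nm x.
Proof. by rewrite nmZ Re_norm_real. Qed.

Lemma ripC H (x y : H) : rip x y = rip y x.
Proof. by rewrite /rip ipC; case: '[y, x]. Qed.
Lemma ripDl H (x y z : H) : rip (x + y) z = rip x z + rip y z.
Proof. by rewrite /rip ipDl raddfD. Qed.
Lemma ripBl H (x y z : H) : rip (x - y) z = rip x z - rip y z.
Proof. by rewrite /rip ipBl raddfB. Qed.
Lemma ripNl H (x z : H) : rip (- x) z = - rip x z.
Proof. by rewrite /rip ipNl raddfN. Qed.
Lemma ripDr H (x y z : H) : rip z (x + y) = rip z x + rip z y.
Proof. by rewrite /rip ipDr raddfD. Qed.
Lemma ripBr H (x y z : H) : rip z (x - y) = rip z x - rip z y.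
Proof. by rewrite /rip ipBr raddfB. Qed.
Lemma ripNr H (x z : H) : rip z (- x) = - rip z x.
Proof. by rewrite /rip ipNr raddfN. Qed.
Lemma Re_mulr (a : R) (z : R[i]) : Re (a%:C * z) = a * Re z.
Proof. by case: z => x y; rewrite /= mul0r subr0. Qed.
Lemma ripZl H (a : R) (x z : H) : rip (a%:C *: x) z = a * rip x z.
Proof. by rewrite /rip ipZl Re_mulr. Qed.
Lemma ripZr H (a : R) (x z : H) : rip z (a%:C *: x) = a * rip z x.
Proof. by rewrite ripC ripZl ripC. Qed.
Lemma rip0l H (z : H) : rip 0 z = 0.
Proof. by rewrite /rip ip0l. Qed.
Lemma Im_Re_i (z : R[i]) : Im z = - Re ('i * z).
Proof. by case: z => a b /=; rewrite mul0r mul1r sub0r opprK. Qed.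

Lemma ip_rip H (x y : H) : '[x, y] = rip x y +i* (- rip ('i *: x) y).
Proof. by rewrite /rip ipZl -Im_Re_i; case: '[x, y]. Qed.

Lemma nm_sqrD H (x y : H) : nm (x + y) ^+ 2 = nm x ^+ 2 + 2 * rip x y + nm y ^+ 2.
Proof. by rewrite -!ripxx ripDl !ripDr (ripC y x); ring. Qed.

Lemma nm_sqrB H (x y : H) : nm (x - y) ^+ 2 = nm x ^+ 2 - 2 * rip x y + nm y ^+ 2.
Proof. by rewrite -!ripxx ripBl !ripBr (ripC y x); ring. Qed.

Lemma discr_le (a b c : R) : 0 <= a -> 0 <= c ->
  (forall t, 0 <= a + 2 * t * b + t ^+ 2 * c) -> b ^+ 2 <= a * c.
Proof.
move=> a0 c0 h; have [c_0|cn0] := eqVneq c 0.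
  rewrite {}c_0 {c c0} in h *.
  have [->|bn0] := eqVneq b 0; first by rewrite expr0n mulr0.
  (* At this t the affine function a + 2 t b takes the value -1. *)
  have := h (- (a + 1) / (2 * b)).
  have -> : 2 * (- (a + 1) / (2 * b)) * b = - (a + 1).
    by field.
  rewrite mulr0; lra.
have cp : 0 < c by rewrite lt_def cn0.
have := h (- b / c).
have -> : a + 2 * (- b / c) * b + (- b / c) ^+ 2 * c = (a * c - b ^+ 2) / c.
  by field.
by rewrite pmulr_lge0 ?invr_gt0// subr_ge0.
Qed.

Lemma rip_le H (x y : H) : rip x y <= nm x * nm y.
Proof.
have : rip x y ^+ 2 <= (nm x * nm y) ^+ 2.
  rewrite exprMn; apply: discr_le; rewrite ?sqr_ge0// => t.
  have := sqr_ge0 (nm (x + t%:C *: y)).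
  by rewrite nm_sqrD ripZr nmZr exprMn real_normK ?num_real// mulrA.
move=> h; rewrite (le_trans (ler_norm _))// -(@ler_sqr R) ?nnegrE//.
  by rewrite real_normK ?num_real.
by rewrite mulr_ge0 ?nm_ge0.
Qed.

Lemma abs_rip_le H (x y : H) : `|rip x y| <= nm x * nm y.
Proof. by rewrite ler_norml rip_le lerNl -ripNl (le_trans (rip_le _ _))// nmN. Qed.

Lemma Re_norm_phase (z : R[i]) : exists2 u : R[i], `|u| = 1 & Re (u * z) = Re `|z|.
Proof.
have [->|z0] := eqVneq z 0; first by exists 1; rewrite ?normr1// mulr0 normr0.
exists (`|z| / z); last by rewrite mulfVK.
by rewrite normrM normrV ?unitfE// normr_id divff// normr_eq0.
Qed.

Lemma ip_le H (x y : H) : Re `|'[x, y]| <= nm x * nm y.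
Proof.
have [u u1 <-] := Re_norm_phase '[x, y].
rewrite -ipZl; apply: le_trans (rip_le _ _) _.
by rewrite nmZ u1 /= mul1r.
Qed.

Lemma rip_eqP H (x y : H) : (forall z, rip x z = rip y z) -> x = y.
Proof.
move=> h; apply/eqP; rewrite -subr_eq0 -nm_eq0 -sqrf_eq0 -ripxx ripBl h subrr.
by [].
Qed.

Lemma ip_eqP H (x y : H) : (forall z, '[x, z] = '[y, z]) -> x = y.
Proof. by move=> h; apply: rip_eqP => z; rewrite /rip h. Qed.

Lemma ip_eqPr H (x y : H) : (forall z, '[z, x] = '[z, y]) -> x = y.
Proof. by move=> h; apply: ip_eqP => z; rewrite ipC h -ipC. Qed.

Definition cvs H (u : nat -> H) (l : H) :=
  forall e : R, 0 < e -> exists n0, forall n, (n0 <= n)%N -> nm (u n - l) <= e.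

Definition cauchys H (u : nat -> H) :=
  forall e : R, 0 < e -> exists n0, forall n m, (n0 <= n)%N -> (n0 <= m)%N ->
    nm (u n - u m) <= e.

Lemma cauchys_cvs H (u : nat -> H) : cauchys u -> exists l, cvs u l.
Proof.
move=> hu.
have cu : cauchy (u @ \oo).
  apply/cauchy_ballP => e e0; have e0' : 0 < Re e.
    by move: e0; rewrite ltcE => /andP[].
  have eE : e = (Re e)%:C by rewrite RRe_real// gtr0_real.
  have e2 : 0 < Re e / 2 by lra.
  have [n0 hn0] := hu _ e2.
  exists ([set x | exists2 n, (n0 <= n)%N & x = u n],
          [set x | exists2 n, (n0 <= n)%N & x = u n]) => /=.
    by split; exists n0 => // n /= hn; exists n.
  move=> [x y] /= [[n hn ->] [m hm ->]]; rewrite -ball_normE /=.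
  rewrite normE eE ltcR; apply: le_lt_trans (hn0 _ _ hn hm) _; lra.
have hl : u @ \oo --> lim (u @ \oo) by exact: cauchy_cvg.
exists (lim (u @ \oo)) => e e0.
have e0' : (0 : R[i]) < e%:C by rewrite ltcR.
have /cvgrPdist_le/(_ _ e0')[n0 _ h] := hl.
exists n0 => n hn; have := h n hn.
by rewrite normE lecR nmBC.
Qed.

Lemma cvs_unique H (u : nat -> H) a b : cvs u a -> cvs u b -> a = b.
Proof.
move=> ha hb; apply/eqP; rewrite -subr_eq0 -nm_eq0 eq_le nm_ge0 andbT.
apply/ler_addgt0Pr => e e0; rewrite add0r.
have e2 : 0 < e / 2 by lra.
have [n h1] := ha _ e2; have [m h2] := hb _ e2.
have -> : a - b = - (u (maxn n m) - a) + (u (maxn n m) - b).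
  by rewrite opprB addrA subrK.
apply: le_trans (nmD _ _) _; rewrite nmN.
by have := h1 _ (leq_maxl n m); have := h2 _ (leq_maxr n m); lra.
Qed.

End InnerProduct.

(** * Minimisation, Riesz representation, orthogonal projection, density *)

Section Variational.
Context {R : realType}.
Implicit Types H K L : hilbert R.

Lemma inv_small (e : R) : 0 < e ->
  exists n0, forall n, (n0 <= n)%N -> n.+1%:R^-1 <= e.
Proof.
move=> e0; exists (Num.bound e^-1) => n hn.
rewrite -[e]invrK lef_pV2 ?posrE ?invr_gt0// ltW//.
apply: lt_le_trans (archi_boundP _) _; first by rewrite invr_ge0 ltW.
by rewrite ler_nat leqW.
Qed.

Lemma sqr_norm_le (a b : R) : 0 <= b -> a ^+ 2 <= b ^+ 2 -> `|a| <= b.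
Proof.
by move=> b0 h; rewrite -(@ler_sqr R) ?nnegrE// real_normK ?num_real.
Qed.

Lemma sqr_le (a b : R) : 0 <= b -> a ^+ 2 <= b ^+ 2 -> a <= b.
Proof. by move=> b0 h; rewrite (le_trans (ler_norm _))// sqr_norm_le. Qed.

(** Direct method: a minimising sequence of J v = b v v - 2 f v is Cauchy for b, and its first
    variation gives the weak equation in the limit. Stated for a semi-definite form and with a
    sequence in place of a limit, so that it serves Hilbert spaces as well as the graph of an
    antilinear map. *)
Lemma variational (E : lmodType R[i]) (V : set E) (b : E -> E -> R)
    (f : E -> R) (k : R) :
  V 0 -> (forall s t x y, V x -> V y -> V (s%:C *: x + t%:C *: y)) ->
  (forall x y, b x y = b y x) ->
  (forall s t x y z, b (s%:C *: x + t%:C *: y) z = s * b x z + t * b y z) ->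
  (forall x, 0 <= b x x) ->
  (forall s t x y, V x -> V y ->
    f (s%:C *: x + t%:C *: y) = s * f x + t * f y) ->
  0 <= k -> (forall x, V x -> f x ^+ 2 <= k * b x x) ->
  exists z : nat -> E, [/\ forall n, V (z n),
    forall e, 0 < e -> exists n0, forall n m, (n0 <= n)%N -> (n0 <= m)%N ->
      b (z n - z m) (z n - z m) <= e &
    forall v, V v -> forall e, 0 < e -> exists n0, forall n, (n0 <= n)%N ->
      `|b v (z n) - f v| <= e].
Proof.
move=> V0 VZ bC bZ b_ge0 fZ k0 fk.
have bZr s t x y z : b z (s%:C *: x + t%:C *: y) = s * b z x + t * b z y.
  by rewrite bC bZ !(bC z).
pose J v := b v v - 2 * f v.
have Jk v : V v -> - k <= J v.
  move=> Vv; rewrite /J; have := fk _ Vv; have := b_ge0 v.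
  set p := b v v; set q := f v => p0 h.
  suff : 2 * q <= p + k by lra.
  have pk : 0 <= p + k by lra.
  apply: sqr_le => //; have := sqr_ge0 (p - k); nra.
have hinf : has_inf (J @` V).
  split; first by exists (J 0); exists 0.
  by exists (- k) => _ [v Vv <-]; exact: Jk.
set mu := inf (J @` V).
have mule v : V v -> mu <= J v by move=> Vv; apply: (ge_inf hinf.2); exists v.
have /choice[z hz] : forall n : nat, exists v, V v /\ J v < mu + n.+1%:R^-1.
  move=> n; have n0 : (0 : R) < n.+1%:R^-1 by rewrite invr_gt0 ltr0Sn.
  by have [_ [v Vv <-] h] := inf_adherent n0 hinf; exists v.
have zV n : V (z n) by have [] := hz n.
have zJ n : J (z n) < mu + n.+1%:R^-1 by have [] := hz n.
exists z; split => //.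
- move=> e e0; have e4 : 0 < e / 4 by lra.
  have [n0 hn0] := inv_small e4; exists n0 => n m hn hm.
  (* The midpoint is a competitor: b (z n - z m) (z n - z m) equals 2 J (z n) + 2 J (z m) minus four
     times J at the midpoint. *)
  have := mule _ (VZ 2^-1 2^-1 _ _ (zV n) (zV m)).
  have -> : z n - z m = 1%:C *: z n + (-1)%:C *: z m.
    by rewrite rmorphN /= scaleNr !scale1r.
  have := zJ n; have := zJ m; have := hn0 _ hn; have := hn0 _ hm.
  rewrite /J !bZ !bZr (bC (z m) (z n)) fZ//.
  set u := _^-1; set w := n.+1%:R^-1; lra.
- move=> v Vv e e0.
  have bv : 0 < b v v + 1 by have := b_ge0 v; lra.
  have e1 : 0 < e ^+ 2 / (b v v + 1) by rewrite divr_gt0// exprn_gt0.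
  have [n0 hn0] := inv_small e1; exists n0 => n hn.
  (* Every z n + t v competes with the infimum, so a quadratic polynomial in t is nonnegative; its
     discriminant bounds the defect of the weak equation. *)
  have h : (b v (z n) - f v) ^+ 2 <= n.+1%:R^-1 * b v v.
    apply: discr_le; [by rewrite invr_ge0|exact: b_ge0|].
    move=> t; have := mule _ (VZ 1 t _ _ (zV n) Vv); have := zJ n.
    rewrite /J !bZ !bZr (bC (z n) v) fZ//.
    set u := _^-1; nra.
  apply: sqr_norm_le; first exact: ltW.
  apply: le_trans h _; apply: (@le_trans _ _ (n.+1%:R^-1 * (b v v + 1))).
    by rewrite ler_wpM2l ?invr_ge0// lerDl.
  by rewrite -ler_pdivlMr// hn0.
Qed.

Lemma real_riesz H (V : set H) (f : H -> R) (k : R) :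
  V 0 -> (forall s t x y, V x -> V y -> V (s%:C *: x + t%:C *: y)) ->
  (forall s t x y, V x -> V y ->
    f (s%:C *: x + t%:C *: y) = s * f x + t * f y) ->
  0 <= k -> (forall x, V x -> `|f x| <= k * nm x) ->
  exists z, (exists2 u, (forall n, V (u n)) & cvs u z) /\
    forall v, V v -> rip v z = f v.
Proof.
move=> V0 VZ fZ k0 fk.
have [|||||z [zV zc zf]] := @variational H V (@rip R H) f (k ^+ 2) V0 VZ (@ripC R H).
- by move=> s t x y z; rewrite ripDl !ripZl.
- by move=> x; rewrite ripxx sqr_ge0.
- exact: fZ.
- exact: sqr_ge0.
- move=> x Vx; rewrite ripxx -exprMn -real_normK ?num_real// ler_sqr ?nnegrE//.
    exact: fk.
  by rewrite mulr_ge0 ?nm_ge0.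
have [l hl] : exists l, cvs z l.
  apply: cauchys_cvs => e e0; have e2 : 0 < e ^+ 2 by rewrite exprn_gt0.
  have [n0 h] := zc _ e2; exists n0 => n m hn hm.
  by apply: sqr_le; [exact: ltW|rewrite -ripxx h].
exists l; split; first by exists z.
move=> v Vv; apply/eqP; rewrite -subr_eq0 -normr_eq0 eq_le normr_ge0 andbT.
apply/ler_addgt0Pr => e e0; rewrite add0r.
have e2 : 0 < e / 2 by lra.
have nv : 0 < nm v + 1 by have := nm_ge0 v; lra.
have e3 : 0 < e / 2 / (nm v + 1) by rewrite divr_gt0.
have [n1 h1] := zf v Vv _ e2; have [n2 h2] := hl _ e3.
have {}h1 := h1 _ (leq_maxl n1 n2); have {}h2 := h2 _ (leq_maxr n1 n2).
have -> : rip v l - f v = rip v (z (maxn n1 n2)) - f v - rip v (z (maxn n1 n2) - l).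
  by rewrite ripBr; ring.
apply: le_trans (ler_normB _ _) _.
suff : `|rip v (z (maxn n1 n2) - l)| <= e / 2 by lra.
apply: le_trans (abs_rip_le _ _) _.
apply: (@le_trans _ _ ((nm v + 1) * (e / 2 / (nm v + 1)))).
  by apply: ler_pM => //; rewrite ?nm_ge0// lerDl.
by rewrite mulrCA mulfV ?mulr1// gt_eqF.
Qed.

Definition csubspace H (V : set H) :=
  V 0 /\ forall c x y, V x -> V y -> V (c *: x + y).

Definition in_closure H (V : set H) (z : H) :=
  forall e : R, 0 < e -> exists2 v, V v & nm (z - v) <= e.

(** The real representation of Re f, with the imaginary part read off at i v. Here f is linear on V
    only, and asking for a vector in the closure of V makes it unique. *)
Lemma riesz_on H (V : set H) (f : H -> R[i]) (k : R) :
  csubspace V ->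
  (forall c x y, V x -> V y -> f (c *: x + y) = c * f x + f y) ->
  0 <= k -> (forall x, V x -> Re `|f x| <= k * nm x) ->
  exists2 z, in_closure V z & forall v, V v -> '[v, z] = f v.
Proof.
move=> [V0 VZ] fZ k0 fk.
have VZr c x : V x -> V (c *: x) by move=> Vx; rewrite -[_ *: _]addr0; exact: VZ.
have f0 : f 0 = 0.
  have := fZ 1 0 0 V0 V0; rewrite scaler0 addr0 mul1r => /eqP.
  by rewrite addrC -subr_eq subrr eq_sym => /eqP.
have fZr c x : V x -> f (c *: x) = c * f x.
  by move=> Vx; rewrite -[c *: x]addr0 fZ// f0 addr0.
have [||||z [[u uV ul] zf]] := @real_riesz H V (fun x => Re (f x)) k V0.
- by move=> s t x y Vx Vy; apply: VZ => //; exact: VZr.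
- move=> s t x y Vx Vy; rewrite fZ ?fZr// ?raddfD/=; last exact: VZr.
  by rewrite !Re_mulr.
- exact: k0.
- move=> x Vx; apply: le_trans (fk _ Vx).
  by have := normc_ge_Re (f x); rewrite lecE => /andP[].
exists z.
  move=> e e0; have [n h] := ul _ e0; exists (u n) => //.
  by rewrite nmBC; apply: h.
move=> v Vv; rewrite ip_rip zf// zf; last exact: VZr.
by rewrite fZr// -Im_Re_i; case: (f v).
Qed.

Lemma proj_exists H (V : set H) x : csubspace V ->
  exists2 z, in_closure V z & forall v, V v -> '[v, x - z] = 0.
Proof.
move=> hV; have [|||z zV h] := @riesz_on H V (fun v => '[v, x]) (nm x) hV.
- by move=> c y w _ _; rewrite ipDl ipZl.
- exact: nm_ge0.
- by move=> v _; rewrite mulrC; exact: ip_le.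
by exists z => // v Vv; rewrite ipBr h// subrr.
Qed.

Lemma in_closure_ip0 H (V : set H) z y :
  in_closure V z -> (forall v, V v -> '[v, y] = 0) -> '[z, y] = 0.
Proof.
move=> hz hy; apply: Re_norm_eq0; apply/eqP; rewrite eq_le Re_norm_ge0 andbT.
apply/ler_addgt0Pr => e e0; rewrite add0r.
have ny : 0 < nm y + 1 by have := nm_ge0 y; lra.
have e3 : 0 < e / (nm y + 1) by rewrite divr_gt0.
have [v Vv h] := hz _ e3.
have -> : '[z, y] = '[z - v, y] by rewrite ipBl (hy v Vv) subr0.
apply: le_trans (ip_le _ _) _; rewrite mulrC.
apply: (@le_trans _ _ ((nm y + 1) * (e / (nm y + 1)))).
  by apply: ler_pM => //; rewrite ?nm_ge0// lerDl.
by rewrite mulrCA mulfV ?mulr1// gt_eqF.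
Qed.

Definition total H (P : set H) :=
  forall z, (forall x, P x -> '[x, z] = 0) -> z = 0.

Lemma total_dense H (V : set H) : csubspace V -> total V ->
  forall x, in_closure V x.
Proof.
move=> hV tV x; have [z zV h] := proj_exists x hV.
suff -> : x = z by [].
by apply/eqP; rewrite -subr_eq0; apply/eqP/tV.
Qed.

(** Formal combinations are lists, so two families over the same index can be compared coefficient
    by coefficient before anything is known to be well defined. *)
Definition lc (V : lmodType R[i]) I (s : I -> V) (l : seq (R[i] * I)) : V :=
  \sum_(p <- l) p.1 *: s p.2.

Lemma lc_nil (V : lmodType R[i]) I (s : I -> V) : lc s [::] = 0.
Proof. by rewrite /lc big_nil. Qed.

Lemma lc_cons (V : lmodType R[i]) I (s : I -> V) p l :
  lc s (p :: l) = p.1 *: s p.2 + lc s l.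
Proof. by rewrite /lc big_cons. Qed.

Lemma lc_cat (V : lmodType R[i]) I (s : I -> V) l l' :
  lc s (l ++ l') = lc s l + lc s l'.
Proof. by rewrite /lc big_cat. Qed.

Definition lcZ I (c : R[i]) (l : seq (R[i] * I)) := [seq (c * p.1, p.2) | p <- l].

Lemma lc_scale (V : lmodType R[i]) I (s : I -> V) c l : lc s (lcZ c l) = c *: lc s l.
Proof.
by rewrite /lc big_map scaler_sumr; apply: eq_bigr => p _; rewrite scalerA.
Qed.

Lemma lc1 (V : lmodType R[i]) I (s : I -> V) i : lc s [:: (1, i)] = s i.
Proof. by rewrite lc_cons lc_nil addr0 scale1r. Qed.

Lemma ip_lc H I J (s : I -> H) (t : J -> H) l l' :
  '[lc s l, lc t l'] =
  \sum_(p <- l) \sum_(q <- l') p.1 * (q.1^*%C * '[s p.2, t q.2]).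
Proof.
rewrite /lc ip_suml; apply: eq_bigr => p _; rewrite ip_sumr; apply: eq_bigr => q _.
by rewrite ipZl ipZr.
Qed.

Lemma lc_csubspace H I (s : I -> H) : csubspace (range (lc s)).
Proof.
split; first by exists [::] => //; rewrite lc_nil.
move=> c _ _ [l _ <-] [l' _ <-]; exists (lcZ c l ++ l') => //.
by rewrite lc_cat lc_scale.
Qed.

Lemma total_lc_dense H I (s : I -> H) : total (range s) ->
  forall x e, 0 < e -> exists l, nm (x - lc s l) <= e.
Proof.
move=> ts x e e0.
have [|_ [l _ <-] h] := @total_dense H (range (lc s)) (lc_csubspace s) _ x e e0.
  move=> z hz; apply: ts => _ [i _ <-]; apply: hz.
  by exists [:: (1, i)] => //; rewrite lc1.
by exists l.
Qed.

End Variational.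

(** * Bundled bounded operators, adjoints, extension from generators *)

Section BoundedOperators.
Context {R : realType}.

(** Bundling makes adjoints, sums and composites total operations; by proof irrelevance two bundles
    with the same function are equal. *)
Record bop (H K : hilbert R) := Bop {
  bfun :> hcar H -> hcar K;
  bopP : bounded_op bfun }.

HB.instance Definition _ (H K : hilbert R) (T : bop H K) :=
  GRing.isLinear.Build R[i] H K *:%R (bfun T) (proj1 (bopP T)).
HB.instance Definition _ (H K : hilbert R) := gen_eqMixin (bop H K).
HB.instance Definition _ (H K : hilbert R) := gen_choiceMixin (bop H K).

Implicit Types H K L : hilbert R.

Lemma bop_eq H K (S T : bop H K) : (forall x, S x = T x) -> S = T.
Proof.
case: S T => [S hS] [T hT] /= /funext ST.
by rewrite ST in hS *; congr Bop; exact: Prop_irrelevance.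
Qed.

Lemma opnorm_leP H K (T : H -> K) (k : R) :
  opnorm_le T k%:C <-> forall x, nm (T x) <= k * nm x.
Proof. by split => h x; have := h x; rewrite !normE -rmorphM lecR. Qed.

Lemma bounded_opP H K (T : H -> K) : linear T ->
  (exists k : R, forall x, nm (T x) <= k * nm x) -> bounded_op T.
Proof. by move=> lT [k h]; split => //; exists k%:C; apply/opnorm_leP. Qed.

Lemma bopZ H K (T : bop H K) c x : T (c *: x) = c *: T x.
Proof. exact: linearZ_LR. Qed.
Lemma bopZD H K (T : bop H K) c x y : T (c *: x + y) = c *: T x + T y.
Proof. exact: linearP. Qed.
Lemma bop_sum H K (T : bop H K) I (r : seq I) (F : I -> H) :
  T (\sum_(i <- r) F i) = \sum_(i <- r) T (F i).
Proof. exact: raddf_sum. Qed.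
Lemma bopB H K (T : bop H K) x y : T (x - y) = T x - T y.
Proof. exact: raddfB. Qed.
Lemma bopD H K (T : bop H K) x y : T (x + y) = T x + T y.
Proof. exact: raddfD. Qed.
Lemma bopN H K (T : bop H K) x : T (- x) = - T x.
Proof. exact: raddfN. Qed.
Lemma bop0 H K (T : bop H K) : T 0 = 0.
Proof. exact: raddf0. Qed.

Lemma bop_bound H K (T : bop H K) :
  exists2 k, 0 <= k & forall x, nm (T x) <= k * nm x.
Proof.
have [_ [M hM]] := bopP T; exists `|Re M| => // x.
have := hM x; rewrite !normE lecE => /andP[_] /=.
have -> : Re (M * (nm x)%:C) = Re M * nm x by rewrite mulrC Re_mulr mulrC.
by move=> h; apply: le_trans h _; rewrite ler_wpM2r ?nm_ge0// ler_norm.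
Qed.

Lemma bop_of H K (T : H -> K) : bounded_op T -> exists S : bop H K, T = S.
Proof. by move=> h; exists (Bop h). Qed.

Lemma mkbop H K (T : H -> K) (k : R) : linear T ->
  (forall x, nm (T x) <= k * nm x) -> exists S : bop H K, T = S.
Proof. by move=> lT h; apply/bop_of/bounded_opP => //; exists k. Qed.

Lemma bounded_comp H K L (S : bop K L) (T : bop H K) : bounded_op (S \o T).
Proof.
have [s s0 hs] := bop_bound S; have [t t0 ht] := bop_bound T.
apply: bounded_opP; first by move=> a u v /=; rewrite !linearP.
exists (s * t) => x /=; apply: le_trans (hs _) _.
by rewrite -mulrA ler_wpM2l.
Qed.
Definition bcomp H K L (S : bop K L) (T : bop H K) := Bop (bounded_comp S T).

Lemma bounded_id H : bounded_op (idfun : H -> H).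
Proof. by apply: bounded_opP => //; exists 1 => x; rewrite mul1r. Qed.
Definition bid H := Bop (bounded_id H).

Lemma bounded_0 H K : bounded_op (0 : H -> K).
Proof.
apply: bounded_opP; first by move=> a u v /=; rewrite /GRing.zero /= scaler0 addr0.
by exists 0 => x; rewrite mul0r /GRing.zero /= nm0.
Qed.

Lemma bounded_lin H K (c : R[i]) (S T : bop H K) :
  bounded_op (c *: (S : H -> K) + (T : H -> K)).
Proof.
have [s s0 hs] := bop_bound S; have [t t0 ht] := bop_bound T.
apply: bounded_opP.
  move=> a u v; change (c *: S (a *: u + v) + T (a *: u + v) =
    a *: (c *: S u + T u) + (c *: S v + T v)).
  rewrite (linearP S) (linearP T) !scalerDr !scalerA.
  by rewrite (mulrC a c) addrACA.
exists (Re `|c| * s + t) => x; change (nm (c *: S x + T x) <= (Re `|c| * s + t) * nm x); apply: le_trans (nmD _ _) _.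
by rewrite mulrDl lerD// nmZ -mulrA ler_wpM2l ?Re_norm_ge0.
Qed.

Lemma bounded_add H K (S T : bop H K) : bounded_op ((S : H -> K) + (T : H -> K)).
Proof. by have := bounded_lin 1 S T; rewrite scale1r. Qed.
Lemma bounded_scale H K c (S : bop H K) : bounded_op (c *: (S : H -> K)).
Proof. by have := bounded_lin c S (Bop (bounded_0 H K)); rewrite /= addr0. Qed.
Lemma bounded_opp H K (S : bop H K) : bounded_op (- (S : H -> K)).
Proof. by have := bounded_scale (-1) S; rewrite scaleN1r. Qed.

Section Zmod.
Variables H K : hilbert R.
Let badd (S T : bop H K) := Bop (bounded_add S T).
Let bopp (S : bop H K) := Bop (bounded_opp S).
Let baddA : associative badd.
Proof. by move=> x y z; apply: bop_eq => v; rewrite /= !fctE addrA. Qed.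
Let baddC : commutative badd.
Proof. by move=> x y; apply: bop_eq => v; rewrite /= !fctE addrC. Qed.
Let badd0 : left_id (Bop (bounded_0 H K)) badd.
Proof. by move=> x; apply: bop_eq => v; rewrite /= !fctE add0r. Qed.
Let baddN : left_inverse (Bop (bounded_0 H K)) bopp badd.
Proof. by move=> x; apply: bop_eq => v; rewrite /= !fctE addNr. Qed.
HB.instance Definition _ := GRing.isZmodule.Build (bop H K) baddA baddC badd0 baddN.
Let bscale c (S : bop H K) := Bop (bounded_scale c S).
Let bscaleA a b v : bscale a (bscale b v) = bscale (a * b) v.
Proof. by apply: bop_eq => x; rewrite /= !fctE scalerA. Qed.
Let bscale1 : left_id 1 bscale.
Proof. by move=> x; apply: bop_eq => v; rewrite /= !fctE scale1r. Qed.
Let bscaleDr : right_distributive bscale +%R.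
Proof. by move=> a x y; apply: bop_eq => v; exact: scalerDr. Qed.
Let bscaleDl v : {morph bscale^~ v : a b / a + b}.
Proof. by move=> a b; apply: bop_eq => x; exact: scalerDl. Qed.
HB.instance Definition _ := GRing.Zmodule_isLmodule.Build R[i] (bop H K)
  bscaleA bscale1 bscaleDr bscaleDl.
End Zmod.

Lemma baddE H K (S T : bop H K) x : (S + T) x = S x + T x. Proof. by []. Qed.
Lemma bsubE H K (S T : bop H K) x : (S - T) x = S x - T x. Proof. by []. Qed.
Lemma boppE H K (S : bop H K) x : (- S) x = - S x. Proof. by []. Qed.
Lemma bscaleE H K c (S : bop H K) x : (c *: S) x = c *: S x. Proof. by []. Qed.
Lemma b0E H K x : (0 : bop H K) x = 0. Proof. by []. Qed.
Lemma bsumE H K I (r : seq I) (F : I -> bop H K) x :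
  (\sum_(i <- r) F i) x = \sum_(i <- r) F i x.
Proof. by elim: r => [|i r IH]; rewrite ?big_nil// !big_cons -IH. Qed.
Lemma bcompE H K L (S : bop K L) (T : bop H K) x : bcomp S T x = S (T x).
Proof. by []. Qed.

Lemma adj_ex H K (T : bop H K) : exists S : K -> H, forall x y, '[T x, y] = '[x, S y].
Proof.
have [k k0 hk] := bop_bound T.
suff /choice[S hS] : forall y, exists z, forall x, '[T x, y] = '[x, z].
  by exists S.
move=> y; have [|||//|z _ h] := @riesz_on R H setT (fun v => '[T v, y]) (k * nm y).
- by split.
- by move=> c u v _ _; rewrite linearP ipDl ipZl.
- by rewrite mulr_ge0 ?nm_ge0.
- move=> x _; apply: le_trans (ip_le _ _) _.
  by rewrite mulrAC ler_wpM2r ?nm_ge0.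
by exists z => x; rewrite h.
Qed.

Lemma adjP H K (T : bop H K) x y : '[T x, y] = '[x, adj T y].
Proof.
by have /xgetPex h := adj_ex T; exact: (h 0 x y).
Qed.

Lemma adjPr H K (T : bop H K) x y : '[x, T y] = '[adj T x, y].
Proof. by rewrite ipC adjP -ipC. Qed.

Lemma adj_bound H K (T : bop H K) k : 0 <= k ->
  (forall x, nm (T x) <= k * nm x) -> forall x, nm (adj T x) <= k * nm x.
Proof.
move=> k0 hk x; have [h0|hn0] := eqVneq (nm (adj T x)) 0.
  by rewrite h0 mulr_ge0 ?nm_ge0.
have np : 0 < nm (adj T x) by rewrite lt_def hn0 nm_ge0.
rewrite -(ler_pM2l np) -expr2 -ripxx /rip -adjP.
apply: le_trans (rip_le _ _) _; rewrite mulrA ler_wpM2r ?nm_ge0// mulrC; exact: hk.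
Qed.

Lemma bounded_adj H K (T : bop H K) : bounded_op (adj T).
Proof.
have [k k0 hk] := bop_bound T; apply: bounded_opP; last first.
  by exists k; exact: adj_bound.
move=> a u v; apply: ip_eqPr => z.
by rewrite -adjP ipDr ipDr !ipZr !adjP.
Qed.
Definition badj H K (T : bop H K) := Bop (bounded_adj T).

Lemma badjP H K (T : bop H K) x y : '[T x, y] = '[x, badj T y].
Proof. exact: adjP. Qed.
Lemma badjPr H K (T : bop H K) x y : '[x, T y] = '[badj T x, y].
Proof. exact: adjPr. Qed.

Lemma adj_uniq H K (T : bop H K) (S : bop K H) :
  (forall x y, '[T x, y] = '[x, S y]) -> badj T = S.
Proof. by move=> h; apply: bop_eq => y; apply: ip_eqPr => x; rewrite -h badjP. Qed.

Lemma badjK H K (T : bop H K) : badj (badj T) = T.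
Proof. by apply: adj_uniq => x y; rewrite -badjPr. Qed.

Lemma badj_comp H K L (S : bop K L) (T : bop H K) :
  badj (bcomp S T) = bcomp (badj T) (badj S).
Proof. by apply: adj_uniq => x y; rewrite !bcompE !badjP. Qed.

Lemma badj_lin H K c (S T : bop H K) :
  badj (c *: S + T) = c^*%C *: badj S + badj T.
Proof.
by apply: adj_uniq => x y; rewrite !baddE !bscaleE ipDl ipDr ipZl ipZr conjcK !badjP.
Qed.

Lemma badj_sub H K (S T : bop H K) : badj (S - T) = badj S - badj T.
Proof. by apply: adj_uniq => x y; rewrite !bsubE ipBl ipBr !badjP. Qed.

Lemma badj_id H : badj (bid H) = bid H.
Proof. exact: adj_uniq. Qed.

Lemma bop_eq_ip H K (S T : bop H K) : (forall x y, '[S x, y] = '[T x, y]) -> S = T.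
Proof. by move=> h; apply: bop_eq => x; apply: ip_eqP. Qed.

Lemma bop_eq_total H K I (s : I -> H) (S T : bop H K) : total (range s) ->
  (forall i, S (s i) = T (s i)) -> S = T.
Proof.
move=> ts h; apply: bop_eq_ip => x y; rewrite !badjP.
suff -> : badj S y = badj T y by [].
apply/eqP; rewrite -subr_eq0; apply/eqP/ts => _ [i _ <-].
by rewrite ipBr -!badjP h subrr.
Qed.

Lemma in_closure_csubspace H (V : set H) : csubspace V -> csubspace (in_closure V).
Proof.
move=> [V0 VZ]; split=> [e e0|c x y hx hy e e0].
  by exists 0; rewrite // subr0 nm0 ltW.
have k1 : 0 < Re `|c| + 1 by have := Re_norm_ge0 c; lra.
have e1 : 0 < e / 2 / (Re `|c| + 1) by rewrite !divr_gt0.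
have [u Vu hu] := hx _ e1; have e2 : 0 < e / 2 by lra.
have [v Vv hv] := hy _ e2; exists (c *: u + v); first exact: VZ.
have -> : c *: x + y - (c *: u + v) = c *: (x - u) + (y - v).
  by rewrite scalerBr opprD addrACA.
apply: le_trans (nmD _ _) _; rewrite nmZ.
suff : Re `|c| * nm (x - u) <= e / 2 by lra.
apply: (@le_trans _ _ ((Re `|c| + 1) * (e / 2 / (Re `|c| + 1)))).
  by apply: ler_pM; rewrite ?Re_norm_ge0 ?nm_ge0// lerDl.
by rewrite mulrCA mulfV ?mulr1// gt_eqF.
Qed.

Lemma in_closure_bound H (V : set H) z c : in_closure V z -> 0 <= c ->
  (forall v, V v -> Re `|'[v, z]| <= c * nm v) -> nm z <= c.
Proof.
move=> hz c0 hv; have [->|zn0] := eqVneq z 0; first by rewrite nm0.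
have np : 0 < nm z by rewrite lt_def nm_eq0 zn0 nm_ge0.
rewrite -(ler_pM2l np) -expr2; apply/ler_addgt0Pr => e e0.
have k1 : 0 < nm z + c by lra.
have e1 : 0 < e / (nm z + c) by rewrite divr_gt0.
have [v Vv h] := hz _ e1.
have -> : nm z ^+ 2 = rip (z - v) z + rip v z by rewrite -ripDl subrK ripxx.
have h1 := rip_le (z - v) z.
have h2 : rip v z <= c * nm v.
  by apply: le_trans (hv v Vv); have := normc_ge_Re '[v, z];
    rewrite lecE => /andP[_]; apply: le_trans; rewrite ler_norm.
have h3 : nm v <= nm z + nm (z - v).
  by rewrite -{1}(subKr z v); apply: le_trans (nmB _ _) _.
have h4 : nm (z - v) * (nm z + c) <= e by rewrite -ler_pdivlMr.
have h5 := ler_wpM2l c0 h3.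
nra.
Qed.

Lemma lc_sub (V : lmodType R[i]) I (s : I -> V) l l' :
  lc s (l ++ lcZ (-1) l') = lc s l - lc s l'.
Proof. by rewrite lc_cat lc_scale scaleN1r. Qed.

Lemma ext_exists I H K (s : I -> H) (t : I -> K) (k : R) : 0 <= k ->
  (forall l, nm (lc t l) <= k * nm (lc s l)) ->
  exists T : bop H K, [/\ forall i, T (s i) = t i,
    forall z, (forall i, '[s i, z] = 0) -> T z = 0 &
    forall x, nm (T x) <= k * nm x].
Proof.
move=> k0 hk; pose V := range (lc s); have hV : csubspace V := lc_csubspace s.
have wd l l' : lc s l = lc s l' -> lc t l = lc t l'.
  move=> e; apply/eqP; rewrite -subr_eq0 -lc_sub -nm_eq0 eq_le nm_ge0 andbT.
  by apply: le_trans (hk _) _; rewrite lc_sub e subrr nm0 mulr0.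
have /choice[pre preP] : forall x, exists l, V x -> lc s l = x.
  move=> x; have [[l _ <-]|nV] := pselect (V x); first by exists l.
  by exists [::].
pose g x := lc t (pre x).
have gE l : g (lc s l) = lc t l by apply: wd; rewrite preP//; exists l.
have /choice[S hS] : forall y, exists z, in_closure V z /\
    (forall v, V v -> '[v, z] = '[g v, y]).
  move=> y; have [|||z zV h] := @riesz_on R H V (fun v => '[g v, y]) (k * nm y) hV.
  - move=> c _ _ [l _ <-] [l' _ <-].
    by rewrite -lc_scale -lc_cat !gE lc_cat lc_scale ipDl ipZl.
  - by rewrite mulr_ge0 ?nm_ge0.
  - move=> _ [l _ <-]; rewrite gE; apply: le_trans (ip_le _ _) _.
    by rewrite mulrAC ler_wpM2r ?nm_ge0.
  by exists z.
have Suniq y z : in_closure V z -> (forall v, V v -> '[v, z] = '[g v, y]) -> z = S y.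
  move=> zV hz; have [SV SE] := hS y.
  apply/eqP; rewrite -subr_eq0 -nm_eq0 -sqrf_eq0 -ripxx /rip.
  rewrite (@in_closure_ip0 _ _ V)//.
    have := (in_closure_csubspace hV).2 (-1) _ _ SV zV.
    by rewrite scaleN1r addrC.
  by move=> v Vv; rewrite ipBr hz// SE// subrr.
have [|x|S' S'E] := @mkbop K H S k.
- move=> a u v; apply/esym/Suniq.
    by apply: (in_closure_csubspace hV).2; [case: (hS u)|case: (hS v)].
  move=> w Vw; have [_ hu] := hS u; have [_ hv] := hS v.
  by rewrite ipDr ipZr hu// hv// ipDr ipZr.
- have [SV SE] := hS x; apply: (in_closure_bound SV); first by rewrite mulr_ge0 ?nm_ge0.
  move=> _ [l _ <-]; rewrite SE; last by exists l.
  rewrite gE; apply: le_trans (ip_le _ _) _; rewrite mulrAC ler_wpM2r ?nm_ge0//.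
have SS y : S' y = S y by rewrite S'E.
exists (badj S'); split.
- move=> i; apply: ip_eqP => y; rewrite -badjPr SS (hS y).2.
    by rewrite -[s i](lc1 s) gE lc1.
  by exists [:: (1, i)] => //; rewrite lc1.
- move=> z hz; apply: ip_eqP => y; rewrite -badjPr SS ip0l ipC.
  rewrite (@in_closure_ip0 _ _ V) ?rmorph0//; first exact: (hS y).1.
  move=> _ [l _ <-]; rewrite ip_suml big1// => p _; by rewrite ipZl hz mulr0.
- apply: adj_bound => // x; rewrite SS; have [SV SE] := hS x.
  apply: (in_closure_bound SV); first by rewrite mulr_ge0 ?nm_ge0.
  move=> _ [l _ <-]; rewrite SE; last by exists l.
  rewrite gE; apply: le_trans (ip_le _ _) _; rewrite mulrAC ler_wpM2r ?nm_ge0//.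
Qed.

Lemma gram_ext I H K (s : I -> H) (t : I -> K) (k : R) : 0 <= k ->
  (forall i j, '[t i, t j] = k%:C * '[s i, s j]) ->
  exists T : bop H K, [/\ forall i, T (s i) = t i,
    forall z, (forall i, '[s i, z] = 0) -> T z = 0 &
    forall x, nm (T x) <= Num.sqrt k * nm x].
Proof.
move=> k0 h; apply: ext_exists; first exact: sqrtr_ge0.
move=> l; apply: sqr_le; first by rewrite mulr_ge0 ?nm_ge0 ?sqrtr_ge0.
rewrite exprMn sqr_sqrtr// -!ripxx /rip -Re_mulr !ip_lc.
rewrite mulr_sumr le_eqVlt; apply/orP; left; apply/eqP; congr Re.
apply: eq_bigr => p _; rewrite mulr_sumr; apply: eq_bigr => q _.
by rewrite h; ring.
Qed.

Lemma bernoulli (d : R) n : 0 <= d -> 1 + n%:R * d <= (1 + d) ^+ n.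
Proof.
move=> d0; elim: n => [|n IH]; first by rewrite mul0r addr0.
rewrite exprS; apply: le_trans (ler_wpM2l _ IH); last by lra.
have : 0 <= n%:R * d by rewrite mulr_ge0.
rewrite -natr1; nra.
Qed.

(** If r = a 1 / a 0 exceeded B, repeated squaring would give a (2^k) >= a 0 r^(2^k), which outgrows
    c B^(2^k): the spectral radius argument. *)
Lemma pow_trick (a : nat -> R) (c B : R) : 0 <= B -> (forall n, 0 <= a n) ->
  (forall n, a n ^+ 2 <= a 0 * a (n + n)%N) -> (forall n, a n <= c * B ^+ n) ->
  a 1%N <= B * a 0.
Proof.
move=> B0 a0 hsq hB; rewrite leNgt; apply/negP => h.
have a00 : 0 < a 0.
  rewrite lt_def a0 andbT; apply/eqP => a00.
  have := hsq 1%N; have := a0 1%N; rewrite a00 mulr0 in h; rewrite a00 mul0r; nra.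
set r := a 1%N / a 0.
have rB : B < r by rewrite ltr_pdivlMr.
have ra k : a 0 * r ^+ (2 ^ k) <= a (2 ^ k)%N.
  elim: k => [|k IH]; first by rewrite expn0 expr1 mulrCA mulfV ?mulr1// gt_eqF.
  have := hsq (2 ^ k)%N; rewrite addnn -mul2n -expnS => h2.
  rewrite -(ler_pM2l a00); apply: le_trans h2.
  rewrite expnS mulnC exprM mulrA -expr2 -exprMn ler_sqr ?nnegrE//.
  by rewrite mulr_ge0 ?a0// exprn_ge0// divr_ge0 ?a0.
have Bp : 0 < B.
  rewrite lt_def B0 andbT; apply/eqP => Bz.
  by have := hB 1%N; have := h; rewrite Bz mul0r expr1 mulr0; lra.
set d := r / B - 1.
have d0 : 0 < d by rewrite subr_gt0 ltr_pdivlMr// mul1r.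
have key k : 1 + k%:R * d <= c / a 0.
  apply: (@le_trans _ _ ((1 + d) ^+ (2 ^ k))).
    apply: le_trans (bernoulli _ (ltW d0)).
    by rewrite lerD2l ler_pM2r// ler_nat ltnW// ltn_expl.
  rewrite ler_pdivlMr//; have -> : 1 + d = r / B by rewrite addrC subrK.
  rewrite expr_div_n mulrAC ler_pdivrMr ?exprn_gt0// mulrC.
  exact: le_trans (ra k) (hB _).
have c0 : 0 <= c / a 0 by have := key 0%N; rewrite mul0r addr0; lra.
have := key (Num.bound (c / a 0 / d)).
have cd0 : 0 <= c / a 0 / d by rewrite divr_ge0// ltW.
by have := archi_boundP cd0; rewrite ltr_pdivrMr//; lra.
Qed.

(* Boundedness of s i |-> t i without knowing it on sums: if the Gram matrix of
   t is that of s twisted by a symmetric y whose powers grow geometrically, then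
   a_n = |sum c_i s (y^n i)| satisfies a_n^2 <= a_0 a_2n. *)
Lemma power_ext I H K (s : I -> H) (t : I -> K) (y : I -> I) (B : R) (c : I -> R) :
  0 <= B -> (forall i j, '[t i, t j] = '[s i, s (y j)]) ->
  (forall i j, '[s (y i), s j] = '[s i, s (y j)]) ->
  (forall n i, nm (s (iter n y i)) <= c i * B ^+ n) ->
  exists T : bop H K, [/\ forall i, T (s i) = t i,
    forall z, (forall i, '[s i, z] = 0) -> T z = 0 &
    forall x, nm (T x) <= Num.sqrt B * nm x].
Proof.
move=> B0 tE yE hc; apply: ext_exists; first exact: sqrtr_ge0.
move=> l; pose sy n := lc (fun i => s (iter n y i)) l; pose a n := nm (sy n).
have itE n i j m : '[s (iter n y i), s (iter m y j)] = '[s i, s (iter (n + m) y j)].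
  by elim: n m => // n' IH m; rewrite iterS yE -iterS IH addnS addSn.
have a1 : a 1%N <= B * a 0.
  apply: (@pow_trick a (\sum_(p <- l) Re `|p.1| * c p.2)) => //.
  - by move=> n; exact: nm_ge0.
  - move=> n; rewrite -ripxx /rip.
    have -> : '[sy n, sy n] = '[sy 0, sy (n + n)%N].
      rewrite !ip_lc; apply: eq_bigr => p _; apply: eq_bigr => q _.
      by rewrite itE.
    exact: rip_le.
  - move=> n; rewrite mulr_suml /a /sy /lc.
    elim: (l) => [|p l' IH]; first by rewrite !big_nil nm0.
    rewrite !big_cons; apply: le_trans (nmD _ _) _; apply: lerD => //.
    by rewrite nmZ -mulrA ler_wpM2l ?Re_norm_ge0.
apply: sqr_le; first by rewrite mulr_ge0 ?nm_ge0 ?sqrtr_ge0.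
rewrite exprMn sqr_sqrtr// -ripxx /rip.
have -> : '[lc t l, lc t l] = '[sy 0, sy 1%N].
  by rewrite !ip_lc; apply: eq_bigr => p _; apply: eq_bigr => q _; rewrite tE.
apply: le_trans (rip_le _ _) _.
apply: le_trans (ler_wpM2l (nm_ge0 (sy 0)) a1) _.
by rewrite mulrCA -expr2.
Qed.

End BoundedOperators.

(** * Spans, rank one operators and finite orthonormal lists *)

Section Density.
Context {R : realType}.
Implicit Types H K L : hilbert R.

Lemma lspan_ind (V : lmodType R[i]) (A P : set V) :
  P 0 -> (forall c u v, P u -> P v -> P (c *: u + v)) -> A `<=` P ->
  lspan A `<=` P.
Proof. by move=> P0 PZ AP x; apply; split. Qed.

Lemma lspan_csub (V : lmodType R[i]) (A : set V) :
  lspan A 0 /\ forall c u v, lspan A u -> lspan A v -> lspan A (c *: u + v).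
Proof.
split; first by move=> B [[]].
by move=> c u v hu hv B hB; apply: hB.1.2; [exact: hu|exact: hv].
Qed.

Lemma lspan_sub (V : lmodType R[i]) (A : set V) : A `<=` lspan A.
Proof. by move=> x Ax B [_]; apply. Qed.

Lemma closure_in H (A : set H) x : closure A x -> in_closure A x.
Proof.
move=> hx e e0; have e0' : (0 : R[i]) < e%:C by rewrite ltcR.
have [y [Ay]] := hx _ (nbhsx_ballx x _ e0').
by rewrite -ball_normE /= normE ltcR => /ltW h; exists y.
Qed.

Lemma in_closure_total H (A : set H) : csubspace A -> (forall x, in_closure A x) -> total A.
Proof.
move=> _ hA z hz; apply/eqP; rewrite -nm_eq0 -sqrf_eq0 -ripxx /rip.
by rewrite (@in_closure_ip0 _ _ A).
Qed.

Lemma closure_total H (A : set H) : closure (lspan A) = setT -> total A.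
Proof.
move=> hA z hz; apply: (@in_closure_total _ (lspan A)) => //.
- by have [? ?] := lspan_csub A; split.
- by move=> x; apply: closure_in; rewrite hA.
- apply: lspan_ind => [|c u v hu hv|x]; first exact: ip0l.
  + by rewrite /= ipDl ipZl hu hv mulr0 addr0.
  + exact: hz.
Qed.

Definition brk H K (a : K) (b : H) : H -> K := fun x => '[x, b] *: a.
Lemma brk_bounded H K (a : K) (b : H) : bounded_op (brk a b).
Proof.
apply: bounded_opP; first by move=> c u v; rewrite /brk ipDl ipZl scalerDl scalerA.
exists (nm b * nm a) => x; rewrite /brk nmZ mulrAC ler_wpM2r ?nm_ge0// mulrC.
exact: ip_le.
Qed.
Definition bbrk H K (a : K) (b : H) : bop H K := Bop (brk_bounded a b).
Lemma bbrkE H K (a : K) (b : H) x : bbrk a b x = '[x, b] *: a.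
Proof. by []. Qed.
Lemma badj_brk H K (a : K) (b : H) : badj (bbrk a b) = bbrk b a.
Proof.
apply: adj_uniq => x y; rewrite !bbrkE ipZl ipZr -(ipC a y).
exact: mulrC.
Qed.

Fixpoint onl H (l : seq H) : Prop :=
  if l is e :: l' then
    [/\ '[e, e] = 1, forall e', e' \in l' -> '[e', e] = 0 & onl l']
  else True.

Definition lproj H (l : seq H) : bop H H := \sum_(e <- l) bbrk e e.

Lemma lprojE H (l : seq H) x : lproj l x = \sum_(e <- l) '[x, e] *: e.
Proof. by rewrite /lproj bsumE. Qed.

Lemma lproj_sa H (l : seq H) : badj (lproj l) = lproj l.
Proof.
apply: adj_uniq => x y; rewrite !lprojE ip_suml ip_sumr.
by apply: eq_bigr => e _; rewrite ipZl ipZr -(ipC e y) mulrC.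
Qed.

Lemma lproj_mem H (l : seq H) e : onl l -> e \in l -> lproj l e = e.
Proof.
rewrite lprojE; elim: l => // f l IH /= [f1 fl ol].
rewrite inE big_cons => /orP[/eqP->|el].
  rewrite f1 scale1r -[RHS]addr0; congr (_ + _); rewrite big_seq big1// => g gl.
  by rewrite ipC fl// rmorph0 scale0r.
by rewrite fl// scale0r add0r IH.
Qed.

Lemma lproj_idem H (l : seq H) x : onl l -> lproj l (lproj l x) = lproj l x.
Proof.
move=> ol; rewrite [in LHS](lprojE l x) bop_sum [RHS]lprojE.
by apply: eq_big_seq => e el; rewrite bopZ lproj_mem.
Qed.

Lemma lproj_le H (l : seq H) x : onl l -> nm (lproj l x) <= nm x.
Proof.
move=> ol; have [h0|hn0] := eqVneq (nm (lproj l x)) 0; first by rewrite h0 nm_ge0.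
have np : 0 < nm (lproj l x) by rewrite lt_def hn0 nm_ge0.
rewrite -(ler_pM2l np) -expr2 -ripxx /rip badjP lproj_sa lproj_idem// mulrC.
exact: rip_le.
Qed.

Lemma lproj_step H (l : seq H) v : onl l ->
  exists l', [/\ onl l', lproj l' v = v & forall x, lproj l x = x -> lproj l' x = x].
Proof.
move=> ol; have [v0|vn0] := eqVneq (v - lproj l v) 0.
  by exists l; split=> //; apply/esym/eqP; rewrite -subr_eq0 v0.
set w := v - lproj l v in vn0; set e := ((nm w)^-1)%:C *: w.
have np : 0 < nm w by rewrite lt_def nm_eq0 vn0 nm_ge0.
have we x : lproj l x = x -> '[x, w] = 0.
  by move=> <-; rewrite /w badjP lproj_sa bopB lproj_idem// subrr ip0r.
have ew x : lproj l x = x -> '[x, e] = 0 by move=> h; rewrite ipZr we// mulr0.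
have e1 : '[e, e] = 1.
  rewrite ipZl ipZr ipxx conjc_real -!rmorphM.
  have -> : (nm w)^-1 * ((nm w)^-1 * nm w ^+ 2) = 1 by field; rewrite gt_eqF.
  by [].
have lE x : lproj (e :: l) x = '[x, e] *: e + lproj l x.
  by rewrite !lprojE big_cons.
exists (e :: l); split.
- by split => // e' el; apply: ew; exact: lproj_mem.
- rewrite lE -[X in _ = X](subrK (lproj l v)); congr (_ + _).
  have -> : '[v, e] = '[w, e] by rewrite ipBl (ew (lproj l v)) ?subr0// lproj_idem.
  rewrite /e ipZr scalerA ipxx conjc_real -!rmorphM.
  have -> : (nm w)^-1 * nm w ^+ 2 * (nm w)^-1 = 1 by field; rewrite gt_eqF.
  by rewrite scale1r.
- by move=> x h; rewrite lE ew// scale0r add0r.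
Qed.

Lemma gram_schmidt H (l0 vs : seq H) : onl l0 ->
  exists l, [/\ onl l, forall v, v \in vs -> lproj l v = v &
    forall x, lproj l0 x = x -> lproj l x = x].
Proof.
move=> o0; elim: vs => [|v vs [l [ol h1 h2]]]; first by exists l0.
have [l' [ol' h3 h4]] := lproj_step v ol; exists l'; split => //.
  by move=> x; rewrite inE => /orP[/eqP->//|xv]; apply/h4/h1.
by move=> x hx; apply/h4/h2.
Qed.

End Density.

(** * Tensor products of operators, slices and reassociation *)

Section TensorOperators.
Context {R : realType} (tp : tensor_choice R).
Implicit Types H K L : hilbert R.
Local Notation "h @ox k" := (tens (tp _ _) h k) (at level 40).

Definition tsr H K (p : H * K) : tp H K := p.1 @ox p.2.

Lemma tsr_total H K : total (range (@tsr H K)).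
Proof.
move=> z hz; apply: (closure_total (tens_dense (tp H K))) => _ [h _ [k _ <-]].
by apply: hz; exists (h, k).
Qed.

Lemma tens_total H K (z : tp H K) : (forall h k, '[h @ox k, z] = 0) -> z = 0.
Proof. by move=> h; apply: tsr_total => _ [[a b] _ <-]; exact: h. Qed.

Lemma tens_eqP H K (x y : tp H K) : (forall h k, '[h @ox k, x] = '[h @ox k, y]) -> x = y.
Proof.
move=> h; apply/eqP; rewrite -subr_eq0; apply/eqP/tens_total => a b.
by rewrite ipBr h subrr.
Qed.

Lemma tens_linl H K a (h h' : H) (k : K) :
  (a *: h + h') @ox k = a *: (h @ox k) + h' @ox k.
Proof.
by apply: tens_eqP => b c; rewrite ipDr ipZr !tens_dot ipDr ipZr; ring.
Qed.

Lemma tens_linr H K a (h : H) (k k' : K) :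
  h @ox (a *: k + k') = a *: (h @ox k) + h @ox k'.
Proof.
by apply: tens_eqP => b c; rewrite ipDr ipZr !tens_dot ipDr ipZr; ring.
Qed.

Lemma nm_tens H K (h : H) (k : K) : nm (h @ox k) = nm h * nm k.
Proof.
apply/eqP; rewrite -(@eqrXn2 _ 2) ?nm_ge0 ?mulr_ge0 ?nm_ge0//.
apply/eqP/complexI; rewrite -ipxx tens_dot !ipxx -rmorphM; congr _%:C.
by rewrite exprMn.
Qed.

Lemma lcol_bounded H K (h : H) : bounded_op (fun k : K => h @ox k).
Proof.
apply: bounded_opP; first by move=> a u v; exact: tens_linr.
by exists (nm h) => k; rewrite nm_tens.
Qed.
Definition lcol H K (h : H) : bop K (tp H K) := Bop (@lcol_bounded H K h).
Arguments lcol {H K} h.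
Lemma rcol_bounded H K (k : K) : bounded_op (fun h : H => h @ox k).
Proof.
apply: bounded_opP; first by move=> a u v; exact: tens_linl.
by exists (nm k) => h; rewrite nm_tens mulrC.
Qed.
Definition rcol H K (k : K) : bop H (tp H K) := Bop (@rcol_bounded H K k).
Arguments rcol {H K} k.
Lemma lcolE H K (h : H) (k : K) : lcol h k = h @ox k. Proof. by []. Qed.
Lemma rcolE H K (h : H) (k : K) : rcol k h = h @ox k. Proof. by []. Qed.

Lemma lcol_adjE H K (h h' : H) (k : K) : badj (lcol h) (h' @ox k) = '[h', h] *: k.
Proof. by apply: ip_eqPr => z; rewrite -badjP lcolE tens_dot ipZr -ipC. Qed.
Lemma rcol_adjE H K (h : H) (k k' : K) : badj (rcol k) (h @ox k') = '[k', k] *: h.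
Proof. by apply: ip_eqPr => z; rewrite -badjP rcolE tens_dot ipZr -ipC mulrC. Qed.

Lemma lcol_adj0 H K (z : tp H K) : (forall h, badj (lcol h) z = 0) -> z = 0.
Proof. by move=> hz; apply: tens_total => h k; rewrite -lcolE badjP hz ip0r. Qed.
Lemma rcol_adj0 H K (z : tp H K) : (forall h, badj (rcol h) z = 0) -> z = 0.
Proof. by move=> hz; apply: tens_total => h k; rewrite -rcolE badjP hz ip0r. Qed.

Lemma tens_ext H K L (S T : bop (tp H K) L) :
  (forall h k, S (h @ox k) = T (h @ox k)) -> S = T.
Proof. by move=> h; apply: bop_eq_total (@tsr_total H K) _ => -[a b]; exact: h. Qed.

Lemma tens_ext_ip H K H' K' (S T : bop (tp H K) (tp H' K')) :
  (forall h k h' k', '[S (h @ox k), h' @ox k'] = '[T (h @ox k), h' @ox k']) -> S = T.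
Proof.
move=> e; apply: tens_ext => h k; apply: tens_eqP => h' k'.
by rewrite ipC e -ipC.
Qed.

(** Boundedness on sums of elementary tensors comes from [power_ext] for the map sending h and k to
    (adj x) x h and (adj y) y k: the iterates grow geometrically on each single tensor. *)
Lemma optens_ex H K H' K' (x : bop H H') (y : bop K K') :
  exists T : bop (tp H K) (tp H' K'), forall h k, T (h @ox k) = x h @ox y k.
Proof.
have [a a0 ha] := bop_bound (bcomp (badj x) x).
have [b b0 hb] := bop_bound (bcomp (badj y) y).
have [||||T [hT _ _]] := @power_ext R (H * K)%type (tp H K) (tp H' K') (@tsr H K)
  (fun p => x p.1 @ox y p.2) (fun p => (badj x (x p.1), badj y (y p.2)))
  (a * b) (fun p => nm p.1 * nm p.2).
- exact: mulr_ge0.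
- by move=> [h k] [h' k']; rewrite /tsr /= !tens_dot !badjP.
- by move=> [h k] [h' k']; rewrite /tsr /= !tens_dot -!badjP -!badjPr.
- elim=> [|n IH] [h k] /=; first by rewrite /tsr nm_tens expr0 mulr1.
  have := IH (h, k); case: (iter n _ _) => u v; rewrite /tsr /= !nm_tens => h1.
  rewrite exprSr mulrA; apply: (@le_trans _ _ ((a * nm u) * (b * nm v))).
    by apply: ler_pM; rewrite ?nm_ge0 ?ha ?hb.
  have -> : a * nm u * (b * nm v) = (nm u * nm v) * (a * b) by ring.
  by apply: ler_wpM2r => //; exact: mulr_ge0.
by exists T => h k; exact: (hT (h, k)).
Qed.

Lemma optensP H K H' K' (x : bop H H') (y : bop K K') :
  bounded_op (@optens R tp H K H' K' x y) /\ forall h k, @optens R tp H K H' K' x y (h @ox k) = x h @ox y k.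
Proof.
have [T hT] := optens_ex x y.
suff : [set T | bounded_op T /\ forall h k, T (h @ox k) = x h @ox y k] (@optens R tp H K H' K' x y).
  by [].
by rewrite /optens; apply: xgetPex; exists (bfun T); split => //; exact: bopP.
Qed.

Definition bopt H K H' K' (x : bop H H') (y : bop K K') :
  bop (tp H K) (tp H' K') := Bop (optensP x y).1.

Lemma boptE H K H' K' (x : bop H H') (y : bop K K') h k :
  bopt x y (h @ox k) = x h @ox y k.
Proof. exact: (optensP x y).2. Qed.

Lemma bopt_comp H K H' K' H2 K2 (x : bop H H') (y : bop K K')
    (x' : bop H' H2) (y' : bop K' K2) :
  bcomp (bopt x' y') (bopt x y) = bopt (bcomp x' x) (bcomp y' y).
Proof. by apply: tens_ext => h k; rewrite bcompE !boptE. Qed.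

Lemma badj_bopt H K H' K' (x : bop H H') (y : bop K K') :
  badj (bopt x y) = bopt (badj x) (badj y).
Proof.
apply: tens_ext => h k; apply: tens_eqP => h' k'.
by rewrite -badjP !boptE !tens_dot -!badjP.
Qed.

Lemma bopt_id H K : bopt (bid H) (bid K) = bid (tp H K).
Proof. by apply: tens_ext => h k; rewrite boptE. Qed.

Lemma bopt_linl H K H' K' c (x x' : bop H H') (y : bop K K') :
  bopt (c *: x + x') y = c *: bopt x y + bopt x' y.
Proof.
by apply: tens_ext => h k; rewrite baddE bscaleE !boptE baddE bscaleE tens_linl.
Qed.

Lemma bopt_linr H K H' K' c (x : bop H H') (y y' : bop K K') :
  bopt x (c *: y + y') = c *: bopt x y + bopt x y'.
Proof.
by apply: tens_ext => h k; rewrite baddE bscaleE !boptE baddE bscaleE tens_linr.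
Qed.

Definition bsl H K H' K' (h : H) (h' : H') (X : bop (tp H K) (tp H' K')) : bop K K' :=
  bcomp (badj (lcol h')) (bcomp X (lcol h)).
Definition bsr H K H' K' (k : K) (k' : K') (X : bop (tp H K) (tp H' K')) : bop H H' :=
  bcomp (badj (rcol k')) (bcomp X (rcol k)).

Lemma bslE H K H' K' (h : H) (h' : H') (X : bop (tp H K) (tp H' K')) k k' :
  '[bsl h h' X k, k'] = '[X (h @ox k), h' @ox k'].
Proof. by rewrite !bcompE -badjPr. Qed.
Lemma bsrE H K H' K' (k : K) (k' : K') (X : bop (tp H K) (tp H' K')) h h' :
  '[bsr k k' X h, h'] = '[X (h @ox k), h' @ox k'].
Proof. by rewrite !bcompE -badjPr. Qed.

Lemma vslice_lE H K (h h' : H) (X : bop (tp H K) (tp H K)) :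
  vslice_l h h' X = bsl h h' X.
Proof.
apply/funext => k; apply: ip_eqP => k'; rewrite bslE.
have : [set Y : K -> K | forall k k', '[Y k, k'] = '[X (h @ox k), h' @ox k']]
  (vslice_l h h' X) by apply: xgetPex; exists (bfun (bsl h h' X)) => ? ?; exact: bslE.
exact.
Qed.

Lemma vslice_rE H K (k k' : K) (X : bop (tp H K) (tp H K)) :
  vslice_r k k' X = bsr k k' X.
Proof.
apply/funext => h; apply: ip_eqP => h'; rewrite bsrE.
have : [set Y : H -> H | forall h h', '[Y h, h'] = '[X (h @ox k), h' @ox k']]
  (vslice_r k k' X) by apply: xgetPex; exists (bfun (bsr k k' X)) => ? ?; exact: bsrE.
exact.
Qed.

Lemma tens3_total H K L (z : tp (tp H K) L) :
  (forall h k l, '[(h @ox k) @ox l, z] = 0) -> z = 0.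
Proof.
move=> hz; apply: rcol_adj0 => l; apply: tens_total => h k.
by rewrite -badjP; exact: hz.
Qed.

Lemma tens3r_total H K L (z : tp H (tp K L)) :
  (forall h k l, '[h @ox (k @ox l), z] = 0) -> z = 0.
Proof.
move=> hz; apply: lcol_adj0 => h; apply: tens_total => k l.
by rewrite -badjP; exact: hz.
Qed.

Lemma tens3_ext H K L E (S T : bop (tp (tp H K) L) E) :
  (forall h k l, S ((h @ox k) @ox l) = T ((h @ox k) @ox l)) -> S = T.
Proof.
move=> h; apply: tens_ext => x l.
have e : bcomp S (rcol l) = bcomp T (rcol l) by apply: tens_ext => a b; exact: h.
exact: (congr1 (fun U : bop _ _ => U x) e).
Qed.

Lemma tens3r_ext H K L E (S T : bop (tp H (tp K L)) E) :
  (forall h k l, S (h @ox (k @ox l)) = T (h @ox (k @ox l))) -> S = T.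
Proof.
move=> h; apply: tens_ext => a x.
have e : bcomp S (lcol a) = bcomp T (lcol a) by apply: tens_ext => k l; exact: h.
exact: (congr1 (fun U : bop _ _ => U x) e).
Qed.

Lemma assocP H K L :
  bounded_op (@assoc R tp H K L) /\
  forall h k l, @assoc R tp H K L ((h @ox k) @ox l) = h @ox (k @ox l).
Proof.
have [|T [hT _ _]] := @gram_ext R (H * K * L)%type (tp (tp H K) L) (tp H (tp K L))
  (fun p => (p.1.1 @ox p.1.2) @ox p.2) (fun p => p.1.1 @ox (p.1.2 @ox p.2)) 1 ler01.
  by move=> [[h k] l] [[h' k'] l'] /=; rewrite !tens_dot mul1r mulrA.
suff : [set T | bounded_op T /\
    forall h k l, T ((h @ox k) @ox l) = h @ox (k @ox l)] (@assoc R tp H K L).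
  by [].
rewrite /assoc; apply: xgetPex; exists (bfun T); split; first exact: bopP.
by move=> h k l; exact: (hT (h, k, l)).
Qed.

Definition basc H K L : bop (tp (tp H K) L) (tp H (tp K L)) := Bop (assocP H K L).1.
Arguments basc {H K L}.

Lemma bascE H K L (h : H) (k : K) (l : L) :
  basc ((h @ox k) @ox l) = h @ox (k @ox l).
Proof. exact: (assocP H K L).2. Qed.

Lemma basc_adjE H K L (h : H) (k : K) (l : L) :
  badj basc (h @ox (k @ox l)) = (h @ox k) @ox l.
Proof.
apply/eqP; rewrite -subr_eq0; apply/eqP/tens3_total => h' k' l'.
by rewrite ipBr -badjP bascE !tens_dot mulrA subrr.
Qed.

Lemma bascK H K L (x : tp (tp H K) L) : badj basc (basc x) = x.
Proof.
rewrite -bcompE; have -> : bcomp (badj basc) basc = bid (tp (tp H K) L); last by [].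
by apply: tens3_ext => h k l; rewrite bcompE bascE basc_adjE.
Qed.

Lemma bascKV H K L (x : tp H (tp K L)) : basc (badj basc x) = x.
Proof.
rewrite -bcompE; have -> : bcomp basc (badj basc) = bid (tp H (tp K L)); last by [].
by apply: tens3r_ext => h k l; rewrite bcompE basc_adjE bascE.
Qed.

End TensorOperators.

Arguments lcol {R tp H K} h.
Arguments rcol {R tp H K} k.
Arguments bopt {R tp H K H' K'} x y.
Arguments basc {R tp H K L}.

(** * Positive operators and their resolvents *)

Section PositiveOperators.
Context {R : realType}.
Implicit Types H K L : hilbert R.

Lemma sa_lin H (A : set (H -> H)) c (x y : bop H H) :
  star_alg A -> A x -> A y -> A (c *: x + y : bop H H).
Proof. by move=> hA Ax Ay; exact: (star_alg_lin hA c Ax Ay). Qed.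
Lemma sa_0 H (A : set (H -> H)) : star_alg A -> A (0 : bop H H).
Proof. by move=> hA; exact: (star_alg_0 hA). Qed.
Lemma sa_scale H (A : set (H -> H)) c (x : bop H H) :
  star_alg A -> A x -> A (c *: x : bop H H).
Proof. by move=> hA Ax; rewrite -[c *: x]addr0; apply: sa_lin => //; exact: sa_0. Qed.
Lemma sa_add H (A : set (H -> H)) (x y : bop H H) :
  star_alg A -> A x -> A y -> A (x + y : bop H H).
Proof. by move=> hA Ax Ay; rewrite -[x]scale1r; exact: sa_lin. Qed.
Lemma sa_sub H (A : set (H -> H)) (x y : bop H H) :
  star_alg A -> A x -> A y -> A (x - y : bop H H).
Proof. by move=> hA Ax Ay; rewrite addrC -scaleN1r; exact: sa_lin. Qed.
Lemma sa_sum H (A : set (H -> H)) (I : eqType) (r : seq I) (F : I -> bop H H) :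
  star_alg A -> (forall i, i \in r -> A (F i)) -> A (\sum_(i <- r) F i : bop H H).
Proof.
move=> hA; elim: r => [|i r IH] h; first by rewrite big_nil; exact: sa_0.
rewrite big_cons; apply: sa_add => //; first by apply: h; rewrite mem_head.
by apply: IH => j jr; apply: h; rewrite inE jr orbT.
Qed.
Lemma sa_comp H (A : set (H -> H)) (x y : bop H H) :
  star_alg A -> A x -> A y -> A (bcomp x y).
Proof. by move=> hA Ax Ay; exact: (star_alg_mul hA Ax Ay). Qed.
Lemma sa_adj H (A : set (H -> H)) (x : bop H H) : star_alg A -> A x -> A (badj x).
Proof. by move=> hA Ax; exact: (star_alg_adj hA Ax). Qed.
Lemma sa_bop H (A : set (H -> H)) (x : H -> H) : star_alg A -> A x ->
  exists2 x' : bop H H, A x' & x = x'.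
Proof.
by move=> hA Ax; have [x' e] := bop_of (star_alg_bounded hA Ax); exists x'; rewrite -?e.
Qed.

Lemma closed_mem H (A : set (H -> H)) (T : bop H H) : opclosure A `<=` A ->
  star_alg A ->
  (forall e, 0 < e -> exists2 S : bop H H, A S & forall x, nm (T x - S x) <= e * nm x) ->
  A T.
Proof.
move=> cA sA h; apply: cA; split; first exact: bopP.
move=> e; rewrite ltcE => /andP[/eqP /= ie re].
have [S AS hS] := h _ re; exists (bfun S) => //.
have -> : e = (Re e)%:C by case: e ie {re hS} => a b /= ->.
by apply/opnorm_leP => x; exact: hS.
Qed.

Definition psd H (T : bop H H) := badj T = T /\ forall x, 0 <= rip (T x) x.
Definition ble H (S T : bop H H) := forall x, rip (S x) x <= rip (T x) x.

Lemma ext_quad H (T : bop H H) : (forall x, '[T x, x] = 0) -> T = 0.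
Proof.
move=> h; apply: bop_eq_ip => x y; rewrite b0E ip0l.
have h1 := h (x + y); have h2 := h (x + 'i *: y).
rewrite !(bopD, bopZ) !(ipDl, ipDr) !(ipZl, ipZr) !h in h1 h2.
move: h1 h2; case: '[T x, y] => a b; case: '[T y, x] => c d.
move=> /eqP; rewrite eq_complex /= => /andP[/eqP h1 /eqP h2].
move=> /eqP; rewrite eq_complex /= => /andP[/eqP h3 /eqP h4].
by apply/eqP; rewrite eq_complex /=; apply/andP; split; apply/eqP; lra.
Qed.

Lemma sa_quad H (T : bop H H) x : badj T = T -> '[T x, x] = (rip (T x) x)%:C.
Proof.
move=> hT; have : '[T x, x] = '[T x, x]^*%C by rewrite -ipC badjP hT.
rewrite /rip; case: '[T x, x] => a b [/eqP]; rewrite -addr_eq0 -mulr2n.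
by rewrite mulrn_eq0 /= => /eqP ->.
Qed.

Lemma psdP H (T : bop H H) : ople 0 T <-> psd T.
Proof.
split => [h|[sT h] x]; last first.
  have -> : (0 : H -> H) x = 0 by [].
  by rewrite ip0l sa_quad// ler0c.
have h0 x : 0 <= '[T x, x].
  have -> : (0 : R[i]) = '[(0 : H -> H) x, x] by rewrite -[(0 : H -> H) x]/(0 : H) ip0l.
  exact: h.
split; last by move=> x; have := h0 x; rewrite lecE => /andP[].
apply/eqP; rewrite -subr_eq0; apply/eqP/ext_quad => x.
rewrite bsubE ipBl -badjPr ipC; have := h0 x; rewrite lecE => /andP[/eqP ie _].
by move: ie; case: '[T x, x] => a b /= ->; rewrite oppr0 subrr.
Qed.

Lemma opleP H (S T : bop H H) : badj S = S -> badj T = T -> (ople S T <-> ble S T).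
Proof.
by move=> hS hT; split => h x; have := h x; rewrite !sa_quad// lecR.
Qed.

Lemma ople_sa H (S T : bop H H) : badj S = S -> ople S T -> badj T = T /\ ble S T.
Proof.
move=> hS h; have : psd (T - S).
  apply/psdP => x; rewrite -[(0 : H -> H) x]/(0 : H) ip0l bsubE ipBl subr_ge0.
  exact: h.
move=> [hTS h']; have hT : badj T = T.
  by move: hTS; rewrite badj_sub hS => /(congr1 (+%R^~ S)); rewrite !subrK.
by split => //; apply/opleP.
Qed.

Lemma psd_comp_adj H K (T : bop H K) : psd (bcomp (badj T) T).
Proof.
split; first by rewrite badj_comp badjK.
by move=> x; rewrite /rip bcompE -badjPr ipxx /= sqr_ge0.
Qed.

Lemma rip_adj_comp H K (T : bop H K) x : rip (bcomp (badj T) T x) x = nm (T x) ^+ 2.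
Proof. by rewrite /rip bcompE -badjPr ipxx. Qed.

Lemma psd_add H (S T : bop H H) : psd S -> psd T -> psd (S + T).
Proof.
move=> [hS pS] [hT pT]; split.
  by have := badj_lin 1 S T; rewrite conjc1 !scale1r hS hT.
by move=> x; rewrite baddE ripDl addr_ge0.
Qed.

Lemma badj_scaler H K (c : R) (S : bop H K) : badj (c%:C *: S) = c%:C *: badj S.
Proof.
by apply: adj_uniq => x y; rewrite !bscaleE ipZl ipZr conjc_real badjP.
Qed.

Lemma psd_scale H (c : R) (S : bop H H) : 0 <= c -> psd S -> psd (c%:C *: S).
Proof.
move=> c0 [hS pS]; split; first by rewrite badj_scaler hS.
by move=> x; rewrite bscaleE ripZl mulr_ge0.
Qed.

Lemma psd_0 H : psd (0 : bop H H).
Proof.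
split; first by apply: adj_uniq => x y; rewrite !b0E ip0l ip0r.
by move=> x; rewrite b0E rip0l.
Qed.

Lemma psd_sum H I (r : seq I) (F : I -> bop H H) :
  (forall i, psd (F i)) -> psd (\sum_(i <- r) F i).
Proof.
by move=> h; elim: r => [|i r IH]; rewrite ?big_nil ?big_cons; [exact: psd_0|exact: psd_add].
Qed.

Lemma sa_sym H (T : bop H H) x y : badj T = T -> rip (T x) y = rip (T y) x.
Proof. by move=> sT; rewrite /rip badjP sT -/(rip _ _) ripC. Qed.

Lemma sa_ip H (T : bop H H) x y : badj T = T -> '[T x, y] = '[x, T y].
Proof. by move=> sT; rewrite badjP sT. Qed.

Lemma psd_cs H (T : bop H H) x y : psd T ->
  rip (T x) y ^+ 2 <= rip (T x) x * rip (T y) y.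
Proof.
move=> [sT pT]; apply: discr_le => // t.
have := pT (x + t%:C *: y).
rewrite bopD bopZ ripDl !ripDr !ripZr !ripZl (sa_sym y x sT).
lra.
Qed.

(** The inequality T^2 <= k T, by Cauchy-Schwarz for the form of T at x and T x. *)
Lemma psd_nm H (T : bop H H) k x : psd T -> 0 <= k ->
  (forall x, rip (T x) x <= k * nm x ^+ 2) -> nm (T x) ^+ 2 <= k * rip (T x) x.
Proof.
move=> pT k0 hk; have [h0|hn0] := eqVneq (nm (T x)) 0.
  by rewrite h0 expr0n /= mulr_ge0 ?pT.2.
have np : 0 < nm (T x) ^+ 2 by rewrite exprn_gt0// lt_def hn0 nm_ge0.
rewrite -(ler_pM2l np) -expr2 -[in X in X <= _]ripxx.
apply: le_trans (psd_cs x (T x) pT) _.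
have := ler_wpM2l (pT.2 x) (hk (T x)); nra.
Qed.

Lemma le_bound H (T : bop H H) : exists2 k, 0 <= k & forall x, rip (T x) x <= k * nm x ^+ 2.
Proof.
have [k k0 hk] := bop_bound T; exists k => // x; apply: le_trans (rip_le _ _) _.
by rewrite expr2 mulrA ler_wpM2r ?nm_ge0.
Qed.

Lemma geometric_small (c r e : R) : 0 <= c -> 0 <= r -> r < 1 -> 0 < e ->
  exists n0, forall n, (n0 <= n)%N -> c * r ^+ n <= e.
Proof.
move=> c0 r0 r1 e0; have [rz|rn0] := eqVneq r 0.
  by exists 1%N => -[//|n] _; rewrite rz expr0n mulr0 ltW.
have rp : 0 < r by rewrite lt_def rn0.
pose d := r^-1 - 1; have d0 : 0 < d by rewrite subr_gt0 invf_gt1.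
have [n0 hn0] : exists n0 : nat, c / e / d <= n0%:R.
  by exists (Num.bound (c / e / d)); rewrite ltW// archi_boundP// !divr_ge0// ltW.
exists n0 => n hn.
have h : c / e <= (1 + d) ^+ n.
  apply: le_trans (bernoulli _ (ltW d0)).
  have : c / e / d <= n%:R by apply: le_trans hn0 _; rewrite ler_nat.
  by rewrite ler_pdivrMr//; lra.
have e1 : 1 + d = r^-1 by rewrite addrC subrK.
rewrite e1 exprVn ler_pdivrMr// in h.
by rewrite -ler_pdivlMr ?exprn_gt0// mulrC.
Qed.

Lemma geo_tail (r : R) n k : 0 <= r -> r < 1 ->
  \sum_(n <= i < n + k) r ^+ i <= r ^+ n / (1 - r).
Proof.
move=> r0 r1; have h : 0 < 1 - r by lra.
suff -> : \sum_(n <= i < n + k) r ^+ i = (r ^+ n - r ^+ (n + k)) / (1 - r).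
  by rewrite ler_pM2r ?invr_gt0// lerBlDr lerDl exprn_ge0.
elim: k => [|k IH]; first by rewrite addn0 big_geq// subrr mul0r.
rewrite addnS big_nat_recr ?leq_addr//= IH exprS; field; lra.
Qed.

Lemma geo_cauchy H (u : nat -> H) (c r : R) : 0 <= c -> 0 <= r -> r < 1 ->
  (forall n, nm (u n.+1 - u n) <= c * r ^+ n) ->
  (forall n k, nm (u (n + k)%N - u n) <= c * r ^+ n / (1 - r)) /\ cauchys u.
Proof.
move=> c0 r0 r1 h.
have h1 n k : nm (u (n + k)%N - u n) <= c * r ^+ n / (1 - r).
  apply: (@le_trans _ _ (c * \sum_(n <= i < n + k) r ^+ i)); last first.
    by rewrite -mulrA ler_wpM2l// geo_tail.
  elim: k => [|k IH]; first by rewrite addn0 subrr nm0 big_geq// mulr0.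
  rewrite addnS big_nat_recr ?leq_addr//= mulrDr.
  have -> : u (n + k).+1 - u n = (u (n + k)%N - u n) + (u (n + k).+1 - u (n + k)%N).
    by rewrite [RHS]addrC addrA subrK.
  by apply: le_trans (nmD _ _) _; apply: lerD.
split => // e e0.
have r1' : 0 < 1 - r by lra.
have e2 : 0 < e / 2 by lra.
have [|n0 hn0] := geometric_small (c := c / (1 - r)) _ r0 r1 e2.
  by rewrite divr_ge0// ltW.
exists n0 => n m hn hm.
have -> : u n - u m = (u n - u n0) - (u m - u n0) by rewrite opprB addrA subrK.
have := h1 n0 (n - n0)%N; have := h1 n0 (m - n0)%N; have := hn0 _ (leqnn n0).
rewrite !subnKC//; have := nmB (u n - u n0) (u m - u n0).
have -> : c / (1 - r) * r ^+ n0 = c * r ^+ n0 / (1 - r) by rewrite mulrAC.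
lra.
Qed.

Lemma cvs_le H (u : nat -> H) l (a : H) k : cvs u l -> (exists n0, forall n, (n0 <= n)%N -> nm (u n - a) <= k) ->
  nm (l - a) <= k.
Proof.
move=> hl [n0 h]; apply/ler_addgt0Pr => e e0; have [n1 h1] := hl _ e0.
have -> : l - a = - (u (maxn n0 n1) - l) + (u (maxn n0 n1) - a).
  by rewrite opprB addrA subrK.
apply: le_trans (nmD _ _) _; rewrite nmN addrC; apply: lerD.
  by apply: h; exact: leq_maxl.
by apply: h1; exact: leq_maxr.
Qed.

Lemma cvs_lin H (u v : nat -> H) a b c : cvs u a -> cvs v b ->
  cvs (fun n => c *: u n + v n) (c *: a + b).
Proof.
move=> hu hv e e0.
have k1 : 0 < Re `|c| + 1 by have := Re_norm_ge0 c; lra.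
have e1 : 0 < e / 2 / (Re `|c| + 1) by rewrite !divr_gt0.
have e2 : 0 < e / 2 by lra.
have [n0 h0] := hu _ e1; have [n1 h1] := hv _ e2; exists (maxn n0 n1) => n.
rewrite geq_max => /andP[hn0 hn1].
have -> : c *: u n + v n - (c *: a + b) = c *: (u n - a) + (v n - b).
  by rewrite scalerBr opprD addrACA.
apply: le_trans (nmD _ _) _; rewrite nmZ.
have := h1 _ hn1; suff : Re `|c| * nm (u n - a) <= e / 2 by lra.
apply: (@le_trans _ _ ((Re `|c| + 1) * (e / 2 / (Re `|c| + 1)))).
  by apply: ler_pM; rewrite ?Re_norm_ge0 ?nm_ge0 ?h0// lerDl.
by rewrite mulrCA mulfV ?mulr1// gt_eqF.
Qed.

Lemma cvs_bop H K (T : bop H K) u l : cvs u l -> cvs (fun n => T (u n)) (T l).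
Proof.
move=> hu e e0; have [k k0 hk] := bop_bound T.
have k1 : 0 < k + 1 by lra.
have e1 : 0 < e / (k + 1) by rewrite divr_gt0.
have [n0 h] := hu _ e1; exists n0 => n hn; rewrite -bopB.
apply: le_trans (hk _) _; apply: (@le_trans _ _ ((k + 1) * (e / (k + 1)))).
  by apply: ler_pM; rewrite ?nm_ge0 ?h// lerDl.
by rewrite mulrCA mulfV ?mulr1// gt_eqF.
Qed.

Lemma cvs_ip H (u : nat -> H) l y : cvs u l ->
  forall e, 0 < e -> exists n0, forall n, (n0 <= n)%N -> Re `|'[u n, y] - '[l, y]| <= e.
Proof.
move=> hu e e0; have k1 : 0 < nm y + 1 by have := nm_ge0 y; lra.
have e1 : 0 < e / (nm y + 1) by rewrite divr_gt0.
have [n0 h] := hu _ e1; exists n0 => n hn; rewrite -ipBl.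
apply: le_trans (ip_le _ _) _; rewrite mulrC.
apply: (@le_trans _ _ ((nm y + 1) * (e / (nm y + 1)))).
  by apply: ler_pM; rewrite ?nm_ge0 ?h// lerDl.
by rewrite mulrCA mulfV ?mulr1// gt_eqF.
Qed.

Lemma strong_limit H K (T : nat -> bop H K) k : 0 <= k ->
  (forall n x, nm (T n x) <= k * nm x) -> (forall x, cauchys (fun n => T n x)) ->
  exists2 S : bop H K, (forall x, cvs (fun n => T n x) (S x)) &
    forall x, nm (S x) <= k * nm x.
Proof.
move=> k0 hk hc.
have /choice[S hS] : forall x, exists y, cvs (fun n => T n x) y.
  by move=> x; exact: cauchys_cvs.
have [||S' e] := @mkbop R H K S k.
- move=> a u v; apply: cvs_unique (hS _) _ => e e0.
  have [n0 h] := cvs_lin a (hS u) (hS v) e0; exists n0 => n hn.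
  by rewrite bopZD; exact: h.
- move=> x; rewrite -[S x]subr0; apply: cvs_le (hS x) _.
  by exists 0%N => n _; rewrite subr0.
exists S' => x; rewrite -e; first exact: hS.
by rewrite -[S x]subr0; apply: cvs_le (hS x) _; exists 0%N => n _; rewrite subr0.
Qed.

Lemma geo_op H K (T : nat -> bop H K) (c r : R) : 0 <= c -> 0 <= r -> r < 1 ->
  (forall n x, nm (T n.+1 x - T n x) <= c * r ^+ n * nm x) ->
  exists S : bop H K, forall n x, nm (S x - T n x) <= c * r ^+ n / (1 - r) * nm x.
Proof.
move=> c0 r0 r1 h; have r1' : 0 < 1 - r by lra.
have h2 x := @geo_cauchy K (fun n => T n x) (c * nm x) r (mulr_ge0 c0 (nm_ge0 x)) r0 r1.
have h3 x : forall n, nm (T n.+1 x - T n x) <= c * nm x * r ^+ n.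
  by move=> n; rewrite mulrAC.
have [k k0 hk] := bop_bound (T 0%N).
have c1 : 0 <= c / (1 - r) by rewrite divr_ge0// ltW.
have [|||S hS _] := @strong_limit H K T (c / (1 - r) + k).
- by rewrite addr_ge0.
- move=> n x; have := (h2 x (h3 x)).1 0%N n; rewrite add0n expr0 mulr1 => h4.
  have := hk x; have := nmD (T n x - T 0%N x) (T 0%N x); rewrite subrK mulrDl.
  by rewrite mulrAC; lra.
- by move=> x; exact: (h2 x (h3 x)).2.
exists S => n x; apply: cvs_le (hS x) _; exists n => m hm.
have := (h2 x (h3 x)).1 n (m - n)%N; rewrite subnKC//.
by have -> : c * nm x * r ^+ n / (1 - r) = c * r ^+ n / (1 - r) * nm x by ring.
Qed.

Lemma closed_geo H (A : set (H -> H)) (T : nat -> bop H H) (S : bop H H) (c r : R) :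
  opclosure A `<=` A -> star_alg A -> 0 <= c -> 0 <= r -> r < 1 ->
  (forall n x, nm (S x - T n x) <= c * r ^+ n * nm x) -> (forall n, A (T n)) -> A S.
Proof.
move=> cA sA c0 r0 r1 h AT; apply: closed_mem => // e e0.
have [n0 hn] := geometric_small c0 r0 r1 e0.
exists (T n0) => // x; apply: le_trans (h _ _) _.
by rewrite ler_wpM2r ?nm_ge0 ?hn.
Qed.

(** Neumann series: with c = 1 / (1 + B) and Q = 1 - c (1 + k) one has 0 <= Q <= 1 - c, and c times
    the sum of the powers of Q inverts 1 + k. Since A may lack a unit, membership is stated for k
    r. *)
Lemma resolvent_ex H (k : bop H H) : psd k -> exists r : bop H H,
  (forall x, r x + k (r x) = x) /\
  forall A : set (H -> H), opclosure A `<=` A -> star_alg A -> A k -> A (bcomp k r).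
Proof.
move=> pk; have [B B0 hB] := le_bound k.
pose c := (1 + B)^-1; have c0 : 0 < c by rewrite invr_gt0; lra.
have cB : c * (1 + B) = 1 by rewrite mulVf// gt_eqF//; lra.
have c1 : c <= 1 by nra.
pose Q : bop H H := bid H - c%:C *: (bid H + k).
have QE x : Q x = x - c%:C *: (x + k x) by [].
have Qsa : badj Q = Q.
  by rewrite badj_sub badj_scaler badj_id; have := badj_lin 1 (bid H) k;
     rewrite conjc1 !scale1r badj_id pk.1 => ->.
have Qform x : rip (Q x) x = (1 - c) * nm x ^+ 2 - c * rip (k x) x.
  by rewrite QE ripBl ripZl ripDl ripxx; ring.
have pQ : psd Q.
  split => // x; rewrite Qform; have := hB x; have := sqr_ge0 (nm x); nra.
have Qn x : nm (Q x) <= (1 - c) * nm x.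
  apply: sqr_le; first by rewrite mulr_ge0 ?nm_ge0// subr_ge0.
  have h y : rip (Q y) y <= (1 - c) * nm y ^+ 2.
    by rewrite Qform; have := pk.2 y; nra.
  have c10 : 0 <= 1 - c by lra.
  apply: le_trans (psd_nm x pQ c10 h) _; rewrite exprMn (expr2 (1 - c)) -mulrA.
  by apply: ler_wpM2l; [lra|exact: h].
pose S := fix S n : bop H H := if n is n'.+1 then c%:C *: bid H + bcomp Q (S n') else 0.
have SE n x : S n.+1 x = c%:C *: x + Q (S n x) by [].
have Sd n x : nm (S n.+1 x - S n x) <= c * (1 - c) ^+ n * nm x.
  elim: n => [|n IH].
    rewrite SE b0E bop0 addr0 subr0 nmZr gtr0_norm//.
    by rewrite expr0 mulr1.
  have -> : S n.+2 x - S n.+1 x = Q (S n.+1 x - S n x).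
    by rewrite bopB !SE opprD addrACA subrr add0r.
  apply: le_trans (Qn _) _; rewrite exprS.
  by have -> : c * ((1 - c) * (1 - c) ^+ n) * nm x = (1 - c) * (c * (1 - c) ^+ n * nm x);
    [ring|apply: ler_wpM2l => //; lra].
have c10 : 0 <= 1 - c by lra.
have c11 : 1 - c < 1 by lra.
have [r hr] := geo_op (ltW c0) c10 c11 Sd.
have hr' n x : nm (r x - S n x) <= (1 - c) ^+ n * nm x.
  have := hr n x; rewrite subKr.
  by have -> : c * (1 - c) ^+ n / c = (1 - c) ^+ n by field; rewrite gt_eqF.
have cvr x : cvs (fun n => S n x) (r x).
  move=> e e0; have [n0 h] := geometric_small (nm_ge0 x) c10 c11 e0.
  exists n0 => n hn; rewrite nmBC; apply: le_trans (hr' n x) _; rewrite mulrC; exact: h.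
have rE x : r x + k (r x) = x.
  have h : r x = c%:C *: x + Q (r x).
    apply: (@cvs_unique _ _ (fun n => S n.+1 x)).
      by move=> e e0; have [n0 h] := cvr x e e0; exists n0 => n hn; apply: h; exact: leqW.
    move=> e e0; have [n0 h] := cvs_bop Q (cvr x) e0; exists n0 => n hn.
    by rewrite SE opprD addrACA subrr add0r; exact: h.
  move: h; rewrite QE addrCA => /eqP; rewrite -subr_eq0 opprD addrA subrr sub0r.
  rewrite oppr_eq0 -scalerBr scaler_eq0 => /orP[/eqP[c_0]|].
    by rewrite c_0 ltxx in c0.
  by rewrite subr_eq0 => /eqP.
exists r; split => // A cA sA Ak.
have [K K0 hK] := bop_bound k.
apply: (@closed_geo _ A (fun n => bcomp k (S n)) _ K (1 - c)) => //.
  move=> n x; rewrite !bcompE -bopB; apply: le_trans (hK _) _.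
  by rewrite -mulrA ler_wpM2l.
elim=> [|n IH].
  have -> : bcomp k (S 0%N) = 0 by apply: bop_eq => x; rewrite bcompE b0E bop0.
  exact: sa_0.
have -> : bcomp k (S n.+1) =
  (c%:C *: k + (1 - c)%:C *: bcomp k (S n)) - c%:C *: bcomp k (bcomp k (S n)).
  apply: bop_eq => x; rewrite [LHS]bcompE SE QE !(bsubE, baddE, bscaleE, bcompE).
  rewrite !(bopB, bopD, bopZ).
  rewrite rmorphB /= scalerBl scale1r scalerDr opprD !addrA.
  by rewrite bopB bopN !bopZ !addrA.
by apply: sa_sub => //; [apply: sa_add => //; exact: sa_scale|do 2?[apply: sa_scale|apply: sa_comp]].
Qed.

Definition res H (k : bop H H) : bop H H :=
  xget (0 : bop H H) [set r : bop H H | forall x, r x + k (r x) = x].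
(** The transform k / (1 + k): monotone, at most 1, and contained in every norm closed star algebra
    containing k. It turns unbounded increasing families into bounded ones. *)
Definition gg H (k : bop H H) : bop H H := bcomp k (res k).

Section Resolvent.
Variables (H : hilbert R) (k : bop H H) (pk : psd k).

Lemma resE x : res k x + k (res k x) = x.
Proof.
have [r [hr _]] := resolvent_ex pk.
suff : [set r : bop H H | forall x, r x + k (r x) = x] (res k) by apply.
by apply: xgetPex; exists r.
Qed.

Lemma one_plus_inj x y : x + k x = y + k y -> x = y.
Proof.
move=> h; apply/eqP; rewrite -subr_eq0 -nm_eq0 -sqrf_eq0.
have h0 : (x - y) + k (x - y) = 0 by rewrite bopB addrACA -opprD h subrr.
have := rip0l (x - y); rewrite -{1}h0 ripDl ripxx => h1.
by have := pk.2 (x - y); have := sqr_ge0 (nm (x - y)); rewrite eq_le; lra.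
Qed.

Lemma resEr x : res k (x + k x) = x.
Proof. by apply: one_plus_inj; rewrite resE. Qed.

Lemma gg_mem (A : set (H -> H)) : opclosure A `<=` A -> star_alg A -> A k -> A (gg k).
Proof.
move=> cA sA Ak; have [r [hr /(_ A cA sA Ak)]] := resolvent_ex pk.
suff -> : r = res k by [].
by apply: bop_eq => x; apply: one_plus_inj; rewrite resE hr.
Qed.

Lemma ggE x : gg k x = x - res k x.
Proof. by rewrite bcompE -{2}(resE x) addrC addKr. Qed.

Lemma res_comm (T : bop H H) : bcomp T k = bcomp k T -> bcomp T (res k) = bcomp (res k) T.
Proof.
move=> h; apply: bop_eq => x; apply: one_plus_inj; rewrite !bcompE resE.
have e y : k (T y) = T (k y) by rewrite -!bcompE h.
by rewrite e -bopD resE.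
Qed.

Lemma res_psd : psd (res k).
Proof.
split.
  apply: adj_uniq => x y; rewrite -{2}(resE x) ipDl (sa_ip _ _ pk.1) -ipDr.
  by rewrite resE.
move=> x; rewrite -{2}(resE x) ripDr ripxx ripC addr_ge0 ?sqr_ge0//.
by have := pk.2 (res k x).
Qed.

Lemma res_sqr_le x : nm (res k x) ^+ 2 <= rip (res k x) x.
Proof. by rewrite -{3}(resE x) ripDr ripxx (ripC _ (k _)) lerDl pk.2. Qed.

Lemma res_le x : nm (res k x) <= nm x.
Proof.
have := res_sqr_le x; have := rip_le (res k x) x.
have := nm_ge0 x; have := nm_ge0 (res k x).
have [->//|n0] := eqVneq (nm (res k x)) 0.
move=> h1 h2 h3 h4; have np : 0 < nm (res k x) by rewrite lt_def n0.
by rewrite -(ler_pM2l np) -expr2; lra.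
Qed.

Lemma gg_psd : psd (gg k).
Proof.
split; first by apply: adj_uniq => x y; rewrite !ggE ipBl ipBr (sa_ip _ _ res_psd.1).
move=> x; rewrite ggE ripBl ripxx; have := rip_le (res k x) x; have := res_le x.
have := nm_ge0 x; nra.
Qed.

Lemma gg_le1 x : rip (gg k x) x <= nm x ^+ 2.
Proof. by rewrite ggE ripBl ripxx gerBl res_psd.2. Qed.

Lemma gg_sqr_le x : nm (gg k x) ^+ 2 <= rip (gg k x) x.
Proof.
have := @psd_nm H (gg k) 1 x gg_psd ler01; rewrite !mul1r; apply => y.
by rewrite mul1r gg_le1.
Qed.

Lemma gg_le_self : ble (gg k) k.
Proof.
move=> x; have := pk.2 (x - res k x); rewrite ggE bopB ripBl !ripBr.
rewrite (sa_sym x (res k x) pk.1) -[k (res k x)]/(gg k x) ggE !ripBl !ripxx.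
have := sqr_ge0 (nm (x - res k x)); rewrite nm_sqrB (ripC x (res k x)); lra.
Qed.

Lemma gg_res_le x : rip (k (res k x)) (res k x) <= rip (gg k x) x.
Proof.
rewrite -bcompE -/(gg k) -[X in rip _ X <= _](subKr x) -ggE ripBr.
by rewrite gerBl ripxx sqr_ge0.
Qed.

End Resolvent.

(** Cauchy-Schwarz for the form of 1 + k at u = res k v and w = res k' v gives <v, w>^2 <= <v, u>
    <(1 + k) w, w>, and the last factor is at most <v, w> because k <= k'. *)
Lemma res_anti H (k k' : bop H H) : psd k -> psd k' -> ble k k' ->
  ble (res k') (res k).
Proof.
move=> pk pk' kk' v; set w := res k' v; set u := res k v.
have pw := (res_psd pk').2 v; have pu := (res_psd pk).2 v.
rewrite -/w -/u in pw pu *.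
have p1k : psd (bid H + k) by apply: psd_add => //; split => [|x]; [exact: badj_id|rewrite ripxx sqr_ge0].
have := psd_cs u w p1k; rewrite !baddE -/u /= (resE pk v) => h.
have h2 : rip w w + rip (k w) w <= rip w v.
  have -> : rip w v = rip w (w + k' w) by rewrite resE.
  by rewrite ripDr lerD2l (ripC w (k' w)) kk'.
rewrite (ripC v w) (ripC v u) ripDl in h.
have [->|w0] := eqVneq (rip w v) 0; first exact: pu.
have wp : 0 < rip w v by rewrite lt_def w0.
rewrite -(ler_pM2r wp) -expr2; apply: le_trans h _.
by apply: ler_wpM2l.
Qed.

Lemma gg_mono H (k k' : bop H H) : psd k -> psd k' -> ble k k' -> ble (gg k) (gg k').
Proof.
move=> pk pk' kk' x; rewrite !ggE// !ripBl lerD2l lerN2.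
exact: res_anti.
Qed.

End PositiveOperators.

(** * Suprema of directed families as strong limits *)

Section MonotoneConvergence.
Context {R : realType}.
Implicit Types H K L : hilbert R.

Lemma ople_trans_bop H (S T : bop H H) : psd S -> ople S T -> psd T /\ ble S T.
Proof.
move=> pS /(ople_sa pS.1)[sT h]; split => //; split => // x.
exact: le_trans (pS.2 x) (h x).
Qed.

Lemma psd_sub H (S T : bop H H) : badj S = S -> badj T = T -> ble S T -> psd (T - S).
Proof.
move=> hS hT h; split; first by rewrite badj_sub hS hT.
by move=> x; rewrite bsubE ripBl subr_ge0.
Qed.

Lemma Re_mul_conj (z : R[i]) : Re (z * z^*%C) = Re `|z| ^+ 2.
Proof.
rewrite -sqr_normc -[in LHS](RRe_real (normr_real z)) -rmorphXn.
by [].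
Qed.

Section Vigier.
Variables (H : hilbert R) (M D : set (H -> H)) (s : bop H H).
Hypotheses (sM : star_alg M) (hD : directed_sup M D s).

Lemma dsup_mem (x : H -> H) : D x -> exists x' : bop H H, [/\ x = x', psd x' & M x'].
Proof.
move=> /(directed_sup_pos hD)[Mx x0]; have [x' Mx' e] := sa_bop sM Mx.
by exists x'; split => //; apply/psdP; rewrite -e.
Qed.

Lemma dsup_dir (x y : bop H H) : D x -> D y ->
  exists z : bop H H, [/\ D z, psd z, ble x z & ble y z].
Proof.
move=> Dx Dy; have [z [Dz xz yz]] := directed_sup_dir hD Dx Dy.
have [x' [ex px _]] := dsup_mem Dx; have [y' [ey py _]] := dsup_mem Dy.
have [z' [ez pz _]] := dsup_mem Dz; rewrite ez in Dz xz yz.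
have sx : badj x = x by rewrite (_ : x = x') ?px.1//; apply: bop_eq => v; rewrite ex.
have sy : badj y = y by rewrite (_ : y = y') ?py.1//; apply: bop_eq => v; rewrite ey.
by exists z'; split => //; apply/opleP => //; exact: pz.1.
Qed.

Lemma dsup_psd (x : bop H H) : D x -> psd x.
Proof.
move=> Dx; have [x' [ex px _]] := dsup_mem Dx.
by rewrite (_ : x = x')//; apply: bop_eq => v; rewrite ex.
Qed.

Lemma dsup_ub (x : bop H H) : D x -> psd s /\ ble x s.
Proof.
by move=> Dx; apply: ople_trans_bop; [exact: dsup_psd|exact: (directed_sup_ub hD)].
Qed.

Lemma dsup_psd_s : psd s.
Proof.
have [x Dx] := directed_sup_nonempty hD; have [x' [ex _ _]] := dsup_mem Dx.
by rewrite ex in Dx; have [] := dsup_ub Dx.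
Qed.

(* If the gap d were positive, w := lim (s - x_n) v would give the smaller
   upper bound s - |w><w| / (2 d). *)
Lemma vigier_inf (v : H) e : 0 < e ->
  exists2 x : bop H H, D x & rip (s v) v - rip (x v) v <= e.
Proof.
move=> e0; pose gap := [set rip (s v) v - rip (x v) v | x in [set x : bop H H | D x]].
have hinf : has_inf gap.
  split.
    have [x Dx] := directed_sup_nonempty hD; have [x' [ex _ _]] := dsup_mem Dx.
    by exists (rip (s v) v - rip (x' v) v); exists x' => //=; rewrite -ex.
  by exists 0 => _ [x Dx <-]; rewrite subr_ge0; exact: (dsup_ub Dx).2.
set d := inf gap.
have dle (x : bop H H) : D x -> d <= rip (s v) v - rip (x v) v.
  by move=> Dx; apply: (ge_inf hinf.2); exists x.
have [d0|dp] := leP d 0.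
  have [_ [x Dx <-] h] := inf_adherent e0 hinf.
  by exists x => //; rewrite -/d in h; lra.
exfalso.
have /choice[X hX] : forall n : nat, exists x : bop H H, D x /\
    rip (s v) v - rip (x v) v < d + n.+1%:R^-1.
  move=> n; have n0 : (0 : R) < n.+1%:R^-1 by rewrite invr_gt0 ltr0Sn.
  by have [_ [x Dx <-] h] := inf_adherent n0 hinf; exists x.
have DX n : D (X n) by have [] := hX n.
have [B B0 hB] := le_bound s.
have gapX n (z : bop H H) : D z -> ble (X n) z -> nm (z v - X n v) ^+ 2 <= B * n.+1%:R^-1.
  move=> Dz h; have pz : psd (z - X n).
    by apply: psd_sub => //; [exact: (dsup_psd (DX n)).1|exact: (dsup_psd Dz).1].
  have := @psd_nm R H (z - X n) B v pz B0; rewrite bsubE => hh.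
  apply: le_trans (hh _) _.
    move=> x; rewrite bsubE ripBl; have := (dsup_psd (DX n)).2 x.
    have := (dsup_ub Dz).2 x; have := hB x; lra.
  apply: ler_wpM2l => //; rewrite ripBl.
  by have := dle _ Dz; have := (hX n).2; set u := _^-1; lra.
have sq_small (a : R) n : 0 < a -> n.+1%:R^-1 <= a ^+ 2 / (B + 1) ->
    forall y : H, nm y ^+ 2 <= B * n.+1%:R^-1 -> nm y <= a.
  move=> a0 hn y hy; apply: sqr_le; first exact: ltW.
  apply: le_trans hy _; rewrite ler_pdivlMr in hn; last by lra.
  by have : 0 <= n.+1%:R^-1 :> R by []; move: hn; set u := _^-1; nra.
have [y hy] : exists y, cvs (fun n => X n v) y.
  apply: cauchys_cvs => a a0; have a2 : 0 < (a / 2) ^+ 2 / (B + 1).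
    by rewrite divr_gt0 ?exprn_gt0//; lra.
  have [n0 hn0] := inv_small a2; exists n0 => n m hn hm.
  have [z [Dz _ h1 h2]] := dsup_dir (DX n) (DX m).
  have a3 : 0 < a / 2 by lra.
  have := sq_small _ _ a3 (hn0 _ hn) _ (gapX n z Dz h1).
  have := sq_small _ _ a3 (hn0 _ hm) _ (gapX m z Dz h2).
  have -> : X n v - X m v = (z v - X m v) - (z v - X n v).
    by rewrite opprB [RHS]addrC -addrA (addrA (- z v)) addNr add0r addrC.
  by have := nmB (z v - X m v) (z v - X n v); lra.
set w := s v - y.
have wd : d <= rip w v.
  apply/ler_addgt0Pr => a a0; have k1 : 0 < nm v + 1 by have := nm_ge0 v; lra.
  have a1 : 0 < a / (nm v + 1) by rewrite divr_gt0.
  have [n0 h] := hy _ a1; have {}h := h _ (leqnn _).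
  have -> : rip w v = (rip (s v) v - rip (X n0 v) v) + rip (X n0 v - y) v.
    by rewrite /w !ripBl; ring.
  have := dle _ (DX n0); have := abs_rip_le (X n0 v - y) v.
  rewrite ler_norml => /andP[h1 _] h2.
  suff : nm (X n0 v - y) * nm v <= a by lra.
  rewrite ler_pdivlMr// in h; apply: le_trans h; apply: ler_wpM2l; rewrite ?nm_ge0//; lra.
have key (x : bop H H) u : D x -> `|rip w u| <= Num.sqrt (2 * d * (rip (s u) u - rip (x u) u)).
  move=> Dx; apply/ler_addgt0Pr => a a0.
  have k1 : 0 < nm u + 1 by have := nm_ge0 u; lra.
  have a1 : 0 < a / 2 / (nm u + 1) by rewrite !divr_gt0.
  have a2 : 0 < (a / 2 / (nm u + 1)) ^+ 2 / (B + 1).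
    by rewrite divr_gt0 ?exprn_gt0//; lra.
  have [n0 h0] := inv_small a2; have [n1 h1] := inv_small dp; have [n2 h2] := hy _ a1.
  pose n := maxn n0 (maxn n1 n2).
  have {}h0 := h0 n (leq_maxl _ _).
  have {}h1 := h1 n (leq_trans (leq_maxl _ _) (leq_maxr _ _)).
  have {}h2 := h2 n (leq_trans (leq_maxr _ _) (leq_maxr _ _)).
  have [z [Dz pz xz nz]] := dsup_dir Dx (DX n).
  have h3 := sq_small _ _ a1 h0 _ (gapX n z Dz nz).
  have psz : psd (s - z) by apply: psd_sub; [exact: pz.1|exact: dsup_psd_s.1|exact: (dsup_ub Dz).2].
  have -> : rip w u = rip ((s - z) v) u + (rip (z v - X n v) u + rip (X n v - y) u).
    by rewrite /w bsubE !ripBl; ring.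
  apply: le_trans (ler_normD _ _) _; apply: lerD.
    rewrite -sqrtr_sqr ler_wsqrtr//; apply: le_trans (psd_cs v u psz) _.
    rewrite !bsubE !ripBl; apply: ler_pM.
    - by rewrite subr_ge0; exact: (dsup_ub Dz).2.
    - by rewrite subr_ge0; exact: (dsup_ub Dz).2.
    - have := nz v; have := (hX n).2; move: h1; set t := _^-1; lra.
    - by rewrite lerD2l lerN2.
  apply: le_trans (ler_normD _ _) _.
  have hh : forall q : H, nm q <= a / 2 / (nm u + 1) -> `|rip q u| <= a / 2.
    move=> q; rewrite ler_pdivlMr// => hq; apply: le_trans (abs_rip_le _ _) _.
    by apply: le_trans hq; apply: ler_wpM2l; rewrite ?nm_ge0//; lra.
  by have := hh _ h2; have := hh _ h3; lra.
pose t : bop H H := s - ((2 * d)^-1)%:C *: bbrk w w.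
have d20 : 0 < 2 * d by lra.
have st : badj t = t by rewrite badj_sub badj_scaler badj_brk dsup_psd_s.1.
have tE u : rip (t u) u = rip (s u) u - (2 * d)^-1 * Re `|'[u, w]| ^+ 2.
  rewrite bsubE bscaleE ripBl ripZl bbrkE /rip ipZl (ipC w u).
  by rewrite Re_mul_conj.
have := directed_sup_least hD (bopP t).
have h : forall x, D x -> ople x t.
  move=> x Dx; have [x' [ex px _]] := dsup_mem Dx; rewrite ex in Dx *.
  apply/opleP => //; first exact: px.1.
  move=> u; rewrite tE lerBrDr -lerBrDl mulrC ler_pdivrMr//.
  have [c c1 <-] := Re_norm_phase '[u, w].
  have := key x' (c *: u) Dx.
  have -> : rip w (c *: u) = Re (c * '[u, w]) by rewrite ripC /rip ipZl.
  have inv (T : bop H H) : rip (T (c *: u)) (c *: u) = rip (T u) u.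
    by rewrite bopZ /rip ipZl ipZr mulrA -sqr_normc c1 expr1n mul1r.
  rewrite !inv => hk.
  have p0 : 0 <= 2 * d * (rip (s u) u - rip (x' u) u).
    by apply: mulr_ge0; [exact: ltW|rewrite subr_ge0; exact: (dsup_ub Dx).2].
  rewrite [X in _ <= X]mulrC -(sqr_sqrtr p0) -[X in X <= _]real_normK ?num_real//.
  by rewrite ler_sqr ?nnegrE ?sqrtr_ge0.
move=> /(_ h) /(opleP dsup_psd_s.1 st)/(_ w); rewrite tE ipxx Re_norm_real.
rewrite ger0_norm ?sqr_ge0// => hw.
have dinv : 0 < (2 * d)^-1 by rewrite invr_gt0.
have : nm w ^+ 2 = 0.
  have p1 := sqr_ge0 (nm w ^+ 2).
  have : (nm w ^+ 2) ^+ 2 <= 0.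
    rewrite -(ler_pM2l dinv) mulr0; lra.
  by move=> p2; apply/eqP; rewrite -sqrf_eq0 eq_le p1 p2.
move/eqP; rewrite sqrf_eq0 nm_eq0 => /eqP w0; move: wd; rewrite w0 rip0l; lra.
Qed.

(** Beyond x the operator s - z is positive and bounded by B, so |(s - z) v|^2 <= B <(s - z) v, v>:
    convergence of forms becomes strong convergence. *)
Lemma vigier (v : H) e : 0 < e ->
  exists2 x : bop H H, D x &
    forall z : bop H H, D z -> ble x z -> nm (s v - z v) <= e.
Proof.
move=> e0; have [B B0 hB] := le_bound s.
have e1 : 0 < e ^+ 2 / (B + 1) by rewrite divr_gt0 ?exprn_gt0//; lra.
have [x Dx hx] := vigier_inf v e1; exists x => // z Dz xz.
apply: sqr_le; first exact: ltW.
have pz : psd (s - z) by apply: psd_sub; [exact: (dsup_psd Dz).1|exact: dsup_psd_s.1|exact: (dsup_ub Dz).2].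
rewrite -bsubE; apply: le_trans (psd_nm v pz B0 _) _.
  by move=> u; rewrite bsubE ripBl; have := (dsup_psd Dz).2 u; have := hB u; lra.
rewrite ler_pdivlMr in hx; last by lra.
rewrite bsubE ripBl; have := xz v; have := (dsup_ub Dz).2 v; nra.
Qed.

Lemma vigier_seq (vs : seq H) e : 0 < e ->
  exists2 x : bop H H, D x & forall z : bop H H, D z -> ble x z ->
    forall v, v \in vs -> nm (s v - z v) <= e.
Proof.
move=> e0; elim: vs => [|v vs [x Dx hx]].
  have [x Dx] := directed_sup_nonempty hD; have [x' [ex _ _]] := dsup_mem Dx.
  by exists x'; rewrite -?ex.
have [y Dy hy] := vigier v e0; have [z [Dz _ xz yz]] := dsup_dir Dx Dy.
exists z => // t Dt zt u; rewrite inE => /orP[/eqP ->|uv].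
  by apply: hy => // q; exact: le_trans (yz q) (zt q).
by apply: hx => // q; exact: le_trans (xz q) (zt q).
Qed.

End Vigier.
End MonotoneConvergence.

(** * Von Neumann algebras, monotone sequences, projections on closed spans *)

Section Algebras.
Context {R : realType}.
Implicit Types H K L : hilbert R.

Lemma nm_small0 H (z : H) k : 0 <= k -> (forall e, 0 < e -> nm z <= k * e) -> z = 0.
Proof.
move=> k0 h; apply: nm_le0; apply/ler_addgt0Pr => e e0; rewrite add0r.
have k1 : 0 < k + 1 by lra.
apply: le_trans (h (e / (k + 1)) _) _; first by rewrite divr_gt0.
rewrite mulrA ler_pdivrMr// mulrC; apply: ler_wpM2l; [exact: ltW|lra].
Qed.

Lemma commutantP H (M : set (H -> H)) (T : bop H H) :
  commutant M T <-> forall x : H -> H, M x -> forall v, T (x v) = x (T v).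
Proof.
split=> [[_ h] x Mx v|h]; first by have := h x Mx; move/(congr1 (fun f => f v)).
by split; [exact: bopP|move=> S MS; apply/funext => v; exact: h].
Qed.

Lemma commutant_bop H (M : set (H -> H)) (T : H -> H) : commutant M T ->
  exists2 T' : bop H H, T = T' & commutant M T'.
Proof. by move=> [bT h]; have [T' e] := bop_of bT; exists T' => //; split; rewrite -?e. Qed.

Lemma commutant_adj H (M : set (H -> H)) (T : bop H H) : star_alg M ->
  commutant M T -> commutant M (badj T).
Proof.
move=> sM /commutantP hT; apply/commutantP => x Mx v.
have [x' Mx' e] := sa_bop sM Mx; rewrite {}e.
apply: ip_eqP => w; rewrite -badjPr !(badjP x') -badjPr; congr '[v, _].
by rewrite hT//; exact: sa_adj.
Qed.

Lemma commutant_comp H (M : set (H -> H)) (S T : bop H H) :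
  commutant M S -> commutant M T -> commutant M (bcomp S T).
Proof.
move=> /commutantP hS /commutantP hT; apply/commutantP => x Mx v.
by rewrite !bcompE hT// hS.
Qed.

Section VonNeumann.
Variables (H : hilbert R) (M : set (H -> H)).
Hypothesis hM : vn_alg M.

Lemma vn_of_comm (x : bop H H) :
  (forall T : bop H H, commutant M T -> forall v, x (T v) = T (x v)) -> M x.
Proof.
move=> h; rewrite -hM.2; apply/commutantP => T hT v.
by have [T' e hT'] := commutant_bop hT; rewrite e h.
Qed.

Lemma vn_comm (x T : bop H H) v : M x -> commutant M T -> x (T v) = T (x v).
Proof. by move=> Mx /commutantP hT; rewrite hT. Qed.

Lemma vn_approx (x : bop H H) :
  (forall v w e, 0 < e -> exists y : bop H H,
     [/\ M y, nm (x v - y v) <= e & nm (x w - y w) <= e]) -> M x.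
Proof.
move=> h; apply: vn_of_comm => T hT v; apply/eqP; rewrite -subr_eq0; apply/eqP.
have [k k0 hk] := bop_bound T; apply: (@nm_small0 _ _ (1 + k)); first by lra.
move=> e e0; have [y [My h1 h2]] := h (T v) v e e0.
have -> : x (T v) - T (x v) = (x (T v) - y (T v)) - T (x v - y v).
  by rewrite bopB (vn_comm v My hT) opprB addrA subrK.
apply: le_trans (nmB _ _) _; rewrite mulrDl mul1r; apply: lerD => //.
by apply: le_trans (hk _) _; exact: ler_wpM2l.
Qed.

Lemma vn_id : M (bid H).
Proof. by apply: vn_of_comm. Qed.

Lemma vn_closed : opclosure M `<=` M.
Proof.
move=> T [bT h]; have [T' e] := bop_of bT; rewrite e in h *.
apply: vn_approx => v w a a0.
have k1 : 0 < nm v + nm w + 1 by have := nm_ge0 v; have := nm_ge0 w; lra.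
have a1 : (0 : R[i]) < (a / (nm v + nm w + 1))%:C by rewrite ltcR divr_gt0.
have [S MS hS] := h _ a1; have [S' MS' eS] := sa_bop hM.1 MS.
exists S'; rewrite eS in hS; move/opnorm_leP: hS => hS; split => //.
  apply: le_trans (hS v) _; rewrite mulrAC ler_pdivrMr//.
  by apply: ler_wpM2l; [exact: ltW|have := nm_ge0 w; lra].
apply: le_trans (hS w) _; rewrite mulrAC ler_pdivrMr//.
by apply: ler_wpM2l; [exact: ltW|have := nm_ge0 v; lra].
Qed.

Lemma vn_limit (T : nat -> bop H H) (S : bop H H) : (forall n, M (T n)) ->
  (forall x, cvs (fun n => T n x) (S x)) -> M S.
Proof.
move=> MT h; apply: vn_approx => v w e e0.
have [n0 h0] := h v _ e0; have [n1 h1] := h w _ e0.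
exists (T (maxn n0 n1)); split => //; rewrite nmBC; [apply: h0|apply: h1].
  exact: leq_maxl.
exact: leq_maxr.
Qed.

End VonNeumann.

Lemma mono_sup H (T : nat -> bop H H) :
  (forall n, psd (T n)) -> (forall n, ble (T n) (T n.+1)) ->
  (forall n x, rip (T n x) x <= nm x ^+ 2) ->
  exists S : bop H H, [/\ psd S, forall n, ble (T n) S,
    forall x, rip (S x) x <= nm x ^+ 2, forall x, cvs (fun n => T n x) (S x) &
    forall M : set (H -> H), (forall n, M (T n)) ->
      directed_sup M (range (fun n => bfun (T n))) S].
Proof.
move=> pT mT T1.
have mono n m : (n <= m)%N -> ble (T n) (T m).
  move=> nm x; elim: m nm => [|m IH]; first by rewrite leqn0 => /eqP ->.
  rewrite leq_eqVlt => /orP[/eqP ->//|]; rewrite ltnS => /IH h; exact: le_trans h (mT m x).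
have diff n m x : (n <= m)%N -> nm (T m x - T n x) ^+ 2 <= rip (T m x) x - rip (T n x) x.
  move=> nm; have p : psd (T m - T n).
    by apply: psd_sub; [exact: (pT n).1|exact: (pT m).1|exact: mono].
  have := @psd_nm R H _ 1 x p ler01; rewrite !mul1r bsubE ripBl; apply => y.
  by rewrite bsubE ripBl mul1r; have := T1 m y; have := (pT n).2 y; lra.
have Tn n x : nm (T n x) <= 1 * nm x.
  apply: sqr_le; first by rewrite mul1r nm_ge0.
  have := @psd_nm R H _ 1 x (pT n) ler01; rewrite !mul1r => h.
  by apply: le_trans (h _) (T1 n x) => y; rewrite mul1r.
have hc x : cauchys (fun n => T n x).
  move=> e e0; pose a := [set rip (T n x) x | n in setT].
  have ha : has_sup a by split; [exists (rip (T 0%N x) x); exists 0%N|exists (nm x ^+ 2) => _ [n _ <-]].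
  have e2 : 0 < (e / 2) ^+ 2 by rewrite exprn_gt0//; lra.
  have [_ [n0 _ <-] h0] := sup_adherent e2 ha.
  have le_sup n : rip (T n x) x <= sup a by apply: (sup_upper_bound ha); exists n.
  have hd n : (n0 <= n)%N -> nm (T n x - T n0 x) <= e / 2.
    move=> hn; apply: sqr_le; first by lra.
    by apply: le_trans (diff _ _ x hn) _; have := le_sup n; lra.
  exists n0 => n m hn hm.
  have -> : T n x - T m x = (T n x - T n0 x) - (T m x - T n0 x) by rewrite opprB addrA subrK.
  by have := nmB (T n x - T n0 x) (T m x - T n0 x); have := hd _ hn; have := hd _ hm; lra.
have [S hS _] := strong_limit ler01 Tn hc.
have limr x (c : R) : (forall n, rip (T n x) x <= c) -> rip (S x) x <= c.
  move=> h; apply/ler_addgt0Pr => e e0; have [n0 hn] := cvs_ip x (hS x) e0.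
  have := hn _ (leqnn _); have := h n0 => h1 h2.
  have : `|Re ('[T n0 x, x] - '[S x, x])| <= e.
    by apply: le_trans h2; have := normc_ge_Re ('[T n0 x, x] - '[S x, x]); rewrite lecE => /andP[].
  by rewrite raddfB /= ler_norml => /andP[h3 _]; rewrite /rip in h1 *; lra.
have TS n : ble (T n) S.
  move=> x; apply/ler_addgt0Pr => e e0; have [n0 hn] := cvs_ip x (hS x) e0.
  have h2 := hn _ (leq_maxr n n0).
  have : `|Re ('[T (maxn n n0) x, x] - '[S x, x])| <= e.
    by apply: le_trans h2; have := normc_ge_Re ('[T (maxn n n0) x, x] - '[S x, x]); rewrite lecE => /andP[].
  have := mono _ _ (leq_maxl n n0) x.
  by rewrite raddfB /= ler_norml /rip => h4 /andP[h3 h5]; lra.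
have sS : badj S = S.
  apply: adj_uniq => x y; apply/eqP; rewrite -subr_eq0; apply/eqP/Re_norm_eq0.
  apply/eqP; rewrite eq_le Re_norm_ge0 andbT; apply/ler_addgt0Pr => e e0; rewrite add0r.
  have e2 : 0 < e / 2 by lra.
  have [n0 h0] := cvs_ip y (hS x) e2; have [n1 h1] := cvs_ip x (hS y) e2.
  have {}h0 := h0 _ (leq_maxl n0 n1); have {}h1 := h1 _ (leq_maxr n0 n1).
  set n := maxn n0 n1 in h0 h1.
  have -> : '[S x, y] - '[x, S y] = ('[T n y, x] - '[S y, x])^*%C - ('[T n x, y] - '[S x, y]).
    have -> (a b : R[i]) : (a - b)^*%C = a^*%C - b^*%C by exact: rmorphB.
    by rewrite -!ipC (sa_ip _ _ (pT n).1); ring.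
  rewrite -lecR RRe_real ?normr_real//; apply: le_trans (ler_normB _ _) _.
  rewrite normcJ -[`|_|]RRe_real ?normr_real// -[X in _ + X]RRe_real ?normr_real//.
  by rewrite -rmorphD lecR; lra.
have pS : psd S by split => // x; exact: le_trans ((pT 0%N).2 x) (TS 0%N x).
exists S; split => //; first by move=> x; apply: limr => n; exact: T1.
move=> M MT; split.
- by move=> _ [n _ <-]; split => //; apply/psdP.
- by exists (T 0%N); exists 0%N.
- move=> _ _ [n _ <-] [m _ <-]; exists (T (maxn n m)); split; first by exists (maxn n m).
    by apply/opleP; [exact: (pT n).1|exact: (pT _).1|apply: mono; exact: leq_maxl].
  by apply/opleP; [exact: (pT m).1|exact: (pT _).1|apply: mono; exact: leq_maxr].
- exact: bopP.
- by move=> _ [n _ <-]; apply/opleP => //; exact: (pT n).1.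
- move=> t bt ht; have [t' e] := bop_of bt; rewrite e in ht *.
  have [|st _] := @ople_sa R H (T 0%N) t' (pT 0%N).1; first by apply: ht; exists 0%N.
  apply/opleP => // x; apply: limr => n.
  have : ople (T n) t' by apply: ht; exists n.
  by move/(opleP (pT n).1 st); apply.
Qed.

(** The orthogonal projection onto the closed span of an arbitrary set, described by its action on S
    and on the orthogonal complement of S. *)
Definition is_proj H (S : set H) (P : bop H H) :=
  [/\ badj P = P, forall x, P (P x) = P x, forall x, S x -> P x = x &
      forall z, (forall x, S x -> '[x, z] = 0) -> P z = 0].

Lemma span_proj H (S : set H) : exists P, is_proj S P.
Proof.
pose s (p : {x : H | S x}) : H := sval p.
have [|P [hP P0 _]] := @ext_exists R _ H H s s 1 ler01; first by move=> l; rewrite mul1r.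
have PS x : S x -> P x = x by move=> Sx; exact: (hP (exist _ x Sx)).
have P0' z : (forall x, S x -> '[x, z] = 0) -> P z = 0.
  by move=> hz; apply: P0 => -[x Sx]; exact: hz.
have Pcl z : in_closure (range (lc s)) z -> P z = z.
  move=> hz; apply/eqP; rewrite -subr_eq0; apply/eqP.
  have [k k0 hk] := bop_bound P; apply: (@nm_small0 _ _ (k + 1)); first by lra.
  move=> e e0; have [_ [l _ <-] h] := hz _ e0.
  have e1 : P (lc s l) = lc s l.
    rewrite /lc bop_sum; apply: eq_bigr => -[c p] _ /=; rewrite bopZ; congr (_ *: _); exact: hP.
  have -> : P z - z = P (z - lc s l) - (z - lc s l) by rewrite bopB e1 opprB addrA subrK.
  apply: le_trans (nmB _ _) _; rewrite mulrDl mul1r; apply: lerD => //.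
  by apply: le_trans (hk _) _; exact: ler_wpM2l.
have dec x : in_closure (range (lc s)) (P x) /\ forall v, S v -> '[v, x - P x] = 0.
  have [z hz h] := proj_exists x (lc_csubspace s).
  have e : P x = z.
    rewrite -[x](subrK z) bopD (Pcl z)// P0' ?add0r// => v Sv; apply: h.
    by exists [:: (1, exist _ v Sv)] => //; rewrite lc1.
  rewrite e; split => // v Sv; apply: h.
  by exists [:: (1, exist _ v Sv)] => //; rewrite lc1.
have orth x y : '[P x, y - P y] = 0.
  apply: (in_closure_ip0 (dec x).1) => _ [l _ <-]; rewrite /lc ip_suml big1// => -[c [v Sv]] _ /=.
  by rewrite ipZl (dec y).2// mulr0.
exists P; split => //; last by move=> x; apply: Pcl; exact: (dec x).1.
apply: adj_uniq => x y; have := orth x y; have := orth y x; rewrite !ipBr.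
move=> /eqP; rewrite subr_eq0 => /eqP h1 /eqP; rewrite subr_eq0 => /eqP ->.
by rewrite ipC -h1 -ipC.
Qed.

Section Projection.
Variables (H : hilbert R) (S : set H) (P : bop H H).
Hypothesis hP : is_proj S P.

Lemma proj_kill K (U : bop H K) : (forall x, S x -> U x = 0) -> forall x, U (P x) = 0.
Proof.
have [sP _ PS P0] := hP; move=> hU x; apply: ip_eqP => y; rewrite ip0l badjP.
rewrite badjP sP P0 ?ip0r// => v Sv.
by rewrite -badjP hU// ip0l.
Qed.

Lemma proj_compl_orth x v : S v -> '[v, x - P x] = 0.
Proof.
by have [sP _ PS _] := hP; move=> Sv; rewrite ipBr (badjPr P) sP PS// subrr.
Qed.

Lemma proj_eq K (U V : bop H K) : (forall x, S x -> U x = V x) ->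
  (forall z, (forall x, S x -> '[x, z] = 0) -> U z = V z) -> U = V.
Proof.
move=> h1 h2; apply: bop_eq => x; rewrite -[x](subrK (P x)) (bopD U) (bopD V); congr (_ + _).
  by apply: h2 => v; exact: proj_compl_orth.
apply/eqP; rewrite -subr_eq0 -bsubE; apply/eqP/proj_kill => v Sv.
by rewrite bsubE h1// subrr.
Qed.

Lemma proj_commute (T : bop H H) : (forall x, S x -> P (T x) = T x) ->
  (forall x, S x -> P (badj T x) = badj T x) -> forall x, P (T x) = T (P x).
Proof.
have [sP PP PS P0] := hP; move=> h1 h2.
have e1 x : P (T (P x)) = T (P x).
  apply/esym/eqP; rewrite -subr_eq0; apply/eqP; apply: (@proj_kill _ (T - bcomp P T)).
  by move=> v Sv; rewrite bsubE bcompE h1// subrr.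
have e2 x : P (badj T (P x)) = badj T (P x).
  apply/esym/eqP; rewrite -subr_eq0; apply/eqP.
  apply: (@proj_kill _ (badj T - bcomp P (badj T))).
  by move=> v Sv; rewrite bsubE bcompE h2// subrr.
move=> x; rewrite -e1; apply: ip_eqP => y.
by rewrite !(sa_ip _ _ sP) !(badjP T) (sa_ip _ _ sP) e2.
Qed.

Lemma proj_psd : psd P.
Proof.
have [sP PP _ _] := hP; split => // x; rewrite -PP /rip (sa_ip _ _ sP) ipxx /=; exact: sqr_ge0.
Qed.

Lemma proj_rip x : rip (P x) x = nm (P x) ^+ 2.
Proof. by have [sP PP _ _] := hP; rewrite -{1}PP /rip (sa_ip _ _ sP) ipxx. Qed.

Lemma proj_nm x : nm (P x) <= nm x.
Proof.
have [->|n0] := eqVneq (nm (P x)) 0; first exact: nm_ge0.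
have np : 0 < nm (P x) by rewrite lt_def n0 nm_ge0.
by rewrite -(ler_pM2l np) -expr2 -proj_rip rip_le.
Qed.

End Projection.
End Algebras.

(** * Star homomorphisms, norm closures and multipliers *)

Section Homomorphisms.
Context {R : realType}.
Implicit Types H K L : hilbert R.

(* y = 1 - (1 - a)^(1/2), the fixed point of y = (a + y^2) / 2 *)
Lemma half_root H (A : set (H -> H)) (a : bop H H) rho :
  opclosure A `<=` A -> star_alg A -> A a -> badj a = a -> 0 <= rho -> rho < 1 ->
  (forall x, nm (a x) <= rho * nm x) ->
  exists y : bop H H, [/\ A y, badj y = y &
    forall x, y x + y x = a x + y (y x)].
Proof.
(* The scalar solution of 2 b = rho + b^2 below 1; it bounds all iterates and is the ratio of their
   convergence. *)
move=> cA sA Aa sa r0 r1 ha; pose b := 1 - Num.sqrt (1 - rho).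
have s0 := sqrtr_ge0 (1 - rho).
have sE : Num.sqrt (1 - rho) ^+ 2 = 1 - rho by rewrite sqr_sqrtr//; lra.
have b0 : 0 <= b by rewrite /b; nra.
have b1 : b < 1 by rewrite /b; nra.
have bE : rho + b ^+ 2 = 2 * b by rewrite /b; nra.
pose Y := fix Y n : bop H H :=
  if n is n'.+1 then (2^-1)%:C *: (a + bcomp (Y n') (Y n')) else 0.
have YE n x : Y n.+1 x = (2^-1)%:C *: (a x + Y n (Y n x)) by [].
have h2 : `|2^-1 : R| = 2^-1 by rewrite ger0_norm// invr_ge0.
have Yb n x : nm (Y n x) <= b * nm x.
  elim: n x => [|n IH] x; first by rewrite b0E nm0 mulr_ge0 ?nm_ge0.
  rewrite YE nmZr h2; have h := nmD (a x) (Y n (Y n x)); have h3 := ha x.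
  have h4 := IH (Y n x); have h5 := ler_wpM2l b0 (IH x).
  by have := nm_ge0 x; nra.
have Yd n x : nm (Y n.+1 x - Y n x) <= 1 * b ^+ n * nm x.
  elim: n x => [|n IH] x.
    rewrite YE !b0E addr0 subr0 nmZr h2 expr0 !mul1r.
    by have := ha x; have := nm_ge0 x; nra.
  have -> : Y n.+2 x - Y n.+1 x = (2^-1)%:C *: (Y n.+1 (Y n.+1 x - Y n x) +
      (Y n.+1 (Y n x) - Y n (Y n x))).
    rewrite bopB addrA subrK (YE n.+1) (YE n) -scalerBr; congr (_ *: _).
    by rewrite opprD addrACA subrr add0r.
  rewrite nmZr h2; have q1 := nmD (Y n.+1 (Y n.+1 x - Y n x)) (Y n.+1 (Y n x) - Y n (Y n x)).
  have q2 := Yb n.+1 (Y n.+1 x - Y n x); have q3 := ler_wpM2l b0 (IH x).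
  have q4 := IH (Y n x).
  have q5 : 1 * b ^+ n * nm (Y n x) <= 1 * b ^+ n * (b * nm x).
    by apply: ler_wpM2l; rewrite ?mul1r ?exprn_ge0.
  rewrite exprS; lra.
have [y hy] := geo_op ler01 b0 b1 Yd.
have cy x : cvs (fun n => Y n x) (y x).
  move=> e e0; have b1' : 0 < 1 - b by lra.
  have [|n0 h] := geometric_small (c := nm x / (1 - b)) _ b0 b1 e0.
    by rewrite divr_ge0 ?nm_ge0// ltW.
  exists n0 => n hn; rewrite nmBC; apply: le_trans (hy n x) _.
  have -> : 1 * b ^+ n / (1 - b) * nm x = nm x / (1 - b) * b ^+ n by ring.
  exact: h.
exists y; split.
- have b1' : 0 < 1 - b by lra.
  apply: (@closed_geo _ _ A Y y (1 - b)^-1 b) => //; first by rewrite invr_ge0 ltW.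
    by move=> n x; have := hy n x; rewrite mul1r (mulrC (b ^+ n)).
  elim=> [|n IH]; first exact: sa_0.
  by apply: sa_scale => //; apply: sa_add => //; exact: sa_comp.
- have sY n : badj (Y n) = Y n.
    elim: n => [|n IH]; first exact: (psd_0 H).1.
    by apply: adj_uniq => u v; rewrite !YE ipZl ipZr conjc_real ipDl ipDr
      (sa_ip _ _ sa) !(sa_ip _ _ IH).
  apply: adj_uniq => u v; apply/eqP; rewrite -subr_eq0; apply/eqP/Re_norm_eq0.
  apply/eqP; rewrite eq_le Re_norm_ge0 andbT; apply/ler_addgt0Pr => e e0; rewrite add0r.
  have e2 : 0 < e / 2 by lra.
  have [n0 h0] := cvs_ip v (cy u) e2; have [n1 h1] := cvs_ip u (cy v) e2.
  have {}h0 := h0 _ (leq_maxl n0 n1); have {}h1 := h1 _ (leq_maxr n0 n1).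
  set n := maxn n0 n1 in h0 h1.
  have -> : '[y u, v] - '[u, y v] = ('[Y n v, u] - '[y v, u])^*%C - ('[Y n u, v] - '[y u, v]).
    have -> (p q : R[i]) : (p - q)^*%C = p^*%C - q^*%C by exact: rmorphB.
    by rewrite -!ipC (sa_ip _ _ (sY n)); ring.
  rewrite -lecR RRe_real ?normr_real//; apply: le_trans (ler_normB _ _) _.
  rewrite normcJ -[`|_|]RRe_real ?normr_real// -[X in _ + X]RRe_real ?normr_real//.
  by rewrite -rmorphD lecR; lra.
- move=> x; have h : y x = (2^-1)%:C *: (a x + y (y x)).
    apply: (@cvs_unique _ _ (fun n => Y n.+1 x)).
      by move=> e e0; have [n0 h] := cy x e e0; exists n0 => n hn; apply: h; exact: leqW.
    have c1 : cvs (fun n => Y n (Y n x)) (y (y x)).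
      move=> e e0; have e2 : 0 < e / 2 by lra.
      have [n0 h0] := cy (y x) _ e2; have [n1 h1] := cy x _ e2.
      exists (maxn n0 n1) => n; rewrite geq_max => /andP[hn0 hn1].
      have -> : Y n (Y n x) - y (y x) = (Y n (y x) - y (y x)) + Y n (Y n x - y x).
        by rewrite bopB [RHS]addrC addrA subrK.
      have := nmD (Y n (y x) - y (y x)) (Y n (Y n x - y x)).
      have := h0 _ hn0; have := h1 _ hn1; have := Yb n (Y n x - y x).
      by have := nm_ge0 (Y n x - y x); nra.
    have c2 : cvs (fun=> (2^-1)%:C *: a x) ((2^-1)%:C *: a x).
      by move=> e e0; exists 0%N => n _; rewrite subrr nm0 ltW.
    have := cvs_lin (2^-1)%:C c1 c2; rewrite scalerDr addrC => c3.
    by move=> e e0; have [n0 h0] := c3 e e0; exists n0 => n hn; rewrite YE scalerDr [X in X - _]addrC; exact: h0.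
  rewrite [in LHS]h -scalerDl -rmorphD /=.
  have -> : (2^-1 + 2^-1 : R) = 1 by lra.
  by rewrite scale1r.
Qed.

Lemma star_hom_bop H K (A : set (H -> H)) (f : (H -> H) -> (K -> K)) x :
  star_hom A f -> A x -> exists y : bop K K, f x = y.
Proof. by move=> hf Ax; apply/bop_of/(star_hom_bounded hf). Qed.

Lemma star_hom0 H K (A : set (H -> H)) (f : (H -> H) -> (K -> K)) :
  star_hom A f -> A 0 -> f 0 = 0.
Proof.
move=> hf A0; have := star_hom_lin hf 1 A0 A0; rewrite scaler0 addr0 scale1r => h.
by apply: (@addrI _ (f 0)); rewrite addr0 -[LHS]h.
Qed.

(** For s > k put a = (adj x) x / s^2, of norm below 1, and write 1 - a = (1 - y)^2 with y in A.
    Applying f gives |v|^2 - |f x v|^2 / s^2 = |v - f y v|^2 >= 0. Working with y instead of the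
    square root 1 - y stays inside a possibly nonunital algebra. *)
Lemma star_hom_contr H K (A : set (H -> H)) (f : (H -> H) -> (K -> K)) (x : bop H H) k :
  opclosure A `<=` A -> star_alg A -> star_hom A f -> A x -> 0 <= k ->
  (forall v, nm (x v) <= k * nm v) -> forall v, nm (f x v) <= k * nm v.
Proof.
move=> cA sA hf Ax k0 hk v.
suff key s : k < s -> nm (f x v) <= s * nm v.
  apply/ler_addgt0Pr => e e0; have nv : 0 < nm v + 1 by have := nm_ge0 v; lra.
  apply: le_trans (key (k + e / (nm v + 1)) _) _; first by rewrite ltrDl divr_gt0.
  rewrite mulrDl lerD2l mulrAC ler_pdivrMr//; apply: ler_wpM2l; [exact: ltW|lra].
move=> ks; have s0 : 0 < s by exact: le_lt_trans k0 ks.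
pose a : bop H H := ((s ^+ 2)^-1)%:C *: bcomp (badj x) x.
have Axx : A (bcomp (badj x) x) by apply: sa_comp => //; exact: sa_adj.
have Aa : A a by exact: sa_scale.
have sq0 : 0 < s ^+ 2 by rewrite exprn_gt0.
have saa : badj a = a by rewrite badj_scaler badj_comp badjK.
have [|||y [Ay sy ye]] := @half_root H A a (k ^+ 2 / s ^+ 2) cA sA Aa saa.
- by rewrite divr_ge0// ?sqr_ge0// ltW.
- by rewrite ltr_pdivrMr// mul1r ltr_sqr ?nnegrE// ltW.
- move=> u; rewrite /a bscaleE nmZr ger0_norm; last by rewrite invr_ge0 ltW.
  have -> : k ^+ 2 / s ^+ 2 * nm u = (s ^+ 2)^-1 * (k * (k * nm u)) by ring.
  apply: ler_wpM2l; first by rewrite invr_ge0 ltW.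
  by rewrite bcompE; apply: le_trans (adj_bound k0 hk _) _; exact: ler_wpM2l.
have [fx fxe] := star_hom_bop hf Ax; have [fy fye] := star_hom_bop hf Ay.
have sfy : badj fy = fy.
  apply: bop_eq => u; rewrite /badj /= -fye -(star_hom_adj hf Ay).
  by have -> : adj y = y by exact: (congr1 (@bfun _ _ _) sy).
have fa : f a = ((s ^+ 2)^-1)%:C *: (bfun (bcomp (badj fx) fx)).
  have -> : (a : H -> H) = ((s ^+ 2)^-1)%:C *: (bfun (bcomp (badj x) x)) + 0 by rewrite addr0.
  rewrite (star_hom_lin hf)//; last exact: star_alg_0.
  rewrite (star_hom0 hf) ?addr0; last exact: star_alg_0.
  congr (_ *: _); rewrite (star_hom_mul hf) ?(star_hom_adj hf)// ?fxe//.
  exact: (star_alg_adj sA).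
have fyy : forall u, fy u + fy u = (((s ^+ 2)^-1)%:C *: bcomp (badj fx) fx) u + fy (fy u).
  have L := star_hom_lin hf 1 Ay Ay.
  have L' := star_hom_lin hf 1 Aa (star_alg_mul sA Ay Ay).
  have e0 : 1 *: (y : H -> H) + y = 1 *: (a : H -> H) + (y \o y).
    by apply/funext => w; rewrite !scale1r; exact: ye.
  have e1 : f y + f y = f a + f (y \o y).
    by rewrite -(scale1r (f a)) -L' -e0 L scale1r.
  rewrite (star_hom_mul hf Ay Ay) fye fa in e1.
  by move=> u; exact: (congr1 (fun g : K -> K => g u) e1).
have h1 : 2 * rip (fy v) v = (s ^+ 2)^-1 * nm (fx v) ^+ 2 + nm (fy v) ^+ 2.
  have : rip (fy v + fy v) v =
    rip ((((s ^+ 2)^-1)%:C *: bcomp (badj fx) fx) v + fy (fy v)) v by rewrite fyy.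
  rewrite !ripDl bscaleE ripZl rip_adj_comp => e.
  rewrite mulrDl mul1r e; congr (_ + _).
  by rewrite /rip (sa_ip _ _ sfy) ipxx.
rewrite fxe; apply: sqr_le; first by rewrite mulr_ge0 ?nm_ge0// ltW.
have := sqr_ge0 (nm (v - fy v)); rewrite nm_sqrB (ripC v) => h2.
rewrite exprMn mulrC -ler_pdivrMr// mulrC; lra.
Qed.

Lemma opclosure_sub H K (A : set (H -> K)) (x : H -> K) : A x -> bounded_op x -> opclosure A x.
Proof.
move=> Ax bx; split => // e e0; exists x => //; rewrite subrr => v.
by rewrite -[(0 : H -> K) v]/(0 : K) normr0 mulr_ge0// ltW.
Qed.

Lemma opclosureP H K (A : set (H -> K)) (x : bop H K) : (forall y, A y -> bounded_op y) ->
  (opclosure A x <-> forall e, 0 < e -> exists2 y : bop H K, A y & forall v, nm (x v - y v) <= e * nm v).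
Proof.
move=> bA; split=> [[_ h] e e0|h].
  have e0' : (0 : R[i]) < e%:C by rewrite ltcR.
  have [y Ay hy] := h _ e0'; have [y' ey] := bop_of (bA _ Ay).
  by exists y'; rewrite -?ey//; move=> v; move/opnorm_leP: hy => /(_ v).
split; first exact: bopP.
move=> e e0; have e1 : 0 < Re e by move: e0; rewrite ltcE => /andP[].
have -> : e = (Re e)%:C by rewrite RRe_real// gtr0_real.
have [y Ay hy] := h _ e1; exists (bfun y) => //; apply/opnorm_leP => v; exact: hy.
Qed.

Lemma opclosure_closed H K (A : set (H -> K)) : (forall y, A y -> bounded_op y) ->
  opclosure (opclosure A) `<=` opclosure A.
Proof.
move=> bA x hx; have [x' e] := bop_of hx.1; rewrite e in hx *.
apply/opclosureP => // d d0; have d2 : 0 < d / 2 by lra.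
have [|y Ay hy] := (opclosureP (A := opclosure A) x' _).1 hx _ d2; first by move=> y [].
have [z Az hz] := (opclosureP y bA).1 Ay _ d2; exists z => // v.
have -> : x' v - z v = (x' v - y v) + (y v - z v) by rewrite addrA subrK.
by have := nmD (x' v - y v) (y v - z v); have := hy v; have := hz v; lra.
Qed.

Lemma opclosure_lin H K (A : set (H -> K)) c (x y : bop H K) : (forall y, A y -> bounded_op y) ->
  (forall c x y, A x -> A y -> A (c *: x + y)) ->
  opclosure A x -> opclosure A y -> opclosure A (c *: x + y : bop H K).
Proof.
move=> bA lA hx hy; apply/opclosureP => // e e0.
have k1 : 0 < Re `|c| + 1 by have := Re_norm_ge0 c; lra.
have e1 : 0 < e / (Re `|c| + 1) by rewrite divr_gt0.
have [x' Ax' hx'] := (opclosureP x bA).1 hx _ e1.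
have [y' Ay' hy'] := (opclosureP y bA).1 hy _ e1.
exists (c *: x' + y'); first exact: lA.
move=> v; rewrite !baddE !bscaleE opprD addrACA -scalerBr.
apply: le_trans (nmD _ _) _; rewrite nmZ.
have -> : e * nm v = Re `|c| * (e / (Re `|c| + 1) * nm v) + e / (Re `|c| + 1) * nm v.
  by field; rewrite gt_eqF.
by apply: lerD => //; apply: ler_wpM2l; rewrite ?Re_norm_ge0.
Qed.

Lemma opclosure_star H (A : set (H -> H)) : star_alg A -> star_alg (opclosure A).
Proof.
move=> sA; have bA := star_alg_bounded sA.
have opc (x : H -> H) : opclosure A x -> exists x' : bop H H, x = x'.
  by move=> [b _]; exact: bop_of.
split.
- by move=> x [].
- by apply: opclosure_sub; [exact: star_alg_0|exact: bounded_0].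
- move=> c x y hx hy; have [x' ex] := opc _ hx; have [y' ey] := opc _ hy.
  rewrite ex ey in hx hy *; exact: (opclosure_lin c bA (star_alg_lin sA) hx hy).
- move=> x y hx hy; have [x' ex] := opc _ hx; have [y' ey] := opc _ hy.
  rewrite ex ey in hx hy *; have [kx kx0 hkx] := bop_bound x'; have [ky ky0 hky] := bop_bound y'.
  apply/(opclosureP (bcomp x' y') bA) => e e0.
  have k1 : 0 < kx + ky + 1 by lra.
  have e1 : 0 < e / (kx + ky + 1) by rewrite divr_gt0.
  have e2 : 0 < Num.min 1 (e / (kx + ky + 1)) by rewrite lt_min ltr01.
  have [p Ap hp] := (opclosureP x' bA).1 hx _ e1.
  have [q Aq hq] := (opclosureP y' bA).1 hy _ e2.
  exists (bcomp p q); first exact: sa_comp.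
  move=> v; rewrite !bcompE.
  have -> : x' (y' v) - p (q v) = x' (y' v - q v) + (x' (q v) - p (q v)) by rewrite bopB addrA subrK.
  apply: le_trans (nmD _ _) _.
  have m1 : Num.min 1 (e / (kx + ky + 1)) <= 1 by rewrite ge_min lexx.
  have m2 : Num.min 1 (e / (kx + ky + 1)) <= e / (kx + ky + 1) by rewrite ge_min lexx orbT.
  set m := Num.min _ _ in m1 m2 hq e2; set d := e / _ in m2 hp e1.
  have h1 : nm (x' (y' v - q v)) <= kx * (d * nm v).
    apply: le_trans (hkx _) _; apply: ler_wpM2l => //; apply: le_trans (hq v) _.
    by apply: ler_wpM2r; rewrite ?nm_ge0.
  have h2 : nm (q v) <= (ky + 1) * nm v.
    have := nmB (y' v) (y' v - q v); rewrite subKr; have := hky v; have := hq v.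
    by have := nm_ge0 v; nra.
  have h3 := ler_wpM2l (ltW e1) h2; have h4 := hp (q v).
  have dE : d * (kx + ky + 1) = e by rewrite /d mulfVK// gt_eqF.
  by rewrite -dE; have := nm_ge0 v; lra.
- move=> x hx; have [x' ex] := opc _ hx; rewrite ex in hx *.
  apply/(opclosureP (badj x') bA) => e e0.
  have [p Ap hp] := (opclosureP x' bA).1 hx _ e0; exists (badj p); first exact: sa_adj.
  move=> v; rewrite -bsubE -badj_sub; exact: (@adj_bound _ _ _ (x' - p) e (ltW e0) hp v).
Qed.

Lemma mult_adj H (A : set (H -> H)) (m : bop H H) : star_alg A -> mult A m -> mult A (badj m).
Proof.
move=> sA [_ hm]; split; first exact: bopP.
move=> a Aa; have [a' Aa' e] := sa_bop sA Aa; rewrite e.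
have [h1 h2] := hm _ (star_alg_adj sA Aa').
split.
  have -> : (badj m : H -> H) \o a' = badj (bcomp (badj a') m).
    by rewrite badj_comp badjK.
  exact: (star_alg_adj sA h2).
have -> : (a' : H -> H) \o (badj m) = badj (bcomp m (badj a')).
  by rewrite badj_comp badjK.
exact: (star_alg_adj sA h1).
Qed.

Lemma mult_star H (A : set (H -> H)) : star_alg A -> star_alg (mult A).
Proof.
move=> sA; have mb (x : H -> H) : mult A x -> exists x' : bop H H, x = x'.
  by move=> [b _]; exact: bop_of.
split.
- by move=> x [].
- split; first exact: bounded_0.
  move=> a Aa; have [a' Aa' ->] := sa_bop sA Aa; split.
    exact: (star_alg_0 sA).
  have -> : (a' : H -> H) \o (0 : H -> H) = (0 : H -> H).
      by apply/funext => v; exact: bop0.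
  exact: (star_alg_0 sA).
- move=> c x y mx my; have [x' ex] := mb _ mx; have [y' ey] := mb _ my.
  rewrite ex ey in mx my *; split; first exact: bounded_lin.
  move=> a Aa; have [a' Aa' ea] := sa_bop sA Aa; rewrite ea.
  have [x1 x2] := mx.2 _ Aa'; have [y1 y2] := my.2 _ Aa'.
  split; first exact: (star_alg_lin sA c x1 y1).
  have -> : (a' : H -> H) \o (c *: (x' : H -> H) + y') = c *: (a' \o x') + (a' \o y').
    by apply/funext => v; exact: bopZD.
  exact: (star_alg_lin sA).
- move=> x y mx my; have [x' ex] := mb _ mx; have [y' ey] := mb _ my.
  rewrite ex ey in mx my *; split; first exact: bounded_comp.
  move=> a Aa; split.
    exact: ((mx.2 _ (my.2 _ Aa).1).1).
  exact: ((my.2 _ (mx.2 _ Aa).2).2).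
- move=> x mx; have [x' ex] := mb _ mx; rewrite ex in mx *; exact: mult_adj.
Qed.

End Homomorphisms.

(** * Extension of a star homomorphism to multipliers *)

Section MultiplierExtension.
Context {R : realType}.
Implicit Types H K L : hilbert R.

(** The extension sends f b v to f (m b) v on the closed span of the ranges and is 0 on its
    complement. It is bounded by [power_ext] for b |-> (adj m) m b, the growth of the iterates being
    controlled by contractivity of f. *)
Lemma mult_ext_ex H K (A : set (H -> H)) (f : (H -> H) -> (K -> K)) :
  opclosure A `<=` A -> star_alg A -> star_hom A f ->
  exists F, star_hom (mult A) F /\ forall a, A a -> F a = f a.
Proof.
move=> cA sA hf.
pose rg := [set z : K | exists b v, A b /\ z = f b v].
have [P hP] := span_proj rg.
have fb a : A a -> exists y : bop K K, f a = y by exact: star_hom_bop.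
have fip a b v w : A a -> A b -> '[f a v, f b w] = '[f (adj b \o a) v, w].
  move=> Aa Ab; rewrite (star_hom_mul hf) ?(star_hom_adj hf)//; last exact: (star_alg_adj sA).
  by have [y ->] := fb _ Ab; rewrite -(badjPr y).
have ex (m : H -> H) : exists T : K -> K, mult A m -> [/\ bounded_op T,
    forall b v, A b -> T (f b v) = f (m \o b) v &
    forall z, (forall x, rg x -> '[x, z] = 0) -> T z = 0].
  have [mm|nm] := pselect (mult A m); last by exists 0.
  have [m' em] := bop_of mm.1; rewrite em in mm *.
  have mm' := mult_adj sA mm.
  have [B B0 hB] := bop_bound (bcomp (badj m') m').
  pose I := ({b : bop H H | A b} * K)%type.
  have mem (b : {b : bop H H | A b}) : A (bcomp (badj m') (bcomp m' (sval b))).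
    by apply: (mm'.2 _ _).1; exact: (mm.2 _ (svalP b)).1.
  have mem1 (b : {b : bop H H | A b}) : A (bcomp m' (sval b)) by exact: (mm.2 _ (svalP b)).1.
  pose y (i : I) : I := (exist (fun b : bop H H => A b) _ (mem i.1), i.2).
  have /choice[c hc] : forall i : I, exists c : R, 0 <= c /\
      forall v, nm (sval i.1 v) <= c * nm v.
    by move=> i; have [c c0 h] := bop_bound (sval i.1); exists c.
  have [|||T [hT T0 _]] := @power_ext R I K K (fun i => f (sval i.1) i.2)
      (fun i => f (m' \o sval i.1) i.2) y B (fun i => c i * nm i.2) B0.
  - move=> [[b Ab] v] [[d Ad] w] /=.
    have A1 := (mm.2 _ Ab).1; have A2 := (mm.2 _ Ad).1.
    have A3 := mem (exist _ d Ad); rewrite /= in A3.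
    rewrite !fip//; congr '[f _ _, _].
    have -> : adj (m' \o d) = bfun (badj (bcomp m' d)) by [].
    have -> : adj (bcomp (badj m') (bcomp m' d)) = bfun (badj (bcomp (badj m') (bcomp m' d))) by [].
    by rewrite !badj_comp badjK; apply/funext.
  - move=> [[b Ab] v] [[d Ad] w] /=.
    have A3 := mem (exist _ d Ad); have A4 := mem (exist _ b Ab).
    rewrite /= in A3 A4; rewrite !fip//; congr '[f _ _, _].
    have -> : adj d = bfun (badj d) by [].
    have -> : adj (bcomp (badj m') (bcomp m' d)) = bfun (badj (bcomp (badj m') (bcomp m' d))) by [].
    by rewrite !badj_comp badjK; apply/funext.
  - move=> n i; have key : forall w, nm (sval (iter n y i).1 w) <= c i * B ^+ n * nm w.
      elim: n => [|n IH] w; first by rewrite expr0 mulr1; exact: (hc i).2.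
      rewrite iterS /= ; have h := hB (sval (iter n y i).1 w).
      apply: le_trans h _; rewrite exprS mulrCA -mulrA; exact: ler_wpM2l.
    have snd : (iter n y i).2 = i.2 by elim: n {key} => // n IH; rewrite iterS.
    rewrite snd mulrAC; apply: (star_hom_contr cA sA hf (svalP (iter n y i).1)) => //.
    by rewrite mulr_ge0 ?exprn_ge0//; exact: (hc i).1.
  exists T => _; split; first exact: bopP.
    move=> b v Ab; have [b' Ab' e] := sa_bop sA Ab; rewrite e.
    exact: (hT (exist _ b' Ab', v)).
  by move=> z hz; apply: T0 => -[[b Ab] v] /=; apply: hz; exists b, v.
have /choice[F hF] := ex.
have Fb m : mult A m -> exists T : bop K K, F m = T by move=> /hF[b _ _]; exact: bop_of.
have Feq m (U : bop K K) : mult A m -> (forall b v, A b -> U (f b v) = f (m \o b) v) ->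
    (forall z, (forall x, rg x -> '[x, z] = 0) -> U z = 0) -> F m = U.
  move=> mm h1 h2; have [T eT] := Fb m mm; have [_ F1 F0] := hF m mm.
  rewrite eT in F1 F0 *; congr bfun; apply: (proj_eq hP).
    by move=> x [b [v [Ab ->]]]; rewrite F1// h1.
  by move=> z hz; rewrite F0// h2.
have sM := mult_star sA.
have Am a : A a -> mult A a.
  move=> Aa; split; first exact: (star_alg_bounded sA).
  by move=> b Ab; split; exact: (star_alg_mul sA).
exists F; split; last first.
  move=> a Aa; have [y ey] := fb _ Aa; rewrite ey; apply: Feq; first exact: Am.
    by move=> b v Ab; rewrite (star_hom_mul hf)// ey.
  move=> z hz; apply: ip_eqP => w; rewrite ip0l badjP ipC hz ?rmorph0//.
  exists (adj a), w; split; first exact: (star_alg_adj sA).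
  by rewrite (star_hom_adj hf)// ey.
split.
- by move=> m /hF[].
- move=> c m n mm mn; have [S eS] := Fb m mm; have [T eT] := Fb n mn.
  have [_ S1 S0] := hF m mm; have [_ T1 T0] := hF n mn.
  rewrite eS in S1 S0 *; rewrite eT in T1 T0 *.
  rewrite (Feq (c *: m + n) (c *: S + T))//; first exact: (star_alg_lin sM).
    move=> b v Ab; rewrite baddE bscaleE S1// T1//.
    have -> : (c *: m + n) \o b = c *: (m \o b) + (n \o b) by [].
    by rewrite (star_hom_lin hf)//; [exact: (mm.2 _ Ab).1|exact: (mn.2 _ Ab).1].
  by move=> z hz; rewrite baddE bscaleE S0// T0// scaler0 addr0.
- move=> m n mm mn; have [S eS] := Fb m mm; have [T eT] := Fb n mn.
  have [_ S1 S0] := hF m mm; have [_ T1 T0] := hF n mn.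
  rewrite eS in S1 S0 *; rewrite eT in T1 T0 *.
  rewrite (Feq (m \o n) (bcomp S T))//; first exact: (star_alg_mul sM).
    by move=> b v Ab; rewrite bcompE T1// S1//; exact: (mn.2 _ Ab).1.
  by move=> z hz; rewrite bcompE T0// bop0.
- move=> m mm; have [S eS] := Fb m mm; have [_ S1 S0] := hF m mm.
  have sm := star_alg_adj sM mm.
  rewrite eS in S1 S0 *; rewrite (Feq (adj m) (badj S))//.
    move=> b v Ab; apply/eqP; rewrite -subr_eq0; apply/eqP; apply: ip_eqP => w.
    rewrite ip0l ipBl -badjPr; apply/eqP; rewrite subr_eq0; apply/eqP.
    have e1 : forall x, '[f b v, S x] = '[f (adj m \o b) v, x].
      have [fbv efb] : exists y : bop K K, f b = y by exact: fb.
      have [g eg] : exists y : bop K K, f (adj m \o b) = y by apply: fb; exact: (sm.2 _ Ab).1.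
      rewrite efb eg.
      suff e : bcomp (badj fbv) S = badj g.
        by move=> x; rewrite !(badjP) -e bcompE.
      apply: (proj_eq hP).
        move=> _ [d [u [Ad ->]]]; apply: ip_eqPr => t.
        rewrite bcompE -!badjP S1// -efb -eg !fip//.
        + congr '[f _ _, _].
          have [m' em] := bop_of mm.1; have [d' Ad' ed] := sa_bop sA Ad; rewrite em ed.
          have -> : adj (m' \o d') = bfun (badj (bcomp m' d')) by [].
          by rewrite badj_comp.
        + exact: (sm.2 _ Ab).1.
        + exact: (mm.2 _ Ad).1.
      move=> z hz; rewrite bcompE S0// bop0; apply/esym; apply: ip_eqPr => t.
      rewrite ip0r -badjP -eg hz//; exists (adj m \o b), t; split => //.
      exact: (sm.2 _ Ab).1.
    exact: e1.
  move=> z hz; apply: ip_eqPr => w; rewrite ip0r -badjP.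
  have e : bcomp P S = S.
    apply: (proj_eq hP); last by move=> u hu; rewrite bcompE S0// bop0.
    move=> _ [d [u [Ad ->]]]; rewrite bcompE S1//; have [_ _ PS _] := hP.
    by apply: PS; exists (m \o d), u; split => //; exact: (mm.2 _ Ad).1.
  have [sP _ _ P0] := hP.
  by rewrite -e bcompE (sa_ip _ _ sP) P0 ?ip0r.
Qed.

End MultiplierExtension.

(** * Approximate units from finite sums of squares *)

Section ApproximateUnit.
Context {R : realType}.
Implicit Types H K L : hilbert R.

(** The list may repeat an element, and its multiplicity serves as an integer weight. *)
Definition ssum H (ys : seq (bop H H)) : bop H H := \sum_(y <- ys) bcomp y (badj y).

Lemma ssum_psd H (ys : seq (bop H H)) : psd (ssum ys).
Proof.
apply: psd_sum => y; have := psd_comp_adj (badj y); by rewrite badjK.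
Qed.

Lemma ssum_rip H (ys : seq (bop H H)) x :
  rip (ssum ys x) x = \sum_(y <- ys) nm (badj y x) ^+ 2.
Proof.
rewrite /ssum bsumE /rip ip_suml raddf_sum; apply: eq_bigr => y _.
by rewrite /= badjP ipxx.
Qed.

Lemma ssum_nseq H n (y : bop H H) x :
  rip (ssum (nseq n y) x) x = n%:R * nm (badj y x) ^+ 2.
Proof.
rewrite ssum_rip; elim: n => [|n IH]; first by rewrite big_nil mul0r.
by rewrite big_cons IH -(natr1 n) mulrDl mul1r addrC.
Qed.

Lemma ssum_cat H (ys zs : seq (bop H H)) : ssum (ys ++ zs) = ssum ys + ssum zs.
Proof. by rewrite /ssum big_cat. Qed.

(** With w = res k (y xi) one has |w|^2 + <k w, w> = <xi, (adj y) w>, while <k w, w> >= n |(adj y)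
    w|^2; completing the square gives the factor 1 / n. *)
Lemma approx_unit_small H (ys : seq (bop H H)) (y : bop H H) n (xi : H) : (0 < n)%N ->
  (forall x, n%:R * nm (badj y x) ^+ 2 <= rip (ssum ys x) x) ->
  nm (res (ssum ys) (y xi)) ^+ 2 <= nm xi ^+ 2 / n%:R.
Proof.
move=> n0 h; set k := ssum ys in h *; have pk : psd k := ssum_psd ys.
have np : (0 : R) < n%:R by rewrite ltr0n.
set w := res k (y xi).
have e1 : nm w ^+ 2 + rip (k w) w = rip (y xi) w.
  by rewrite -ripxx -ripDl resE.
have h1 := h w; have h2 : rip (y xi) w <= nm xi * nm (badj y w).
  by rewrite /rip badjP; exact: rip_le.
rewrite ler_pdivlMr//.
have := sqr_ge0 (nm xi - n%:R * nm (badj y w)).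
have := pk.2 w; have := nm_ge0 xi; have := nm_ge0 (badj y w).
set a := nm xi; set b := nm (badj y w) => b0 a0 kw sq.
have h3 : n%:R * b ^+ 2 <= a * b by have := sqr_ge0 (nm w); lra.
have h4 : nm w ^+ 2 <= a * b - n%:R * b ^+ 2 by lra.
have h5 : nm w ^+ 2 * n%:R <= (a * b - n%:R * b ^+ 2) * n%:R by rewrite ler_pM2r.
nra.
Qed.

(** Resolvents of large sums become small on each range y H, so the transforms increase to the
    projection on the span of these ranges. Keeping Y an arbitrary set lets it be a closed ideal in
    one use and the adjoints of square integrable elements in another. *)
Lemma approx_unit H (M Y : set (H -> H)) (P : bop H H) :
  (forall ys : seq (bop H H), (forall y, y \in ys -> Y y) -> M (gg (ssum ys))) ->
  is_proj [set z | exists (y : bop H H) v, Y y /\ z = y v] P ->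
  directed_sup M [set g : H -> H | exists2 ys : seq (bop H H),
     (forall y, y \in ys -> Y y) & g = bfun (gg (ssum ys))] P.
Proof.
move=> hM hP; have [sP PP PS P0] := hP.
have Py (y : bop H H) v : Y y -> P (y v) = y v by move=> Yy; apply: PS; exists y, v.
have gP (ys : seq (bop H H)) : (forall y, y \in ys -> Y y) -> ble (gg (ssum ys)) P.
  move=> hys x; set k := ssum ys; have pk : psd k := ssum_psd ys.
  have kP z : P (k z) = k z.
    by rewrite /k /ssum bsumE bop_sum; apply: eq_big_seq => y /hys Yy; rewrite bcompE Py.
  have gP z : P (gg k z) = gg k z by rewrite bcompE kP.
  have e : gg k (P x) = gg k x.
    apply: ip_eqP => z; rewrite !(sa_ip _ _ (gg_psd pk).1) (sa_ip _ _ sP) gP.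
    by [].
  have : rip (gg k x) x = rip (gg k (P x)) (P x).
    by rewrite e [RHS]ripC [RHS]/rip (sa_ip _ _ sP) gP -/(rip _ _) ripC.
  move=> ->; apply: le_trans (gg_le1 pk _) _.
  by rewrite (proj_rip hP).
split.
- move=> _ [ys hys ->]; split; first exact: hM.
  by apply/psdP; exact: gg_psd (ssum_psd ys).
- by exists (bfun (gg (ssum [::]))); exists [::].
- move=> _ _ [ys hys ->] [zs hzs ->]; exists (bfun (gg (ssum (ys ++ zs)))); split.
  + by exists (ys ++ zs) => // y; rewrite mem_cat => /orP[/hys|/hzs].
  + apply/opleP; [exact: (gg_psd (ssum_psd _)).1|exact: (gg_psd (ssum_psd _)).1|].
    apply: gg_mono; try exact: ssum_psd.
    by move=> x; rewrite ssum_cat baddE ripDl lerDl (ssum_psd zs).2.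
  + apply/opleP; [exact: (gg_psd (ssum_psd _)).1|exact: (gg_psd (ssum_psd _)).1|].
    apply: gg_mono; try exact: ssum_psd.
    by move=> x; rewrite ssum_cat baddE ripDl lerDr (ssum_psd ys).2.
- exact: bopP.
- by move=> _ [ys hys ->]; apply/opleP => //; [exact: (gg_psd (ssum_psd _)).1|exact: gP].
move=> t bt ht; have [t' et] := bop_of bt; rewrite et in ht *.
have h0 : (exists2 ys : seq (bop H H), (forall y, y \in ys -> Y y) &
    bfun (gg (ssum [::])) = bfun (gg (ssum ys))) by exists [::].
have [st _] := @ople_sa R H (gg (ssum [::])) t' (gg_psd (ssum_psd _)).1 (ht _ h0).
apply/opleP => // v; set u := P v.
rewrite (proj_rip hP) -/u.
pose s (p : {y : bop H H | Y y} * H) : H := sval p.1 p.2.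
have ucl : in_closure (range (lc s)) u.
  have [z hz h] := proj_exists v (lc_csubspace s).
  suff -> : u = z by [].
  have Pz : P z = z.
    apply/eqP; rewrite -subr_eq0; apply/eqP.
    have [k k0 hk] := bop_bound P; apply: (@nm_small0 _ _ _ (k + 1)); first by lra.
    move=> e e0; have [_ [l _ <-] h'] := hz _ e0.
    have e1 : P (lc s l) = lc s l.
      rewrite /lc bop_sum; apply: eq_bigr => -[c [[y Yy] w]] _ /=; rewrite bopZ /s /=.
      by rewrite Py.
    have -> : P z - z = P (z - lc s l) - (z - lc s l) by rewrite bopB e1 opprB addrA subrK.
    apply: le_trans (nmB _ _) _; rewrite mulrDl mul1r; apply: lerD => //.
    by apply: le_trans (hk _) _; exact: ler_wpM2l.
  rewrite /u -[v](subrK z) bopD Pz P0 ?add0r// => _ [y [w [Yy ->]]]; apply: h.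
  by exists [:: (1, (exist _ y Yy, w))] => //; rewrite lc1.
apply/ler_addgt0Pr => e e0.
have k1 : 0 < nm u + 1 by have := nm_ge0 u; lra.
have e2 : 0 < e / 2 / (nm u + 1) by rewrite !divr_gt0.
have [_ [l _ <-] hl] := ucl _ e2; set d := e / 2 / _ in e2 hl.
have [ys [hys small]] : exists ys : seq (bop H H), (forall y, y \in ys -> Y y) /\
    forall ys', ble (ssum ys) (ssum ys') -> nm (res (ssum ys') (lc s l)) <= d.
  elim: (l) (d) (e2) => [|[c [[y Yy] w]] l' IH] f f0.
    by exists [::]; split => // ys' _; rewrite lc_nil bop0 nm0 ltW.
  have f2 : 0 < f / 2 by lra.
  have [ys1 [hys1 h1]] := IH _ f2.
  pose m := Re `|c| * nm w; have m0 : 0 <= m by rewrite mulr_ge0 ?Re_norm_ge0 ?nm_ge0.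
  have mf : 0 <= (m / (f / 2)) ^+ 2 by exact: sqr_ge0.
  (* With n copies of y the resolvent has norm at most m / sqrt n at c y w, hence at most f / 2. *)
  pose n := (Num.bound ((m / (f / 2)) ^+ 2)).+1.
  have np : (0 : R) < n%:R by rewrite ltr0n.
  have mn : m ^+ 2 / n%:R <= (f / 2) ^+ 2.
    rewrite ler_pdivrMr// mulrC -ler_pdivrMr ?exprn_gt0// -expr_div_n ltW//.
    by rewrite (lt_trans (archi_boundP mf))// ltr_nat.
  exists (nseq n y ++ ys1); split.
    by move=> z; rewrite mem_cat mem_nseq => /orP[/andP[_ /eqP ->//]|/hys1].
  move=> ys' hle; rewrite lc_cons bopD bopZ; apply: le_trans (nmD _ _) _.
  have -> : f = f / 2 + f / 2 by lra.
  apply: lerD; last first.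
    apply: h1 => x; apply: le_trans (hle x).
    by rewrite ssum_cat baddE ripDl lerDr (ssum_psd _).2.
  rewrite nmZ; apply: sqr_le; first by lra.
  apply: le_trans mn; rewrite exprMn.
  have -> : m ^+ 2 / n%:R = Re `|c| ^+ 2 * (nm w ^+ 2 / n%:R) by rewrite /m; ring.
  apply: ler_wpM2l; first exact: sqr_ge0.
  apply: approx_unit_small => // x; apply: le_trans (hle x).
  rewrite ssum_cat baddE ripDl; apply: (@le_trans _ _ (rip (ssum (nseq n y) x) x)).
    by rewrite ssum_nseq.
  by rewrite lerDl (ssum_psd _).2.
have small' : nm (res (ssum ys) u) <= e / (nm u + 1).
  have -> : e / (nm u + 1) = d + d by rewrite /d; field; rewrite gt_eqF.
  have -> : res (ssum ys) u = res (ssum ys) (u - lc s l) + res (ssum ys) (lc s l).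
    by rewrite -bopD subrK.
  apply: le_trans (nmD _ _) _.
  have h1 := res_le (ssum_psd ys) (u - lc s l).
  have h2 := small ys (fun x => lexx _).
  by rewrite lerD// (le_trans h1).
have -> : nm u ^+ 2 = rip (gg (ssum ys) u) u + rip (res (ssum ys) u) u.
  by rewrite (ggE (ssum_psd ys)) ripBl ripxx subrK.
apply: lerD.
  have ht' : ople (gg (ssum ys)) t' by apply: ht; exists ys.
  move/(opleP (gg_psd (ssum_psd ys)).1 st): ht' => ht'.
  suff -> : rip (gg (ssum ys) u) u = rip (gg (ssum ys) v) v by exact: ht'.
  have kP z : P (ssum ys z) = ssum ys z.
    by rewrite /ssum bsumE bop_sum; apply: eq_big_seq => y /hys Yy; rewrite bcompE Py.
  have gP' z : P (gg (ssum ys) z) = gg (ssum ys) z by rewrite bcompE kP.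
  have eq1 : gg (ssum ys) u = gg (ssum ys) v.
    by apply: ip_eqP => z; rewrite !(sa_ip _ _ (gg_psd (ssum_psd ys)).1) (sa_ip _ _ sP) gP'.
  by rewrite eq1 [LHS]ripC /rip (sa_ip _ _ sP) gP' -/(rip _ _) ripC.
apply: le_trans (rip_le _ _) _.
apply: le_trans (ler_wpM2r (nm_ge0 u) small') _.
by rewrite mulrAC ler_pdivrMr// mulrDr mulr1 lerDl ltW.
Qed.

End ApproximateUnit.

(** * Bounded substitutes for the tails of a series of positive operators *)

Section TailSuprema.
Context {R : realType}.
Implicit Types H K L : hilbert R.

Lemma rip_cvs_le H (u : nat -> H) l y (c : R) : cvs u l ->
  (forall n, rip (u n) y <= c) -> rip l y <= c.
Proof.
move=> hu h; apply/ler_addgt0Pr => e e0; have k1 : 0 < nm y + 1 by have := nm_ge0 y; lra.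
have e1 : 0 < e / (nm y + 1) by rewrite divr_gt0.
have [n0 hn] := hu _ e1; have {}hn := hn _ (leqnn _); have h0 := h n0.
have := abs_rip_le (u n0 - l) y; rewrite ripBl ler_norml => /andP[h1 _].
suff : nm (u n0 - l) * nm y <= e by lra.
rewrite ler_pdivlMr// in hn; apply: le_trans hn; apply: ler_wpM2l; rewrite ?nm_ge0//; lra.
Qed.

Definition psum H (y : nat -> bop H H) m j : bop H H := \sum_(m <= i < m + j) y i.

Lemma psum_psd H (y : nat -> bop H H) m j : (forall n, psd (y n)) -> psd (psum y m j).
Proof. by move=> hy; exact: psd_sum. Qed.

Lemma psumS H (y : nat -> bop H H) m j : psum y m j.+1 = psum y m j + y (m + j)%N.
Proof. by rewrite /psum addnS big_nat_recr ?leq_addr. Qed.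

Lemma psumSl H (y : nat -> bop H H) m j : psum y m j.+1 = y m + psum y m.+1 j.
Proof. by rewrite /psum big_ltn ?addnS ?ltnS ?leq_addr// addSn. Qed.

Lemma psum1 H (y : nat -> bop H H) m : psum y m 1 = y m.
Proof. by rewrite /psum addn1 big_nat1. Qed.

(** On the spectrum t <= 2 t / (1 + t) for 0 <= t <= 1. This converts bounds on transforms back into
    bounds on k. *)
Lemma gg_half H (k : bop H H) x : psd k -> (forall x, rip (k x) x <= nm x ^+ 2) ->
  rip (k x) x <= 2 * rip (gg k x) x.
Proof.
move=> pk k1; set r := res k x; set g := k r.
have gE : gg k x = g by [].
have xE : x = r + g by rewrite resE.
have h := @psd_nm R H k 1 g pk ler01; rewrite mul1r in h.
have {}h := h (fun y => ltac:(by rewrite mul1r)).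
have h2 := @psd_nm R H k 1 r pk ler01; rewrite mul1r in h2.
have {}h2 := h2 (fun y => ltac:(by rewrite mul1r)).
have kx : k x = g + k g by rewrite xE bopD.
rewrite gE kx xE !(ripDl, ripDr) ripxx -/g.
have -> : rip (k g) r = nm g ^+ 2 by rewrite (sa_sym g r pk.1) -/g ripxx.
rewrite -/g in h2; have := k1 g; have := pk.2 g; have := pk.2 r; rewrite -/g; lra.
Qed.

(** The series of the y i may diverge, so its tails are replaced by the suprema G_ m of the
    transforms of their partial sums. These stay below 1 and in M, inherit every bound on the forms
    of the partial sums, and decrease strongly to some G. *)
Lemma tail_sup H (M : set (H -> H)) (y : nat -> bop H H) : vn_alg M ->
  (forall n, psd (y n)) -> (forall n, M (y n)) ->
  exists (G_ : nat -> bop H H) (G : bop H H),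
  [/\ forall m, [/\ M (G_ m), psd (G_ m) & forall x, rip (G_ m x) x <= nm x ^+ 2],
      forall m j, ble (gg (psum y m j)) (G_ m),
      forall m, directed_sup M (range (fun j => bfun (gg (psum y m j)))) (G_ m),
      forall m c x, (forall j, rip (psum y m j x) x <= c) -> rip (G_ m x) x <= c &
      [/\ psd G, M G, forall m, ble G (G_ m), forall x, cvs (fun m => G_ m x) (G x) &
        directed_sup M (range (fun m => bfun (bid H - G_ m))) (bid H - G)]].
Proof.
move=> hM py My.
have pT m j := psum_psd m j py.
have MT m j : M (psum y m j).
  by rewrite /psum; apply: (sa_sum hM.1) => i _.
have Mg m j : M (gg (psum y m j)) by apply: gg_mem => //; [exact: vn_closed|exact: hM.1].
have /choice[G_ hG] : forall m, exists S : bop H H, [/\ psd S,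
    forall j, ble (gg (psum y m j)) S, forall x, rip (S x) x <= nm x ^+ 2,
    forall x, cvs (fun j => gg (psum y m j) x) (S x) &
    directed_sup M (range (fun j => bfun (gg (psum y m j)))) S].
  move=> m; have [|||S [h1 h2 h3 h4 h5]] := @mono_sup R H (fun j => gg (psum y m j)).
  - by move=> j; exact: gg_psd.
  - move=> j; apply: gg_mono => // x; rewrite psumS baddE ripDl lerDl.
    exact: (py _).2.
  - by move=> j x; exact: gg_le1.
  by exists S; split => //; exact: h5.
have pG m : psd (G_ m) by have [] := hG m.
have gG m j : ble (gg (psum y m j)) (G_ m) by have [_ h _ _ _] := hG m; exact: h.
have G1 m x : rip (G_ m x) x <= nm x ^+ 2 by have [_ _ h _ _] := hG m; exact: h.
have cG m x : cvs (fun j => gg (psum y m j) x) (G_ m x) by have [_ _ _ h _] := hG m; exact: h.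
have dG m : directed_sup M (range (fun j => bfun (gg (psum y m j)))) (G_ m) by have [] := hG m.
have MG m : M (G_ m) by apply: (vn_limit hM (fun j => Mg m j)) => x; exact: cG.
have mG m : ble (G_ m.+1) (G_ m).
  move=> x; apply: rip_cvs_le (cG m.+1 x) _ => j; apply: le_trans (gG m j.+1 x).
  apply: gg_mono => // z; rewrite psumSl baddE ripDl lerDr; exact: (py _).2.
have M1 m : M (bid H - G_ m) by apply: sa_sub => //; [exact: hM.1|exact: vn_id].
have p1 m : psd (bid H - G_ m).
  apply: psd_sub; [exact: (pG m).1|exact: badj_id|].
  by move=> x; rewrite /= ripxx G1.
have [||S [pS TS S1 cS dS]] := @mono_sup R H (fun m => bid H - G_ m) p1.
- by move=> m x; rewrite !bsubE !ripBl lerD2l lerN2 mG.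
- by move=> m x; rewrite bsubE ripBl ripxx lerBlDr lerDl (pG m).2.
have eS : bid H - (bid H - S) = S by rewrite opprB addrCA subrr addr0.
have M_S : M S by exact: (vn_limit hM M1 cS).
exists G_, (bid H - S); split => //.
  move=> m c x h; apply: rip_cvs_le (cG m x) _ => j.
  by apply: le_trans (h j); exact: gg_le_self.
split.
- apply: psd_sub; [exact: pS.1|exact: badj_id|]; by move=> x; rewrite /= ripxx S1.
- by apply: sa_sub => //; [exact: hM.1|exact: vn_id].
- move=> m x; rewrite bsubE ripBl; have := TS m x; rewrite bsubE ripBl; lra.
- move=> x e e0; have [n0 h] := cS x e e0; exists n0 => n hn.
  have -> : G_ n x - (bid H - S) x = - ((bid H - G_ n) x - S x).
    by rewrite !bsubE /= !opprB addrCA addrA.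
  by rewrite nmN; exact: h.
- by rewrite eS; exact: dS.
Qed.

End TailSuprema.

(** * Normal positive functionals and smallness on a countable family *)

Section NormalFunctionals.
Context {R : realType}.
Implicit Types H K L : hilbert R.

Section One.
Variables (H : hilbert R) (L : set (H -> H)) (w : (H -> H) -> R[i]).
Hypotheses (hL : vn_alg L) (hw : normal_functional L w).

Let sL := hL.1.

Lemma nf_lin c (x y : bop H H) : L x -> L y -> w (c *: x + y : bop H H) = c * w x + w y.
Proof. by move=> Lx Ly; exact: (normal_functional_lin hw c Lx Ly). Qed.

Lemma nf_0 : w (0 : bop H H) = 0.
Proof.
have h := nf_lin 1 (sa_0 sL) (sa_0 sL); rewrite scaler0 addr0 mul1r in h.
by apply: (@addrI _ (w (0 : bop H H))); rewrite addr0 -[LHS]h.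
Qed.

Lemma nf_scale c (x : bop H H) : L x -> w (c *: x : bop H H) = c * w x.
Proof. by move=> Lx; rewrite -[c *: x]addr0 nf_lin ?nf_0 ?addr0//; exact: sa_0. Qed.

Lemma nf_add (x y : bop H H) : L x -> L y -> w (x + y : bop H H) = w x + w y.
Proof. by move=> Lx Ly; rewrite -{1}[x]scale1r nf_lin// mul1r. Qed.

Lemma nf_sub (x y : bop H H) : L x -> L y -> w (x - y : bop H H) = w x - w y.
Proof. by move=> Lx Ly; rewrite addrC -scaleN1r nf_lin// mulN1r addrC. Qed.

Lemma nf_psd (x : bop H H) : L x -> psd x -> 0 <= w x.
Proof.
by move=> Lx px; apply: (normal_functional_ge0 hw); split => //; apply/psdP.
Qed.

Lemma nf_le (x y : bop H H) : L x -> L y -> psd (y - x) -> w x <= w y.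
Proof.
move=> Lx Ly h; rewrite -subr_ge0 -nf_sub//; apply: nf_psd => //; exact: sa_sub.
Qed.

Lemma nf_real (x : bop H H) : L x -> badj x = x -> Im (w x) = 0.
Proof.
move=> Lx sx; have [k k0 hk] := le_bound (- x).
have : psd (x + k%:C *: bid H).
  split.
    by have := badj_lin k%:C (bid H) x; rewrite badj_id sx conjc_real addrC => ->; rewrite addrC.
  by move=> v; have := hk v; rewrite baddE bscaleE boppE ripDl ripNl ripZl ripxx; lra.
have Lid := vn_id hL.
move=> /nf_psd; rewrite nf_add//; last exact: sa_scale.
rewrite nf_scale// => /(_ (sa_add sL Lx (sa_scale _ sL Lid))).
have : 0 <= w (bid H) by apply: nf_psd => //; split => [|v]; [exact: badj_id|rewrite ripxx sqr_ge0].
rewrite !lecE; case: (w (bid H)) => a b; case: (w x) => c d /=.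
by move=> /andP[/eqP -> _] /andP[/eqP]; rewrite !mulr0 mul0r !addr0.
Qed.

Lemma nf_sup (D : set (H -> H)) (s : bop H H) e : directed_sup L D s -> 0 < e ->
  exists2 x : bop H H, D x & Re (w s) - Re (w x) <= e.
Proof.
move=> hD e0; have [h1 h2] := normal_functional_sup hw hD.
apply: contrapT => h.
have : w s <= w s - e%:C.
  apply: h2 => x Dx; have [x' [ex px Lx]] := dsup_mem sL hD Dx.
  have : 0 <= w x by rewrite ex; exact: nf_psd.
  have := h1 _ Dx; rewrite lecE => /andP[/eqP i1 _].
  rewrite lecE raddfB raddfB /= i1 subr0 eqxx /= => _.
  rewrite leNgt; apply/negP => h3; apply: h; exists x'; rewrite -?ex//; lra.
by rewrite lerDl oppr_ge0 lecR; lra.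
Qed.

Lemma nf_cs (z : bop H H) : L z -> badj z = z ->
  Re (w z) ^+ 2 <= Re (w (bcomp z z)) * Re (w (bid H)).
Proof.
move=> Lz sz; have Lid := vn_id hL.
have Lzz : L (bcomp z z) by exact: sa_comp.
have ge0 (x : bop H H) : L x -> psd x -> 0 <= Re (w x).
  by move=> Lx px; have := nf_psd Lx px; rewrite lecE => /andP[].
have pzz : psd (bcomp z z) by rewrite -{1}sz; exact: psd_comp_adj.
apply: discr_le; [exact: ge0|by apply: ge0 => //; split => [|v]; [exact: badj_id|rewrite ripxx sqr_ge0]|].
move=> t; pose u := z + t%:C *: bid H.
have su : badj u = u.
  by have := badj_lin t%:C (bid H) z; rewrite badj_id sz conjc_real /u addrC => ->; rewrite addrC.
have Lt : L (t%:C *: bid H) by exact: sa_scale.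
have Lu : L u by exact: sa_add.
have : 0 <= Re (w (bcomp u u)) by apply: ge0; [exact: sa_comp|rewrite -{1}su; exact: psd_comp_adj].
have -> : bcomp u u = (2 * t)%:C *: z + (bcomp z z + (t ^+ 2)%:C *: bid H).
  apply: bop_eq => v; rewrite bcompE /u !(baddE, bscaleE, bcompE) /= bopD bopZ.
  rewrite scalerDr scalerA -rmorphM -expr2.
  have -> : (2 * t)%:C *: z v = t%:C *: z v + t%:C *: z v.
    have -> : 2 * t = t + t by ring.
    by rewrite rmorphD scalerDl.
  by rewrite [X in X + _ = _]addrC addrACA.
rewrite nf_lin//; last by apply: sa_add => //; exact: sa_scale.
rewrite nf_add//; last exact: sa_scale.
rewrite nf_scale// !raddfD /= !Re_mulr; lra.
Qed.

(* small on y for a faithful-enough countable family S implies small for w *)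
Lemma nf_small (S : nat -> H) (P : bop H H) (y : nat -> bop H H) :
  L P -> is_proj [set z | exists (T : bop H H) n, commutant L T /\ z = T (S n)] P ->
  Re (w (bid H - P)) <= 0 -> (forall n, L (y n)) -> (forall n, psd (y n)) ->
  (forall n x, rip (y n x) x <= nm x ^+ 2) ->
  (forall n k, (k <= n)%N -> rip (y n (S k)) (S k) <= 2^-1 ^+ n) ->
  forall e, 0 < e -> exists n0, forall n, (n0 <= n)%N -> Re (w (y n)) <= e.
Proof.
move=> LP hP wP Ly py y1 yS e e0; have [sP PP PS P0] := hP.
(* On each S k the forms of the y n are summable, so the limit G vanishes there and hence under P;
   thus w(G) <= w(1 - P) <= 0 and some w(G_ m) is small. From there on G_ m dominates gg (y n), and
   y n <= 2 gg (y n). *)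
have [G_ [G [hG gG dG hle [pG MG GG cG dd]]]] := tail_sup hL py Ly.
have GS k : G (S k) = 0.
  suff h : rip (G (S k)) (S k) <= 0.
    apply: nm0_eq0; apply/eqP; rewrite -sqrf_eq0 eq_le sqr_ge0 andbT.
    have := @psd_nm R H G 1 (S k) pG ler01; rewrite mul1r => h2.
    apply: le_trans (h2 _) h => x; rewrite mul1r.
    by apply: le_trans (GG 0%N x) _; have [_ _ h3] := hG 0%N; exact: h3.
  apply/ler_addgt0Pr => d d0; rewrite add0r.
  have h0 : (0 : R) <= 2^-1 by rewrite invr_ge0.
  have h1 : (2^-1 : R) < 1 by lra.
  have [n0 hn] := geometric_small (c := 2) (r := 2^-1) (ltac:(lra)) h0 h1 d0.
  set n := maxn k n0; apply: le_trans (GG n _) _.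
  apply: hle => j; apply: le_trans (hn n (leq_maxr _ _)).
  have -> : 2 * 2^-1 ^+ n = 2^-1 ^+ n / (1 - 2^-1) :> R.
    have -> : 1 - 2^-1 = 2^-1 :> R by lra.
    by rewrite invrK mulrC.
  apply: le_trans (geo_tail n j h0 h1).
  rewrite /psum bsumE /rip ip_suml raddf_sum /= big_nat_cond [X in _ <= X]big_nat_cond.
  apply: ler_sum => i /andP[/andP[hi _] _]; apply: yS.
  exact: leq_trans (leq_maxl _ _) hi.
have GP x : G (P x) = 0.
  apply: (proj_kill hP) => _ [T [n [hT ->]]].
  by rewrite (vn_comm _ MG hT) GS bop0.
have G1P : psd ((bid H - P) - G).
  split; first by rewrite !badj_sub badj_id sP pG.1.
  move=> x; rewrite bsubE ripBl subr_ge0.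
  have -> : rip (G x) x = rip (G (x - P x)) (x - P x).
    rewrite bopB GP subr0 ripBr; have -> : rip (G x) (P x) = 0; last by rewrite subr0.
    by rewrite (sa_sym _ _ pG.1) GP rip0l.
  apply: le_trans (GG 0%N _) _; have [_ _ h3] := hG 0%N; apply: le_trans (h3 _) _.
  rewrite bsubE /= nm_sqrB ripBl ripxx (ripC x) (proj_rip hP); lra.
have Lid := vn_id hL; have L1P : L (bid H - P) by exact: sa_sub.
have wG : Re (w G) <= 0.
  by have := nf_le MG L1P G1P; rewrite lecE => /andP[_ h]; exact: le_trans h wP.
have e2 : 0 < e / 2 by lra.
have [x [m0 _ ex] hx] := nf_sup dd e2.
have MGm m : L (G_ m) by have [] := hG m.
have wm : Re (w (G_ m0)) <= e / 2.
  move: hx; rewrite -ex nf_sub// nf_sub// !raddfB /=; lra.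
exists m0 => n hn.
have gyn : Re (w (y n)) <= 2 * Re (w (gg (y n))).
  have Lg : L (gg (y n)) by apply: gg_mem => //; exact: vn_closed.
  have : w (y n) <= w (2%:C *: gg (y n)).
    apply: nf_le => //; first exact: sa_scale.
    apply: psd_sub; [exact: (py n).1|by rewrite badj_scaler (gg_psd (py n)).1|].
    by move=> v; rewrite bscaleE ripZl; exact: gg_half.
  by rewrite nf_scale// lecE => /andP[_]; rewrite Re_mulr.
have : w (gg (y n)) <= w (G_ m0).
  apply: nf_le => //; first by apply: gg_mem => //; exact: vn_closed.
  have [_ pGm _] := hG m0.
  apply: psd_sub; [exact: (gg_psd (py n)).1|exact: pGm.1|].
  move=> v; apply: le_trans (gG m0 (n - m0).+1 v).
  apply: gg_mono => //; first exact: psum_psd.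
  move=> u; rewrite psumS subnKC// baddE ripDl lerDr.
  exact: (psum_psd m0 (n - m0) py).2.
by rewrite lecE => /andP[_]; lra.
Qed.

End One.
End NormalFunctionals.

(** * The double commutant theorem on finite sets of vectors *)

Section DoubleCommutant.
Context {R : realType} (tp : tensor_choice R).
Implicit Types H K L : hilbert R.
Local Notation "h @ox k" := (tens (tp _ _) h k) (at level 40).

Lemma bopt0r H K H' K' (x : bop H H') : bopt (tp := tp) x (0 : bop K K') = 0.
Proof.
have := @bopt_linr R tp _ _ _ _ 1 x (0 : bop K K') 0; rewrite !scale1r addr0 => h.
by apply: (@addrI _ (bopt x 0)); rewrite -h addr0.
Qed.

Lemma boptBr H K H' K' (x : bop H H') (y z : bop K K') :
  bopt (tp := tp) x (y - z) = bopt x y - bopt x z.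
Proof. by rewrite addrC -scaleN1r bopt_linr scaleN1r addrC. Qed.

Lemma boptZr H K H' K' c (x : bop H H') (y : bop K K') :
  bopt (tp := tp) x (c *: y) = c *: bopt x y.
Proof. by rewrite -[c *: y]addr0 bopt_linr bopt0r addr0. Qed.

Lemma proj_fix_cl H (S : set H) (P : bop H H) z : is_proj S P -> in_closure S z -> P z = z.
Proof.
move=> hP hz; have [sP PP PS P0] := hP.
have h1 : '[z, z - P z] = 0.
  by apply: (in_closure_ip0 hz) => v Sv; exact: (proj_compl_orth hP).
apply/esym/eqP; rewrite -subr_eq0 -nm_eq0 -sqrf_eq0 -ripxx /rip ipBl h1.
by rewrite (sa_ip _ _ sP) bopB PP subrr ip0r subrr.
Qed.

Lemma proj_range_cl H (S : set H) (P : bop H H) z : csubspace S -> is_proj S P ->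
  in_closure S (P z).
Proof.
move=> hS hP; have [z' hz' h] := proj_exists z hS; have [sP PP PS P0] := hP.
suff -> : P z = z' by [].
by rewrite -[z](subrK z') bopD (proj_fix_cl hP hz') P0 ?add0r.
Qed.

Definition ampl H K (L0 : set (K -> K)) : set (tp H K -> tp H K) :=
  [set z : tp H K -> tp H K | exists2 y : bop K K, L0 y & z = bopt (bid H) y].
Arguments ampl H {K} L0.

Lemma ampl_star H K (L0 : set (K -> K)) : star_alg L0 -> star_alg (ampl H L0).
Proof.
move=> sL; split.
- by move=> _ [y _ ->]; exact: bopP.
- exists 0; first exact: sa_0.
  by rewrite bopt0r.
- move=> c _ _ [x Lx ->] [y Ly ->]; exists (c *: x + y); first exact: sa_lin.
  by rewrite bopt_linr.
- move=> _ _ [x Lx ->] [y Ly ->]; exists (bcomp x y); first exact: sa_comp.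
  have h : bcomp (bopt (bid H) x) (bopt (bid H) y) = bopt (tp := tp) (bid H) (bcomp x y).
    by rewrite bopt_comp; congr bopt; exact: bop_eq.
  exact: (congr1 (@bfun _ _ _) h).
- move=> _ [x Lx ->]; exists (badj x); first exact: sa_adj.
  by rewrite -[adj _]/(bfun (badj (bopt (bid H) x))) badj_bopt badj_id.
Qed.

Lemma ampl_bicommutant H K (L0 : set (K -> K)) (X : bop K K) : star_alg L0 ->
  commutant (commutant L0) X -> commutant (commutant (ampl H L0)) (bopt (tp := tp) (bid H) X).
Proof.
move=> sL hX; apply/commutantP => T hT v.
have [T' e hT'] := commutant_bop hT; rewrite {}e in hT *.
have slice h h' : commutant L0 (bsl h h' T').
  apply/commutantP => x Lx u; have [y Ly e] := sa_bop sL Lx; rewrite {}e.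
  apply: ip_eqP => w; rewrite bslE (badjP y) bslE.
  have -> : h @ox y u = bopt (bid H) y (h @ox u) by rewrite boptE.
  have -> : h' @ox badj y w = badj (bopt (bid H) y) (h' @ox w).
    by rewrite badj_bopt badj_id boptE.
  rewrite -badjP; congr '[_, _].
  by have /commutantP := hT'; apply; exists y.
have e : bcomp (bopt (bid H) X) T' = bcomp T' (bopt (bid H) X).
  apply: tens_ext_ip => h k h' k'; rewrite !bcompE boptE badjP badj_bopt badj_id boptE.
  rewrite -!bslE -badjP; congr '[_, _].
  by have /commutantP := hX; apply; exact: slice.
by rewrite -!bcompE e.
Qed.

Lemma bicommutant_dense1 H (L0 : set (H -> H)) (X : bop H H) xi : star_alg L0 ->
  L0 (bid H) -> commutant (commutant L0) X ->
  in_closure [set z | exists2 y : bop H H, L0 y & z = y xi] (X xi).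
Proof.
move=> sL L1 /commutantP hX; set S := [set z | _].
have hS : csubspace S.
  split; first by exists 0; [exact: sa_0|].
  move=> c _ _ [x Lx ->] [y Ly ->]; exists (c *: x + y) => //; exact: sa_lin.
have [P hP] := span_proj S; have [sP PP PS P0] := hP.
have Pc : commutant L0 P.
  apply/commutantP => x Lx v; have [y Ly ->] := sa_bop sL Lx.
  apply: (proj_commute hP) => _ [z Lz ->]; apply: PS.
    by exists (bcomp y z) => //; exact: sa_comp.
  by exists (bcomp (badj y) z) => //; apply: sa_comp => //; exact: sa_adj.
have -> : X xi = P (X xi).
  by rewrite -(hX _ Pc) PS//; exists (bid H).
exact: proj_range_cl.
Qed.

(** With Xi the sum of e tensor e over an orthonormal list spanning vs, the vector (1 tensor D) Xi
    has all the D e as components. The tensor square thereby plays the part of the n-fold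
    amplification. *)
Lemma list_vector H (vs : seq H) : exists (Xi : tp H H) (c : R), 0 <= c /\
  forall (D : bop H H) v, v \in vs -> nm (D v) <= c * nm (bopt (bid H) D Xi).
Proof.
have [l [ol hl _]] := @gram_schmidt R H [::] vs I.
pose Xi : tp H H := \sum_(e <- l) e @ox e.
pose c := (\sum_(v <- vs) nm v) * (size l)%:R.
exists Xi, c; split; first by rewrite mulr_ge0// sumr_ge0// => v _; exact: nm_ge0.
move=> D v hv.
have De e : e \in l -> D e = badj (lcol e) (bopt (bid H) D Xi).
  move=> el; rewrite /Xi !bop_sum.
  transitivity (\sum_(f <- l) '[f, e] *: D f); last first.
    by apply: eq_bigr => f _; rewrite boptE lcol_adjE.
  transitivity (D (\sum_(f <- l) '[f, e] *: f)); last first.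
    by rewrite bop_sum; apply: eq_bigr => f _; rewrite bopZ.
  congr (D _); elim: l ol el {hl Xi c} => // f l IH /= [f1 fl ol].
  rewrite inE big_cons => /orP[/eqP ->|el].
    rewrite f1 scale1r -[LHS]addr0; congr (_ + _); rewrite big_seq big1// => g gl.
    by rewrite fl// scale0r.
  by rewrite (ipC f) fl// rmorph0 scale0r add0r -IH.
have De' e : e \in l -> nm (D e) <= nm (bopt (bid H) D Xi).
  move=> el; rewrite De//.
  have e1 : nm e = 1.
    have : '[e, e] = 1.
      elim: l ol el {hl Xi c De} => // f l IH /= [f1 fl ol].
      by rewrite inE => /orP[/eqP ->|/(IH ol)].
    by rewrite ipxx => -[/eqP]; rewrite sqrf_eq1 => /orP[/eqP //|/eqP h]; have := nm_ge0 e; lra.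
  have := @adj_bound R H (tp H H) (lcol e) 1 ler01; rewrite -[X in _ <= X]mul1r; apply.
  by move=> x; rewrite lcolE nm_tens e1.
have -> : D v = \sum_(e <- l) '[v, e] *: D e.
  by rewrite -{1}(hl _ hv) lprojE bop_sum; apply: eq_bigr => e _; rewrite bopZ.
have nv : nm v <= \sum_(u <- vs) nm u.
  rewrite (big_rem v)//= lerDl; apply: sumr_ge0 => u _; exact: nm_ge0.
apply: (@le_trans _ _ (nm v * (size l)%:R * nm (bopt (bid H) D Xi))); last first.
  by apply: ler_wpM2r; rewrite ?nm_ge0//; apply: ler_wpM2r.
have e1 e : e \in l -> nm e <= 1.
  move=> el; have : '[e, e] = 1.
    elim: l ol el {hl Xi c De De'} => // f l IH /= [f1 fl ol].
    by rewrite inE => /orP[/eqP ->|/(IH ol)].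
  by rewrite ipxx => -[/eqP]; rewrite sqrf_eq1 => /orP[/eqP ->//|/eqP ->]; lra.
move: De' e1; set N := nm (bopt _ _ _); have N0 : 0 <= N by exact: nm_ge0.
elim: (l) => [|e l' IH] h1 h2; first by rewrite big_nil nm0 mulr0 mul0r.
rewrite big_cons /= -(natr1 (size l')) mulrDr mulr1 mulrDl addrC.
apply: le_trans (nmD _ _) _; apply: lerD.
  by apply: IH => f fl; [apply: h1|apply: h2]; rewrite inE fl orbT.
rewrite nmZ; apply: ler_pM; rewrite ?nm_ge0 ?Re_norm_ge0//; last by apply: h1; rewrite mem_head.
apply: le_trans (ip_le _ _) _; rewrite -[X in _ <= X]mulr1; apply: ler_wpM2l; first exact: nm_ge0.
by apply: h2; rewrite mem_head.
Qed.

Lemma list_approx H (Y : set (bop H H)) (X : bop H H) (vs : seq H) e : 0 < e ->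
  (forall Xi : tp H H, in_closure [set z | exists2 y, Y y & z = bopt (bid H) y Xi]
     (bopt (bid H) X Xi)) ->
  exists2 y, Y y & forall v, v \in vs -> nm (X v - y v) <= e.
Proof.
move=> e0 h; have [Xi [c [c0 hc]]] := list_vector vs.
have c1 : 0 < c + 1 by lra.
have e1 : 0 < e / (c + 1) by rewrite divr_gt0.
have [_ [y Yy ->] hy] := h Xi _ e1; exists y => // v vv.
rewrite -bsubE; apply: le_trans (hc _ _ vv) _.
have -> : bopt (bid H) (X - y) Xi = bopt (bid H) X Xi - bopt (bid H) y Xi.
  by rewrite boptBr.
apply: le_trans (ler_wpM2l c0 hy) _; rewrite mulrA ler_pdivrMr// mulrC.
by apply: ler_wpM2l; [exact: ltW|lra].
Qed.

Lemma bicommutant_dense H (L0 : set (H -> H)) (X : bop H H) (vs : seq H) e : star_alg L0 ->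
  L0 (bid H) -> commutant (commutant L0) X -> 0 < e ->
  exists2 y : bop H H, L0 y & forall v, v \in vs -> nm (X v - y v) <= e.
Proof.
move=> sL L1 hX e0; apply: (@list_approx _ [set y : bop H H | L0 y]) => // Xi.
have sA := ampl_star H sL.
have A1 : ampl H L0 (bid (tp H H)) by exists (bid H); rewrite // bopt_id.
have := bicommutant_dense1 Xi sA A1 (ampl_bicommutant H sL hX) => h d d0.
have [_ [z [y Ly ez] ->] hz] := h d d0; exists (bopt (bid H) y Xi); first by exists y.
by move: hz; rewrite ez.
Qed.

(** Taking self-adjoint parts of strong approximants fails, since the adjoint is not strongly
    continuous. Instead X1 Xi is projected on the real closed subspace of the y Xi with y
    self-adjoint; the defect d is real orthogonal to (y + adj y) Xi for every y, and approximating X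
    at Xi and at d simultaneously gives d = 0. *)
Lemma bicommutant_dense_sa H (L0 : set (H -> H)) (X : bop H H) (vs : seq H) e : star_alg L0 ->
  L0 (bid H) -> commutant (commutant L0) X -> badj X = X -> 0 < e ->
  exists y : bop H H, [/\ L0 y, badj y = y & forall v, v \in vs -> nm (X v - y v) <= e].
Proof.
move=> sL L1 hX sX e0.
suff [y [Ly sy] hy] : exists2 y, [set y : bop H H | L0 y /\ badj y = y] y &
    forall v, v \in vs -> nm (X v - y v) <= e by exists y.
apply: list_approx => // Xi.
have sA := ampl_star H sL.
have A1 : ampl H L0 (bid (tp H H)) by exists (bid H); rewrite // bopt_id.
set X1 := bopt (bid H) X; have sX1 : badj X1 = X1 by rewrite badj_bopt badj_id sX.
set V := [set z | _].
have [|||||z [[u uV uz] hz]] := @real_riesz R (tp H H) V (fun v => rip v (X1 Xi)) (nm (X1 Xi)).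
- exists 0; last by rewrite bopt0r.
  by split; [exact: sa_0|exact: (psd_0 H).1].
- move=> s t _ _ [x [Lx sx] ->] [y [Ly sy] ->]; exists (s%:C *: x + t%:C *: y).
    split; first by apply: sa_lin => //; exact: sa_scale.
    by rewrite badj_lin badj_scaler sx sy conjc_real.
  by rewrite bopt_linr boptZr.
- by move=> s t x y _ _; rewrite ripDl !ripZl.
- exact: nm_ge0.
- by move=> x _; rewrite mulrC; exact: abs_rip_le.
set d := X1 Xi - z.
have Vd v : V v -> rip v d = 0 by move=> Vv; rewrite ripBr hz// subrr.
have zd : rip z d = 0.
  have h1 : rip z d <= 0 by apply: rip_cvs_le uz _ => n; rewrite Vd.
  have h2 : rip z (- d) <= 0 by apply: rip_cvs_le uz _ => n; rewrite ripNr Vd// oppr0.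
  by rewrite ripNr in h2; lra.
have Xd : rip (X1 Xi) d = 0.
  apply/eqP; rewrite -normr_eq0 eq_le normr_ge0 andbT; apply/ler_addgt0Pr => f f0; rewrite add0r.
  have k1 : 0 < nm d + nm Xi + 1 by have := nm_ge0 d; have := nm_ge0 Xi; lra.
  have f1 : 0 < f / (nm d + nm Xi + 1) by rewrite divr_gt0.
  have [y1 [y Ly e1] hy] := bicommutant_dense [:: Xi; d] sA A1 (ampl_bicommutant H sL hX) f1.
  have {}e1 : y1 = bopt (bid H) y by apply: bop_eq => v; rewrite e1.
  have h1 : nm (X1 Xi - y1 Xi) <= f / (nm d + nm Xi + 1) by apply: hy; rewrite mem_head.
  have h2 : nm (X1 d - y1 d) <= f / (nm d + nm Xi + 1) by apply: hy; rewrite !inE eqxx orbT.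
  have h3 : rip (y1 Xi) d + rip Xi (y1 d) = 0.
    have := Vd (y1 Xi + badj y1 Xi); rewrite ripDl /rip (adjPr y1) => <- //.
    exists (1 *: y + badj y).
      split; first by apply: sa_lin => //; exact: sa_adj.
      by rewrite badj_lin badjK conjc1 !scale1r addrC.
    by rewrite bopt_linr baddE scale1r e1 badj_bopt badj_id.
  have e2 : rip Xi (X1 d) = rip (X1 Xi) d by rewrite /rip (badjPr X1) sX1.
  have : 2 * rip (X1 Xi) d = rip (X1 Xi - y1 Xi) d + rip Xi (X1 d - y1 d).
    by rewrite ripBl ripBr e2; lra.
  have b1 := abs_rip_le (X1 Xi - y1 Xi) d; have b2 := abs_rip_le Xi (X1 d - y1 d).
  have c1 := ler_wpM2r (nm_ge0 d) h1; have c2 := ler_wpM2l (nm_ge0 Xi) h2.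
  have c3 : f / (nm d + nm Xi + 1) * (nm d + nm Xi + 1) = f by rewrite mulfVK// gt_eqF.
  move: b1 b2; rewrite !ler_norml => /andP[b1 b1'] /andP[b2 b2'] b3.
  by apply/andP; split; nra.
have d0 : d = 0.
  by apply: nm0_eq0; apply/eqP; rewrite -sqrf_eq0 -ripxx {1}/d ripBl Xd zd subrr.
have -> : X1 Xi = z by apply/eqP; rewrite -subr_eq0 -/d d0.
by move=> f f0; have [n hn] := uz _ f0; exists (u n) => //; rewrite nmBC; exact: hn.
Qed.

End DoubleCommutant.

(** * Normal functionals are determined on a weakly dense subalgebra *)

Section FunctionalUniqueness.
Context {R : realType} (tp : tensor_choice R).
Implicit Types H K L : hilbert R.

(* x / (1 + x^2) *)
Definition hh H (Y : bop H H) : bop H H := bcomp Y (res (bcomp Y Y)).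

Lemma psd_sq H (Y : bop H H) : badj Y = Y -> psd (bcomp Y Y).
Proof. by move=> sY; rewrite -{1}sY; exact: psd_comp_adj. Qed.

Lemma hh_comm H (Y : bop H H) : badj Y = Y ->
  bcomp Y (res (bcomp Y Y)) = bcomp (res (bcomp Y Y)) Y.
Proof. by move=> sY; apply: res_comm; [exact: psd_sq|exact: bop_eq]. Qed.

Lemma hh_sa H (Y : bop H H) : badj Y = Y -> badj (hh Y) = hh Y.
Proof.
by move=> sY; rewrite /hh badj_comp (res_psd (psd_sq sY)).1 sY -hh_comm.
Qed.

Lemma hh_nm H (Y : bop H H) x : badj Y = Y -> nm (hh Y x) <= nm x.
Proof.
move=> sY; apply: sqr_le; first exact: nm_ge0.
apply: le_trans (gg_le1 (psd_sq sY) x); apply: le_trans (gg_res_le (psd_sq sY) x).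
by rewrite -ripxx /rip !bcompE (sa_ip (Y _) _ sY).
Qed.

Lemma hh_mem H (A : set (H -> H)) (Y : bop H H) : opclosure A `<=` A -> star_alg A ->
  badj Y = Y -> A Y -> A (hh Y).
Proof.
move=> cA sA sY AY.
have -> : hh Y = Y - bcomp Y (gg (bcomp Y Y)).
  apply: bop_eq => x; rewrite bsubE !bcompE -bopB; congr (Y _).
  by have := ggE (psd_sq sY) x; rewrite !bcompE => ->; rewrite subKr.
apply: sa_sub => //; apply: sa_comp => //; apply: gg_mem => //; first exact: psd_sq.
exact: sa_comp.
Qed.

(** Kaplansky's identity: hh Y - hh X = (1 + Y^2)^-1 (Y - X) u + hh Y (X - Y) X u, applied with u =
    (1 + X^2)^-1 v. Only X - Y at vectors independent of Y occurs, so the transform is strongly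
    continuous on self-adjoint operators without a norm bound on Y. *)
Lemma hh_diff H (X Y : bop H H) v : badj X = X -> badj Y = Y ->
  nm (hh Y v - hh X v) <= nm (X (res (bcomp X X) v) - Y (res (bcomp X X) v)) +
    nm (X (X (res (bcomp X X) v)) - Y (X (res (bcomp X X) v))).
Proof.
move=> sX sY; set u := res (bcomp X X) v.
have vE : v = u + X (X u) by rewrite -{1}(resE (psd_sq sX) v).
set r := res (bcomp Y Y).
have -> : hh Y v - hh X v = r (Y u - X u) + hh Y (X (X u) - Y (X u)).
  have rY x : hh Y x = r (Y x) by rewrite /hh hh_comm.
  have e : r (X u + Y (Y (X u))) = X u by exact: (resEr (psd_sq sY) (X u)).
  have eL : hh X v = r (X u + Y (Y (X u))) by rewrite e.
  have eY : Y v = Y u + Y (X (X u)) by rewrite {1}vE bopD.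
  rewrite !rY eL eY -(bopB r) -(bopD r); congr (r _).
  by rewrite bopB opprD addrACA.
apply: le_trans (nmD _ _) _; apply: lerD.
  by apply: le_trans (res_le (psd_sq sY) _) _; rewrite nmBC.
exact: hh_nm.
Qed.

Lemma sa_decomp H (x : bop H H) : exists a b : bop H H,
  [/\ badj a = a, badj b = b, x = 'i *: b + a,
    forall c, 0 <= c -> (forall v, nm (x v) <= c * nm v) ->
      (forall v, nm (a v) <= c * nm v) /\ (forall v, nm (b v) <= c * nm v) &
    (forall L : set (H -> H), star_alg L -> L x -> L a) /\
    (forall L : set (H -> H), star_alg L -> L x -> L b)].
Proof.
pose a := (2^-1)%:C *: (x + badj x).
pose b := (2^-1)%:C *: ((- 'i) *: x + 'i *: badj x).
have sa : badj a = a.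
  by rewrite badj_scaler; have := badj_lin 1 x (badj x); rewrite badjK conjc1 !scale1r => ->; rewrite addrC.
have ci : ('i : R[i])^*%C = - 'i by rewrite -[RHS]/(Complex (- 0) (- 1)) oppr0.
have sb : badj b = b.
  rewrite badj_scaler badj_lin; congr (_ *: _).
  have -> : badj ('i *: badj x) = (- 'i) *: x.
    have := badj_lin 'i (badj x) 0; rewrite badjK (psd_0 H).1 !addr0 => ->.
    by rewrite ci.
  rewrite addrC; congr (_ + _ *: _).
  by rewrite -ci conjcK.
have xE : x = 'i *: b + a.
  rewrite /b /a scalerA mulrC -scalerA -scalerDr.
  have -> : 'i *: ((- 'i) *: x + 'i *: badj x) = x - badj x.
    by rewrite scalerDr !scalerA mulrN -expr2 sqr_i opprK scale1r scaleN1r.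
  rewrite addrACA addNr addr0 scalerDr -scalerDl -rmorphD /=.
  have -> : 2^-1 + 2^-1 = 1 :> R by lra.
  by rewrite scale1r.
exists a, b; split => //; last first.
  split => L sL Lx; have Lax : L (badj x) by exact: sa_adj.
    by apply: sa_scale => //; exact: sa_add.
  by apply: sa_scale => //; apply: sa_add => //; exact: sa_scale.
move=> c c0 hc; have hc' := adj_bound c0 hc.
have half (u v : H) d : nm u <= d -> nm v <= d -> nm ((2^-1)%:C *: (u + v)) <= d.
  move=> hu hv; rewrite nmZr ger0_norm ?invr_ge0//.
  by have := nmD u v; lra.
split=> v; first by rewrite bscaleE baddE half// hc'.
have n1 : Re `|(- 'i : R[i])| = 1 by rewrite normrN normc_def /= expr0n add0r expr1n sqrtr1.
have n2 : Re `|('i : R[i])| = 1 by rewrite normc_def /= expr0n add0r expr1n sqrtr1.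
by rewrite bscaleE baddE !bscaleE half// nmZ ?n1 ?n2 mul1r ?hc'.
Qed.

Lemma nf_bound_sa H (L : set (H -> H)) (w : (H -> H) -> R[i]) (x : bop H H) c :
  vn_alg L -> normal_functional L w -> L x -> badj x = x -> 0 <= c ->
  (forall v, nm (x v) <= c * nm v) -> `|Re (w x)| <= c * Re (w (bid H)).
Proof.
move=> hL hw Lx sx c0 hc; have sL := hL.1; have Lid := vn_id hL.
have q (x' : bop H H) : L x' -> badj x' = x' -> (forall v, nm (x' v) <= c * nm v) ->
    Re (w x') <= c * Re (w (bid H)).
  move=> Lx' sx' hc'; have : w x' <= w (c%:C *: bid H).
    apply: (nf_le hL hw) => //; first exact: sa_scale.
    apply: psd_sub => //; first by rewrite badj_scaler badj_id.
    move=> v; rewrite bscaleE ripZl ripxx; apply: le_trans (rip_le _ _) _.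
    by rewrite expr2 mulrA; apply: ler_wpM2r; rewrite ?nm_ge0.
  by rewrite (nf_scale hL hw)// lecE Re_mulr => /andP[].
rewrite ler_norml q// andbT lerNl.
have := q ((-1)%:C *: x); rewrite (nf_scale hL hw)// Re_mulr mulN1r; apply.
- exact: sa_scale.
- by rewrite badj_scaler sx.
- by move=> v; rewrite bscaleE nmZr normrN1 mul1r.
Qed.

Lemma nf_bound H (L : set (H -> H)) (w : (H -> H) -> R[i]) (x : bop H H) c :
  vn_alg L -> normal_functional L w -> L x -> 0 <= c ->
  (forall v, nm (x v) <= c * nm v) -> Re `|w x| <= 2 * c * Re (w (bid H)).
Proof.
move=> hL hw Lx c0 hc; have sL := hL.1.
have [a [b [sa sb xE /(_ c c0 hc)[ha hb] [/(_ L sL Lx) La /(_ L sL Lx) Lb]]]] := sa_decomp x.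
have h1 := nf_bound_sa hL hw La sa c0 ha; have h2 := nf_bound_sa hL hw Lb sb c0 hb.
have e : `|w x| = (Re `|'i * w b + w a|)%:C by rewrite xE (nf_lin hw)// RRe_real// normr_real.
rewrite -lecR RRe_real ?normr_real// xE (nf_lin hw)//.
apply: le_trans (ler_normD _ _) _; rewrite normrM.
have -> : `|'i : R[i]| = 1 by rewrite normc_def /= expr0n add0r expr1n sqrtr1.
have re (z : R[i]) : Im z = 0 -> `|z| = `|Re z|%:C.
  by case: z => p q /= ->; rewrite normc_def /= expr0n addr0 sqrtr_sqr.
rewrite mul1r !re ?(nf_real hL hw)// -rmorphD lecR; lra.
Qed.

(** The projections on the spans of commutant orbits of sequences form a directed set with supremum
    1. Normality provides sequences carrying w up to 1 / (n + 1), and one sequence enumerating all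
    of them carries w entirely; so does every larger one. *)
Lemma nf_support H (L : set (H -> H)) w : vn_alg L -> normal_functional L w ->
  exists (S : nat -> H), forall (S' : nat -> H) (P : bop H H),
    (forall n, exists m, S n = S' m) ->
    is_proj [set z | exists (T : bop H H) n, commutant L T /\ z = T (S' n)] P ->
    L P /\ Re (w (bid H - P)) <= 0.
Proof.
move=> hL hw; have sL := hL.1.
pose rg (S : nat -> H) := [set z | exists (T : bop H H) n, commutant L T /\ z = T (S n)].
have mem S (P : bop H H) : is_proj (rg S) P -> L P.
  move=> hP; apply: (vn_of_comm hL) => T hT v; have [_ _ PS _] := hP.
  apply: (proj_commute hP) => _ [U [n [hU ->]]]; apply: PS.
    by exists (bcomp T U), n; split => //; exact: commutant_comp.
  exists (bcomp (badj T) U), n; split => //; apply: commutant_comp => //.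
  exact: commutant_adj.
have mono S S' (P P' : bop H H) : (forall n, exists m, S n = S' m) ->
    is_proj (rg S) P -> is_proj (rg S') P' -> ble P P'.
  move=> h hP hP' x; have [sP PP PS _] := hP; have [sP' PP' PS' _] := hP'.
  have e y : P' (P y) = P y.
    apply/esym/eqP; rewrite -subr_eq0; apply/eqP; apply: (proj_kill (U := bid H - P') hP).
    move=> _ [T [n [hT ->]]]; have [m em] := h n.
    by rewrite bsubE /= PS' ?subrr//; exists T, m; rewrite em.
  have e2 : P x = P (P' x).
    by apply: ip_eqP => y; rewrite !(sa_ip _ _ sP) (sa_ip _ _ sP') e.
  rewrite (proj_rip hP) (proj_rip hP') e2 ler_sqr ?nnegrE ?nm_ge0//.
  exact: proj_nm hP _.
pose D : set (H -> H) := [set p | exists S P, is_proj (rg S) P /\ p = bfun P].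
have id1 : commutant L (bid H) by apply/commutantP.
have hD : directed_sup L D (bid H).
  split.
  - move=> _ [S [P [hP ->]]]; split; first exact: (mem S).
    by apply/psdP; exact: (proj_psd hP).
  - by have [P hP] := span_proj (rg (fun=> 0)); exists (bfun P), (fun=> 0), P.
  - move=> _ _ [S [P [hP ->]]] [S' [P' [hP' ->]]].
    pose S2 n := if odd n then S n./2 else S' n./2.
    have [P2 hP2] := span_proj (rg S2); exists (bfun P2); split; first by exists S2, P2.
      apply/opleP; [exact: (proj_psd hP).1|exact: (proj_psd hP2).1|].
      by apply: mono hP hP2 => n; exists n.*2.+1; rewrite /S2 /= odd_double uphalf_double.
    apply/opleP; [exact: (proj_psd hP').1|exact: (proj_psd hP2).1|].
    by apply: mono hP' hP2 => n; exists n.*2; rewrite /S2 odd_double doubleK.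
  - exact: bopP.
  - move=> _ [S [P [hP ->]]]; apply/opleP; [exact: (proj_psd hP).1|exact: badj_id|].
    move=> x; rewrite (proj_rip hP) /= ripxx ler_sqr ?nnegrE ?nm_ge0//; exact: (proj_nm hP).
  - move=> t bt ht; have [t' e] := bop_of bt; rewrite {}e in ht *.
    have [P0 hP0] := span_proj (rg (fun=> 0)).
    have D0 : D P0 by exists (fun=> 0), P0.
    have [st _] := ople_sa (proj_psd hP0).1 (ht _ D0).
    apply/opleP => //; first exact: badj_id.
    move=> v; have [P hP] := span_proj (rg (fun=> v)).
    have Pv : P v = v by have [_ _ PS _] := hP; apply: PS; exists (bid H), 0%N.
    have DP : D P by exists (fun=> v), P.
    by have /(opleP (proj_psd hP).1 st)/(_ v) := ht _ DP; rewrite Pv.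
have /choice[S_ hS_] : forall n : nat, exists S, exists P : bop H H, is_proj (rg S) P /\
    Re (w (bid H)) - Re (w P) <= n.+1%:R^-1.
  move=> n; have n0 : (0 : R) < n.+1%:R^-1 by rewrite invr_gt0 ltr0Sn.
  have [x [S [P [hP ex]]] h] := nf_sup hL hw hD n0.
  by exists S, P; rewrite -ex.
(* Runs through all the sequences by the enumeration of pairs; the default fills the numbers that
   code no pair. *)
pose S n := let p := odflt (0%N, 0%N) (unpickle n) in S_ p.1 p.2.
exists S => S' P hS' hP; have LP := mem _ _ hP; split => //.
apply/ler_addgt0Pr => e e0; rewrite add0r.
have [n0 hn] := inv_small e0; have [Pn [hPn h]] := hS_ n0.
apply: le_trans (hn _ (leqnn _)); apply: le_trans h.
rewrite (nf_sub hw)//; last exact: vn_id.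
rewrite raddfB /= lerD2l lerN2.
have : w Pn <= w P.
  apply: (nf_le hL hw) => //; first exact: mem hPn.
  apply: psd_sub; [exact: (proj_psd hPn).1|exact: (proj_psd hP).1|].
  apply: mono hPn hP => n; have [m em] := hS' (pickle (n0, n)).
  by exists m; rewrite -em /S pickleK.
by rewrite lecE => /andP[].
Qed.

(** Normality speaks of suprema only, so strong density has to be converted into convergence of
    values. Self-adjoint Y n in L0 approximate X at a geometric rate on a countable family carrying
    both functionals; the bounded differences hh (Y n) - hh X then become small under r and s by
    [nf_small] and Cauchy-Schwarz. Hence r and s agree on hh X, and X is the norm limit of hh (t X)
    / t as t tends to 0. *)
Lemma functional_uniq H (L0 L : set (H -> H)) (r s : (H -> H) -> R[i]) :
  opclosure L0 `<=` L0 -> star_alg L0 -> L0 (bid H) -> L = commutant (commutant L0) ->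
  vn_alg L -> L0 `<=` L -> normal_functional L r -> normal_functional L s ->
  (forall x : bop H H, L0 x -> r x = s x) -> forall x : bop H H, L x -> r x = s x.
Proof.
move=> cL0 sL0 L01 LE hL sub hr hs rs; have sL := hL.1.
have bic (X : bop H H) : L X -> commutant (commutant L0) X by rewrite LE.
clear LE.
have Lid := vn_id hL.
have [Sr hSr] := nf_support hL hr; have [Ss hSs] := nf_support hL hs.
pose S n := if odd n then Sr n./2 else Ss n./2.
have [P hP] := span_proj [set z | exists (T : bop H H) n, commutant L T /\ z = T (S n)].
have [|LP rP] := hSr S P _ hP.
  by move=> n; exists n.*2.+1; rewrite /S /= odd_double uphalf_double.
have [|_ sP] := hSs S P _ hP.
  by move=> n; exists n.*2; rewrite /S odd_double doubleK.
have hhE (X : bop H H) : L X -> badj X = X -> Re (r (hh X)) = Re (s (hh X)).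
  move=> LX sX; set u := res (bcomp X X).
  have hX := bic X LX.
  have pos n : 0 < 2^-1 ^+ n / 2 :> R by rewrite divr_gt0// exprn_gt0// invr_gt0.
  have /choice[Y hY] : forall n : nat, exists y : bop H H, [/\ L0 y, badj y = y &
      forall v, v \in [seq u (S k) | k <- iota 0 n.+1] ++ [seq X (u (S k)) | k <- iota 0 n.+1] ->
        nm (X v - y v) <= 2^-1 ^+ n / 2].
    by move=> n; exact: (bicommutant_dense_sa tp _ sL0 L01 hX sX (pos n)).
  pose z n := hh (Y n) - hh X.
  have sY n : badj (Y n) = Y n by have [] := hY n.
  have LhX : L (hh X) by apply: hh_mem => //; exact: vn_closed.
  have L0Y n : L0 (hh (Y n)) by apply: hh_mem => //; have [] := hY n.
  have Lz n : L (z n) by apply: sa_sub => //; exact: sub.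
  have sz n : badj (z n) = z n by rewrite badj_sub !hh_sa.
  have zS n k : (k <= n)%N -> nm (z n (S k)) <= 2^-1 ^+ n.
    move=> kn; rewrite bsubE; apply: le_trans (hh_diff _ sX (sY n)) _.
    have -> : 2^-1 ^+ n = 2^-1 ^+ n / 2 + 2^-1 ^+ n / 2 :> R by lra.
    have [_ _ h] := hY n; apply: lerD; apply: h; rewrite mem_cat; apply/orP; [left|right].
      by apply/mapP; exists k => //; rewrite mem_iota add0n ltnS.
    by apply/mapP; exists k => //; rewrite mem_iota add0n ltnS.
  have zn n x : nm (z n x) <= 2 * nm x.
    rewrite bsubE; apply: le_trans (nmB _ _) _.
    by have := hh_nm x (sY n); have := hh_nm x sX; lra.
  (* The factor 1/4 brings the square below 1, since |z n v| <= 2 |v|. *)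
  pose y n := (4^-1)%:C *: bcomp (z n) (z n).
  have yq n x : rip (y n x) x = 4^-1 * nm (z n x) ^+ 2.
    by rewrite bscaleE ripZl bcompE /rip (sa_ip _ _ (sz n)) ipxx.
  have small (w : (H -> H) -> R[i]) : normal_functional L w -> Re (w (bid H - P)) <= 0 ->
      forall e, 0 < e -> exists n0, forall n, (n0 <= n)%N -> `|Re (w (z n))| <= e.
    move=> hw wP e e0; set w1 := Re (w (bid H)).
    have w10 : 0 <= w1.
      have := nf_psd hw Lid; rewrite lecE => /(_ _)/andP[]//.
      by split => [|v]; [exact: badj_id|rewrite ripxx sqr_ge0].
    have k1 : 0 < 4 * (w1 + 1) by lra.
    have e1 : 0 < e ^+ 2 / (4 * (w1 + 1)) by rewrite divr_gt0 ?exprn_gt0.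
    have Lzz n : L (bcomp (z n) (z n)) by exact: sa_comp.
    have [||||n0 hn] := @nf_small R H L w hL hw S P y LP hP wP _ _ _ _ _ e1.
    - by move=> n; exact: sa_scale.
    - by move=> n; apply: psd_scale; [rewrite invr_ge0|exact: psd_sq].
    - by move=> n x; rewrite yq; have := zn n x; have := nm_ge0 (z n x); have := nm_ge0 x; nra.
    - move=> n k kn; rewrite yq; have := zS n k kn; have := nm_ge0 (z n (S k)).
      have h1 : 2^-1 ^+ n <= 1 :> R by rewrite exprn_ile1 ?invr_ge0//; lra.
      have h0 : 0 <= 2^-1 ^+ n :> R by rewrite exprn_ge0 ?invr_ge0.
      nra.
    exists n0 => n hn0; apply: sqr_norm_le; first exact: ltW.
    apply: le_trans (nf_cs hL hw (Lz n) (sz n)) _.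
    have := hn n hn0; rewrite /y (nf_scale hL hw)// Re_mulr -/w1.
    rewrite ler_pdivlMr// => h.
    have pz : 0 <= Re (w (bcomp (z n) (z n))).
      by have := nf_psd hw (Lzz n) (psd_sq (sz n)); rewrite lecE => /andP[].
    nra.
  apply/eqP; rewrite -subr_eq0 -normr_eq0 eq_le normr_ge0 andbT.
  apply/ler_addgt0Pr => e e0; rewrite add0r; have e2 : 0 < e / 2 by lra.
  have [n0 h0] := small r hr rP _ e2; have [n1 h1] := small s hs sP _ e2.
  have {}h0 := h0 _ (leq_maxl n0 n1); have {}h1 := h1 _ (leq_maxr n0 n1).
  move: h0 h1; rewrite /z (nf_sub hr) ?(nf_sub hs)//; try exact: sub.
  rewrite rs// !raddfB /= => h0 h1; set a := Re (s (hh (Y _))) in h0 h1.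
  have -> : Re (r (hh X)) - Re (s (hh X)) = (a - Re (s (hh X))) - (a - Re (r (hh X))) by ring.
  by apply: le_trans (ler_normB _ _) _; lra.
have saE (X : bop H H) : L X -> badj X = X -> r X = s X.
  move=> LX sX; suff e : Re (r X) = Re (s X).
    have := nf_real hL hr LX sX; have := nf_real hL hs LX sX; move: e.
    by case: (r X) => a b; case: (s X) => c d /= -> -> ->.
  have [k k0 hk] := bop_bound X.
  set C := k * k ^+ 2 * (Re (r (bid H)) + Re (s (bid H))).
  have key t : 0 < t -> `|Re (r X) - Re (s X)| <= t ^+ 2 * C.
    (* The difference X - hh (t X) / t is X composed with the transform of (t X)^2, of norm at most
       t^2 k^3. *)
    move=> t0; pose Z := t%:C *: X; pose g := (t^-1)%:C *: hh Z.
    have sZ : badj Z = Z by rewrite badj_scaler sX.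
    have LZ : L Z by exact: sa_scale.
    have LhZ : L (hh Z) by apply: hh_mem => //; exact: vn_closed.
    have Lg : L g by exact: sa_scale.
    have sg : badj g = g by rewrite badj_scaler hh_sa.
    have gE : Re (r g) = Re (s g).
      by rewrite (nf_scale hL hr)// (nf_scale hL hs)// !Re_mulr hhE.
    have d v : nm ((X - g) v) <= t ^+ 2 * (k * k ^+ 2) * nm v.
      have -> : (X - g) v = X (gg (bcomp Z Z) v).
        rewrite bsubE bscaleE (ggE (psd_sq sZ)) bopB; congr (_ - _).
        rewrite bcompE /Z bscaleE scalerA -rmorphM mulVf ?gt_eqF//.
        by rewrite scale1r.
      apply: le_trans (hk _) _.
      have -> : t ^+ 2 * (k * k ^+ 2) * nm v = k * (t ^+ 2 * k ^+ 2 * nm v) by ring.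
      apply: ler_wpM2l => //.
      rewrite !bcompE /Z !bscaleE bopZ scalerA -rmorphM nmZr ger0_norm; last by rewrite mulr_ge0 ?ltW.
      have -> : t ^+ 2 * k ^+ 2 * nm v = t * t * (k * (k * nm v)) by ring.
      apply: ler_wpM2l; first by rewrite mulr_ge0 ?ltW.
      apply: le_trans (hk _) _; apply: ler_wpM2l => //; apply: le_trans (hk _) _.
      apply: ler_wpM2l => //; exact: (res_le (psd_sq sZ)).
    have sd : badj (X - g) = X - g by rewrite badj_sub sX sg.
    have Ld : L (X - g) by exact: sa_sub.
    have c0 : 0 <= t ^+ 2 * (k * k ^+ 2) by apply: mulr_ge0; [exact: sqr_ge0|apply: mulr_ge0 => //; exact: sqr_ge0].
    have b1 := nf_bound_sa hL hr Ld sd c0 d; have b2 := nf_bound_sa hL hs Ld sd c0 d.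
    move: b1 b2; rewrite (nf_sub hr)// (nf_sub hs)// !raddfB /= gE => b1 b2.
    have -> : Re (r X) - Re (s X) = (Re (r X) - Re (s g)) - (Re (s X) - Re (s g)) by ring.
    apply: le_trans (ler_normB _ _) _; rewrite /C; lra.
  apply/eqP; rewrite -subr_eq0 -normr_eq0 eq_le normr_ge0 andbT.
  apply/ler_addgt0Pr => e e0; rewrite add0r.
  have C0 : 0 <= C by have := key 1 ltr01; rewrite expr1n mul1r; apply: le_trans.
  have C1 : 0 < C + 1 by lra.
  have e1 : 0 < e / (C + 1) by rewrite divr_gt0.
  apply: le_trans (key (Num.sqrt (e / (C + 1))) _) _; first by rewrite sqrtr_gt0.
  rewrite sqr_sqrtr; last exact: ltW.
  by rewrite mulrAC ler_pdivrMr// mulrDr mulr1 lerDl ltW.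
move=> x Lx; have [a [b [sa sb xE _ [La Lb]]]] := sa_decomp x.
have {}La := La _ sL Lx; have {}Lb := Lb _ sL Lx.
by rewrite xE (nf_lin hr)// (nf_lin hs)// !saE.
Qed.

End FunctionalUniqueness.

(** * Minimal and von Neumann tensor products of operator algebras *)

Section TensorAlgebras.
Context {R : realType} (tp : tensor_choice R).
Implicit Types H K L E : hilbert R.
Local Notation "h @ox k" := (tens (tp _ _) h k) (at level 40).

Lemma commutantS H (A B : set (H -> H)) : A `<=` B -> commutant B `<=` commutant A.
Proof. by move=> AB T [bT h]; split => // S /AB; exact: h. Qed.

Lemma sub_bicommutant H (A : set (H -> H)) : (forall x, A x -> bounded_op x) ->
  A `<=` commutant (commutant A).
Proof. by move=> bA x Ax; split => [|S [_ h]]; [exact: bA|rewrite h]. Qed.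

Lemma commutant3 H (A : set (H -> H)) : (forall x, A x -> bounded_op x) ->
  commutant (commutant (commutant A)) = commutant A.
Proof.
move=> bA; apply/seteqP; split; last by apply: sub_bicommutant => x [].
exact/commutantS/sub_bicommutant.
Qed.

Lemma commutant_star H (A : set (H -> H)) :
  (forall x, A x -> exists2 x' : bop H H, x = x' & A (badj x')) -> star_alg (commutant A).
Proof.
move=> hA.
have cl (T : bop H H) : (forall x : bop H H, A x -> forall v, T (x v) = x (T v)) ->
    commutant A T.
  by move=> h; apply/commutantP => x Ax; have [x' e _] := hA _ Ax; rewrite {}e in Ax *; exact: h.
split.
- by move=> x [].
- by apply: (cl (0 : bop H H)) => x _ v; rewrite !b0E bop0.
- move=> c x y /commutant_bop[x' -> hx] /commutant_bop[y' -> hy].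
  apply: (cl (c *: x' + y')) => z Az v; rewrite !baddE !bscaleE bopZD.
  by rewrite ((commutantP _ _).1 hx _ Az) ((commutantP _ _).1 hy _ Az).
- move=> x y /commutant_bop[x' -> hx] /commutant_bop[y' -> hy].
  exact: commutant_comp.
- move=> x /commutant_bop[x' -> hx]; apply: (cl (badj x')) => z Az v.
  have [z' e Az'] := hA _ Az; have {e} : z = z' by exact: bop_eq (fun x => congr1 (@^~ x) e).
  move=> zz'; rewrite -{}zz' in Az'; apply: ip_eqP => y.
  by rewrite -(badjPr x') !(badjP z) -(badjPr x') ((commutantP _ _).1 hx _ Az').
Qed.

Lemma bicommutant_vn H (A : set (H -> H)) :
  (forall x, A x -> exists2 x' : bop H H, x = x' & A (badj x')) ->
  vn_alg (commutant (commutant A)).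
Proof.
move=> hA; have s1 := commutant_star hA; split; last first.
  by apply: commutant3 => x [].
apply: commutant_star => x hx; have [x' e _] := commutant_bop hx.
by exists x' => //; rewrite e in hx; exact: sa_adj hx.
Qed.

Definition elem H K (M : set (H -> H)) (N : set (K -> K)) : set (tp H K -> tp H K) :=
  [set optens x y | x in M & y in N].

Section Elem.
Variables (H K : hilbert R) (M : set (H -> H)) (N : set (K -> K)).
Hypotheses (sM : star_alg M) (sN : star_alg N).

Lemma elemP z : elem M N z -> exists (x : bop H H) (y : bop K K),
  [/\ M x, N y & z = bopt (tp := tp) x y].
Proof.
move=> [x Mx [y Ny <-]]; have [x' Mx' ->] := sa_bop sM Mx.
by have [y' Ny' ->] := sa_bop sN Ny; exists x', y'.
Qed.

Lemma elem_bopt (x : bop H H) (y : bop K K) : M x -> N y -> elem M N (bopt x y).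
Proof. by move=> Mx Ny; exists x => //; exists y. Qed.

Lemma elem_adj z : elem M N z ->
  exists2 z' : bop (tp H K) (tp H K), z = z' & elem M N (badj z').
Proof.
move=> /elemP[x [y [Mx Ny ->]]]; exists (bopt x y) => //.
by rewrite badj_bopt; apply: elem_bopt; exact: sa_adj.
Qed.

Lemma vnt_vn : vn_alg (vn_tensor (tp := tp) M N).
Proof. exact: bicommutant_vn elem_adj. Qed.

Lemma vnt_elem : elem M N `<=` vn_tensor (tp := tp) M N.
Proof. by apply: sub_bicommutant => z /elem_adj[z' -> _]; exact: bopP. Qed.

Lemma vnt_bopt (x : bop H H) (y : bop K K) : M x -> N y ->
  vn_tensor M N (bopt (tp := tp) x y).
Proof. by move=> Mx Ny; apply: vnt_elem; exact: elem_bopt. Qed.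

Lemma vnt_comm (X S : bop (tp H K) (tp H K)) : vn_tensor M N X ->
  (forall (x : bop H H) (y : bop K K), M x -> N y ->
    bcomp S (bopt x y) = bcomp (bopt x y) S) -> bcomp X S = bcomp S X.
Proof.
move=> [_ hX] hS; apply: bop_eq => z; suff h : commutant (elem M N) S by have /(congr1 (@^~ z)) := hX _ h.
apply/commutantP => _ /elemP[x [y [Mx Ny ->]]] v.
by rewrite -bcompE hS.
Qed.

Lemma vnt_comml (X : bop (tp H K) (tp H K)) (T : bop H H) : vn_tensor M N X ->
  commutant M T -> bcomp X (bopt T (bid K)) = bcomp (bopt T (bid K)) X.
Proof.
move=> hX hT; apply: vnt_comm => // x y Mx Ny; apply: tens_ext => h k.
by rewrite !bcompE !boptE /= ((commutantP _ _).1 hT _ Mx).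
Qed.

Lemma vnt_commr (X : bop (tp H K) (tp H K)) (T : bop K K) : vn_tensor M N X ->
  commutant N T -> bcomp X (bopt (bid H) T) = bcomp (bopt (bid H) T) X.
Proof.
move=> hX hT; apply: vnt_comm => // x y Mx Ny; apply: tens_ext => h k.
by rewrite !bcompE !boptE /= ((commutantP _ _).1 hT _ Ny).
Qed.

Lemma lspan_bop z : lspan (elem M N) z -> bounded_op z.
Proof.
apply: lspan_ind; first exact: bounded_0.
- by move=> c u v /bop_of[u' ->] /bop_of[v' ->]; exact: bopP (c *: u' + v').
- by move=> u /elem_adj[u' -> _]; exact: bopP.
Qed.

Lemma lspan_elem_star : star_alg (lspan (elem M N)).
Proof.
have [l0 ll] := lspan_csub (elem M N).
split => //.
- by move=> z; exact: lspan_bop.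
- move=> x y hx hy; move: x hx; apply: lspan_ind => //.
  + move=> c u v hu hv; exact: (ll c (u \o y) (v \o y) hu hv).
  + move=> u hu; move: y hy; apply: lspan_ind.
    * have [u' -> _] := elem_adj hu; have := l0; congr (lspan _ _).
      by apply/funext => z; exact: esym (bop0 u').
    * move=> c v w hv hw; have [u' e _] := elem_adj hu; rewrite e in hv hw *.
      have := ll c (bfun u' \o v) (bfun u' \o w) hv hw; congr (lspan _ _).
      by apply/funext => z; exact: esym (bopZD u' c (v z) (w z)).
    * move=> v hv; have [x [y [Mx Ny ->]]] := elemP hu; have [x' [y' [Mx' Ny' ->]]] := elemP hv.
      have -> : bfun (bopt (tp := tp) x y) \o bopt (tp := tp) x' y' = bcomp (bopt x y) (bopt x' y') by [].
      by rewrite bopt_comp; apply: lspan_sub; apply: elem_bopt; exact: sa_comp.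
- move=> x hx; suff : exists2 x' : bop (tp H K) (tp H K), x = x' & lspan (elem M N) (badj x').
    by move=> [x' -> //].
  move: x hx; apply: lspan_ind.
  + by exists 0 => //; rewrite (psd_0 _).1.
  + move=> c _ _ [u -> hu] [v -> hv]; exists (c *: u + v) => //.
    by rewrite badj_lin; exact: (ll _ (badj u) (badj v)).
  + by move=> u /elem_adj[u' e h]; exists u' => //; exact: lspan_sub.
Qed.

Lemma min_tensor_star : star_alg (min_tensor (tp := tp) M N).
Proof. exact/opclosure_star/lspan_elem_star. Qed.

Lemma min_tensor_closed : opclosure (min_tensor M N) `<=` min_tensor (tp := tp) M N.
Proof. by apply: opclosure_closed => z; exact: lspan_bop. Qed.

Lemma elem_min_tensor : elem M N `<=` min_tensor (tp := tp) M N.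
Proof. by move=> z hz; apply: opclosure_sub; [exact: lspan_sub|have [z' -> _] := elem_adj hz; exact: bopP]. Qed.

End Elem.

(** [functional_uniq] asks for a norm closed subalgebra, so agreement is first carried from the span
    of elementary tensors to the minimal tensor product by the norm bound [nf_bound]. *)
Lemma vnt_functional_uniq H K (M : set (H -> H)) (N : set (K -> K)) r s :
  vn_alg M -> vn_alg N -> normal_functional (vn_tensor M N) r ->
  normal_functional (vn_tensor M N) s ->
  (forall (x : bop H H) (y : bop K K), M x -> N y -> r (bopt (tp := tp) x y) = s (bopt (tp := tp) x y)) ->
  forall X : bop (tp H K) (tp H K), vn_tensor M N X -> r X = s X.
Proof.
move=> hM hN hr hs rs; have [sM _] := hM; have [sN _] := hN.
have hV := vnt_vn sM sN; have [sV _] := hV.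
have sub1 : lspan (elem M N) `<=` vn_tensor (tp := tp) M N.
  apply: lspan_ind; [exact: star_alg_0 sV|exact: star_alg_lin sV|exact: vnt_elem].
have sub : min_tensor M N `<=` vn_tensor (tp := tp) M N.
  move=> z [bz hz]; apply: (vn_closed hV); split => // e /hz[y hy ?]; exists y => //; exact: sub1.
have bE x : elem M N x -> bounded_op x by move=> /(elem_adj sM sN)[x' -> _]; exact: bopP.
apply: (functional_uniq tp (min_tensor_closed sM sN) (min_tensor_star sM sN)) => //.
- by rewrite -bopt_id; apply: (elem_min_tensor sM sN); apply: elem_bopt; exact: vn_id.
- congr commutant; apply/seteqP; split; last exact/commutantS/(elem_min_tensor sM sN).
  by rewrite -(commutant3 bE); exact: commutantS.
have e1 (X : bop (tp H K) (tp H K)) : lspan (elem M N) X -> r X = s X.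
  suff h : lspan (elem M N) `<=` [set z | vn_tensor M N z /\ r z = s z] by move=> /h[].
  apply: lspan_ind.
  - by split; [exact: star_alg_0 sV|rewrite (nf_0 hV hr) (nf_0 hV hs)].
  - move=> c u v [hu eu] [hv ev]; split; first exact: star_alg_lin sV _ _ _ hu hv.
    by rewrite (normal_functional_lin hr)// (normal_functional_lin hs)// eu ev.
  - move=> u hu; split; first exact: vnt_elem.
    by have [x [y [Mx Ny ->]]] := elemP sM sN hu; exact: rs.
move=> X hX; have VX := sub _ hX; apply/eqP; rewrite -subr_eq0; apply/eqP.
apply: Re_norm_eq0; apply/eqP; rewrite eq_le Re_norm_ge0 andbT.
apply/ler_addgt0Pr => e e0; rewrite add0r.
set C := 2 * Re (r (bid _)) + 2 * Re (s (bid _)).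
have Vid := vn_id hV.
have C0 : 0 <= C.
  have p : psd (bid (tp H K)) by split => [|v]; [exact: badj_id|rewrite ripxx sqr_ge0].
  have := nf_psd hr Vid p; have := nf_psd hs Vid p; rewrite !lecE => /andP[_ h1] /andP[_ h2].
  by rewrite /C; move: h1 h2 => /=; lra.
have C1 : 0 < C + 1 by lra.
have d0 : 0 < e / (C + 1) by rewrite divr_gt0.
have [Y hY hXY] := (opclosureP X (@lspan_bop H K M N sM sN)).1 hX _ d0.
have VY := sub1 _ hY; have Vd : vn_tensor M N (X - Y) by exact: sa_sub.
have hd v : nm ((X - Y) v) <= e / (C + 1) * nm v by exact: hXY.
have b1 := nf_bound hV hr Vd (ltW d0) hd; have b2 := nf_bound hV hs Vd (ltW d0) hd.
move: b1 b2; rewrite (nf_sub hr)// (nf_sub hs)// (e1 _ hY) => b1 b2.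
have -> : r X - s X = (r X - s Y) - (s X - s Y) by ring.
have tri (a b : R[i]) : Re `|a - b| <= Re `|a| + Re `|b|.
  have : `|a - b| <= `|a| + `|b| by exact: ler_normB.
  by rewrite lecE => /andP[_]; rewrite raddfD.
apply: le_trans (tri _ _) _.
have eE : (e / (C + 1)) * (C + 1) = e by rewrite divfK// gt_eqF.
move: b1 b2 eE d0; set d := e / (C + 1); rewrite /C => b1 b2 eE d0; nra.
Qed.

End TensorAlgebras.

(** * Normal homomorphisms on tensor products and their slices *)

Section NormalHomomorphisms.
Context {R : realType} (tp : tensor_choice R).
Implicit Types H K L E : hilbert R.
Local Notation "h @ox k" := (tens (tp _ _) h k) (at level 40).

Lemma polar H (q : H -> H -> R[i]) :
  (forall c a b d, q (c *: a + b) d = c * q a d + q b d) ->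
  (forall c a b d, q d (c *: a + b) = c^*%C * q d a + q d b) ->
  (forall a, q a a = 0) -> forall a b, q a b = 0.
Proof.
move=> ql qr q0 a b.
have q1 c : c * q a b + c^*%C * q b a = 0.
  have := q0 (c *: a + b); rewrite ql !qr !q0 mulr0 add0r addr0 => <-; ring.
have := q1 1; have := q1 'i; rewrite conjc1 !mul1r.
have -> : ('i : R[i])^*%C = - 'i by rewrite -[RHS]/(Complex (- 0) (- 1)) oppr0.
have i0 : ('i : R[i]) == 0 = false by rewrite eq_complex /= oner_eq0 andbF.
rewrite mulNr -mulrBr => /eqP; rewrite mulf_eq0 i0 /= subr_eq0 => /eqP <- /eqP.
by rewrite -mulr2n mulrn_eq0 /= => /eqP.
Qed.

Lemma bounded_star H : star_alg (@bounded_op R H H).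
Proof.
split=> //; first exact: bounded_0.
- by move=> c x y /bop_of[x' ->] /bop_of[y' ->]; exact: bopP (c *: x' + y').
- by move=> x y /bop_of[x' ->] /bop_of[y' ->]; exact: bounded_comp.
- by move=> x /bop_of[x' ->]; exact: bounded_adj.
Qed.

Section NormalHom.
Variables (H K : hilbert R) (M : set (H -> H)) (f : (H -> H) -> (K -> K)).
Hypotheses (sM : star_alg M) (hf : star_hom M f) (nf : normal_map M f).

Lemma nhom_pos (x : bop H H) : M x -> psd x -> exists2 y : bop K K, f x = y & psd y.
Proof.
move=> Mx px; have [y fy] := star_hom_bop hf Mx; exists y => //; apply/psdP.
have M0 := star_alg_0 sM.
have hD : directed_sup M [set z : H -> H | z = 0 \/ z = x] x.
  have p0 : ople 0 x by apply/psdP.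
  have r S : @ople R H S S by move=> v; exact: lexx.
  split.
  - by move=> _ [->|->]; split => // v; exact: lexx.
  - by exists 0; left.
  - by move=> y1 y2 h1 h2; exists x; split; [right|case: h1 => ->|case: h2 => ->].
  - exact: bopP.
  - by move=> _ [->|->].
  - by move=> t _; apply; right.
have [_ h _] := nf hD; have := h 0 (or_introl erefl).
by rewrite (star_hom0 hf M0) fy.
Qed.

Lemma nhom_dsup D (s : bop H H) : directed_sup M D s ->
  directed_sup (@bounded_op R K K) (f @` D) (f s).
Proof.
move=> hD; have [bs ub le] := nf hD; split => //.
- move=> _ [x Dx <-]; have [x' [e px Mx]] := dsup_mem sM hD Dx; rewrite {}e.
  by have [y -> py] := nhom_pos Mx px; split; [exact: bopP|apply/psdP].
- by have [x Dx] := directed_sup_nonempty hD; exists (f x), x.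
- move=> _ _ [x Dx <-] [y Dy <-].
  have [x' [ex px Mx]] := dsup_mem sM hD Dx; have [y' [ey py My]] := dsup_mem sM hD Dy.
  rewrite ex ey in Dx Dy *.
  have [z [Dz pz xz yz]] := dsup_dir sM hD Dx Dy; exists (f z).
  have le' (u : bop H H) : M u -> psd u -> ble u z -> ople (f u) (f z).
    move=> Mu pu uz; have [v fv pv] := nhom_pos Mu pu.
    have Mz' : M z by have [] := directed_sup_pos hD Dz.
    have [w fw pw] := nhom_pos Mz' pz.
    have [d fd pd] := nhom_pos (sa_sub sM Mz' Mu) (psd_sub pu.1 pz.1 uz).
    rewrite fv fw; apply/opleP; [exact: pv.1|exact: pw.1|] => t.
    have := pd.2 t; have -> : d = w - v; last by rewrite bsubE ripBl subr_ge0.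
    apply: bop_eq => t'; rewrite -fd bsubE -fv -fw.
    have -> : bfun (z - u) = bfun ((-1) *: u + z) by rewrite scaleN1r addrC.
    have -> : f ((-1) *: u + z : bop H H) t' = -1 *: f u t' + f z t'.
      by have /(congr1 (@^~ t')) := star_hom_lin hf (-1) Mu Mz'.
    by rewrite scaleN1r addrC.
  by split; [exists z|exact: le'|exact: le'].
- by move=> _ [x Dx <-]; exact: ub.
- by move=> t bt ht; apply: le => // x Dx; apply: ht; exists x.
Qed.

Lemma nf_hom_vec (v : K) : normal_functional M (fun x => '[f x v, v]).
Proof.
split.
- by move=> c x y Mx My; rewrite (star_hom_lin hf)// [X in '[X, _]]/(c *: f x v + f y v) ipDl ipZl.
- move=> x [Mx px]; have [x' Mx' e] := sa_bop sM Mx; rewrite {}e in Mx px *.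
  have [y -> py] := nhom_pos Mx ((psdP x').1 px).
  by rewrite (sa_quad _ py.1) lecR; exact: py.2.
- move=> D s hD; split; first by have [_ h _] := nf hD; move=> x /h/(_ v).
  move=> t ht; have [s1 e1] := bop_of (directed_sup_bounded hD); rewrite {}e1 in hD *.
  have hD' := nhom_dsup hD; have [s' es] := bop_of (directed_sup_bounded hD'); rewrite es in hD' *.
  have ps := dsup_psd_s (bounded_star K) hD'.
  rewrite (sa_quad _ ps.1).
  have ht' (x : bop K K) : (f @` D) x -> Im t = 0 /\ rip (x v) v <= Re t.
    move=> Dx; have px := dsup_psd (bounded_star K) hD' Dx; have [y Dy ey] := Dx.
    by have := ht _ Dy; rewrite ey (sa_quad _ px.1) lecE /= => /andP[/eqP ->].
  have [x0 Dx0] := directed_sup_nonempty hD'.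
  have [x' [e _ _]] := dsup_mem (bounded_star K) hD' Dx0; rewrite e in Dx0.
  rewrite lecE /= (ht' _ Dx0).1 eqxx /=.
  apply/ler_addgt0Pr => e' e0; have [x Dx h] := vigier_inf (bounded_star K) hD' v e0.
  by have := (ht' _ Dx).2; lra.
Qed.

End NormalHom.

Lemma nf_vec H (M : set (H -> H)) v : star_alg M -> normal_functional M (fun x => '[x v, v]).
Proof.
move=> sM; apply: (@nf_hom_vec H H M id) => //.
  by split => // x Mx; exact: star_alg_bounded sM _ Mx.
by move=> D s [? ? ? ? ? ?].
Qed.

Lemma dsup_conj H K (P : set (K -> K)) (N : set (H -> H)) D (s : bop K K) (T : bop H K) :
  star_alg P -> (forall x : bop K K, P x -> N (bcomp (badj T) (bcomp x T))) ->
  directed_sup P D s ->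
  directed_sup N [set y | exists2 x, D x & y = adj T \o (x \o T)] (bcomp (badj T) (bcomp s T)).
Proof.
move=> sP hN hD.
have cE (x : bop K K) v : rip (bcomp (badj T) (bcomp x T) v) v = rip (x (T v)) (T v).
  by rewrite /rip !bcompE -badjPr.
have csa (x : bop K K) : psd x -> psd (bcomp (badj T) (bcomp x T)).
  move=> px; split; first by rewrite !badj_comp badjK px.1; exact: bop_eq.
  by move=> v; rewrite cE; exact: px.2.
have cle (x y : bop K K) : psd x -> psd y -> ble x y ->
    ople (bcomp (badj T) (bcomp x T)) (bcomp (badj T) (bcomp y T)).
  move=> px py xy; apply/opleP; [exact: (csa x px).1|exact: (csa y py).1|].
  by move=> v; rewrite !cE.
split.
- move=> _ [x Dx ->]; have [x' [e px Px]] := dsup_mem sP hD Dx; rewrite {}e.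
  by split; [exact: hN|exact: ((psdP _).2 (csa x' px))].
- by have [x Dx] := directed_sup_nonempty hD; exists (adj T \o (x \o T)), x.
- move=> _ _ [x Dx ->] [y Dy ->].
  have [x' [ex px Mx]] := dsup_mem sP hD Dx; have [y' [ey py My]] := dsup_mem sP hD Dy.
  rewrite ex ey in Dx Dy *.
  have [z [Dz pz xz yz]] := dsup_dir sP hD Dx Dy; exists (bcomp (badj T) (bcomp z T)).
  by split; [exists z|exact: cle|exact: cle].
- exact: bopP.
- move=> _ [x Dx ->]; have [x' [e px Mx]] := dsup_mem sP hD Dx; rewrite {}e in Dx *.
  by have [ps xs] := dsup_ub sP hD Dx; exact: cle.
- move=> t /bop_of[t' ->] ht.
  have [x0 Dx0] := directed_sup_nonempty hD.
  have [x' [e px _]] := dsup_mem sP hD Dx0; rewrite e in Dx0.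
  have [st _] := ople_sa (csa _ px).1 (ht _ (ex_intro2 _ _ _ Dx0 erefl)).
  have ps := dsup_psd_s sP hD.
  apply/opleP => //; first exact: (csa _ ps).1.
  move=> v; apply/ler_addgt0Pr => e' e0.
  have [x Dx h] := vigier_inf sP hD (T v) e0.
  have px' := dsup_psd sP hD Dx.
  have /(opleP (csa _ px').1 st)/(_ v) := ht _ (ex_intro2 _ _ _ Dx erefl).
  by rewrite !cE; lra.
Qed.

Lemma nf_conj H K (P : set (K -> K)) (N : set (H -> H)) (T : bop H K) w :
  star_alg P -> star_alg N -> (forall x : bop K K, P x -> N (bcomp (badj T) (bcomp x T))) ->
  normal_functional N w -> normal_functional P (fun x => w (adj T \o (x \o T))).
Proof.
move=> sP sN hN hw.
split.
- move=> c x y Px Py; have [x' Px' ex] := sa_bop sP Px; have [y' Py' ey] := sa_bop sP Py.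
  rewrite {}ex {}ey in Px Py *; rewrite -(nf_lin hw c (hN _ Px') (hN _ Py')); congr w.
  by apply/funext => v; exact: (bopZD (badj T) c (x' (T v)) (y' (T v))).
- move=> x [Px px]; have [x' Px' e] := sa_bop sP Px; rewrite {}e in Px px *.
  apply: (normal_functional_ge0 hw); split; first exact: hN.
  move: px => /psdP px; have -> : adj T \o (x' \o T) = bcomp (badj T) (bcomp x' T) by [].
  by apply/psdP; split => [|v]; [rewrite !badj_comp badjK px.1; exact: bop_eq|rewrite /rip !bcompE -badjPr; exact: px.2].
- move=> D s hD; have [s' es] := bop_of (directed_sup_bounded hD); rewrite {}es in hD *.
  have [h1 h2] := normal_functional_sup hw (dsup_conj sP hN hD).
  by split=> [x Dx|t ht]; [apply: h1; exists x|apply: h2 => _ [x Dx ->]; exact: ht].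
Qed.

Section Slices.
Variables (H K : hilbert R) (M : set (H -> H)) (N : set (K -> K)).
Hypotheses (hM : vn_alg M) (hN : vn_alg N).
Let sM := hM.1.
Let sN := hN.1.

Lemma vnt_bsl h h' (X : bop (tp H K) (tp H K)) : vn_tensor M N X -> N (bsl h h' X).
Proof.
move=> hX; apply: (vn_of_comm hN) => T hT v; apply: ip_eqP => w.
have e z : X (bopt (bid H) T z) = bopt (bid H) T (X z).
  by rewrite -!bcompE (vnt_commr sM sN hX hT).
rewrite (badjP T) !bslE; have -> : h @ox T v = bopt (bid H) T (h @ox v) by rewrite boptE.
by rewrite e badjP badj_bopt badj_id boptE.
Qed.

Lemma nhom_uniq L F G : star_hom (vn_tensor M N) F -> normal_map (vn_tensor M N) F ->
  star_hom (vn_tensor M N) G -> normal_map (vn_tensor M N) G ->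
  (forall (x : bop H H) (y : bop K K), M x -> N y ->
     F (bopt (tp := tp) x y) = G (bopt (tp := tp) x y)) ->
  forall X : bop (tp H K) (tp H K), vn_tensor M N X -> F X = G X :> (L -> L).
Proof.
move=> hF nF hG nG FG X hX; have sV := (vnt_vn tp sM sN).1.
have [FX eF] := star_hom_bop hF hX; have [GX eG] := star_hom_bop hG hX.
suff : FX - GX = 0 by rewrite eF eG => /eqP; rewrite subr_eq0 => /eqP ->.
apply: ext_quad => v; rewrite bsubE ipBl -eF -eG; apply/eqP; rewrite subr_eq0; apply/eqP.
apply: (vnt_functional_uniq hM hN (nf_hom_vec sV hF nF v) (nf_hom_vec sV hG nG v)) => //.
by move=> x y Mx Ny; rewrite FG.
Qed.

(** Polarisation reduces to a = a' and b = b'. Both sides are then normal functionals of X that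
    agree on elementary tensors, so [vnt_functional_uniq] applies. *)
Lemma slice_hom L (f : (K -> K) -> (L -> L)) F : star_hom N f -> normal_map N f ->
  star_hom (vn_tensor M N) F -> normal_map (vn_tensor M N) F ->
  (forall (x : bop H H) (y : bop K K), M x -> N y ->
     F (bopt (tp := tp) x y) = optens (tp := tp) x (f y)) ->
  forall (X : bop (tp H K) (tp H K)) a a' b b', vn_tensor M N X ->
    '[F X (a @ox b), a' @ox b'] = '[f (bsl a a' X) b, b'].
Proof.
move=> hf nf hF nF FE X a a' b b' hX; have sV := (vnt_vn tp sM sN).1.
have [FX eF] := star_hom_bop hF hX.
have linl c u v d : bsl (c *: u + v) d X = c *: bsl u d X + bsl v d X.
  by apply: bop_eq_ip => x y; rewrite baddE bscaleE ipDl ipZl !bslE tens_linl bopZD ipDl ipZl.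
have linr c u v d : bsl d (c *: u + v) X = c^*%C *: bsl d u X + bsl d v X.
  by apply: bop_eq_ip => x y; rewrite baddE bscaleE ipDl ipZl !bslE tens_linl ipDr ipZr.
have flin c (x y : bop K K) z : N x -> N y -> f (c *: x + y : bop K K) z = c *: f x z + f y z.
  by move=> Nx Ny; have /(congr1 (@^~ z)) := star_hom_lin hf c Nx Ny.
pose q a a' := '[FX (a @ox b), a' @ox b'] - '[f (bsl a a' X) b, b'].
rewrite eF; apply/eqP; rewrite -subr_eq0; apply/eqP; rewrite -/(q a a'); apply: polar.
- move=> c u v d; rewrite /q linl flin; [|exact: vnt_bsl|exact: vnt_bsl].
  rewrite tens_linl bopZD !(ipDl, ipZl); ring.
- move=> c u v d; rewrite /q linr flin; [|exact: vnt_bsl|exact: vnt_bsl].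
  rewrite tens_linl !(ipDl, ipZl, ipDr, ipZr); ring.
move=> {a a'} a; have [g eg] := star_hom_bop hf (vnt_bsl a a hX).
rewrite /q eg -bslE -ipBl -bsubE; suff -> : bsl a a FX - g = 0 by rewrite ip0l.
apply: ext_quad => {b b' q} v; rewrite bsubE ipBl bslE -eF -eg; apply/eqP; rewrite subr_eq0; apply/eqP.
have hs := @nf_conj _ _ (vn_tensor M N) N (lcol a) (fun x => '[f x v, v]) sV sN
  (fun x h => vnt_bsl a a h) (nf_hom_vec sN hf nf v).
have := @vnt_functional_uniq R tp H K M N _ _ hM hN (nf_hom_vec sV hF nF (a @ox v)) hs _ X hX; apply.
move=> x y Mx Ny; rewrite FE//.
have e : bsl a a (bopt (tp := tp) x y) = ('[x a, a] *: y + 0 : bop K K).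
  by apply: bop_eq_ip => k k'; rewrite addr0 bslE boptE tens_dot bscaleE ipZl.
rewrite -[X in _ = '[f X v, _]]/(bfun (bsl a a (bopt x y))) e flin//; last exact: sa_0.
have [fy efy] := star_hom_bop hf Ny.
rewrite (star_hom0 hf (star_alg_0 sN)) [X in _ + X]/0 addr0 ipZl efy.
by have -> := (optensP tp x fy).2 a v; rewrite tens_dot.
Qed.

End Slices.
End NormalHomomorphisms.

(** * Amplification of a homomorphism implemented by intertwiners *)

Section Amplification.
Context {R : realType} (tp : tensor_choice R).
Implicit Types H K L E : hilbert R.
Local Notation "h @ox k" := (tens (tp _ _) h k) (at level 40).

Definition bl H K E (x : bop H K) : bop (tp H E) (tp K E) := bopt x (bid E).
Arguments bl {H K} E x.

Lemma blE H K E (x : bop H K) h (e : E) : bl E x (h @ox e) = x h @ox e.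
Proof. exact: boptE. Qed.

Lemma bl_comp H K L E (x : bop H K) (y : bop K L) v : bl E y (bl E x v) = bl E (bcomp y x) v.
Proof. by rewrite -bcompE bopt_comp; congr (bopt _ _ v); exact: bop_eq. Qed.

Lemma badj_bl H K E (x : bop H K) : badj (bl E x) = bl E (badj x).
Proof. by rewrite badj_bopt badj_id. Qed.

(* operators between L tensor E and L tensor E' whose right slices lie in M *)
Definition lint L (M : set (L -> L)) E E' (X : bop (tp L E) (tp L E')) :=
  forall T : bop L L, commutant M T -> forall v, X (bl E T v) = bl E' T (X v).

Lemma lint_adj L (M : set (L -> L)) E E' (X : bop (tp L E) (tp L E')) : star_alg M ->
  lint M X -> lint M (badj X).
Proof.
move=> sM hX T hT v; apply: ip_eqP => w.
rewrite -(badjPr X) (badjP (bl E' T)) (badjP (bl E T)) !badj_bl -hX; last exact: commutant_adj.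
by rewrite (badjPr X).
Qed.

Lemma lint_comp L (M : set (L -> L)) E E' E'' (X : bop (tp L E) (tp L E')) (Y : bop (tp L E') (tp L E'')) :
  lint M X -> lint M Y -> lint M (bcomp Y X).
Proof. by move=> hX hY T hT v; rewrite !bcompE hX// hY. Qed.

Variables (L K : hilbert R) (M : set (L -> L)) (I : Type) (s : I -> bop L K).
Hypotheses (hM : vn_alg M) (hs : forall i j, commutant M (bcomp (badj (s j)) (s i)))
  (hts : forall z, (forall i v, '[s i v, z] = 0) -> z = 0).
Let sM := hM.1.

Lemma bl_total E (z : tp K E) : (forall i v, '[bl E (s i) v, z] = 0) -> z = 0.
Proof.
move=> h; apply: rcol_adj0 => e; apply: hts => i v.
by rewrite -(badjP (rcol e)) rcolE -blE h.
Qed.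

Lemma bl_ext E F (S T : bop (tp K E) F) :
  (forall i v, S (bl E (s i) v) = T (bl E (s i) v)) -> S = T.
Proof.
move=> h; apply: (@bop_eq_total R _ _ (I * tp L E)%type (fun p => bl E (s p.1) p.2)).
  by move=> z hz; apply: bl_total => i v; apply: hz; exists (i, v).
by move=> [i v]; exact: h.
Qed.

(** Since (adj (s j)) (s i) lies in the commutant of M, it passes through X and through (adj X) X in
    the first leg. This makes the prescription on the vectors s i v compatible with inner products,
    and [power_ext] for v |-> (adj X) X v bounds it. *)
Lemma amp_ex E E' (X : bop (tp L E) (tp L E')) : lint M X ->
  exists T : bop (tp K E) (tp K E'), forall i v, T (bl E (s i) v) = bl E' (s i) (X v).
Proof.
move=> hX.
have e i j (v w : tp L E') : '[bl E' (s i) v, bl E' (s j) w] = '[bl E' (bcomp (badj (s j)) (s i)) v, w].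
  by rewrite badjPr badj_bl bl_comp.
have e' i j (v w : tp L E) : '[bl E (s i) v, bl E (s j) w] = '[bl E (bcomp (badj (s j)) (s i)) v, w].
  by rewrite badjPr badj_bl bl_comp.
pose Y := bcomp (badj X) X.
have hY : lint M Y by apply: lint_comp => //; exact: lint_adj.
have sY : badj Y = Y by exact: (psd_comp_adj X).1.
have [b b0 hb] := bop_bound Y.
have [] := @power_ext R (I * tp L E)%type _ _ (fun p => bl E (s p.1) p.2)
  (fun p => bl E' (s p.1) (X p.2)) (fun p => (p.1, Y p.2)) b
  (fun p => (xget 0 [set k | 0 <= k /\ forall v, nm (bl E (s p.1) v) <= k * nm v]) * nm p.2) b0.
- by move=> [i v] [j w] /=; rewrite e e' -(hX _ (hs i j)) badjP.
- by move=> [i v] [j w] /=; rewrite !e' -(hY _ (hs i j)) (sa_ip _ _ sY).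
- move=> n [i v].
  have -> : iter n (fun p : I * tp L E => (p.1, Y p.2)) (i, v) = (i, iter n Y v).
    by elim: n => //= n ->.
  rewrite /=; case: xgetP => [k _ [k0 hk]|/=].
    apply: le_trans (hk _) _; rewrite -mulrA; apply: ler_wpM2l => //.
    elim: n => [|n IH]; first by rewrite expr0 mulr1.
    by rewrite iterS; apply: le_trans (hb _) _; rewrite exprS mulrCA ler_wpM2l.
  have [k k0 hk] := bop_bound (bl E (s i)).
  by move=> /(_ k); case; split.
by move=> T [hT _ _]; exists T => i v; exact: (hT (i, v)).
Qed.

Definition amp E (X : tp L E -> tp L E) : tp K E -> tp K E :=
  xget 0 [set T : tp K E -> tp K E | bounded_op T /\ forall i v, T (bl E (s i) v) = bl E (s i) (X v)].

Lemma ampP E (X : bop (tp L E) (tp L E)) : lint M X ->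
  exists2 T : bop (tp K E) (tp K E), amp X = T & forall i v, T (bl E (s i) v) = bl E (s i) (X v).
Proof.
move=> hX; rewrite /amp; case: xgetP => [T _ [/bop_of[T' ->] h]|]; first by exists T'.
by have [T hT] := amp_ex hX; move=> /(_ (bfun T)); case; split => //; exact: bopP.
Qed.

Lemma amp_uniq E (X : bop (tp L E) (tp L E)) (T : bop (tp K E) (tp K E)) : lint M X ->
  (forall i v, T (bl E (s i) v) = bl E (s i) (X v)) -> amp X = T.
Proof.
move=> hX hT; have [T' -> hT'] := ampP hX; congr bfun; apply: bl_ext => i v.
by rewrite hT hT'.
Qed.

Lemma lc_ip_le E (S T : bop (tp K E) (tp K E)) :
  (forall l, rip (S (lc (fun p : I * tp L E => bl E (s p.1) p.2) l)) (lc (fun p : I * tp L E => bl E (s p.1) p.2) l)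
    <= rip (T (lc (fun p : I * tp L E => bl E (s p.1) p.2) l)) (lc (fun p : I * tp L E => bl E (s p.1) p.2) l)) -> ble S T.
Proof.
set sg := fun p : I * tp L E => _.
move=> h z; rewrite -subr_ge0 -ripBl -bsubE; set D := T - S.
have hD l : 0 <= rip (D (lc sg l)) (lc sg l) by rewrite bsubE ripBl subr_ge0.
have [k k0 hk] := bop_bound D.
apply/ler_addgt0Pr => e e0.
have [d d0 hd] : exists2 d, 0 < d & k * d * (2 * nm z + d) <= e.
  have pos : 0 < k * (2 * nm z + 1) + 1.
    by rewrite ltr_wpDl// mulr_ge0// addr_ge0// mulr_ge0// nm_ge0.
  have [n0 hn] := inv_small (divr_gt0 e0 pos).
  exists (n0.+1%:R^-1); first by rewrite invr_gt0 ltr0Sn.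
  have := hn _ (leqnn n0); set d := _^-1 => hd.
  have d0 : 0 <= d by rewrite invr_ge0 ler0n.
  have d1 : d <= 1 by rewrite invf_le1 ?ltr0Sn// ler1n.
  have z0 := nm_ge0 z.
  have {hd} : d * (k * (2 * nm z + 1) + 1) <= e by rewrite -ler_pdivlMr.
  have : k * d * (2 * nm z + d) <= k * d * (2 * nm z + 1).
    by apply: ler_wpM2l; [exact: mulr_ge0|rewrite lerD2l].
  by lra.
have tot : total (range sg).
  by move=> x hx; apply: bl_total => i v; apply: hx; exists (i, v).
have [l hl] := total_lc_dense tot z d0; set x := lc sg l in hl.
have -> : rip (D z) z = rip (D x) x + (rip (D (z - x)) z + rip (D x) (z - x)).
  by rewrite bopB !ripBl !ripBr; ring.
have h1 : - rip (D (z - x)) z <= k * d * nm z.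
  rewrite -ripNl; apply: le_trans (rip_le _ _) _; rewrite nmN; apply: ler_wpM2r; first exact: nm_ge0.
  by apply: le_trans (hk _) _; rewrite ler_wpM2l.
have h2 : - rip (D x) (z - x) <= k * d * (nm z + d).
  rewrite -ripNl; apply: le_trans (rip_le _ _) _; rewrite nmN.
  have nx : nm x <= nm z + d.
    by have := nmB z (z - x); rewrite subKr; lra.
  have := hk x; have := nm_ge0 (D x); have := nm_ge0 (z - x); have := nm_ge0 x; move: hl nx k0.
  set a := nm (z - x); set b := nm (D x); set c := nm x; set f := nm z => *.
  have : b * a <= (k * (f + d)) * d by apply: ler_pM => //; nra.
  by lra.
by have := hD l; rewrite -/x; lra.
Qed.

(** Positivity of amp X is read from contractivity: k - X has norm at most k, hence so has its
    image. For normality the supremum is approximated strongly on finitely many v, which controls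
    the image on combinations of the s i v; these are dense enough to compare forms by
    [lc_ip_le]. *)
Lemma amp_hom E (N : set (E -> E)) (th : (L -> L) -> (K -> K)) : vn_alg N ->
  star_hom M th -> (forall (x : bop L L) i v, M x -> th x (s i v) = s i (x v)) ->
  [/\ star_hom (vn_tensor M N) (@amp E), normal_map (vn_tensor M N) (@amp E) &
    forall (x : bop L L) (y : bop E E), M x -> N y ->
      amp (bopt (tp := tp) x y) = optens (tp := tp) (th x) y].
Proof.
move=> hN hth hi; have sN := hN.1; have hV := vnt_vn tp sM sN; have sV := hV.1.
have lV (X : bop (tp L E) (tp L E)) : vn_tensor M N X -> lint M X.
  move=> hX T hT v; have /(congr1 (fun S : bop _ _ => S v)) := vnt_comml sM sN hX hT.
  by rewrite !bcompE.
have sh : star_hom (vn_tensor M N) (@amp E).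
  split.
  - by move=> X hX; have [X' hX' ->] := sa_bop sV hX; have [T -> _] := ampP (lV _ hX'); exact: bopP.
  - move=> c X Y hX hY; have [X' hX' ->] := sa_bop sV hX; have [Y' hY' ->] := sa_bop sV hY.
    have [S eS hS] := ampP (lV _ hX'); have [T eT hT] := ampP (lV _ hY').
    rewrite eS eT; apply: (@amp_uniq E (c *: X' + Y') (c *: S + T)); first by apply: lV; exact: sa_lin.
    by move=> i v; rewrite !baddE !bscaleE hS hT bopZD.
  - move=> X Y hX hY; have [X' hX' ->] := sa_bop sV hX; have [Y' hY' ->] := sa_bop sV hY.
    have [S eS hS] := ampP (lV _ hX'); have [T eT hT] := ampP (lV _ hY').
    rewrite eS eT; apply: (@amp_uniq E (bcomp X' Y') (bcomp S T)); first by apply: lV; exact: sa_comp.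
    by move=> i v; rewrite !bcompE hT hS.
  - move=> X hX; have [X' hX' ->] := sa_bop sV hX.
    have [S eS hS] := ampP (lV _ hX'); rewrite eS.
    have hA : lint M (badj X') by apply: lV; exact: sa_adj.
    have [T eT hT] := ampP hA; rewrite [LHS]eT.
    suff -> : T = badj S by [].
    apply: bl_ext => i v; rewrite hT.
    apply/eqP; rewrite -subr_eq0; apply/eqP; apply: bl_total => j w; rewrite ipBr.
    rewrite -(badjP S) hS; apply/eqP; rewrite subr_eq0; apply/eqP.
    rewrite !(badjP (bl E (s j))) !badj_bl !bl_comp.
    by rewrite -hA ?(badjP X')//; exact: hs.
have one : amp (bid (tp L E)) = bid (tp K E).
  by apply: amp_uniq => //; apply: lV; exact: vn_id.
have pos (X : bop (tp L E) (tp L E)) : vn_tensor M N X -> psd X ->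
    exists2 T : bop (tp K E) (tp K E), amp X = T & psd T.
  move=> hX pX; have [T eT hT] := ampP (lV _ hX); exists T => //.
  have sT : badj T = T.
    have := star_hom_adj sh hX; have -> : adj X = X by exact: (congr1 (@bfun _ _ _) pX.1).
    rewrite eT => e.
    by apply: bop_eq => x; rewrite [RHS](congr1 (@^~ x) e).
  split => // z; have [k k0 hk] := bop_bound X.
  have hk' x : rip (X x) x <= k * nm x ^+ 2.
    apply: le_trans (rip_le _ _) _; rewrite expr2 mulrA; apply: ler_wpM2r => //; exact: nm_ge0.
  pose Z := k%:C *: bid (tp L E) - X.
  have ZE x : rip (Z x) x = k * nm x ^+ 2 - rip (X x) x.
    by rewrite bsubE ripBl bscaleE ripZl ripxx.
  have hZ : vn_tensor M N Z.
    by apply: sa_sub => //; apply: sa_scale => //; exact: vn_id.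
  have pZ : psd Z.
    apply: psd_sub; [exact: pX.1|by rewrite badj_scaler badj_id|].
    by move=> x; rewrite bscaleE ripZl ripxx.
  have nZ x : nm (Z x) <= k * nm x.
    apply: sqr_le; first by rewrite mulr_ge0// nm_ge0.
    have := psd_nm x pZ k0; rewrite ZE exprMn expr2 -mulrA => h.
    apply: le_trans (h _) _; first by move=> y; rewrite ZE; have := pX.2 y; lra.
    by apply: ler_wpM2l => //; have := pX.2 x; lra.
  have := star_hom_contr (vn_closed hV) sV sh hZ k0 nZ z.
  have -> : amp Z = k%:C *: bid (tp K E) - T.
    apply: amp_uniq; first exact: lV.
    by move=> i v; rewrite !bsubE !bscaleE hT bopB bopZ.
  move=> h; have := rip_le ((k%:C *: bid (tp K E) - T) z) z.
  have := ler_wpM2r (nm_ge0 z) h; rewrite bsubE ripBl bscaleE ripZl ripxx; move: (nm z) => q; lra.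
have mono (X Y : bop (tp L E) (tp L E)) : vn_tensor M N X -> vn_tensor M N Y ->
    psd X -> psd Y -> ble X Y -> ople (amp X) (amp Y).
  move=> hX hY pX pY XY; have hD := sa_sub sV hY hX.
  have [S eS pS] := pos _ hX pX; have [T eT pT] := pos _ hY pY.
  have [Q eQ pQ] := pos _ hD (psd_sub pX.1 pY.1 XY).
  rewrite eS eT; apply/opleP; [exact: pS.1|exact: pT.1|move=> v].
  have := pQ.2 v; suff -> : Q = T - S by rewrite bsubE ripBl subr_ge0.
  apply: bop_eq => u; rewrite -eQ; congr (_ u); apply: amp_uniq; first exact: lV.
  have [S' eS' hS] := ampP (lV _ hX); have [T' eT' hT] := ampP (lV _ hY).
  by move=> i w; rewrite !bsubE -eS eS' -eT eT' hS hT bopB.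
split => //; last first.
  move=> x y Mx Ny; have [x' ex] := star_hom_bop hth Mx; rewrite ex.
  apply: (@amp_uniq E (bopt x y) (bopt x' y)); first by apply: lV; exact: vnt_bopt.
  move=> i; move=> v; rewrite -!bcompE; congr (bfun _ v); apply: tens_ext => h k.
  by rewrite !bcompE blE !boptE -ex hi.
move=> D S hD; have [S' eS] := bop_of (directed_sup_bounded hD); rewrite {}eS in hD *.
have pS := dsup_psd_s sV hD.
have hS : vn_tensor M N S'.
  apply: (vn_of_comm hV) => T hT v; apply/eqP; rewrite -subr_eq0; apply/eqP.
  have [k k0 hk] := bop_bound T.
  apply: (@nm_small0 R _ _ (1 + k)) => [|e e0]; first by lra.
  have [x Dx hx] := vigier_seq sV hD [:: v; T v] e0.
  have Vx : vn_tensor M N x by have [] := directed_sup_pos hD Dx.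
  have rf : ble x x by [].
  have h1 := hx x Dx rf v (mem_head _ _); have h2 := hx x Dx rf (T v); rewrite !inE eqxx orbT in h2.
  have -> : S' (T v) - T (S' v) = (S' (T v) - x (T v)) - T (S' v - x v).
    by rewrite bopB -(vn_comm v Vx hT); rewrite opprB addrA subrK.
  apply: le_trans (nmB _ _) _; rewrite mulrDl mul1r; apply: lerD; first exact: h2.
  by apply: le_trans (hk _) _; rewrite ler_wpM2l.
have [TS eTS pTS] := pos _ hS pS.
have [TS' eTS' hTS] := ampP (lV _ hS).
have {eTS' hTS TS'} hTS : forall i v, TS (bl E (s i) v) = bl E (s i) (S' v) by move=> i v; rewrite -eTS eTS'.
have memD (x : bop (tp L E) (tp L E)) : D x -> vn_tensor M N x /\ psd x.
  by move=> Dx; split; [have [] := directed_sup_pos hD Dx|exact: (dsup_psd sV hD Dx)].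
split; first by rewrite eTS; exact: bopP.
  move=> x Dx; have [x' [ex px Mx]] := dsup_mem sV hD Dx; rewrite {}ex in Dx *.
  by apply: mono => //; have [] := dsup_ub sV hD Dx.
move=> t /bop_of[t' ->] ht.
have [x0 Dx0] := directed_sup_nonempty hD.
have [x' [ex px Mx]] := dsup_mem sV hD Dx0; rewrite {}ex in Dx0.
have [T0 eT0 pT0] := pos _ Mx px.
have [st _] : badj t' = t' /\ ble T0 t' by apply: ople_sa; [exact: pT0.1|rewrite -eT0; exact: ht].
rewrite eTS; apply/opleP; [exact: pTS.1|exact: st|apply: lc_ip_le => l].
set sg := fun p : I * tp L E => _; set z := lc sg l.
have [C [C0 hC]] : exists C, 0 <= C /\ forall (T : bop (tp K E) (tp K E)) (X : bop (tp L E) (tp L E)) e,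
    0 <= e -> (forall i v, T (bl E (s i) v) = bl E (s i) (X v)) ->
    (forall v, v \in [seq p.2.2 | p <- l] -> nm (X v) <= e) -> nm (T z) <= C * e.
  rewrite {}/z; elim: l => [|[c [i v]] l [C [C0 IH]]].
    by exists 0; split => // T X e _ _ _; rewrite lc_nil bop0 nm0 mul0r.
  have [k k0 hk] := bop_bound (bl E (s i)).
  exists (Re `|c| * k + C); split; first by rewrite addr_ge0// mulr_ge0// Re_norm_ge0.
  move=> T X e e0 hT hX; rewrite lc_cons bopZD /sg /= hT mulrDl.
  apply: le_trans (nmD _ _) _; apply: lerD.
    rewrite nmZ -mulrA; apply: ler_wpM2l; first exact: Re_norm_ge0.
    by apply: le_trans (hk _) _; apply: ler_wpM2l => //; apply: hX; rewrite inE eqxx.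
  by apply: (IH T X) => // w hw; apply: hX; rewrite inE hw orbT.
apply/ler_addgt0Pr => e e0.
have pos1 : 0 < C * nm z + 1 by rewrite ltr_wpDl// mulr_ge0// nm_ge0.
have [x Dx hx] := vigier_seq sV hD [seq p.2.2 | p <- l] (divr_gt0 e0 pos1).
have [Vx pxx] := memD _ Dx; have [T eT pT] := pos _ Vx pxx.
have [T' eT' hT] := ampP (lV _ Vx).
have := hC (TS - T) (S' - x) _ (ltW (divr_gt0 e0 pos1)) _ (hx x Dx _).
have -> : (TS - T) z = TS z - T z by [].
move=> h; have {}h : nm (TS z - T z) <= C * (e / (C * nm z + 1)).
  by apply: h => // i v; rewrite !bsubE hTS -eT eT' hT bopB.
have h2 : rip (T z) z <= rip (t' z) z.
  by move: (ht _ Dx); rewrite eT => /(opleP pT.1 st)/(_ z).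
have h3 := rip_le (TS z - T z) z; rewrite ripBl in h3.
have h4 := ler_wpM2r (nm_ge0 z) h.
have h5 : C * (e / (C * nm z + 1)) * nm z <= e.
  have d0 := ltW (divr_gt0 e0 pos1).
  have eE : e / (C * nm z + 1) * (C * nm z + 1) = e by rewrite divfK// gt_eqF.
  move: d0 eE; set d := e / _ => d0 eE; nra.
by lra.
Qed.

End Amplification.

(** * Elements of finite weight, square integrable elements, the GNS map *)

Section Weights.
Context {R : realType}.
Implicit Types H K L E : hilbert R.

Section Trace.
Variables (L : hilbert R) (M : set (L -> L)) (phi : (L -> L) -> \bar R).
Hypotheses (hM : vn_alg M) (hphi : nsf_weight M phi).
Let sM := hM.1.

(** Restricted to positive elements of finite weight, the weight becomes a real additive function
    [tr], monotone and normal. *)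
Definition fin (x : bop L L) := [/\ M x, psd x & (phi x < +oo)%E].
Definition tr (x : bop L L) : R := fine (phi x).

Lemma pos_part (x : bop L L) : M x -> psd x -> positive_part M x.
Proof. by move=> Mx /psdP px. Qed.

Lemma finE (x : bop L L) : fin x -> phi x = (tr x)%:E.
Proof.
move=> [Mx px fx]; rewrite /tr fineK// ge0_fin_numE//.
exact: (weight_ge0 hphi (pos_part Mx px)).
Qed.

Lemma fin_le (x y : bop L L) : fin y -> M x -> psd x -> ble x y -> fin x /\ tr x <= tr y.
Proof.
move=> [My py fy] Mx px xy.
have Md : M (y - x : bop L L) by exact: sa_sub.
have pd : psd (y - x) by apply: psd_sub => //; [exact: px.1|exact: py.1].
have := weight_add hphi (pos_part Mx px) (pos_part Md pd).
rewrite [X in phi X](congr1 (@bfun _ _ _) (subrKC x y : x + (y - x) = y)) => e.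
have d0 := weight_ge0 hphi (pos_part Md pd); have x0 := weight_ge0 hphi (pos_part Mx px).
have le : (phi x <= phi y)%E by rewrite e leeDl.
have fx : fin x by split => //; exact: le_lt_trans fy.
split => //; rewrite -lee_fin -(finE fx) -finE//.
Qed.

Lemma fin_add (x y : bop L L) : fin x -> fin y -> fin (x + y) /\ tr (x + y) = tr x + tr y.
Proof.
move=> fx fy; have [Mx px _] := fx; have [My py _] := fy.
have e : phi (x + y : bop L L) = (tr x + tr y)%:E.
  by rewrite [LHS](weight_add hphi (pos_part Mx px) (pos_part My py)) !finE.
have f : fin (x + y).
  by split; [exact: sa_add|exact: psd_add|rewrite e ltry].
by split => //; apply/eqP; rewrite -eqe -finE// e.
Qed.

Lemma fin_scale c (x : bop L L) : 0 <= c -> fin x -> fin (c%:C *: x) /\ tr (c%:C *: x) = c * tr x.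
Proof.
move=> c0 fx; have [Mx px _] := fx.
have e : phi (c%:C *: x : bop L L) = (c * tr x)%:E.
  by rewrite [LHS](weight_scale hphi c0 (pos_part Mx px)) finE.
have f : fin (c%:C *: x).
  by split; [exact: sa_scale|exact: psd_scale|rewrite e ltry].
by split => //; apply/eqP; rewrite -eqe -finE// e.
Qed.

Lemma fin_sub (x y : bop L L) : fin x -> fin y -> ble x y -> fin (y - x) /\ tr (y - x) = tr y - tr x.
Proof.
move=> fx fy xy; have [Mx px _] := fx; have [My py _] := fy.
have [|||fd _] := @fin_le (y - x) y fy.
- exact: sa_sub.
- by apply: psd_sub => //; [exact: px.1|exact: py.1].
- by move=> v; rewrite bsubE ripBl gerBl; exact: px.2.
split => //; have [_] := fin_add fx fd; rewrite subrKC => ->; ring.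
Qed.

Lemma tr_ge0 (x : bop L L) : fin x -> 0 <= tr x.
Proof.
by move=> fx; have [Mx px _] := fx; rewrite -lee_fin -finE//; exact: (weight_ge0 hphi (pos_part Mx px)).
Qed.

Lemma tr_faithful (x : bop L L) : fin x -> tr x = 0 -> x = 0.
Proof.
move=> fx t0; have [Mx px _] := fx; apply: bop_eq => v.
by have -> := weight_faithful hphi (pos_part Mx px) (etrans (finE fx) (congr1 _ t0)).
Qed.

Lemma fin0 : fin 0 /\ tr 0 = 0.
Proof.
have p0 : positive_part M (0 : bop L L) by apply: pos_part; [exact: sa_0|exact: psd_0].
have e : phi (0 : bop L L) = 0%E.
  have := weight_scale hphi (lexx 0) p0; rewrite mul0e => <-; congr phi.
  by apply/funext => v; exact: esym (scaler0 _ _).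
split; last by rewrite /tr e.
by split; [exact: sa_0|exact: psd_0|rewrite e ltry].
Qed.

Lemma fin_sum (I : Type) (r : seq I) (F : I -> bop L L) : (forall i, fin (F i)) ->
  fin (\sum_(i <- r) F i) /\ tr (\sum_(i <- r) F i) = \sum_(i <- r) tr (F i).
Proof.
move=> hF; elim: r => [|i r [f e]]; first by rewrite !big_nil; exact: fin0.
by rewrite !big_cons -e; exact: fin_add.
Qed.

Lemma tr_sup D (s : bop L L) e : directed_sup M D s -> fin s -> 0 < e ->
  exists2 x : bop L L, D x & tr s - tr x <= e.
Proof.
move=> hD fs e0; apply: contrapT => h.
suff : (phi s <= (tr s - e)%:E)%E by rewrite finE// lee_fin; lra.
rewrite (weight_normal hphi hD); apply: ge_ereal_sup => _ [x Dx <-].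
have [x' [ex px Mx]] := dsup_mem sM hD Dx; rewrite {}ex in Dx *.
have [fx _] := fin_le fs Mx px (dsup_ub sM hD Dx).2.
rewrite finE// lee_fin leNgt; apply/negP => h'; apply: h; exists x' => //; lra.
Qed.

Lemma fin_sup D (s : bop L L) c : directed_sup M D s -> M s ->
  (forall x : bop L L, D x -> fin x /\ tr x <= c) -> fin s /\ tr s <= c.
Proof.
move=> hD Ms hc.
have le : (phi s <= c%:E)%E.
  rewrite (weight_normal hphi hD); apply: ge_ereal_sup => _ [x Dx <-].
  have [x' [ex px Mx]] := dsup_mem sM hD Dx; rewrite {}ex in Dx *.
  by have [fx h] := hc _ Dx; rewrite finE// lee_fin.
have fs : fin s by split => //; [exact: dsup_psd_s hD|exact: le_lt_trans le (ltry _)].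
by split => //; rewrite -lee_fin -finE.
Qed.

Definition sq (x : bop L L) := M x /\ fin (bcomp (badj x) x).

Lemma sqP (x : bop L L) : sq_integrable M phi x <-> sq x.
Proof.
split=> [[Mx fx]|[Mx [_ _ fx]]]; split => //; split => //; last exact: psd_comp_adj.
by apply: sa_comp => //; exact: sa_adj.
Qed.

Lemma square_le H K (x : bop H K) E (a : bop K E) : exists2 k, 0 <= k &
  ble (bcomp (badj (bcomp a x)) (bcomp a x)) (k%:C *: bcomp (badj x) x).
Proof.
have [k k0 hk] := bop_bound a; exists (k ^+ 2); first exact: sqr_ge0.
move=> v; rewrite bscaleE ripZl !rip_adj_comp bcompE -exprMn ler_sqr ?nnegrE ?nm_ge0//.
by rewrite mulr_ge0// nm_ge0.
Qed.

Lemma sq_mul (a x : bop L L) : M a -> sq x -> sq (bcomp a x).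
Proof.
move=> Ma [Mx fx]; have Max := sa_comp sM Ma Mx; split => //.
have [k k0 hk] := square_le x a.
have [fk _] := fin_scale k0 fx.
have [] // := fin_le fk _ (psd_comp_adj (bcomp a x)) hk.
by apply: sa_comp => //; exact: sa_adj.
Qed.

Lemma sq_scale c (x : bop L L) : sq x -> sq (c *: x).
Proof.
move=> hx; have -> : c *: x = bcomp (c *: bid L) x by exact: bop_eq.
by apply: sq_mul => //; apply: sa_scale => //; exact: vn_id.
Qed.

Lemma sq_add (x y : bop L L) : sq x -> sq y -> sq (x + y).
Proof.
move=> [Mx fx] [My fy]; have Ms := sa_add sM Mx My; split => //.
have [f _] := fin_add fx fy; have [f2 _] := fin_scale (ler0n _ 2) f.
have [] // := fin_le f2 _ (psd_comp_adj (x + y)).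
  by apply: sa_comp => //; exact: sa_adj.
move=> v; rewrite bscaleE ripZl baddE ripDl !rip_adj_comp baddE nm_sqrD.
have := sqr_ge0 (nm (x v - y v)); rewrite nm_sqrB; lra.
Qed.

Lemma comp0r H K E (x : bop K E) : bcomp x (0 : bop H K) = 0.
Proof. by apply: bop_eq => v; rewrite bcompE !b0E bop0. Qed.

Lemma sq0 : sq 0.
Proof. by split; [exact: sa_0|rewrite comp0r; exact: fin0.1]. Qed.

End Trace.

Section GNS.
Variables (L : hilbert R) (M : set (L -> L)) (phi : (L -> L) -> \bar R) (Lam : (L -> L) -> L).
Hypotheses (hM : vn_alg M) (hphi : nsf_weight M phi) (hLam : gns_map M phi Lam).
Let sM := hM.1.
Notation sq := (sq M phi).
Notation fin := (fin M phi).
Notation tr := (tr phi).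

Lemma gns_sq (x : bop L L) : sq x -> nm (Lam x) ^+ 2 = tr (bcomp (badj x) x).
Proof.
move=> hx; have := gns_norm hLam ((sqP phi hM x).2 hx); have [_ f] := hx.
by rewrite [RHS](finE hphi f) ipxx /= => -[].
Qed.

Lemma gns_linb c (x y : bop L L) : sq x -> sq y -> Lam (c *: x + y : bop L L) = c *: Lam x + Lam y.
Proof. by move=> /(sqP phi hM) hx /(sqP phi hM) hy; exact: (gns_lin hLam). Qed.

Lemma gns_mulb (a x : bop L L) : M a -> sq x -> Lam (bcomp a x) = a (Lam x).
Proof. by move=> Ma /(sqP phi hM) hx; exact: (gns_mul hLam). Qed.

Lemma gns_0 : Lam (0 : bop L L) = 0.
Proof.
apply: nm0_eq0; apply/eqP; rewrite -sqrf_eq0 gns_sq; last exact: sq0.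
by rewrite comp0r (fin0 hM hphi).2.
Qed.

Lemma gns_sub (x y : bop L L) : sq x -> sq y -> Lam (x - y : bop L L) = Lam x - Lam y.
Proof.
move=> hx hy; have -> : x - y = (-1) *: y + x by rewrite scaleN1r addrC.
by rewrite gns_linb// scaleN1r addrC.
Qed.

Lemma gns_sum (I : Type) (r : seq I) (F : I -> bop L L) : (forall i, sq (F i)) ->
  sq (\sum_(i <- r) F i) /\ Lam (\sum_(i <- r) F i : bop L L) = \sum_(i <- r) Lam (F i).
Proof.
move=> hF; elim: r => [|i r [f e]]; first by rewrite !big_nil; split; [exact: sq0|exact: gns_0].
rewrite !big_cons -e; split; first exact: sq_add.
by have := gns_linb 1 (hF i) f; rewrite !scale1r.
Qed.

Lemma gns_total z : (forall x : bop L L, sq x -> '[Lam x, z] = 0) -> z = 0.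
Proof.
move=> h; apply: nm0_eq0; apply/eqP; rewrite -sqrf_eq0 -ripxx.
have : in_closure (Lam @` sq_integrable M phi) z.
  by apply: closure_in; rewrite (gns_dense hLam).
move=> hz; rewrite /rip (in_closure_ip0 hz)// => _ [x hx <-].
by have [x' Mx ex] := sa_bop sM hx.1; rewrite ex in hx *; apply: h; apply/(sqP phi hM).
Qed.
End GNS.
End Weights.

(** * Column operators of finite weight and their finite truncations *)

Section Columns.
Context {R : realType} (tp : tensor_choice R).
Implicit Types H K E : hilbert R.
Local Notation "h @ox k" := (tens (tp _ _) h k) (at level 40).

Definition pl E (L : hilbert R) (l : seq E) : bop (tp E L) (tp E L) := bopt (lproj l) (bid L).
Arguments pl {E} L l.

Lemma plE E L l (z : tp E L) : pl L l z = \sum_(e <- l) lcol e (badj (lcol e) z).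
Proof.
rewrite -(bsumE l (fun e => bcomp (lcol e) (badj (lcol e))) z).
congr (bfun _ z); apply: tens_ext => h k; rewrite boptE lprojE bsumE -rcolE bop_sum.
by apply: eq_bigr => e _; rewrite bcompE lcol_adjE bopZ rcolE (bopZ (lcol e)).
Qed.

Lemma pl_sa E L l : badj (@pl E L l) = pl L l.
Proof. by rewrite badj_bopt lproj_sa badj_id. Qed.

Lemma pl_idem E L l z : onl l -> pl L l (pl L l z) = pl L l z :> tp E L.
Proof.
move=> ol; rewrite -bcompE bopt_comp; congr (bopt _ _ z); last exact: bop_eq.
by apply: bop_eq => x; exact: lproj_idem.
Qed.

Lemma pl_fix E L l l' (z : tp E L) : (forall x, lproj l x = x -> lproj l' x = x) -> onl l ->
  pl L l' (pl L l z) = pl L l z.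
Proof.
move=> h ol; rewrite -bcompE bopt_comp; congr (bopt _ _ z); last exact: bop_eq.
by apply: bop_eq => x; apply: h; exact: lproj_idem.
Qed.

Lemma pl_le E L l (z : tp E L) : onl l -> nm (pl L l z) <= nm z.
Proof.
move=> ol; apply: sqr_le; first exact: nm_ge0.
have e : rip (pl L l z) z = nm (pl L l z) ^+ 2.
  by rewrite -ripxx [RHS]sa_sym ?pl_sa// pl_idem.
have := rip_le (pl L l z) z; rewrite e !expr2; have := nm_ge0 (pl L l z); have := nm_ge0 z.
set a := nm _; set b := nm _ => *; have [->|a0] := eqVneq b 0; nra.
Qed.

Lemma pl_approx E L (l0 : seq E) (z : tp E L) e : onl l0 -> 0 < e -> exists l,
  [/\ onl l, forall x, lproj l0 x = x -> lproj l x = x & nm (z - pl L l z) <= e].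
Proof.
move=> ol0 e0; have e2 : 0 < e / 2 by lra.
have [s hs] := total_lc_dense (@tsr_total R tp E L) z e2.
have [l [ol hl mono]] := gram_schmidt [seq p.2.1 | p <- s] ol0.
exists l; split => //; set y := lc _ s in hs.
have yE : pl L l y = y.
  rewrite /y /lc bop_sum [LHS]big_seq [RHS]big_seq; apply: eq_bigr => p hp.
  by rewrite bopZ /tsr boptE hl//; apply/mapP; exists p.
have -> : z - pl L l z = (z - y) - pl L l (z - y).
  by rewrite bopB yE opprB addrA subrK.
by apply: le_trans (nmB _ _) _; have := pl_le (z - y) ol; lra.
Qed.

Section Weight.
Variables (L : hilbert R) (M : set (L -> L)) (phi : (L -> L) -> \bar R) (Lam : (L -> L) -> L).
Hypotheses (hM : vn_alg M) (hphi : nsf_weight M phi).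
Let sM := hM.1.
Notation sq := (sq M phi).
Notation fin := (fin M phi).
Notation tr := (tr phi).

(* operators from L to E tensor L whose slices lie in M *)
Definition cint E (Y : bop L (tp E L)) :=
  forall T : bop L L, commutant M T -> forall v, Y (T v) = bopt (bid E) T (Y v).

(* the same for operators between E tensor L and E' tensor L *)
Definition rint E E' (X : bop (tp E L) (tp E' L)) :=
  forall T : bop L L, commutant M T -> forall v, X (bopt (bid E) T v) = bopt (bid E') T (X v).

Definition csq E (Y : bop L (tp E L)) := cint Y /\ fin (bcomp (badj Y) Y).

Lemma lcol_comm E (T : bop L L) (e : E) (z : tp E L) :
  badj (lcol e) (bopt (bid E) T z) = T (badj (lcol e) z).
Proof.
have : bcomp (badj (lcol e)) (bopt (tp := tp) (bid E) T) = bcomp T (badj (lcol e)).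
  by apply: tens_ext => h k; rewrite !bcompE boptE !lcol_adjE bopZ.
by move/(congr1 (fun S : bop _ _ => S z)).
Qed.

Definition ls E (e : E) (Y : bop L (tp E L)) : bop L L := bcomp (badj (lcol e)) Y.

Lemma ls_mem E (e : E) Y : cint Y -> M (ls e Y).
Proof. by move=> hY; apply: (vn_of_comm hM) => T hT v; rewrite !bcompE hY// lcol_comm. Qed.

Lemma cint_comp E E' (Y : bop L (tp E L)) (X : bop (tp E L) (tp E' L)) : cint Y -> rint X -> cint (bcomp X Y).
Proof. by move=> hY hX T hT v; rewrite !bcompE hY// hX. Qed.

Lemma cint_sub E (Y Y' : bop L (tp E L)) : cint Y -> cint Y' -> cint (Y - Y').
Proof. by move=> hY hY' T hT v; rewrite !bsubE hY// hY'// bopB. Qed.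

Lemma cint_mul E (Y Z : bop L (tp E L)) : cint Y -> cint Z -> M (bcomp (badj Z) Y).
Proof.
move=> hY hZ; apply: (vn_of_comm hM) => T hT v; apply: ip_eqP => w.
rewrite !bcompE hY// (badjP T) -!(badjPr Z) hZ; last exact: commutant_adj.
by rewrite (badjP (bopt _ _)) badj_bopt badj_id.
Qed.

Lemma rint_pl E (l : seq E) : rint (pl L l).
Proof.
move=> T hT v; rewrite -!bcompE !bopt_comp; congr (bopt _ _ v); exact: bop_eq.
Qed.

Lemma lsZ E c (e e' : E) Y : ls (c *: e + e') Y = c^*%C *: ls e Y + ls e' Y.
Proof.
apply: bop_eq_ip => x y; rewrite baddE bscaleE ipDl ipZl !bcompE -!badjPr.
by rewrite !lcolE tens_linl ipDr ipZr.
Qed.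

Lemma ls_sum E (Y : bop L (tp E L)) l x : ls (lproj l x) Y = \sum_(e <- l) '[e, x] *: ls e Y.
Proof.
rewrite lprojE; elim: l => [|e l IH].
  by rewrite !big_nil; apply: bop_eq_ip => u v; rewrite bcompE -badjPr lcolE -rcolE bop0 ip0r b0E ip0l.
by rewrite !big_cons lsZ IH [in RHS]ipC.
Qed.

Lemma comp_pl E (Y : bop L (tp E L)) l :
  bcomp (badj Y) (bcomp (pl L l) Y) = \sum_(e <- l) bcomp (badj (ls e Y)) (ls e Y).
Proof.
apply: bop_eq => v; rewrite !bcompE plE bsumE bop_sum; apply: eq_bigr => e _.
by rewrite bcompE badj_comp badjK.
Qed.

Lemma csq_fin E E' (Y : bop L (tp E L)) (X : bop (tp E L) (tp E' L)) : csq Y -> rint X -> csq (bcomp X Y).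
Proof.
move=> [hY fY] hX; have hc := cint_comp hY hX; split => //.
have [k k0 hk] := square_le Y X; have [fk _] := fin_scale hM hphi k0 fY.
by have [] := fin_le hM hphi fk (cint_mul hc hc) (psd_comp_adj _) hk.
Qed.

Lemma ls_sq E (Y : bop L (tp E L)) e : csq Y -> sq (ls e Y).
Proof.
move=> [hY fY]; have Ml := ls_mem e hY; split => //.
have [k k0 hk] := square_le Y (badj (lcol e)); have [fk _] := fin_scale hM hphi k0 fY.
have [] // := fin_le hM hphi fk _ (psd_comp_adj _) hk.
by apply: sa_comp => //; exact: sa_adj.
Qed.

Lemma rip_pl E (Y : bop L (tp E L)) l v : onl l ->
  rip (bcomp (badj Y) (bcomp (pl L l) Y) v) v = nm (pl L l (Y v)) ^+ 2.
Proof.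
move=> ol; by rewrite !bcompE -ripxx [RHS]sa_sym ?pl_sa// pl_idem// /rip -badjPr.
Qed.

Lemma psd_pl E (Y : bop L (tp E L)) l : onl l -> psd (bcomp (badj Y) (bcomp (pl L l) Y)).
Proof.
move=> ol; split; first by rewrite !badj_comp badjK pl_sa; exact: bop_eq.
by move=> v; rewrite rip_pl// sqr_ge0.
Qed.

Lemma ble_pl E (Y : bop L (tp E L)) l : onl l ->
  ble (bcomp (badj Y) (bcomp (pl L l) Y)) (bcomp (badj Y) Y).
Proof.
move=> ol v; rewrite rip_pl// rip_adj_comp ler_sqr ?nnegrE ?nm_ge0//; exact: pl_le.
Qed.

Lemma fin_pl E (Y : bop L (tp E L)) l : csq Y -> onl l ->
  fin (bcomp (badj Y) (bcomp (pl L l) Y)) /\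
  tr (bcomp (badj Y) (bcomp (pl L l) Y)) <= tr (bcomp (badj Y) Y).
Proof.
move=> [hY fY] ol; apply: (fin_le hM hphi fY) => //; [|exact: psd_pl|exact: ble_pl].
by apply: cint_mul => //; apply: cint_comp => //; exact: rint_pl.
Qed.

(** Truncating the outer leg by finite orthonormal projections exhausts the square of a column from
    below, so normality of the weight reduces columns to finitely many slices. *)
Lemma dsup_pl E (Y : bop L (tp E L)) : cint Y ->
  directed_sup M [set y : L -> L | exists2 l : seq E, onl l & y = bcomp (badj Y) (bcomp (pl L l) Y)]
    (bcomp (badj Y) Y).
Proof.
move=> hY; have le (l l' : seq E) : onl l -> onl l' -> (forall x, lproj l x = x -> lproj l' x = x) ->
    ople (bcomp (badj Y) (bcomp (pl L l) Y)) (bcomp (badj Y) (bcomp (pl L l') Y)).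
  move=> ol ol' h; apply/opleP; [exact: (psd_pl Y ol).1|exact: (psd_pl Y ol').1|move=> v].
  rewrite !rip_pl// ler_sqr ?nnegrE ?nm_ge0//.
  have e : pl L l (pl L l' (Y v)) = pl L l (Y v).
    apply: ip_eqP => w; rewrite !(sa_ip _ _ (pl_sa L _)); congr '[_, _].
    exact: pl_fix.
  by rewrite -e; exact: pl_le.
have nil : onl (@nil E) by rewrite /onl.
split.
- move=> _ [l ol ->]; split; last by apply/psdP; exact: psd_pl.
  by apply: cint_mul => //; apply: cint_comp => //; exact: rint_pl.
- by exists (bcomp (badj Y) (bcomp (pl L [::]) Y)), [::].
- move=> _ _ [l ol ->] [l' ol' ->]; have [m [om hm mono]] := gram_schmidt l' ol.
  exists (bcomp (badj Y) (bcomp (pl L m) Y)); split; [by exists m|exact: le|apply: le => // x <-].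
  rewrite (lprojE l') bop_sum [LHS]big_seq [RHS]big_seq; apply: eq_bigr => e he.
  by rewrite bopZ hm.
- exact: bopP.
- move=> _ [l ol ->]; apply/opleP; [exact: (psd_pl Y ol).1|exact: (psd_comp_adj Y).1|exact: ble_pl].
- move=> t /bop_of[t' ->] ht.
  have [st _] := ople_sa (psd_pl Y nil).1 (ht _ (ex_intro2 _ _ _ nil erefl)).
  apply/opleP; [exact: (psd_comp_adj Y).1|exact: st|move=> v].
  rewrite rip_adj_comp; apply/ler_addgt0Pr => e e0.
  have pos : 0 < 2 * nm (Y v) + 1 by have := nm_ge0 (Y v); lra.
  have [l [ol _ hl]] := pl_approx (Y v) nil (divr_gt0 e0 pos).
  have := (opleP (psd_pl Y ol).1 st).1 (ht _ (ex_intro2 _ _ _ ol erefl)) v.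
  rewrite rip_pl//; move: hl; set d := e / _ => hl.
  have dE : d * (2 * nm (Y v) + 1) = e by rewrite divfK// gt_eqF.
  have := nmD (Y v - pl L l (Y v)) (pl L l (Y v)); rewrite subrK.
  have := pl_le (Y v) ol; have := nm_ge0 (pl L l (Y v)); have := nm_ge0 (Y v).
  move: hl dE; set a := nm (Y v); set b := nm (pl _ _ _); set c := nm (_ - _) => *; nra.
Qed.
End Weight.
End Columns.

(** * The GNS map applied to columns *)

Section ColumnVectors.
Context {R : realType} (tp : tensor_choice R).
Implicit Types H K E : hilbert R.
Local Notation "h @ox k" := (tens (tp _ _) h k) (at level 40).
Variables (L : hilbert R) (M : set (L -> L)) (phi : (L -> L) -> \bar R) (Lam : (L -> L) -> L).
Hypotheses (hM : vn_alg M) (hphi : nsf_weight M phi) (hLam : gns_map M phi Lam).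
Let sM := hM.1.
Notation sq := (sq M phi).
Notation fin := (fin M phi).
Notation tr := (tr phi).
Notation csq := (csq (tp := tp) M phi).
Notation pl := (pl tp L).

Lemma gns_scale c (x : bop L L) : sq x -> Lam (c *: x : bop L L) = c *: Lam x.
Proof.
move=> hx; have := gns_linb hM hLam c hx (sq0 hM hphi).
by rewrite (gns_0 hM hphi hLam) !addr0.
Qed.

(* the vector (id tensor Lam)(Y) *)
Definition is_vec E (Y : bop L (tp E L)) (t : tp E L) :=
  forall e k, '[t, e @ox k] = '[Lam (ls e Y), k].

Lemma is_vec_uniq E (Y : bop L (tp E L)) t t' : is_vec Y t -> is_vec Y t' -> t = t'.
Proof.
move=> h h'; apply: tens_eqP => e k; by rewrite [LHS]ipC [RHS]ipC h h'.
Qed.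

Lemma is_vec_pl E (Y : bop L (tp E L)) (l : seq E) t : csq Y -> is_vec Y t ->
  pl l t = \sum_(e <- l) e @ox Lam (ls e Y).
Proof.
move=> hY ht; rewrite plE; apply: eq_bigr => e _; rewrite lcolE; congr tens.
by apply: ip_eqP => k; rewrite -badjPr lcolE ht.
Qed.

Lemma nm_pl E (Y : bop L (tp E L)) (l : seq E) t : csq Y -> onl l ->
  t = \sum_(e <- l) e @ox Lam (ls e Y) ->
  (forall e k, '[t, e @ox k] = '[Lam (ls (lproj l e) Y), k]) /\
  nm t ^+ 2 = tr (bcomp (badj Y) (bcomp (pl l) Y)).
Proof.
move=> hY ol tE.
have sqs e x : sq ('[e, x] *: ls e Y) by apply: sq_scale => //; exact: ls_sq.
have h e k : '[t, e @ox k] = '[Lam (ls (lproj l e) Y), k].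
  rewrite tE ls_sum (gns_sum hM hphi hLam l (fun e' => sqs e' e)).2 !ip_suml.
  by apply: eq_bigr => e' _; rewrite tens_dot gns_scale ?ipZl//; exact: ls_sq.
split => //; have sl e : sq (ls e Y) by exact: ls_sq.
rewrite comp_pl (fin_sum hM hphi l (fun e => (sl e).2)).2 -ripxx {2}tE /rip ip_sumr raddf_sum /=.
rewrite [LHS]big_seq [RHS]big_seq; apply: eq_bigr => e he.
by rewrite h (lproj_mem ol he) -(gns_sq hM hphi hLam)// -ripxx.
Qed.

(** For a finite orthonormal list the vector is the sum of e tensor Lam (ls e Y), with squared norm
    the weight of the truncated square, hence bounded by that of Y. These vectors are consistent on
    larger lists and define a bounded functional on the union of the finite ranges, which Riesz
    represents. *)
Lemma col_vec E (Y : bop L (tp E L)) : csq Y -> exists t, is_vec Y t.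
Proof.
move=> hY; pose u (l : seq E) := \sum_(e <- l) e @ox Lam (ls e Y) : tp E L.
have hu l : onl l -> _ := fun ol => nm_pl hY ol (erefl (u l)).
have nil : onl (@nil E) by rewrite /onl.
have comm (z : tp E L) l l' : onl l -> onl l' -> (forall x, lproj l x = x -> lproj l' x = x) ->
    pl l z = z -> '[z, u l] = '[z, u l'].
  move=> ol ol' mono hz; suff <- : pl l (u l') = u l by rewrite -[LHS](sa_ip _ _ (pl_sa tp L l)) hz.
  apply: tens_eqP => e k; rewrite [LHS]ipC [RHS]ipC; congr _^*%C.
  rewrite (sa_ip _ _ (pl_sa tp L l)) boptE (hu _ ol).1 (hu _ ol').1.
  by rewrite mono// lproj_idem.
pose V := [set z : tp E L | exists2 l, onl l & pl l z = z].
have join (l l' : seq E) : onl l -> exists m, [/\ onl m, forall x, lproj l x = x -> lproj m x = x &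
    forall x, lproj l' x = x -> lproj m x = x].
  move=> ol; have [m [om hm mono]] := gram_schmidt l' ol; exists m; split => // x hx.
  rewrite -hx (lprojE l') bop_sum [LHS]big_seq [RHS]big_seq; apply: eq_bigr => e he.
  by rewrite bopZ hm.
have widen (z : tp E L) l m : onl l -> (forall x, lproj l x = x -> lproj m x = x) ->
    pl l z = z -> pl m z = z.
  by move=> ol h hz; rewrite -hz pl_fix.
pose f z := '[z, u (xget [::] [set l | onl l /\ pl l z = z])].
have fE z l : onl l -> pl l z = z -> f z = '[z, u l].
  move=> ol hz; rewrite /f; case: xgetP => [l' _ [ol' hz']|/(_ l)]; last by case.
  have [m [om h1 h2]] := join l l' ol.
  by rewrite (comm z l' m)// (comm z l m).
have [||||t _ ht] := @riesz_on R _ V f (Num.sqrt (tr (bcomp (badj Y) Y))).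
- split; first by exists [::] => //; rewrite bop0.
  move=> c x y [l ol hx] [l' ol' hy]; have [m [om h1 h2]] := join l l' ol.
  by exists m => //; rewrite bopZD (widen x l)// (widen y l').
- move=> c x y [l ol hx] [l' ol' hy]; have [m [om h1 h2]] := join l l' ol.
  have mx := widen x l m ol h1 hx; have my := widen y l' m ol' h2 hy.
  by rewrite !(fE _ m)// ?bopZD ?mx ?my// ipDl ipZl.
- exact: sqrtr_ge0.
- move=> x [l ol hx]; rewrite (fE _ l)//; apply: le_trans (ip_le _ _) _.
  rewrite mulrC; apply: ler_wpM2r; first exact: nm_ge0.
  apply: sqr_le; first exact: sqrtr_ge0.
  rewrite (hu _ ol).2 sqr_sqrtr; first exact: (fin_pl hM hphi hY ol).2.
  exact: (tr_ge0 hphi hY.2).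
exists t => e k; have [l [ol hl _]] := gram_schmidt [:: e] nil.
have he : lproj l e = e by apply: hl; rewrite mem_head.
have pe : pl l (e @ox k) = e @ox k by rewrite boptE he.
by rewrite ipC ht; [rewrite (fE _ l)// -ipC (hu _ ol).1 he|exists l].
Qed.

Lemma vec_pl E (Y : bop L (tp E L)) (l : seq E) t : csq Y -> is_vec Y t -> onl l ->
  nm (pl l t) ^+ 2 = tr (bcomp (badj Y) (bcomp (pl l) Y)).
Proof. by move=> hY ht ol; have [] := nm_pl hY ol (is_vec_pl l hY ht). Qed.

Lemma vec_nm E (Y : bop L (tp E L)) t : csq Y -> is_vec Y t ->
  nm t ^+ 2 = tr (bcomp (badj Y) Y).
Proof.
move=> hY ht; have nil : onl (@nil E) by rewrite /onl.
apply/eqP; rewrite eq_le; apply/andP; split; apply/ler_addgt0Pr => e e0.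
  have pos : 0 < 2 * nm t + 1 by have := nm_ge0 t; lra.
  have [l [ol _ hl]] := pl_approx t nil (divr_gt0 e0 pos).
  have := (fin_pl hM hphi hY ol).2; rewrite -(vec_pl hY ht ol).
  move: hl; set d := e / _ => hl.
  have dE : d * (2 * nm t + 1) = e by rewrite divfK// gt_eqF.
  have := nmD (t - pl l t) (pl l t); rewrite subrK.
  have := pl_le t ol; have := nm_ge0 (pl l t); have := nm_ge0 t.
  move: hl dE; set a := nm t; set b := nm (pl _ _); set c := nm (_ - _) => *; nra.
have [x [l ol ex] h] := tr_sup hM hphi (dsup_pl hM hY.1) hY.2 e0.
have {}ex : x = bcomp (badj Y) (bcomp (pl l) Y) by apply: bop_eq => v; rewrite ex.
move: h; rewrite ex -(vec_pl hY ht ol) => h.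
have := pl_le t ol; rewrite -ler_sqr ?nnegrE ?nm_ge0// => h'; lra.
Qed.

Lemma vec_defect E (Y : bop L (tp E L)) (l : seq E) t : csq Y -> is_vec Y t -> onl l ->
  tr (bcomp (badj (Y - bcomp (pl l) Y)) (Y - bcomp (pl l) Y)) <= nm (t - pl l t) ^+ 2.
Proof.
move=> hY ht ol; have [f1 _] := fin_pl hM hphi hY ol.
have e : bcomp (badj (Y - bcomp (pl l) Y)) (Y - bcomp (pl l) Y) =
    bcomp (badj Y) Y - bcomp (badj Y) (bcomp (pl l) Y).
  apply: bop_eq => v; rewrite badj_sub badj_comp pl_sa !(bsubE, bcompE) !(bopB (pl l)) !(bopB (badj Y)).
  by rewrite pl_idem// subrr subr0.
rewrite e (fin_sub hM hphi f1 hY.2 (ble_pl Y ol)).2 -(vec_nm hY ht) -(vec_pl hY ht ol).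
have : rip t (pl l t) = nm (pl l t) ^+ 2 by rewrite ripC -ripxx [RHS]sa_sym ?pl_sa// pl_idem.
by rewrite nm_sqrB; lra.
Qed.

(* compatibility of (id tensor Lam) with left multiplication, for a row [rho] *)
Lemma vec_row E (Y : bop L (tp E L)) (rho : bop (tp E L) L) t : csq Y -> is_vec Y t ->
  (forall T : bop L L, commutant M T -> forall v, rho (bopt (bid E) T v) = T (rho v)) ->
  sq (bcomp rho Y) /\ Lam (bcomp rho Y) = rho t.
Proof.
move=> hY ht hr; have [cY fY] := hY.
have mem (Z : bop L (tp E L)) : cint M Z -> M (bcomp rho Z).
  by move=> hZ; apply: (vn_of_comm hM) => T hT v; rewrite !bcompE hZ// hr.
have [k k0 hk] := bop_bound rho.
have fr (Z : bop L (tp E L)) : csq Z -> sq (bcomp rho Z) /\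
    tr (bcomp (badj (bcomp rho Z)) (bcomp rho Z)) <= k ^+ 2 * tr (bcomp (badj Z) Z).
  move=> [cZ fZ]; have [fk <-] := fin_scale hM hphi (sqr_ge0 k) fZ.
  have Mr := mem _ cZ.
  have [|||f h] := fin_le hM hphi (x := bcomp (badj (bcomp rho Z)) (bcomp rho Z)) fk.
  - by apply: sa_comp => //; exact: sa_adj.
  - exact: psd_comp_adj.
  - move=> v; rewrite bscaleE ripZl !rip_adj_comp bcompE -exprMn ler_sqr ?nnegrE ?nm_ge0//.
    by rewrite mulr_ge0// nm_ge0.
  by split.
have [sr _] := fr _ hY; split => //; apply/eqP; rewrite -subr_eq0; apply/eqP.
have nil : onl (@nil E) by rewrite /onl.
apply: (@nm_small0 R _ _ (2 * k)) => [|e e0]; first by lra.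
have [l [ol _ hl]] := pl_approx t nil e0.
have hp : csq (bcomp (pl l) Y) by apply: csq_fin => //; exact: rint_pl.
have hd : csq (Y - bcomp (pl l) Y).
  split; first by apply: cint_sub => //; exact: hp.1.
  have := csq_fin hM hphi hY (X := bid (tp E L) - pl l) _; have -> : bcomp (bid (tp E L) - pl l) Y = Y - bcomp (pl l) Y.
    exact: bop_eq.
  by case => // T hT v; rewrite !bsubE (bopB (bopt _ _)) (rint_pl l hT).
have [sp _] := fr _ hp; have [sd bd] := fr _ hd.
have e1 : Lam (bcomp rho (bcomp (pl l) Y)) = rho (pl l t).
  have -> : bcomp rho (bcomp (pl l) Y) = \sum_(e <- l) bcomp (bcomp rho (lcol e)) (ls e Y).
    by apply: bop_eq => v; rewrite !bcompE plE bsumE bop_sum; apply: eq_bigr => e' _.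
  have Mc e' : M (bcomp rho (lcol e')).
    apply: (vn_of_comm hM) => T hT v; rewrite !bcompE -hr//; congr (rho _).
    by rewrite boptE.
  have sl e' : sq (ls e' Y) by exact: ls_sq.
  have sc e' : sq (bcomp (bcomp rho (lcol e')) (ls e' Y)) by exact: sq_mul.
  rewrite (gns_sum hM hphi hLam l sc).2 (is_vec_pl l hY ht) bop_sum.
  by apply: eq_bigr => e' _; rewrite (gns_mulb hM hLam).
have -> : Lam (bcomp rho Y) - rho t = Lam (bcomp rho (Y - bcomp (pl l) Y)) - rho (t - pl l t).
  have -> : bcomp rho (Y - bcomp (pl l) Y) = bcomp rho Y - bcomp rho (bcomp (pl l) Y).
    by apply: bop_eq => v; rewrite bcompE !bsubE bopB.
  by rewrite (gns_sub hM hLam sr sp) e1 bopB opprB addrA subrK.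
apply: le_trans (nmB _ _) _; have h1 := hk (t - pl l t).
have h2 : nm (Lam (bcomp rho (Y - bcomp (pl l) Y))) <= k * e.
  apply: sqr_le; first by rewrite mulr_ge0// ltW.
  rewrite (gns_sq hM hphi hLam sd); apply: le_trans bd _; rewrite exprMn.
  apply: ler_wpM2l; first exact: sqr_ge0.
  apply: le_trans (vec_defect hY ht ol) _; rewrite ler_sqr ?nnegrE ?nm_ge0//; exact: ltW.
have := ler_wpM2l k0 hl; lra.
Qed.

Lemma vec_map E E' (Y : bop L (tp E L)) (X : bop (tp E L) (tp E' L)) t :
  csq Y -> is_vec Y t -> rint M X -> is_vec (bcomp X Y) (X t).
Proof.
move=> hY ht hX e k.
have [|_ +] := @vec_row E Y (bcomp (badj (lcol e)) X) t hY ht.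
  by move=> T hT v; rewrite !bcompE hX// lcol_comm.
have -> : bcomp (bcomp (badj (lcol e)) X) Y = ls e (bcomp X Y) by exact: bop_eq.
by move=> ->; rewrite bcompE -badjPr.
Qed.

Lemma vec_eq0 E (Y : bop L (tp E L)) : csq Y -> is_vec Y 0 -> Y = 0.
Proof.
move=> hY h0; have := vec_nm hY h0; rewrite nm0 expr0n /= => /esym/(tr_faithful hphi hY.2) e.
apply: bop_eq => v; apply: nm0_eq0; apply/eqP; rewrite -sqrf_eq0 -rip_adj_comp e b0E rip0l//.
Qed.

End ColumnVectors.

(** * The regular representation built from left invariance *)

Section RegularRepresentation.
Context {R : realType} (tp : tensor_choice R).
Implicit Types H K E : hilbert R.
Local Notation "h @ox k" := (tens (tp _ _) h k) (at level 40).

(** The value of f at x as a bundled operator, with 0 as default when f x is not bounded. *)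
Definition hb H K (f : (H -> H) -> (K -> K)) (x : H -> H) : bop K K :=
  xget (0 : bop K K) [set y : bop K K | bfun y = f x].

Section HomBop.
Variables (H K : hilbert R) (A : set (H -> H)) (f : (H -> H) -> (K -> K)).
Hypotheses (sA : star_alg A) (hf : star_hom A f).

Lemma hbE (x : bop H H) : A x -> f x = hb f x.
Proof.
move=> Ax; rewrite /hb; case: xgetP => [y _ <-//|/=]; have [y e] := star_hom_bop hf Ax.
by move=> /(_ y); case.
Qed.

Lemma hb_lin c (x y : bop H H) : A x -> A y -> hb f (c *: x + y : bop H H) = c *: hb f x + hb f y.
Proof.
move=> Ax Ay; apply: bop_eq => v; rewrite -hbE; last exact: sa_lin.
by rewrite baddE bscaleE -!hbE//; have /(congr1 (@^~ v)) := star_hom_lin hf c Ax Ay.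
Qed.

Lemma hb_comp (x y : bop H H) : A x -> A y -> hb f (bcomp x y) = bcomp (hb f x) (hb f y).
Proof.
move=> Ax Ay; apply: bop_eq => v; rewrite -hbE; last exact: sa_comp.
by rewrite bcompE -!hbE//; have /(congr1 (@^~ v)) := star_hom_mul hf Ax Ay.
Qed.

Lemma hb_adj (x : bop H H) : A x -> hb f (badj x) = badj (hb f x).
Proof.
move=> Ax; apply: bop_eq => v; rewrite -hbE; last exact: sa_adj.
have /(congr1 (@^~ v)) := star_hom_adj hf Ax; move=> ->.
by rewrite [in LHS]hbE.
Qed.

Lemma hb_0 : hb f (0 : bop H H) = 0.
Proof.
have A0 := sa_0 sA; apply: bop_eq => v; rewrite -hbE//.
by have -> := star_hom0 hf A0.
Qed.

End HomBop.

Lemma strong_closure_at H (A : set (H -> H)) (x : H -> H) v e : strong_closure A x -> 0 < e ->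
  exists2 y, A y & nm (x v - y v) <= e.
Proof.
move=> hx e0; have : nbhs (x : {ptws hcar H -> hcar H}) [set y : H -> H | ball (x v) e%:C (y v)].
  have h : {for (x : {ptws hcar H -> hcar H}), continuous (fun y : {ptws hcar H -> hcar H} => y v)}.
    exact: (@proj_continuous _ (fun=> hcar H) v).
  by apply: h; apply: nbhsx_ballx; rewrite ltcR.
move=> /hx[y [Ay]]; rewrite /= -ball_normE /= normE ltcR => /ltW h.
by exists y.
Qed.

Variable G : lcqg tp.
Notation L2 := (l2 G).
Notation M := (@linf R tp G).
Notation phi := (@haar R tp G).
Notation Lam := (@gns R tp G).
Notation sq := (sq M phi).
Let hM : vn_alg M := linf_vn G.
Let sM : star_alg M := hM.1.
Let hphi : nsf_weight M phi := haar_nsf G.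
Let hLam : gns_map M phi Lam := gns_haar G.
Let hD : star_hom M (@comul R tp G) := comul_star_hom G.

Definition dl (x : L2 -> L2) : bop (tp L2 L2) (tp L2 L2) := hb (@comul R tp G) x.

Lemma dl_mem (x : bop L2 L2) : M x -> vn_tensor M M (dl x).
Proof. by move=> Mx; rewrite -(hbE hD Mx); apply: comul_image; exists (bfun x). Qed.

Definition dcol (u : L2) (y : bop L2 L2) : bop L2 (tp L2 L2) := bcomp (dl y) (lcol u).

Lemma rint_dl (y : bop L2 L2) : M y -> rint M (dl y).
Proof.
move=> My T hT v; have := vnt_commr sM sM (dl_mem My) hT.
by move/(congr1 (fun S : bop _ _ => S v)).
Qed.

Lemma dcol_cint u (y : bop L2 L2) : M y -> cint M (dcol u y).
Proof. by move=> My T hT v; rewrite !bcompE -rint_dl// boptE. Qed.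

Lemma left_inv u (x : bop L2 L2) : fin M phi x ->
  fin M phi (bsl u u (dl x)) /\ tr phi (bsl u u (dl x)) = nm u ^+ 2 * tr phi x.
Proof.
move=> fx; have [Mx px xoo] := fx.
have := haar_left (nf_vec u sM) (pos_part Mx px) xoo.
have -> : slice_l (fun x : L2 -> L2 => '[x u, u]) (@comul R tp G x) = bsl u u (dl x).
  have q k k' : '[vslice_r k k' (@comul R tp G x) u, u] = '[dl x (u @ox k), u @ox k'].
    by rewrite (hbE hD Mx) vslice_rE bsrE.
  rewrite /slice_l; case: xgetP => [Y _ hY|/(_ (bfun (bsl u u (dl x))))]; last first.
    by case => k k'; rewrite bslE q.
  by apply/funext => k; apply: ip_eqP => k'; rewrite bslE hY q.
have -> : complex.Re '[(idfun : L2 -> L2) u, u] = nm u ^+ 2 by rewrite -ripxx.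
rewrite (finE hphi fx) => e.
have f : fin M phi (bsl u u (dl x)).
  split; last by rewrite e -EFinM ltry.
    exact: (vnt_bsl hM hM u u (dl_mem Mx)).
  have [y ey py] := nhom_pos sM hD (@comul_normal R tp G) Mx px.
  have {ey} -> : dl x = y by apply: bop_eq => v; rewrite -ey -(hbE hD Mx).
  split => [|v]; first by rewrite !badj_comp badjK py.1; exact: bop_eq.
  by rewrite /rip bslE; exact: py.2.
by split => //; apply/eqP; rewrite -eqe -(finE hphi f) e.
Qed.

Lemma dcol_sq u (y : bop L2 L2) : sq y ->
  bcomp (badj (dcol u y)) (dcol u y) = bsl u u (dl (bcomp (badj y) y)).
Proof.
move=> [My _]; have Ma := sa_adj sM My.
by rewrite /dl (hb_comp sM hD Ma My) (hb_adj sM hD My) badj_comp; exact: bop_eq.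
Qed.

Lemma dcol_csq u (y : bop L2 L2) : sq y -> csq M phi (dcol u y).
Proof.
move=> hy; split; first exact: (dcol_cint u hy.1).
by rewrite dcol_sq//; have [] := left_inv u hy.2.
Qed.

(** The image of Delta(y) (u tensor 1) under id tensor Lam, that is, W^* at u tensor Lam y. *)
Definition wv (u : L2) (y : bop L2 L2) : tp L2 L2 := xget 0 [set t | is_vec Lam (dcol u y) t].

Lemma wvP u (y : bop L2 L2) : sq y -> is_vec Lam (dcol u y) (wv u y).
Proof.
move=> hy; rewrite /wv; case: xgetP => [t _ //|].
by have [t ht] := col_vec hM hphi hLam (dcol_csq u hy) => /(_ t).
Qed.

Lemma wv_nm u (y : bop L2 L2) : sq y -> nm (wv u y) = nm u * nm (Lam y).
Proof.
move=> hy; apply/eqP; rewrite -(eqrXn2 (n := 2))// ?mulr_ge0 ?nm_ge0//.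
rewrite (vec_nm hM hphi hLam (dcol_csq u hy) (wvP u hy)) dcol_sq//.
by rewrite (left_inv u hy.2).2 exprMn (gns_sq hM hphi hLam).
Qed.

Lemma wv_lin u c (x y : bop L2 L2) : sq x -> sq y ->
  sq (c *: x + y) /\ wv u (c *: x + y) = c *: wv u x + wv u y.
Proof.
move=> hx hy; have hs : sq (c *: x + y) by apply: (sq_add hM hphi) => //; exact: sq_scale.
split => //; apply: is_vec_uniq (wvP u hs) _ => e k.
have -> : ls e (dcol u (c *: x + y)) = c *: ls e (dcol u x) + ls e (dcol u y).
  apply: bop_eq => v; rewrite baddE bscaleE /ls /dcol !bcompE /dl (hb_lin sM hD c hx.1 hy.1).
  by rewrite baddE bscaleE bopZD.
have h z : sq z -> sq (ls e (dcol u z)) by move=> hz; apply: (ls_sq hM hphi); exact: dcol_csq.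
rewrite (gns_linb hM hLam c (h _ hx) (h _ hy)) !ipDl !ipZl.
by rewrite (wvP u hx) (wvP u hy).
Qed.

Lemma w_ex u : exists T : bop L2 (tp L2 L2), forall y : bop L2 L2, sq y -> T (Lam y) = wv u y.
Proof.
pose I := {y : bop L2 L2 | sq y}.
have hl (l : seq (R[i] * I)) : exists2 y : bop L2 L2, sq y &
    lc (fun i : I => Lam (sval i)) l = Lam y /\ lc (fun i : I => wv u (sval i)) l = wv u y.
  elim: l => [|[c i] l [y hy [e1 e2]]].
    exists 0; first exact: (sq0 hM hphi).
    rewrite !lc_nil (gns_0 hM hphi hLam); split => //; apply/esym/nm0_eq0.
    by rewrite wv_nm ?(gns_0 hM hphi hLam) ?nm0 ?mulr0//; exact: (sq0 hM hphi).
  have [hs e] := wv_lin u c (svalP i) hy; exists (c *: sval i + y) => //.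
  by rewrite !lc_cons e1 e2 e (gns_linb hM hLam c (svalP i) hy).
have [|T [hT _ _]] := @ext_exists R I _ _ (fun i => Lam (sval i)) (fun i => wv u (sval i)) _ (nm_ge0 u).
  by move=> l; have [y hy [-> ->]] := hl l; rewrite wv_nm.
by exists T => y hy; have := hT (exist _ y hy).
Qed.

(* [w u] is the operator a |-> W^* (u tensor a) *)
Definition w (u : L2) : bop L2 (tp L2 L2) :=
  xget (0 : bop L2 (tp L2 L2)) [set T : bop L2 (tp L2 L2) | forall y : bop L2 L2, sq y -> T (Lam y) = wv u y].

Lemma wE u (y : bop L2 L2) : sq y -> w u (Lam y) = wv u y.
Proof.
move: y; rewrite /w; case: xgetP => [T _ //|h y hy].
by have [T hT] := w_ex u; case: (h T).
Qed.

Lemma w_vec u (y : bop L2 L2) : sq y -> is_vec Lam (dcol u y) (w u (Lam y)).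
Proof. by move=> hy; rewrite wE//; exact: wvP. Qed.

Lemma gns_ext E (S T : bop L2 E) : (forall y : bop L2 L2, sq y -> S (Lam y) = T (Lam y)) -> S = T.
Proof.
move=> h; apply: (@bop_eq_total R _ _ {y : bop L2 L2 | sq y} (fun i => Lam (sval i))).
  by move=> z hz; apply: (gns_total hM hLam) => y hy; apply: hz; exists (exist _ y hy).
by move=> [y hy]; exact: h.
Qed.

Lemma w_lin c u u' : w (c *: u + u') = c *: w u + w u'.
Proof.
apply: gns_ext => y hy; rewrite baddE bscaleE; apply: is_vec_uniq (w_vec _ hy) _ => e k.
have -> : ls e (dcol (c *: u + u') y) = c *: ls e (dcol u y) + ls e (dcol u' y).
  by apply: bop_eq => v; rewrite baddE bscaleE /ls /dcol !bcompE !lcolE tens_linl !bopZD.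
have h z : sq (ls e (dcol z y)) by apply: (ls_sq hM hphi); exact: dcol_csq.
by rewrite (gns_linb hM hLam c (h _) (h _)) !ipDl !ipZl (w_vec _ hy) (w_vec _ hy).
Qed.

(** Left invariance for the vector functional of u gives |w u (Lam y)| = |u| |Lam y|; density of the
    Lam y and polarisation do the rest. In other words W^* is isometric. *)
Lemma w_ip u u' a b : '[w u a, w u' b] = '[u, u'] * '[a, b].
Proof.
have sqE v : badj (bcomp (badj (w v)) (w v) - (nm v ^+ 2)%:C *: bid L2) =
    bcomp (badj (w v)) (w v) - (nm v ^+ 2)%:C *: bid L2.
  by rewrite badj_sub badj_comp badjK badj_scaler badj_id.
have nmw v x : nm (w v x) = nm v * nm x.
  have [k k0 hk] := bop_bound (w v).
  apply/eqP; rewrite -subr_eq0 -normr_eq0 eq_le normr_ge0 andbT.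
  apply/ler_addgt0Pr => e e0; rewrite add0r.
  have v0 := nm_ge0 v; have pos : 0 < k + nm v + 1 by lra.
  have : in_closure (Lam @` sq_integrable M phi) x by apply: closure_in; rewrite (gns_dense hLam).
  move=> /(_ _ (divr_gt0 e0 pos))[_ [y hy <-]].
  have [y' My' ey] := sa_bop sM hy.1; rewrite {}ey in hy *.
  have {}hy : sq y' by apply/(sqP phi hM).
  set d := e / _ => hd; have dE : d * (k + nm v + 1) = e by rewrite divfK// gt_eqF.
  have h1 := wv_nm v hy; rewrite -wE// in h1.
  have n1 (h : hilbert R) (z z' : h) : `|nm z - nm z'| <= nm (z - z') :> R.
    by rewrite ler_norml; have := nmD (z - z') z'; have := nmD (z' - z) z; rewrite !subrK (nmBC z' z); lra.
  have h2 := n1 _ (w v x) (w v (Lam y')); rewrite -bopB in h2.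
  have h3 := hk (x - Lam y'); have h4 := n1 _ x (Lam y').
  have -> : nm (w v x) - nm v * nm x = (nm (w v x) - nm (w v (Lam y'))) - nm v * (nm x - nm (Lam y')).
    by rewrite h1; ring.
  apply: le_trans (ler_normB _ _) _; rewrite normrM (ger0_norm v0).
  have h5 := ler_wpM2l k0 hd; have h6 := ler_wpM2l v0 (le_trans h4 hd).
  have d0 : 0 < d by rewrite divr_gt0.
  by lra.
apply/eqP; rewrite -subr_eq0; apply/eqP.
apply: (@polar R _ (fun u u' => '[w u a, w u' b] - '[u, u'] * '[a, b])) u u'.
- by move=> c u v d; rewrite w_lin baddE bscaleE !ipDl !ipZl; ring.
- by move=> c u v d; rewrite w_lin baddE bscaleE !ipDr !ipZr; ring.
move=> v; have : bcomp (badj (w v)) (w v) - (nm v ^+ 2)%:C *: bid L2 = 0.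
  apply: ext_quad => x; rewrite (sa_quad _ (sqE v)) bsubE ripBl rip_adj_comp bscaleE ripZl ripxx.
  by rewrite nmw exprMn subrr.
move=> /(congr1 (fun S : bop _ _ => '[S a, b])).
by rewrite bsubE ipBl bcompE -badjPr bscaleE ipZl b0E ip0l ipxx.
Qed.

(** Left multiplication by Delta(x) takes the column of y to that of x y, and id tensor Lam respects
    left multiplication. *)
Lemma dl_w (x : bop L2 L2) u v : M x -> dl x (w u v) = w u (x v).
Proof.
move=> Mx; rewrite -!bcompE; congr (bfun _ v); apply: gns_ext => y hy; rewrite !bcompE.
rewrite -(gns_mulb hM hLam Mx hy).
have h := vec_map hM hphi hLam (dcol_csq u hy) (w_vec u hy) (rint_dl Mx).
apply: is_vec_uniq h _ => e k; rewrite (w_vec u (sq_mul hM hphi Mx hy)).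
by rewrite /dcol /dl (hb_comp sM hD Mx hy.1); congr '[Lam (bfun _), k]; exact: bop_eq.
Qed.

(** Delta(y) commutes with T tensor 1 for T in the commutant, so the first leg of W^* lies in M. *)
Lemma w_comm (T : bop L2 L2) u v : commutant M T -> w (T u) v = bl tp L2 T (w u v).
Proof.
move=> hT; rewrite -bcompE; congr (bfun _ v); apply: gns_ext => y hy; rewrite !bcompE.
have hr : rint M (bl tp L2 T).
  by move=> S hS z; rewrite -!bcompE !bopt_comp; congr (bfun (bopt _ _) z); exact: bop_eq.
have h := vec_map hM hphi hLam (dcol_csq u hy) (w_vec u hy) hr.
apply: is_vec_uniq (w_vec _ hy) _ => e k; rewrite h; congr '[Lam (bfun (bcomp _ _)), k].
apply: bop_eq => z; rewrite !bcompE.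
have := vnt_comml sM sM (dl_mem hy.1) hT => /(congr1 (fun S : bop _ _ => S (u @ox z))).
by rewrite !bcompE boptE.
Qed.

End RegularRepresentation.

(** * Implementation of the comultiplication and slices of W *)

Section Implementation.
Context {R : realType} (tp : tensor_choice R).
Implicit Types H K E : hilbert R.
Local Notation "h @ox k" := (tens (tp _ _) h k) (at level 40).
Variable G : lcqg tp.
Notation L2 := (l2 G).
Notation M := (@linf R tp G).
Notation phi := (@haar R tp G).
Notation Lam := (@gns R tp G).
Notation sq := (sq M phi).
Let hM : vn_alg M := linf_vn G.
Let sM : star_alg M := hM.1.
Let hphi : nsf_weight M phi := haar_nsf G.
Let hLam : gns_map M phi Lam := gns_haar G.
Let hD : star_hom M (@comul R tp G) := comul_star_hom G.

Lemma sq_total (z : L2) : (forall y : bop L2 L2, sq y -> y z = 0) -> z = 0.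
Proof.
move=> h; apply: (@nm_small0 R _ _ 1) => // e e0.
have [y Ny hy] := strong_closure_at z (weight_semifinite hphi (vn_id hM)) e0.
have [y' My' ey] := sa_bop sM Ny.1; rewrite {}ey in hy Ny.
have hs : sq y' by apply/(sqP phi hM).
by move: hy; rewrite (h _ hs) subr0 mul1r.
Qed.

(* The closed span of the vectors below is invariant under 1 (x) M' and Delta(M), so it reduces to
   [vec_eq0] for the complementary projection. *)
Lemma w_total (z : tp L2 L2) :
  (forall (T : bop L2 L2) u v, commutant M T -> '[bopt (bid L2) T (w u v), z] = 0) -> z = 0.
Proof.
pose S : set (tp L2 L2) := [set z | exists (T : bop L2 L2) u v, commutant M T /\ z = bopt (bid L2) T (w u v)].
move=> hz; have [P hP] := span_proj S; have [sP PP PS P0] := hP.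
pose Q := bid (tp L2 L2) - P.
have hQ : rint M Q.
  move=> T hT v; have mem (T' : bop L2 L2) : commutant M T' -> forall x, S x -> P (bopt (bid L2) T' x) = bopt (bid L2) T' x.
    move=> hT' _ [U [u [a [hU ->]]]]; apply: PS; exists (bcomp T' U), u, a.
    split; first exact: commutant_comp.
    by rewrite -!bcompE bopt_comp; congr (bfun (bcomp (bopt _ _) _) a); exact: bop_eq.
  rewrite !bsubE (bopB (bopt _ _)) (proj_commute hP (T := bopt (bid L2) T)) => //; first exact: mem.
  by rewrite badj_bopt badj_id; apply: mem; exact: commutant_adj.
have Qw u v : Q (w u v) = 0.
  rewrite bsubE PS ?subrr//; exists (bid L2), u, v; split; last by rewrite bopt_id.
  by apply/commutantP.
have Qd y : sq y -> bcomp Q (dl y) = 0.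
  move=> hy; apply: tens_ext => u v; rewrite bcompE b0E.
  have hc := csq_fin hM hphi (dcol_csq u hy) hQ.
  have ht := vec_map hM hphi hLam (dcol_csq u hy) (w_vec u hy) hQ; rewrite Qw in ht.
  by have /(congr1 (fun S : bop _ _ => S v)) := vec_eq0 hM hphi hLam hc ht.
(* Sums of squares over Y have square integrable transforms increasing to 1. By normality Delta of
   them tends strongly to 1, and Q Delta(y) = 0 for square integrable y then gives Q z = 0. *)
pose Y : set (L2 -> L2) := [set y : L2 -> L2 | exists2 y' : bop L2 L2, y = bfun y' & sq (badj y')].
have gsq ys : (forall y, y \in ys -> Y (bfun y)) -> sq (gg (ssum ys)).
  move=> hys; have sk : sq (ssum ys).
    rewrite /ssum; elim: ys hys => [|y ys IH] h; first by rewrite big_nil; exact: (sq0 hM hphi).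
    rewrite big_cons; apply: (sq_add hM hphi); last by apply: IH => y' hy'; apply: h; rewrite inE hy' orbT.
    have [y' e hy'] := h y (mem_head _ _); have {e} -> : y = y' by apply: bop_eq => v; rewrite e.
    apply: (sq_mul hM hphi) => //; rewrite -(badjK y'); exact: (sa_adj sM hy'.1).
  have pk := ssum_psd ys; have Mg := gg_mem pk (vn_closed hM) sM sk.1.
  have -> : gg (ssum ys) = bcomp (bid L2 - gg (ssum ys)) (ssum ys).
    apply: bop_eq => v; rewrite [RHS]bcompE bsubE (ggE pk (ssum ys v)) [RHS]subKr.
    by have /(congr1 (fun S : bop _ _ => S v)) := res_comm pk (T := ssum ys) erefl.
  by apply: (sq_mul hM hphi) => //; apply: sa_sub => //; exact: vn_id.
have hid : is_proj [set z | exists (y : bop L2 L2) v, Y y /\ z = y v] (bid L2).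
  split => //; first exact: badj_id.
  move=> x hx; apply: sq_total => y hy; apply: ip_eqP => v.
  rewrite badjP ip0l ipC hx ?conjc0//; exists (badj y), v; split => //; exists (badj y) => //.
  by rewrite badjK.
have hdir := approx_unit (fun ys hys => (gsq ys hys).1) hid.
have hdir' := nhom_dsup sM hD (@comul_normal R tp G) hdir.
have e1 : @comul R tp G (bid L2) = bid (tp L2 L2) by exact: comul_unital.
rewrite e1 in hdir'.
have Qz : Q z = 0.
  have [k k0 hk] := bop_bound Q; apply: (nm_small0 k0) => e e0.
  have [x Dx /(_ x Dx (fun _ => lexx _)) hx] := vigier (bounded_star _) hdir' z e0.
  have [_ [ys hys ->] ex] := Dx.
  have {ex} <- : Q (z - x z) = Q z.
    rewrite bopB -ex (hbE hD (gsq ys hys).1).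
    by have /(congr1 (fun S : bop _ _ => S z)) := Qd _ (gsq ys hys); rewrite bcompE => ->; rewrite subr0.
  by apply: le_trans (hk _) _; rewrite ler_wpM2l.
have : P z = 0 by apply: P0 => _ [T [u [v [hT ->]]]]; exact: hz.
by move=> Pz; move: Qz; rewrite bsubE Pz subr0.
Qed.

Lemma wst_ex : exists T : bop (tp L2 L2) (tp L2 L2), forall u a, T (u @ox a) = w u a.
Proof.
have [|T [hT _ _]] := @gram_ext R _ _ _ (@tsr R tp L2 L2) (fun p => w p.1 p.2) 1 ler01.
  by move=> [u a] [u' b]; rewrite mul1r w_ip tens_dot.
by exists T => u a; rewrite (hT (u, a)).
Qed.

Definition wst : bop (tp L2 L2) (tp L2 L2) :=
  xget (0 : bop _ _) [set T : bop (tp L2 L2) (tp L2 L2) | forall u a, T (u @ox a) = w u a].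

Lemma wstE u a : wst (u @ox a) = w u a.
Proof.
move: u a; rewrite /wst; case: xgetP => [T _ //|h u a].
by have [T hT] := wst_ex; case: (h T).
Qed.

(** The defining relation fixes adj W on the total set of vectors h tensor Lam y, so W is a single
    operator, the adjoint of [wst]. *)
Lemma left_regular_wst (W : tp L2 L2 -> tp L2 L2) : left_regular W <-> W = badj wst.
Proof.
have key y h h' k : sq y -> '[w h (Lam y), h' @ox k] = '[Lam (vslice_l h h' (@comul R tp G y)), k].
  by move=> hy; rewrite (w_vec h hy) (hbE hD hy.1) vslice_lE.
split=> [[/bop_of[W' ->] hW]|->].
  congr bfun; rewrite -(badjK W'); congr badj; apply: tens_ext => h a; rewrite wstE.
  suff {a} <- : bcomp (badj W') (lcol h) = w h by []; apply: gns_ext => y hy.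
  apply: tens_eqP => h' k; rewrite [LHS]ipC [RHS]ipC; congr _^*%C.
  by rewrite bcompE lcolE (key y)// hW//; apply/(sqP phi hM).
split; first exact: bopP.
move=> x h h' k hx; have [x' Mx' ex] := sa_bop sM hx.1; rewrite {}ex in hx *.
rewrite -[adj _]/(bfun (badj (badj wst))) badjK wstE key//; exact/(sqP phi hM).
Qed.

(* the right slices (id tensor omega_(f,e))(W^* ) *)
Definition cc (f e : L2) : bop L2 L2 := bsr f e wst.

Lemma ccE f e u u' : '[cc f e u, u'] = '[w u f, u' @ox e].
Proof. by rewrite bsrE wstE. Qed.

Lemma c0E : @c0 R tp G = cspan [set a | exists f e, a = bfun (badj (cc f e))].
Proof.
congr cspan; apply/seteqP; split => a.
  move=> [W [k [k' [/left_regular_wst -> ->]]]]; exists k', k; rewrite vslice_rE; congr bfun.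
  apply: bop_eq_ip => h h'; rewrite bsrE -badjPr wstE.
  by rewrite -[RHS]badjPr [RHS]ipC ccE -ipC.
move=> [f [e ->]]; exists (badj wst), e, f; split; first exact/left_regular_wst.
rewrite vslice_rE; congr bfun; apply: bop_eq_ip => h h'.
by rewrite -[LHS]badjPr [LHS]ipC ccE -ipC bsrE -badjPr wstE.
Qed.

(** The intertwiners a |-> (1 tensor T) w u a with T in the commutant: each carries x to Delta(x),
    their ranges together are total, and they are the family along which Delta is amplified. *)
Definition iw (i : {T : bop L2 L2 | commutant M T} * L2) : bop L2 (tp L2 L2) :=
  bcomp (bopt (bid L2) (sval i.1)) (w i.2).

Lemma dl_iw (x : bop L2 L2) i v : M x -> dl x (iw i v) = iw i (x v).
Proof. by move=> Mx; rewrite !bcompE (rint_dl Mx (svalP i.1)) dl_w. Qed.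

Lemma iw_comm i j : commutant M (bcomp (badj (iw j)) (iw i)).
Proof.
apply/commutantP => x Mx v; have [x' Mx' ex] := sa_bop sM Mx; rewrite {}ex in Mx *.
apply: ip_eqP => y.
change ('[badj (iw j) (iw i (x' v)), y] = '[x' (badj (iw j) (iw i v)), y]).
rewrite -(dl_iw i v Mx') -(badjPr (iw j)) (badjP x') -(badjPr (iw j)).
by rewrite -(dl_iw j y (sa_adj sM Mx')) /dl (hb_adj sM hD Mx') -badjP.
Qed.

Lemma iw_total (z : tp L2 L2) : (forall i v, '[iw i v, z] = 0) -> z = 0.
Proof. by move=> h; apply: w_total => T u v hT; exact: (h (exist _ T hT, u) v). Qed.

(** If u is orthogonal to every slice, then u tensor u is orthogonal to all (1 tensor T) w a f: take
    the slice at f and e = (adj T) u. *)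
Lemma c0_total u : (forall f e a, '[cc f e a, u] = 0) -> u = 0.
Proof.
move=> h; have u0 : u @ox u = 0.
  apply: w_total => T a f hT; rewrite badjP badj_bopt badj_id boptE.
  exact: (etrans (esym (ccE _ _ _ _)) (h _ _ _)).
by apply: nm0_eq0; apply/eqP; rewrite -sqrf_eq0 expr2 -(nm_tens tp) u0 nm0.
Qed.

End Implementation.

(** * The homomorphism Delta tensor id and the coaction identity on slices *)

Section Coassociativity.
Context {R : realType} (tp : tensor_choice R).
Implicit Types H K E : hilbert R.
Local Notation "h @ox k" := (tens (tp _ _) h k) (at level 40).
Variable G : lcqg tp.
Notation L2 := (l2 G).
Notation M := (@linf R tp G).
Let hM : vn_alg M := linf_vn G.
Let sM : star_alg M := hM.1.
Let hD : star_hom M (@comul R tp G) := comul_star_hom G.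

(* Theta = Delta tensor id *)
Definition th H (X : tp L2 H -> tp L2 H) : tp (tp L2 L2) H -> tp (tp L2 L2) H :=
  amp (@iw R tp G) X.

Section Theta.
Variable H : hilbert R.

Lemma thE (X : bop (tp L2 H) (tp L2 H)) : lint M X ->
  exists2 T : bop (tp (tp L2 L2) H) (tp (tp L2 L2) H), th X = T &
    forall i v, T (bl tp H (iw i) v) = bl tp H (iw i) (X v).
Proof. exact: (ampP hM (@iw_comm R tp G)). Qed.

Lemma vnt_lint (N : set (H -> H)) (X : bop (tp L2 H) (tp L2 H)) : vn_alg N ->
  vn_tensor M N X -> lint M X.
Proof.
move=> hN hX T hT v; have := vnt_comml sM hN.1 hX hT.
by move/(congr1 (fun S : bop _ _ => S v)).
Qed.

Lemma th_hom (N : set (H -> H)) : vn_alg N ->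
  [/\ star_hom (vn_tensor M N) (@th H), normal_map (vn_tensor M N) (@th H) &
    forall (x : bop L2 L2) (y : bop H H), M x -> N y ->
      th (bopt (tp := tp) x y) = optens (tp := tp) (@comul R tp G x) y].
Proof.
move=> hN.
have hi (x : bop L2 L2) i v : M x -> comul (l := G) x (iw i v) = iw i (x v).
  by move=> Mx; rewrite (hbE hD Mx); exact: dl_iw.
exact: (amp_hom tp hM (@iw_comm R tp G) (@iw_total R tp G) hN hD hi).
Qed.

Lemma vnt_hom_th (N : set (H -> H)) (X : bop (tp L2 H) (tp L2 H)) : vn_alg N ->
  vn_tensor M N X -> vn_tensor_hom M N (@comul R tp G) idfun X = th X.
Proof.
move=> hN hX; have [h1 h2 h3] := th_hom hN.
rewrite /vn_tensor_hom; case: xgetP => [F _ [g1 g2 g3]|/(_ (@th H))]; last first.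
  by case; split => // x y /(sa_bop sM)[x' Mx' ->] /(sa_bop hN.1)[y' Ny' ->]; exact: h3.
by apply: (nhom_uniq hM hN g1 g2 h1 h2) => // x y Mx Ny; rewrite [LHS]g3// -h3.
Qed.

Variables (N : set (H -> H)) (DN : (H -> H) -> (tp L2 H -> tp L2 H)).
Hypotheses (hN : vn_alg N) (hDN : star_hom N DN) (nDN : normal_map N DN)
  (uDN : DN idfun = idfun) (iDN : DN @` N `<=` vn_tensor M N)
  (cDN : forall x, N x ->
    @assoc R tp L2 L2 H \o vn_tensor_hom M N (@comul R tp G) idfun (DN x) =
    vn_tensor_hom M N idfun DN (DN x) \o @assoc R tp L2 L2 H).

Lemma hb_vnt (x : bop H H) : N x -> vn_tensor M N (hb DN x).
Proof. by move=> Nx; rewrite -(hbE hDN Nx); apply: iDN; exists (bfun x). Qed.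

(** The abstract homomorphisms of the coaction identity become explicit: Delta tensor id is [th] by
    uniqueness of normal homomorphisms, and id tensor DN is evaluated through its slices. *)
Lemma coassoc_slice (x : bop H H) a b v a' b' v' : N x ->
  '[th (hb DN x) ((a @ox b) @ox v), (a' @ox b') @ox v'] =
  '[hb DN (bsl a a' (hb DN x)) (b @ox v), b' @ox v'].
Proof.
move=> Nx; have hX := hb_vnt Nx; have [T eT hT] := thE (vnt_lint hN hX).
have Nb c c' : N (bsl c c' (hb DN x)) by exact: (vnt_bsl hM hN c c' hX).
have [ex|nex] := pselect (exists F, [/\ star_hom (vn_tensor M N) F, normal_map (vn_tensor M N) F &
    forall y z, M y -> N z -> F (optens (tp := tp) y z) = optens (tp := tp) (idfun y) (DN z)]).
  have [F [h1 h2 h3] eF] : exists2 F, [/\ star_hom (vn_tensor M N) F, normal_map (vn_tensor M N) F &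
      forall y z, M y -> N z -> F (optens (tp := tp) y z) = optens (tp := tp) (idfun y) (DN z)] &
      vn_tensor_hom M N idfun DN = F.
    rewrite /vn_tensor_hom; case: xgetP => [F _ hF|h]; first by exists F.
    by have [F hF] := ex; have [] := h F hF.
  have := cDN Nx; rewrite (hbE hDN Nx) (vnt_hom_th hN hX) eF eT.
  move=> e0; have {e0} e : basc (T ((a @ox b) @ox v)) = F (hb DN x) (basc ((a @ox b) @ox v)).
    exact: (congr1 (@^~ ((a @ox b) @ox v)) e0).
  rewrite bascE in e.
  have -> : '[T ((a @ox b) @ox v), (a' @ox b') @ox v'] = '[basc (T ((a @ox b) @ox v)), a' @ox (b' @ox v')].
    by rewrite [RHS](badjP basc) basc_adjE.
  rewrite e (slice_hom hM hN hDN nDN h1 h2 h3 a a' _ _ hX).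
  by rewrite (hbE hDN (Nb _ _)).
(* If no homomorphism id tensor DN existed, the default 0 would stand for it; the coaction identity
   at the unit would then annihilate the whole triple tensor product, and both sides vanish. *)
have zero (z : tp (tp L2 L2) H) : z = 0.
  have Nid := vn_id hN; have hid := hb_vnt Nid.
  have := cDN Nid; rewrite (hbE hDN Nid) (vnt_hom_th hN hid).
  have -> : hb DN (bid H) = bid _ by apply: bop_eq => u; rewrite -(hbE hDN Nid) [DN _]uDN.
  have -> : th (bid (tp L2 H)) = bid _.
    by apply: (amp_uniq hM (@iw_comm R tp G) (@iw_total R tp G)).
  have -> : vn_tensor_hom M N idfun DN = 0 :> ((tp L2 H -> tp L2 H) -> (tp L2 (tp L2 H) -> tp L2 (tp L2 H))).
    by rewrite /vn_tensor_hom; case: xgetP => [F _ hF|//]; case: nex; exists F.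
  move=> e; rewrite -(bascK z).
  have -> : basc z = 0 by exact: (congr1 (@^~ z) e).
  by rewrite bop0.
rewrite eT (zero (T _)) ip0l.
have : (a @ox b) @ox v = 0 by exact: zero.
move=> /(congr1 (@nm _ _)); rewrite nm_tens nm_tens nm0 -mulrA => /eqP.
rewrite mulf_eq0 nm_eq0 -(nm_tens tp) nm_eq0 => /orP[/eqP ->|/eqP ->]; last by rewrite bop0 ip0l.
have -> : bsl 0 a' (hb DN x) = 0.
  by apply: bop_eq_ip => k k'; rewrite bslE -rcolE !bop0 b0E !ip0l.
by rewrite (hb_0 hN.1 hDN) b0E ip0l.
Qed.

End Theta.
End Coassociativity.

(** * Tail estimates for a weight and closability of the adjoint operation *)

Section Closability.
Context {R : realType}.
Implicit Types H K E : hilbert R.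
Variables (L : hilbert R) (M : set (L -> L)) (phi : (L -> L) -> \bar R).
Hypotheses (hM : vn_alg M) (hphi : nsf_weight M phi).
Let sM := hM.1.
Notation sq := (sq M phi).
Notation fin := (fin M phi).
Notation tr := (tr phi).

(** Induction on j with |a + b|^2 <= 2 |a|^2 + 2 |b|^2: each step doubles the weight, and the
    geometric weights pay for any number of summands. *)
Lemma weighted_sum_le E (Z : nat -> bop L E) m j u :
  2 ^+ m * nm (\sum_(m <= i < m + j) Z i u) ^+ 2 <=
  rip (psum (fun i => (2 ^+ i.+1)%:C *: bcomp (badj (Z i)) (Z i)) m j u) u.
Proof.
elim: j m => [|j IH] m.
  by rewrite addn0 /psum !addn0 !big_geq// nm0 expr0n mulr0 b0E rip0l.
rewrite psumSl baddE ripDl bscaleE ripZl rip_adj_comp addnS big_ltn ?ltnS ?leq_addr//.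
have := IH m.+1; rewrite addSn.
set S := \sum_(_ <= _ < _) _; have := sqr_ge0 (nm (Z m u - S)).
rewrite nm_sqrB nm_sqrD (exprS 2 m) => h1 h2.
have p : 0 <= 2 ^+ m :> R by rewrite exprn_ge0.
apply: le_trans (lerD (lexx _) h2); move: (2 ^+ m) p h1 => q p h1.
by rewrite -subr_ge0; have := mulr_ge0 p h1; congr (0 <= _); ring.
Qed.

(** The weights 2^(i+1) turn 8^-i into 2 4^-i, so the weighted squares keep a summable weight with
    tail at most 4 4^-m; g m is the tail supremum of their transforms. For the last bound v = res k
    v + gg k v: the form of k controls the first part, the uniform bound c the second. *)
Lemma tails E (Z : nat -> bop L E) :
  (forall n, fin (bcomp (badj (Z n)) (Z n))) ->
  (forall n, tr (bcomp (badj (Z n)) (Z n)) <= 8^-1 ^+ n) ->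
  exists g : nat -> bop L L, [/\ forall m, fin (g m) /\ tr (g m) <= 4 * 4^-1 ^+ m,
    forall x, cvs (fun m => g m x) 0,
    forall m, ble (gg (bcomp (badj (Z m)) (Z m))) (g m) &
    forall m j c v, 0 <= c -> (forall u, nm (\sum_(m <= i < m + j) Z i u) <= c * nm u) ->
      nm (\sum_(m <= i < m + j) Z i v) ^+ 2 <= (1 + c) ^+ 2 * rip (g m v) v].
Proof.
move=> fZ tZ; pose a i := (2 ^+ i.+1)%:C *: bcomp (badj (Z i)) (Z i).
have p2 i : 0 <= 2 ^+ i :> R by rewrite exprn_ge0.
have fa i := fin_scale hM hphi (p2 i.+1) (fZ i).
have pa i : psd (a i) by have [[]] := fa i.
have Ma i : M (a i) by have [[]] := fa i.
have ta i : tr (a i) <= 2 * 4^-1 ^+ i.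
  rewrite (fa i).2; apply: le_trans (ler_wpM2l (p2 _) (tZ i)) _.
  by rewrite exprS -mulrA -exprMn; have -> : 2 * 8^-1 = 4^-1 :> R by lra.
have q0 : 0 <= 4^-1 :> R by lra.
have [G_ [G [G1 G2 G3 _ [pG MG GG Gc _]]]] := tail_sup hM pa Ma.
have fp m j : fin (psum a m j) /\ tr (psum a m j) <= 4 * 4^-1 ^+ m.
  have [f e] := fin_sum hM hphi (index_iota m (m + j)) (fun i => (fa i).1).
  split => //; rewrite [tr _]e.
  have : \sum_(m <= i < m + j) tr (a i) <= \sum_(m <= i < m + j) 2 * 4^-1 ^+ i.
    by apply: ler_sum => i _; exact: ta.
  rewrite -mulr_sumr => h; have := geo_tail m j q0 (ltac:(lra) : 4^-1 < 1 :> R).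
  have -> : (1 - 4^-1)^-1 = 4 / 3 :> R by field.
  have : 0 <= 4^-1 ^+ m :> R by rewrite exprn_ge0.
  by move: h; set S := \sum_(_ <= _ < _) 4^-1 ^+ _; rewrite /a; set S' := \sum_(_ <= _ < _) _; lra.
have fg m j : fin (gg (psum a m j)) /\ tr (gg (psum a m j)) <= 4 * 4^-1 ^+ m.
  have [f t] := fp m j; have pp := psum_psd m j pa.
  have Mp : M (psum a m j) by have [] := f.
  have [f' t'] := fin_le hM hphi f (gg_mem pp (vn_closed hM) sM Mp) (gg_psd pp) (gg_le_self pp).
  by split => //; exact: le_trans t' t.
have fG m : fin (G_ m) /\ tr (G_ m) <= 4 * 4^-1 ^+ m.
  apply: (fin_sup hM hphi (G3 m)); first by have [] := G1 m.
  by move=> x [j _ ex]; have -> : x = gg (psum a m j) by apply: bop_eq => v; rewrite -ex.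
have G0 : G = 0.
  have h m := fin_le hM hphi (fG m).1 MG pG (GG m).
  apply: (tr_faithful hphi (h 0%N).1); apply/eqP; rewrite eq_le (tr_ge0 hphi (h 0%N).1) andbT.
  apply/ler_addgt0Pr => e e0; rewrite add0r.
  have [n0 hn] := geometric_small (ler0n R 4) q0 (ltac:(lra) : 4^-1 < 1 :> R) e0.
  by apply: le_trans (h n0).2 _; apply: le_trans (fG n0).2 _; exact: hn.
exists G_; split => //.
- by move=> x; have := Gc x; rewrite G0.
- move=> m; have := G2 m 1%N; rewrite psum1 => h v; apply: le_trans (h v).
  apply: gg_mono; [exact: psd_comp_adj|exact: pa|move=> w].
  rewrite bscaleE ripZl ler_peMl//; first exact: (psd_comp_adj (Z m)).2.
  by rewrite exprn_ege1// ler1n.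
move=> m j c v c0 hc; have pk := psum_psd m j pa; set k := psum a m j in pk.
pose B u := \sum_(m <= i < m + j) Z i u.
have BD u w : B (u + w) = B u + B w by rewrite /B -big_split; apply: eq_bigr => i _; rewrite bopD.
set s := Num.sqrt (rip (gg k v) v).
have s2 : s ^+ 2 = rip (gg k v) v by rewrite sqr_sqrtr//; exact: (gg_psd pk).2.
have s0 : 0 <= s by exact: sqrtr_ge0.
have h1 : nm (B (res k v)) <= s.
  apply: sqr_le => //; rewrite s2; apply: le_trans (gg_res_le pk v).
  apply: le_trans (weighted_sum_le Z m j (res k v)).
  by rewrite ler_peMl ?sqr_ge0// exprn_ege1// ler1n.
have h2 : nm (B (gg k v)) <= c * s.
  apply: le_trans (hc _) _; apply: ler_wpM2l => //; apply: sqr_le => //.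
  by rewrite s2; exact: gg_sqr_le.
have h3 : nm (B v) <= (1 + c) * s.
  have -> : v = res k v + gg k v by rewrite (ggE pk) addrC subrK.
  by rewrite BD; apply: le_trans (nmD _ _) _; rewrite mulrDl mul1r lerD.
have h4 : rip (gg k v) v <= rip (G_ m v) v by exact: G2.
apply: le_trans (_ : ((1 + c) * s) ^+ 2 <= _).
  by rewrite ler_sqr ?nnegrE ?nm_ge0 ?mulr_ge0// addr_ge0.
by rewrite exprMn s2; apply: ler_wpM2l => //; exact: sqr_ge0.
Qed.

Variable (Lam : (L -> L) -> L).
Hypothesis hLam : gns_map M phi Lam.

(** Let Lam (x n) -> 0 rapidly and Lam (adj (x n)) -> xi. The operators Y n = (1 + k n)^-1 adj (x
    n), with k n = adj (x n) x n, are contractions; as the weight of k n decays, gg (k n) tends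
    strongly to 0, so Lam (Y n) -> xi while adj (Y n) -> 0 strongly. On a fast subsequence [tails]
    dominates the squares of the Y n by operators of weight of order 4^-m, hence Lam (Y n) -> 0
    too. *)
Lemma sharp_closable xi :
  (forall e, 0 < e -> exists x : bop L L, [/\ sq x, sq (badj x), nm (Lam x) <= e &
    nm (Lam (badj x) - xi) <= e]) -> xi = 0.
Proof.
move=> hx; have p8 n : 0 < 8^-1 ^+ n :> R by rewrite exprn_gt0// invr_gt0.
have p81 n : 8^-1 ^+ n <= 1 :> R by rewrite exprn_ile1 ?invr_ge0// invf_le1// ler1n.
have /choice[x {}hx] := fun n => hx _ (p8 n).
pose k n := bcomp (badj (x n)) (x n).
have pk n : psd (k n) by exact: psd_comp_adj.
have [|n|g [_ gc gk _]] := @tails _ x; first by move=> n; have [[]] := hx n.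
  have [h _ h' _] := hx n; rewrite -(gns_sq hM hphi hLam h).
  by have := p8 n; have := p81 n; have := nm_ge0 (Lam (x n)); nra.
pose Y n := bcomp (res (k n)) (badj (x n)).
have Mk n : M (k n) by have [[_ []]] := hx n.
have Mr n : M (res (k n)).
  have -> : res (k n) = bid L - gg (k n) by apply: bop_eq => v; rewrite bsubE (ggE (pk n)) /= subKr.
  by apply: sa_sub => //; [exact: vn_id|apply: gg_mem => //; exact: vn_closed].
have sY n : sq (Y n) by apply: sq_mul => //; have [] := hx n.
have LY n : Lam (Y n) = res (k n) (Lam (badj (x n))) by apply: (gns_mulb hM hLam) => //; have [] := hx n.
have adjY n v : nm (badj (Y n) v) ^+ 2 <= rip (gg (k n) v) v.
  rewrite badj_comp badjK (res_psd (pk n)).1 bcompE -rip_adj_comp; exact: (gg_res_le (pk n)).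
have nY n v : nm (Y n v) <= nm v.
  have := @adj_bound _ _ _ (badj (Y n)) 1 ler01 _ v.
  rewrite -[adj _]/(bfun (badj (badj (Y n)))) badjK mul1r; apply => u; rewrite mul1r.
  by apply: sqr_le; [exact: nm_ge0|apply: le_trans (adjY _ _) _; exact: gg_le1].
have gsm v e : 0 < e -> exists n0, forall n, (n0 <= n)%N -> rip (g n v) v <= e ^+ 2.
  move=> e0; have pos : 0 < nm v + 1 by have := nm_ge0 v; lra.
  have e1 : 0 < e ^+ 2 / (nm v + 1) by rewrite divr_gt0// exprn_gt0.
  have [n0 hn] := gc v _ e1; exists n0 => n /hn; rewrite subr0 => h.
  apply: le_trans (rip_le _ _) _; apply: le_trans (ler_wpM2r (nm_ge0 v) h) _.
  by rewrite mulrAC ler_pdivrMr// ler_wpM2l ?sqr_ge0//; lra.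
have sub n : exists m, (n <= m)%N /\ nm (Lam (Y m) - xi) <= 8^-1 ^+ n / 2.
  have d0 : 0 < 8^-1 ^+ n / 4 :> R by rewrite divr_gt0.
  have [n0 hn0] := gsm xi _ d0.
  have [n1 hn1] := geometric_small ler01 (ltac:(lra) : 0 <= 8^-1 :> R) (ltac:(lra) : 8^-1 < 1 :> R) d0.
  pose m := maxn n (maxn n0 n1); exists m; split; first exact: leq_maxl.
  have m0 : (n0 <= m)%N by rewrite /m maxnCA leq_maxl.
  have m1 : (n1 <= m)%N by rewrite /m maxnA leq_maxr.
  have -> : Lam (Y m) - xi = res (k m) (Lam (badj (x m)) - xi) - gg (k m) xi.
    by rewrite LY bopB (ggE (pk m)) opprB addrA subrK.
  have h1 : nm (gg (k m) xi) <= 8^-1 ^+ n / 4.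
    apply: sqr_le; first exact: ltW.
    by apply: le_trans (gg_sqr_le (pk m) xi) _; apply: le_trans (gk m xi) _; exact: hn0.
  have h2 : nm (res (k m) (Lam (badj (x m)) - xi)) <= 8^-1 ^+ n / 4.
    apply: le_trans (res_le (pk m) _) _; have [_ _ _ h] := hx m; apply: le_trans h _.
    by have := hn1 m m1; rewrite mul1r.
  by apply: le_trans (nmB _ _) _; lra.
have {sub}/choice[s hs] := sub; pose Y' n := Y (s n).
pose Z n := Y' n.+1 - Y' n.
have sZ n : sq (Z n).
  by have := sq_add hM hphi (sq_scale hM hphi (-1) (sY (s n))) (sY (s n.+1)); rewrite scaleN1r addrC.
have [|n|g' [g1 _ _ g2]] := @tails _ Z; first by move=> n; have [] := sZ n.
  rewrite -(gns_sq hM hphi hLam (sZ n)) (gns_sub hM hLam (sY _) (sY _)).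
  have [_ h1] := hs n; have [_ h2] := hs n.+1.
  have -> : Lam (Y (s n.+1)) - Lam (Y (s n)) = (Lam (Y (s n.+1)) - xi) - (Lam (Y (s n)) - xi).
    by rewrite opprB addrA subrK.
  set a := _ - xi in h2 *; set b := _ - xi in h1 *.
  have h3 : 8^-1 ^+ n.+1 <= 8^-1 ^+ n :> R by rewrite exprS; have := p8 n; lra.
  have := nmB a b; have := nm_ge0 (a - b); have := p8 n; have := p81 n; nra.
have tel m j v : \sum_(m <= i < m + j) Z i v = Y' (m + j)%N v - Y' m v.
  by rewrite (@telescope_sumr_eq _ _ _ (fun i => Y' i v)) ?leq_addr// => i _; rewrite bsubE.
have key m v : nm (Y' m v) ^+ 2 <= 9 * rip (g' m v) v.
  set t := Num.sqrt (rip (g' m v) v).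
  have [[_ pg _] _] := g1 m.
  have t2 : t ^+ 2 = rip (g' m v) v by rewrite sqr_sqrtr//; exact: pg.2.
  have t0 : 0 <= t by exact: sqrtr_ge0.
  have hB j : nm (Y' (m + j)%N v - Y' m v) <= 3 * t.
    apply: sqr_le; first by rewrite mulr_ge0.
    have := g2 m j 2 v (ler0n _ 2); rewrite !tel exprMn t2.
    have -> : (1 + 2) ^+ 2 = 3 ^+ 2 :> R by lra.
    apply => u; rewrite tel; apply: le_trans (nmB _ _) _.
    by have := nY (s (m + j)%N) u; have := nY (s m) u; rewrite /Y'; lra.
  (* Y' (m + j) v tends weakly to 0 because the adjoints tend strongly to 0; so the bound 3 t on the
     increments is a bound on Y' m v itself. *)
  set u := Y' m v; suff : nm u <= 3 * t by rewrite -t2; have := nm_ge0 u; nra.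
  suff h : nm u ^+ 2 <= 3 * t * nm u.
    by have := nm_ge0 u; have [->|u0] := eqVneq (nm u) 0; nra.
  apply/ler_addgt0Pr => e e0; have pos : 0 < nm v + 1 by have := nm_ge0 v; lra.
  have [n0 hn0] := gsm u _ (divr_gt0 e0 pos).
  have hj : (n0 <= s (m + n0)%N)%N by have [h _] := hs (m + n0)%N; apply: leq_trans h; exact: leq_addl.
  have h1 : nm (badj (Y (s (m + n0)%N)) u) <= e / (nm v + 1).
    apply: sqr_le; first by rewrite ltW// divr_gt0.
    by apply: le_trans (adjY _ _) _; apply: le_trans (gk _ _) _; exact: hn0.
  have h2 : rip (Y' (m + n0)%N v) u <= e.
    have -> : rip (Y' (m + n0)%N v) u = rip v (badj (Y (s (m + n0)%N)) u) by rewrite /rip badjP.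
    apply: le_trans (rip_le _ _) _; apply: le_trans (ler_wpM2l (nm_ge0 v) h1) _.
    rewrite mulrA ler_pdivrMr// mulrC; apply: ler_wpM2l; [exact: ltW|lra].
  have -> : nm u ^+ 2 = rip (Y' (m + n0)%N v) u - rip (Y' (m + n0)%N v - u) u.
    by rewrite -ripBl subKr ripxx.
  have h3 : - rip (Y' (m + n0)%N v - u) u <= 3 * t * nm u.
    rewrite -ripNl; apply: le_trans (rip_le _ _) _; rewrite nmN.
    by apply: ler_wpM2r; [exact: nm_ge0|exact: hB].
  by lra.
have small m : nm xi <= 7 * 2^-1 ^+ m.
  have [[Mg pg fg] tg] := g1 m; have [f9 t9] := fin_scale hM hphi (ler0n _ 9) (g1 m).1.
  have [_ [My _ _]] := sY (s m).
  have [|_ h] := fin_le hM hphi f9 My (psd_comp_adj _).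
    by move=> v; rewrite rip_adj_comp bscaleE ripZl; exact: key.
  rewrite -(gns_sq hM hphi hLam (sY _)) t9 in h.
  have h1 : nm (Lam (Y (s m))) <= 6 * 2^-1 ^+ m.
    have q2 : 0 <= 2^-1 ^+ m :> R by rewrite exprn_ge0// invr_ge0.
    apply: sqr_le; first by rewrite mulr_ge0.
    have e4 : 4^-1 ^+ m = (2^-1 ^+ m) ^+ 2 :> R.
      by rewrite -exprM mulnC exprM; congr (_ ^+ m); rewrite expr2; lra.
    by move: h tg; rewrite e4; nra.
  have [_ h2] := hs m.
  have h3 : 8^-1 ^+ m <= 2^-1 ^+ m :> R.
    by rewrite lerXn2r ?nnegrE ?invr_ge0// lef_pV2 ?posrE// ler_nat.
  have := nmB (Lam (Y (s m))) (Lam (Y (s m)) - xi); rewrite subKr.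
  have := p8 m; lra.
apply: (@nm_small0 R _ _ 1) => // e e0; rewrite mul1r.
have [n0 hn] := geometric_small (ler0n R 7) (ltac:(lra) : 0 <= 2^-1 :> R) (ltac:(lra) : 2^-1 < 1 :> R) e0.
by apply: le_trans (small n0) _; exact: hn.
Qed.

End Closability.

(** * Density of the domain of the adjoint of Lam x |-> Lam (adj x) *)

Section SharpDual.
Context {R : realType}.
Variables (L : hilbert R) (M : set (L -> L)) (phi : (L -> L) -> \bar R) (Lam : (L -> L) -> L).
Hypotheses (hM : vn_alg M) (hphi : nsf_weight M phi) (hLam : gns_map M phi Lam).
Let sM := hM.1.
Notation sq := (sq M phi).

(* [e] belongs to the domain of the adjoint of the antilinear map S : Lam x |-> Lam (x^* ), and
   [e'] is its image *)
Definition sharp_dual (e e' : L) := forall x : bop L L, sq x -> sq (badj x) ->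
  '[Lam x, e] = '[Lam (badj x), e']^*%C.

(* [xi - z2] lies in the domain of S^*, for the projection [(z1, z2)] of [(0, xi)] on the closure
   of the graph of S. *)
Lemma sharp_dual_total xi : (forall e e', sharp_dual e e' -> '[e, xi] = 0) -> xi = 0.
Proof.
move=> hxi.
pose V : set (L * L)%type := [set p | exists x : bop L L, [/\ sq x, sq (badj x) & p = (Lam x, Lam (badj x))]].
pose b (p q : L * L) := rip p.1 q.1 + rip p.2 q.2.
pose f (p : L * L) := rip p.2 xi.
have V0 : V 0.
  exists 0; split; rewrite ?(psd_0 L).1 ?(gns_0 hM hphi hLam)//; exact: (sq0 hM hphi).
have [|||||||z [Vz cz hz]] := @variational R (L * L)%type V b f (nm xi ^+ 2) V0.
- move=> s t _ _ [x [hx hx' ->]] [y [hy hy' ->]]; exists (s%:C *: x + t%:C *: y).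
  have e : badj (s%:C *: x + t%:C *: y) = s%:C *: badj x + t%:C *: badj y.
    by rewrite badj_lin badj_scaler conjc_real.
  have st (u v : bop L L) : sq u -> sq v -> sq (s%:C *: u + t%:C *: v).
    by move=> hu hv; apply: (sq_add hM hphi); exact: sq_scale.
  have lin (u v : bop L L) : sq u -> sq v -> Lam (s%:C *: u + t%:C *: v : bop L L) = s%:C *: Lam u + t%:C *: Lam v.
    by move=> hu hv; rewrite (gns_linb hM hLam _ hu (sq_scale hM hphi _ hv)) (gns_scale hM hphi hLam).
  by split; [exact: st|rewrite e; exact: st|rewrite e !lin].
- by move=> x y; rewrite /b !(ripC x.1) !(ripC x.2).
- by move=> s t x y z; rewrite /b !ripDl !ripZl; ring.
- by move=> x; rewrite /b !ripxx addr_ge0// sqr_ge0.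
- by move=> s t x y _ _; rewrite /f ripDl !ripZl.
- exact: sqr_ge0.
- move=> x _; rewrite /f /b !ripxx -ler_sqrt; last by rewrite mulr_ge0// ?sqr_ge0// addr_ge0// sqr_ge0.
  rewrite sqrtr_sqr; apply: le_trans (abs_rip_le _ _) _.
  rewrite -(ger0_norm (mulr_ge0 (nm_ge0 x.2) (nm_ge0 xi))) -sqrtr_sqr ler_sqrt; last first.
    by rewrite mulr_ge0// ?sqr_ge0// addr_ge0// sqr_ge0.
  by rewrite exprMn mulrC ler_wpM2l ?sqr_ge0// lerDr sqr_ge0.
have cauchy1 : cauchys (fun n => (z n).1) /\ cauchys (fun n => (z n).2).
  split=> e e0; have [n0 hn] := cz _ (exprn_gt0 2 e0); exists n0 => n m hn0 hm0;
    apply: sqr_le (ltW e0) _; apply: le_trans (hn n m hn0 hm0); rewrite /b !ripxx /=.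
    by rewrite lerDl sqr_ge0.
  by rewrite lerDr sqr_ge0.
have [z1 h1] := cauchys_cvs cauchy1.1; have [z2 h2] := cauchys_cvs cauchy1.2.
have lim (u : nat -> L) l y (e : R) : cvs u l -> 0 < e -> exists n0, forall n, (n0 <= n)%N -> `|rip (u n) y - rip l y| <= e.
  move=> hu e0; have pos : 0 < nm y + 1 by have := nm_ge0 y; lra.
  have [n0 hn] := hu _ (divr_gt0 e0 pos); exists n0 => n /hn h; rewrite -ripBl.
  apply: le_trans (abs_rip_le _ _) _; apply: le_trans (ler_wpM2r (nm_ge0 y) h) _.
  by rewrite mulrAC ler_pdivrMr// ler_wpM2l//; [exact: ltW|lra].
have key v : V v -> rip v.1 z1 + rip v.2 z2 = rip v.2 xi.
  move=> Vv; apply/eqP; rewrite -subr_eq0 -normr_eq0 eq_le normr_ge0 andbT.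
  apply/ler_addgt0Pr => e e0; rewrite add0r; have e3 : 0 < e / 3 by lra.
  have [n0 k0] := hz v Vv _ e3; have [n1 k1] := lim _ _ v.1 _ h1 e3; have [n2 k2] := lim _ _ v.2 _ h2 e3.
  pose n := (n0 + n1 + n2)%N.
  have {}k0 := k0 n (leq_trans (leq_addr _ _) (leq_addr _ _)).
  have {}k1 := k1 n (leq_trans (leq_addl _ _) (leq_addr _ _)); have {}k2 := k2 n (leq_addl _ _).
  rewrite !(ripC v.1) !(ripC v.2); rewrite /b /f !(ripC v.1) !(ripC v.2) in k0.
  set A := rip (z n).1 _ in k0 k1; set B := rip (z n).2 _ in k0 k2.
  set A' := rip z1 _ in k1 *; set B' := rip z2 _ in k2 *; set C := rip xi _ in k0 *.
  have -> : A' + B' - C = (A + B - C) - ((A - A') + (B - B')) by ring.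
  apply: le_trans (ler_normB _ _) _; have := ler_normD (A - A') (B - B'); lra.
have dual : sharp_dual (xi - z2) z1.
  have rE (x : bop L L) : sq x -> sq (badj x) -> rip (Lam x) (xi - z2) = rip (Lam (badj x)) z1.
    move=> hx hx'; have Vp : V (Lam (badj x), Lam x) by exists (badj x); rewrite badjK.
    by have := key _ Vp; rewrite /= ripBr => <-; rewrite addrK.
  move=> x hx hx'; have ci : ('i : R[i])^*%C = - 'i by rewrite -[RHS]/(Complex (- 0) (- 1)) oppr0.
  have ea : badj ('i *: x) = (- 'i) *: badj x.
    by have := badj_lin 'i x 0; rewrite !addr0 (psd_0 L).1 addr0 ci.
  have := rE ('i *: x) (sq_scale hM hphi _ hx); rewrite ea => /(_ (sq_scale hM hphi _ hx')).
  rewrite !(gns_scale hM hphi hLam)// scaleNr ripNl => hi.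
  by rewrite !ip_rip rE// hi /= !opprK.
have s12 : rip z1 z1 + rip z2 (z2 - xi) = 0.
  apply/eqP; rewrite -normr_eq0 eq_le normr_ge0 andbT.
  apply/ler_addgt0Pr => e e0; rewrite add0r; have e2 : 0 < e / 2 by lra.
  have [n1 k1] := lim _ _ z1 _ h1 e2; have [n2 k2] := lim _ _ (z2 - xi) _ h2 e2.
  pose n := (n1 + n2)%N; have {}k1 := k1 n (leq_addr _ _); have {}k2 := k2 n (leq_addl _ _).
  have := key _ (Vz n) => hk.
  have hk' : rip (z n).1 z1 + rip (z n).2 (z2 - xi) = 0 by rewrite ripBr -hk; ring.
  move: k1 k2 hk'; set A := rip _ z1; set B := rip _ (z2 - xi); set A' := rip z1 z1; set B' := rip z2 _ => k1 k2 hk'.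
  have -> : A' + B' = (A + B) - ((A - A') + (B - B')) by ring.
  by rewrite hk' sub0r normrN; have := ler_normD (A - A') (B - B'); lra.
have o := hxi _ _ dual; have {}o : rip (xi - z2) xi = 0 by rewrite /rip o.
rewrite ripBl ripxx in o; rewrite ripBr !ripxx in s12.
have d : nm (z2 - xi) ^+ 2 = - nm z1 ^+ 2 by rewrite nm_sqrB; lra.
have z10 : nm z1 = 0.
  by apply/eqP; rewrite -sqrf_eq0 eq_le sqr_ge0 andbT -oppr_ge0 -d sqr_ge0.
have z2x : z2 = xi.
  by apply/eqP; rewrite -subr_eq0 -nm_eq0 -sqrf_eq0 d z10 expr0n oppr0.
apply: (sharp_closable hM hphi hLam) => e e0.
have [n1 k1] := h1 e e0; have [n2 k2] := h2 e e0.
have := k1 (n1 + n2)%N (leq_addr _ _); have := k2 (n1 + n2)%N (leq_addl _ _).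
have [x [hx hx' ->]] := Vz (n1 + n2)%N.
by rewrite z2x (nm0_eq0 z10) subr0; exists x.
Qed.

End SharpDual.

(** * Left invariance for Delta tensor id *)

Section Pentagon.
Context {R : realType} (tp : tensor_choice R).
Implicit Types H K E : hilbert R.
Local Notation "h @ox k" := (tens (tp _ _) h k) (at level 40).
Variable G : lcqg tp.
Notation L2 := (l2 G).
Notation M := (@linf R tp G).
Notation phi := (@haar R tp G).
Notation Lam := (@gns R tp G).
Notation sq := (sq M phi).
Let hM : vn_alg M := linf_vn G.
Let sM : star_alg M := hM.1.
Let hphi : nsf_weight M phi := haar_nsf G.
Let hLam : gns_map M phi Lam := gns_haar G.
Let hD : star_hom M (@comul R tp G) := comul_star_hom G.

Lemma iw_ext E (S T : bop (tp L2 L2) E) : (forall i v, S (iw i v) = T (iw i v)) -> S = T.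
Proof.
move=> h; apply: (@bop_eq_total R _ _ ({T : bop L2 L2 | commutant M T} * L2 * L2)%type (fun p => iw p.1 p.2)).
  by move=> z hz; apply: iw_total => i v; apply: hz; exists (i, v).
by move=> [i v]; exact: h.
Qed.

Definition thb E (X : tp L2 E -> tp L2 E) : bop (tp (tp L2 L2) E) (tp (tp L2 L2) E) := hb (@th R tp G E) X.

Lemma thbE E (X : bop (tp L2 E) (tp L2 E)) : lint M X -> th X = thb X /\
  forall i v, thb X (bl tp E (iw i) v) = bl tp E (iw i) (X v).
Proof.
move=> hX; have [T eT hT] := thE hX.
have -> : thb X = T.
  rewrite /thb /hb; case: xgetP => [y _ ey|/(_ T)]; last by case; rewrite eT.
  by apply: bop_eq => v; rewrite ey eT.
by [].
Qed.

Lemma lint_bsr E (X : bop (tp L2 E) (tp L2 E)) k k' : lint M X -> M (bsr k k' X).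
Proof.
move=> hX; apply: (vn_of_comm hM) => T hT v; apply: ip_eqP => u.
rewrite (badjP T) !bsrE -!(blE tp) hX// (badjP (bl tp E T)) badj_bl//.
Qed.

Lemma th_bsr E (X : bop (tp L2 E) (tp L2 E)) k k' : lint M X -> bsr k k' (thb X) = dl (bsr k k' X).
Proof.
move=> hX; apply: iw_ext => i v; rewrite (dl_iw _ _ (lint_bsr k k' hX)).
apply: ip_eqP => u; rewrite bsrE -(blE tp) (thbE hX).2 (badjP (bl _ _ _)) badj_bl blE.
by rewrite (badjP (iw i)) bsrE.
Qed.

Lemma dl_lint (y : bop L2 L2) : M y -> lint M (dl y).
Proof. by move=> My; apply: (vnt_lint hM); exact: dl_mem. Qed.

Lemma rint_thb (y : bop L2 L2) : M y -> rint M (thb (dl y)).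
Proof.
move=> My T hT v; rewrite -!bcompE; congr (bfun _ v).
apply: (bl_ext (@iw_total R tp G)) => i u; rewrite !bcompE.
have sw x : bopt (bid (tp L2 L2)) T (bl tp L2 (iw i) x) = bl tp L2 (iw i) (bopt (bid L2) T x).
  by rewrite -!bcompE !bopt_comp; congr (bfun (bopt _ _) x); exact: bop_eq.
by rewrite sw !(thbE (dl_lint My)).2 sw (rint_dl My hT).
Qed.

(** Left invariance is applied to the normal functional x |-> <Delta(x) z, z>; slicing Delta(x) by
    it is the same as slicing (Delta tensor id) Delta(x) by the vector z. *)
Lemma left_inv2 z (x : bop L2 L2) : fin M phi x ->
  fin M phi (bsl z z (thb (dl x))) /\ tr phi (bsl z z (thb (dl x))) = nm z ^+ 2 * tr phi x.
Proof.
move=> fx; have [Mx px xoo] := fx; have lx := dl_lint Mx.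
have := haar_left (nf_hom_vec sM hD (@comul_normal R tp G) z) (pos_part Mx px) xoo.
have -> : slice_l (fun x : L2 -> L2 => '[@comul R tp G x z, z]) (@comul R tp G x) = bsl z z (thb (dl x)).
  have q k k' : '[@comul R tp G (vslice_r k k' (@comul R tp G x)) z, z] = '[thb (dl x) (z @ox k), z @ox k'].
    by rewrite (hbE hD Mx) vslice_rE (hbE hD (lint_bsr k k' lx)) -/(dl (bsr k k' (dl x))) -th_bsr// bsrE.
  rewrite /slice_l; case: xgetP => [Y _ hY|/(_ (bfun (bsl z z (thb (dl x)))))]; last first.
    by case => k k'; rewrite bslE q.
  by apply/funext => k; apply: ip_eqP => k'; rewrite bslE hY q.
have -> : complex.Re '[@comul R tp G (idfun : L2 -> L2) z, z] = nm z ^+ 2 by rewrite comul_unital -ripxx.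
rewrite (finE hphi fx) => e.
have hV := vnt_vn tp sM sM; have [h1 h2 _] := @th_hom R tp G L2 M hM.
have f : fin M phi (bsl z z (thb (dl x))).
  split; last by rewrite e -EFinM ltry.
    apply: (vn_of_comm hM) => T hT v; apply: ip_eqP => u; rewrite (badjP T) !bslE.
    have bE (S : bop L2 L2) c : z @ox S c = bopt (bid _) S (z @ox c) by rewrite boptE.
    by rewrite !bE (rint_thb Mx hT) (badjP (bopt _ _)) badj_bopt badj_id.
  have [y ey py] := nhom_pos sM hD (@comul_normal R tp G) Mx px.
  have ed : dl x = y by apply: bop_eq => v; rewrite -ey -(hbE hD Mx).
  have [|y2 ey2 py2] := nhom_pos hV.1 h1 h2 (dl_mem Mx); first by rewrite ed.
  have e2 : thb (dl x) = y2 by apply: bop_eq => v; rewrite -ey2 (thbE lx).1.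
  rewrite e2; split => [|v]; first by rewrite !badj_comp badjK py2.1; exact: bop_eq.
  by rewrite /rip bslE; exact: py2.2.
by split => //; apply/eqP; rewrite -eqe -(finE hphi f) e.
Qed.
End Pentagon.

(** * The pentagon equation for slices of W *)

Section ReducedAlgebra.
Context {R : realType} (tp : tensor_choice R).
Implicit Types H K E : hilbert R.
Local Notation "h @ox k" := (tens (tp _ _) h k) (at level 40).
Variable G : lcqg tp.
Notation L2 := (l2 G).
Notation M := (@linf R tp G).
Notation phi := (@haar R tp G).
Notation Lam := (@gns R tp G).
Notation sq := (sq M phi).
Notation Wst := (@wst R tp G).
Let hM : vn_alg M := linf_vn G.
Let sM : star_alg M := hM.1.
Let hphi : nsf_weight M phi := haar_nsf G.
Let hLam : gns_map M phi Lam := gns_haar G.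
Let hD : star_hom M (@comul R tp G) := comul_star_hom G.

Definition dcol2 (z : tp L2 L2) (y : bop L2 L2) : bop L2 (tp (tp L2 L2) L2) :=
  bcomp (thb (dl y)) (lcol z).

Lemma dcol2_sq z (y : bop L2 L2) : sq y ->
  bcomp (badj (dcol2 z y)) (dcol2 z y) = bsl z z (thb (dl (bcomp (badj y) y))).
Proof.
move=> [My fy]; have Ma := sa_adj sM My; have hV := (vnt_vn tp sM sM).1.
have [h1 _ _] := @th_hom R tp G L2 M hM.
rewrite /dl (hb_comp sM hD Ma My) (hb_adj sM hD My) -/(dl y) /thb.
rewrite (hb_comp hV h1 (sa_adj hV (dl_mem My)) (dl_mem My)) (hb_adj hV h1 (dl_mem My)) badj_comp.
exact: bop_eq.
Qed.

Lemma dcol2_csq z (y : bop L2 L2) : sq y -> csq M phi (dcol2 z y).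
Proof.
move=> hy; split; last by rewrite dcol2_sq//; have [] := left_inv2 z hy.2.
by move=> T hT v; rewrite !bcompE -(rint_thb hy.1 hT) boptE.
Qed.

(** T z is the GNS vector of (Delta tensor id) Delta(y) (z tensor 1). It is computed below in two
    ways, as W^*_23 W^*_13 by coassociativity and through the intertwiners; comparing them yields
    the pentagon equation. *)
Lemma w2_ex (y : bop L2 L2) : sq y -> exists T : bop (tp L2 L2) (tp (tp L2 L2) L2),
  forall z, is_vec Lam (dcol2 z y) (T z).
Proof.
move=> hy; pose T0 z := xget 0 [set t | is_vec Lam (dcol2 z y) t].
have hT z : is_vec Lam (dcol2 z y) (T0 z).
  rewrite /T0; case: xgetP => [t _ //|]; have [t ht] := col_vec hM hphi hLam (dcol2_csq z hy).
  by move=> /(_ t).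
have lT : linear T0.
  move=> c u u'; apply: is_vec_uniq (hT _) _ => e k.
  have -> : ls e (dcol2 (c *: u + u') y) = c *: ls e (dcol2 u y) + ls e (dcol2 u' y).
    by apply: bop_eq => v; rewrite baddE bscaleE /ls /dcol2 !bcompE !lcolE tens_linl !bopZD.
  have h z : sq (ls e (dcol2 z y)) by apply: (ls_sq hM hphi); exact: dcol2_csq.
  by rewrite (gns_linb hM hLam c (h _) (h _)) !ipDl !ipZl hT hT.
have bT z : nm (T0 z) <= nm (Lam y) * nm z.
  apply: sqr_le; first by rewrite mulr_ge0// nm_ge0.
  rewrite (vec_nm hM hphi hLam (dcol2_csq z hy) (hT z)) exprMn (gns_sq hM hphi hLam hy).
  by rewrite dcol2_sq// (left_inv2 z hy.2).2 mulrC.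
by have [T eT] := mkbop lT bT; exists T => z; rewrite -eT.
Qed.

Lemma w2_elem (y : bop L2 L2) (T : bop (tp L2 L2) (tp (tp L2 L2) L2)) g g' : sq y ->
  (forall z, is_vec Lam (dcol2 z y) (T z)) ->
  T (g @ox g') = badj basc (bopt (bid L2) (w g') (w g (Lam y))).
Proof.
move=> hy hT; apply/eqP; rewrite -subr_eq0; apply/eqP; apply: tens3_total => a b k.
rewrite ipBr; apply/eqP; rewrite subr_eq0; apply/eqP; rewrite [LHS]ipC [RHS]ipC; congr _^*%C.
rewrite hT -(badjPr basc) bascE (badjP (bopt _ _)) badj_bopt badj_id boptE.
pose s := ls a (dcol g y); have hs : sq s by apply: (ls_sq hM hphi); exact: dcol_csq.
rewrite (w_vec g hy) -(badjP (w g')) (w_vec g' hs); congr '[Lam (bfun _), k].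
apply: bop_eq_ip => u v; rewrite !bcompE -!badjPr !lcolE.
have := @coassoc_slice R tp G L2 M (@comul R tp G) hM hD (@comul_normal R tp G) (@comul_unital R tp G)
  (@comul_image R tp G) (@comul_coassoc R tp G) y g g' u a b v hy.1.
rewrite -/(dl y) (thbE (dl_lint hy.1)).1 => ->.
by [].
Qed.

Lemma w2_iw (y : bop L2 L2) (T : bop (tp L2 L2) (tp (tp L2 L2) L2)) i k : sq y ->
  (forall z, is_vec Lam (dcol2 z y) (T z)) -> T (iw i k) = bl tp L2 (iw i) (w k (Lam y)).
Proof.
move=> hy hT; have hr : rint M (bl tp L2 (iw i)).
  by move=> S hS z; rewrite -!bcompE !bopt_comp; congr (bfun (bopt _ _) z); exact: bop_eq.
have h := vec_map hM hphi hLam (dcol_csq k hy) (w_vec k hy) hr.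
apply: is_vec_uniq (hT _) _ => e x; rewrite h; congr '[Lam (bfun (bcomp _ _)), x].
by apply: bop_eq => v; rewrite !bcompE !lcolE -(thbE (dl_lint hy.1)).2 blE.
Qed.

Lemma w2_w (y : bop L2 L2) (T : bop (tp L2 L2) (tp (tp L2 L2) L2)) u k : sq y ->
  (forall z, is_vec Lam (dcol2 z y) (T z)) -> T (w u k) = bl tp L2 (w u) (w k (Lam y)).
Proof.
move=> hy hT; have h1 : commutant M (bid L2) by apply/commutantP.
pose i : {T : bop L2 L2 | commutant M T} * L2 := (exist (fun T : bop L2 L2 => commutant M T) (bid L2) h1, u).
have := w2_iw i k hy hT.
have -> : iw i = w u by rewrite /iw /= bopt_id; exact: bop_eq.
by [].
Qed.

(** The left slice of [wst] at x and y, an element on the side of the dual quantum group. *)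
Definition lam (x y : L2) : bop L2 L2 := bcomp (badj (lcol y)) (w x).

Lemma lam_ip (x y s t : L2) : '[lam x y s, t] = '[cc s t x, y].
Proof. by rewrite ccE bcompE -badjPr lcolE. Qed.

Lemma ip_functional_eq H K E (S : bop H K) (T : bop H E) A B (P : set H) : total P ->
  (forall z, P z -> '[S z, A] = '[T z, B]) -> forall z, '[S z, A] = '[T z, B].
Proof.
move=> tP h z; rewrite !badjP; congr '[z, _]; apply/eqP; rewrite -subr_eq0; apply/eqP.
by apply: tP => x Px; rewrite ipBr -!badjP h// subrr.
Qed.

Lemma cc_adjE (f e u : L2) : cc f e u = badj (rcol e) (w u f).
Proof. by apply: ip_eqP => v; rewrite ccE -badjPr. Qed.

(* the pentagon equation W23^* W13^* W12^* = W12^* W23^* in sliced form *)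
Lemma pentagon (x y a e g f : L2) :
  '[bl tp L2 (lam x y) (w a e), w g f] = '[w (badj (rcol g) (w x a)) e, y @ox f].
Proof.
pose S := bcomp (bl tp L2 (lam x y)) (w a).
pose T' := bcomp Wst (lcol (badj (rcol g) (w x a))).
rewrite -(wstE (badj (rcol g) (w x a)) e) -[bl tp L2 (lam x y) (w a e)]/(S e) -[Wst _]/(T' e).
apply: (ip_functional_eq (P := [set z | exists2 y : bop L2 L2, sq y & z = Lam y])) => [z hz|_ [y' hy' ->]].
  by apply: (gns_total hM hLam) => y' hy'; apply: hz; exists y'.
rewrite /S /T' {S T' e} !bcompE lcolE wstE; have [T hT] := w2_ex hy'.
have -> : bl tp L2 (lam x y) (w a (Lam y')) = bl tp L2 (badj (lcol y)) (bl tp L2 (w x) (w a (Lam y'))).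
  by rewrite bl_comp.
rewrite -(w2_w x a hy' hT) badjP badj_bl badjK.
(* Both sides are bounded and linear in the vector w x a, which may therefore be replaced by
   elementary tensors. *)
pose V := bcomp Wst (bcomp (rcol (Lam y')) (badj (rcol (tp := tp) (H := L2) g))).
have -> : w (badj (rcol g) (w x a)) (Lam y') = V (w x a) by rewrite /V !bcompE rcolE wstE.
apply: (ip_functional_eq (P := range (@tsr R tp L2 L2)) _ _ (w x a)); first exact: tsr_total.
move=> _ [[s t] _ <-]; rewrite -[tsr tp (s, t)]/(s @ox t) /V !bcompE rcol_adjE rcolE wstE (w2_elem s t hy' hT).
have -> : bl tp L2 (lcol (tp := tp) (K := L2) y) (w g f) = badj basc (y @ox w g f).
  have e : bl tp L2 (lcol (tp := tp) (K := L2) y) = bcomp (badj (basc (tp := tp))) (lcol (tp := tp) y).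
    by apply: tens_ext => h k; rewrite bcompE blE !lcolE basc_adjE.
  by rewrite e bcompE lcolE.
rewrite badjP badjK bascKV badjP badj_bopt badj_id boptE.
have -> : badj (w t) (w g f) = '[g, t] *: f.
  by apply: ip_eqP => q; rewrite -badjPr ?badjK w_ip ipZl.
have wZ c : w (c *: s) = c *: w s.
  have w0 : w 0 = 0 :> bop L2 (tp L2 L2).
    by have := @w_lin R tp G 1 0 0; rewrite scaler0 addr0 scale1r => e; apply: (@addrI _ (w 0)); rewrite addr0 -e.
  by have := w_lin c s 0; rewrite w0 !addr0.
have tZ : y @ox ('[g, t] *: f) = '[g, t] *: (y @ox f) by rewrite -!lcolE bopZ.
by rewrite wZ bscaleE ipZl tZ ipZr -ipC.
Qed.

Lemma nm_isom H K E (x : bop H K) k (v : tp H E) : (forall a b, '[x a, x b] = (k ^+ 2)%:C * '[a, b]) ->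
  0 <= k -> nm (bl tp E x v) = k * nm v.
Proof.
move=> hx k0; have e : bcomp (badj x) x = (k ^+ 2)%:C *: bid H.
  by apply: bop_eq_ip => a b; rewrite bcompE -badjPr hx bscaleE ipZl.
apply/eqP; rewrite -(eqrXn2 (n := 2)) ?mulr_ge0 ?nm_ge0//; apply/eqP.
rewrite -ripxx /rip badjP badj_bl bl_comp e exprMn -[nm v ^+ 2]ripxx -ripZr.
congr (Re '[v, _]); rewrite -[RHS]/(((k ^+ 2)%:C *: bid (tp H E)) v); congr (bfun _ v).
by apply: tens_ext => h f; rewrite blE !bscaleE -!rcolE bopZ.
Qed.

Lemma lam_bound (x y : L2) (z z' : tp L2 L2) :
  Re `|'[bl tp L2 (lam x y) z, z']| <= nm x * nm y * (nm z * nm z').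
Proof.
have -> : '[bl tp L2 (lam x y) z, z'] = '[bl tp L2 (w x) z, bl tp L2 (lcol y) z'].
  by rewrite -bl_comp badjPr badj_bl.
apply: le_trans (ip_le _ _) _; rewrite (@nm_isom _ _ _ _ (nm x)) ?nm_ge0//; last first.
  by move=> a b; rewrite w_ip ipxx.
rewrite (@nm_isom _ _ _ _ (nm y)) ?nm_ge0//; last by move=> a b; rewrite !lcolE tens_dot ipxx.
by rewrite mulrACA.
Qed.

Lemma cc_bound (f e u : L2) : nm (cc f e u) <= nm f * nm e * nm u.
Proof.
have h := ip_le (w u f) (cc f e u @ox e); rewrite -ccE ipxx Re_norm_real nm_tens in h.
have wn : nm (w u f) = nm u * nm f.
  by apply/eqP; rewrite -(eqrXn2 (n := 2)) ?mulr_ge0 ?nm_ge0// -!ripxx /rip w_ip !ipxx exprMn -rmorphM.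
rewrite wn ger0_norm ?sqr_ge0// in h.
have n0 := nm_ge0 (cc f e u); have [->|n1] := eqVneq (nm (cc f e u)) 0.
  by rewrite !mulr_ge0// nm_ge0.
have n2 : 0 < nm (cc f e u) by rewrite lt_neqAle eq_sym n1.
rewrite -(ler_pM2r n2); apply: le_trans (_ : nm u * nm f * (nm (cc f e u) * nm e) <= _).
  by move: h; rewrite expr2.
by rewrite le_eqVlt; apply/orP; left; apply/eqP; ring.
Qed.

End ReducedAlgebra.

(** * The closed span of slices is a star algebra *)

Section ReducedStar.
Context {R : realType} (tp : tensor_choice R).
Implicit Types H K E : hilbert R.
Local Notation "h @ox k" := (tens (tp _ _) h k) (at level 40).
Variable G : lcqg tp.
Notation L2 := (l2 G).
Notation M := (@linf R tp G).
Notation phi := (@haar R tp G).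
Notation Lam := (@gns R tp G).
Notation sq := (sq M phi).
Let hM : vn_alg M := linf_vn G.
Let sM : star_alg M := hM.1.
Let hphi : nsf_weight M phi := haar_nsf G.
Let hLam : gns_map M phi Lam := gns_haar G.
Let hD : star_hom M (@comul R tp G) := comul_star_hom G.

Definition ccs : set (L2 -> L2) := [set a : L2 -> L2 | exists f e : L2, a = bfun (cc f e)].
Definition cca : set (L2 -> L2) := [set a : L2 -> L2 | exists f e : L2, a = bfun (badj (cc f e))].

Lemma lspan_bounded (A : set (L2 -> L2)) : (forall y, A y -> bounded_op y) ->
  forall y, lspan A y -> bounded_op y.
Proof.
move=> bA; apply: lspan_ind => //; first exact: bounded_0.
by move=> c u v /bop_of[u' ->] /bop_of[v' ->]; exact: bopP (c *: u' + v').
Qed.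

Let b1 : forall y, lspan ccs y -> bounded_op y.
Proof. by apply: lspan_bounded => _ [f [e ->]]; exact: bopP. Qed.
Let b2 : forall y, lspan cca y -> bounded_op y.
Proof. by apply: lspan_bounded => _ [f [e ->]]; exact: bopP. Qed.

(** The closed span of the slices of W^*, whereas C0 is the closed span of their adjoints, the
    slices of W; the two are identified once [cal] is closed under adjoints. *)
Definition cal : set (L2 -> L2) := opclosure (lspan ccs).

Lemma cal_bop x : cal x -> exists x' : bop L2 L2, x = x'.
Proof. by move=> [/bop_of[x' ->] _]; exists x'. Qed.

Lemma cal_closed : opclosure cal `<=` cal.
Proof. exact: opclosure_closed b1. Qed.

Lemma cal_lspan : lspan ccs `<=` cal.
Proof. by move=> y hy; apply: opclosure_sub => //; exact: b1. Qed.

Lemma cal_cc (f e : L2) : cal (cc f e).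
Proof. by apply: cal_lspan; apply: lspan_sub; exists f, e. Qed.

Lemma cal_lin c x y : cal x -> cal y -> cal (c *: x + y).
Proof.
move=> hx hy; have [x' ex] := cal_bop hx; have [y' ey] := cal_bop hy.
rewrite {}ex {}ey in hx hy *; exact: (opclosure_lin c b1 (lspan_csub ccs).2 hx hy).
Qed.

Lemma cal_0 : cal 0.
Proof. by apply: cal_lspan; have [l0 _] := lspan_csub ccs. Qed.

Lemma lspan_sum I (r : seq I) (F : I -> bop L2 L2) : (forall i, lspan ccs (F i)) ->
  lspan ccs (\sum_(i <- r) F i : bop L2 L2).
Proof.
have [l0 ll] := lspan_csub ccs.
move=> hF; elim: r => [|i r IH]; first by rewrite big_nil; exact: l0.
rewrite big_cons; have := ll 1 _ _ (hF i) IH; congr (lspan _ _).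
by apply/funext => v; rewrite -[LHS]/(1 *: F i v + (\sum_(j <- r) F j : bop L2 L2) v) scale1r.
Qed.

Lemma lspan_scale c (f e : L2) : lspan ccs (c *: cc f e : bop L2 L2).
Proof.
have [l0 ll] := lspan_csub ccs.
have := ll c _ _ (lspan_sub (ex_intro _ f (ex_intro _ e erefl) : ccs (cc f e))) l0; congr (lspan _ _).
by apply/funext => v; rewrite -[LHS]/(c *: cc f e v + 0) addr0.
Qed.

(* By the pentagon equation a product of slices is a slice of W_12^* W_13^*-type vectors, which
   are approximated by finite sums of elementary tensors. *)
Lemma cal_cc_mul (f e0 xi a : L2) : cal (bcomp (cc f e0) (cc xi a)).
Proof.
apply/(opclosureP _ b1) => e e_gt0.
set zt := w xi f; set zt' := w a e0.
have pE u u' : '[bcomp (cc f e0) (cc xi a) u, u'] = '[bl tp L2 (lam u u') zt, zt'].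
  by rewrite bcompE ccE pentagon cc_adjE.
pose K := nm zt + nm zt' + 1; have K0 : 0 < K by have := nm_ge0 zt; have := nm_ge0 zt'; rewrite /K; lra.
have Ke : 0 < K + e by lra.
(* This tolerance d is at most 1 and satisfies d K <= e; the summand 1 in K absorbs the quadratic
   term d^2. *)
have d0 : 0 < e / (K + e) by rewrite divr_gt0.
have dE : e / (K + e) * (K + e) = e by rewrite divfK// gt_eqF.
move: d0 dE; set d := e / (K + e) => d0 dE.
have d1 : d <= 1 by rewrite /d ler_pdivrMr// mul1r; lra.
have [l hl] := total_lc_dense (@tsr_total R tp L2 L2) zt d0.
have [l' hl'] := total_lc_dense (@tsr_total R tp L2 L2) zt' d0.
set z := lc _ l in hl; set z' := lc _ l' in hl'.
pose b : bop L2 L2 := \sum_(p <- l) \sum_(q <- l')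
  (p.1 * (q.1^*%C * '[p.2.2, q.2.2])) *: cc p.2.1 q.2.1.
exists b; first by apply: lspan_sum => p; apply: lspan_sum => q; exact: lspan_scale.
have bE u u' : '[b u, u'] = '[bl tp L2 (lam u u') z, z'].
  have -> : bl tp L2 (lam u u') z = lc (fun p : L2 * L2 => lam u u' p.1 @ox p.2) l.
    by rewrite /z /lc bop_sum; apply: eq_bigr => p _; rewrite bopZ blE.
  rewrite ip_lc bsumE ip_suml; apply: eq_bigr => p _; rewrite bsumE ip_suml; apply: eq_bigr => q _.
  by rewrite bscaleE ipZl tens_dot lam_ip; ring.
move=> u; set v := bcomp _ _ u - b u.
have h : Re `|'[v, v]| <= nm u * nm v * e.
  have -> : '[v, v] = '[bl tp L2 (lam u v) (zt - z), zt'] + '[bl tp L2 (lam u v) z, zt' - z'].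
    by rewrite {1}/v ipBl pE bE bopB ipBl ipBr; ring.
  have tri (x y : R[i]) : Re `|x + y| <= Re `|x| + Re `|y|.
    by have := ler_normD x y; rewrite lecE => /andP[_]; rewrite raddfD.
  apply: le_trans (tri _ _) _.
  have h1 := lam_bound u v (zt - z) zt'; have h2 := lam_bound u v z (zt' - z').
  have nz : nm z <= nm zt + d by have := nmB zt (zt - z); rewrite subKr; lra.
  apply: le_trans (lerD h1 h2) _; rewrite -mulrDr; apply: ler_wpM2l; first by rewrite mulr_ge0 ?nm_ge0.
  have := nm_ge0 (zt - z); have := nm_ge0 (zt' - z'); have := nm_ge0 z; have := nm_ge0 zt'; have := nm_ge0 zt.
  move: hl hl' nz dE; rewrite /K; set p1 := nm (zt - z); set p2 := nm (zt' - z'); set p3 := nm z; set p4 := nm zt'; set p5 := nm zt.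
  move=> q1 q2 q3 q4 r5 r4 r3 r2 r1.
  have t1 : p1 * p4 <= d * p4 by exact: ler_wpM2r.
  have t2 : p3 * p2 <= (p5 + d) * d by apply: ler_pM => //.
  have t3 : d * d <= d * 1 by rewrite ler_wpM2l// ltW.
  have t4 : 0 <= d * e by rewrite mulr_ge0// ltW.
  by move: q4; rewrite mulrDr; lra.
rewrite ipxx Re_norm_real ger0_norm ?sqr_ge0// in h.
have v0 := nm_ge0 v; have [->|v1] := eqVneq (nm v) 0; first by rewrite mulr_ge0 ?nm_ge0// ltW.
have v2 : 0 < nm v by rewrite lt_neqAle eq_sym v1.
by rewrite -(ler_pM2r v2) -expr2; apply: le_trans h _; rewrite mulrAC (mulrC e).
Qed.

Lemma cal_mul x y : cal x -> cal y -> cal (x \o y).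
Proof.
have h1 (f e : L2) y' : lspan ccs y' -> cal (bfun (cc f e) \o y').
  move: y'; apply: lspan_ind.
  - by have := cal_0; congr cal; apply/funext => v; exact: esym (bop0 (cc f e)).
  - move=> c u v hu hv; have := cal_lin c hu hv; congr cal.
    by apply/funext => t; exact: esym (bopZD (cc f e) c (u t) (v t)).
  - by move=> _ [xi [a ->]]; exact: cal_cc_mul.
have h2 x' y' : lspan ccs x' -> lspan ccs y' -> cal (x' \o y').
  move=> hx hy; move: x' hx; apply: lspan_ind.
  - by have := cal_0; congr cal; apply/funext.
  - by move=> c u v hu hv; exact: (cal_lin c hu hv).
  - by move=> _ [f [e ->]]; exact: h1.
move=> hx hy; have [x' ex] := cal_bop hx; have [y' ey] := cal_bop hy; rewrite {}ex {}ey in hx hy *.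
apply: cal_closed; apply/(opclosureP (bcomp x' y')) => [z /cal_bop[z' ->]|e e0]; first exact: bopP.
have [k k0 hk] := bop_bound x'.
have d0 : 0 < e / 2 / (k + 1) by rewrite !divr_gt0//; lra.
have [y1 Sy hy1] := (opclosureP y' b1).1 hy _ d0.
have [k' k'0 hk'] := bop_bound y1.
have d1 : 0 < e / 2 / (k' + 1) by rewrite !divr_gt0//; lra.
have [x1 Sx hx1] := (opclosureP x' b1).1 hx _ d1.
exists (bcomp x1 y1); first exact: h2.
move=> v; have -> : bcomp x' y' v - bcomp x1 y1 v = x' (y' v - y1 v) + (x' (y1 v) - x1 (y1 v)).
  by rewrite bopB addrA subrK.
apply: le_trans (nmD _ _) _.
have a1 := le_trans (hk (y' v - y1 v)) (ler_wpM2l k0 (hy1 v)).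
have a2 := le_trans (hx1 (y1 v)) (ler_wpM2l (ltW d1) (hk' v)).
have q1 : e / 2 / (k + 1) * (k + 1) = e / 2 by rewrite divfK// gt_eqF//; lra.
have q2 : e / 2 / (k' + 1) * (k' + 1) = e / 2 by rewrite divfK// gt_eqF//; lra.
move: q1 q2 a1 a2 d0 d1; set p1 := e / 2 / (k + 1); set p2 := e / 2 / (k' + 1) => q1 q2 a1 a2 d0 d1.
have n0 := nm_ge0 v; have w1 : k * p1 <= e / 2 by lra.
have w2 : p2 * k' <= e / 2 by lra.
have := ler_wpM2r n0 w1; have := ler_wpM2r n0 w2; move: a1 a2; rewrite !mulrA; lra.
Qed.

Lemma cc_sub (f f' e e' u : L2) : cc f e u - cc f' e' u = cc (f - f') e u + cc f' (e - e') u.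
Proof.
apply: ip_eqP => v; rewrite ipBl ipDl !ccE (bopB (w u)) ipBl.
have -> : v @ox (e - e') = v @ox e - v @ox e' by rewrite -!lcolE bopB.
by rewrite ipBr; ring.
Qed.

(** A matrix coefficient of the slice at Lam a and e is the pairing of Lam s with e, for a slice s
    of Delta(a). Passing to adjoints turns s into the corresponding slice of Delta(adj a), and
    [sharp_dual] moves e to e'. *)
Lemma cc_adj (a : bop L2 L2) e e' : sq a -> sq (badj a) -> sharp_dual M phi Lam e e' ->
  badj (cc (Lam a) e) = cc (Lam (badj a)) e'.
Proof.
move=> ha ha' hd; apply: bop_eq_ip => u' u; rewrite -[LHS]badjPr [LHS]ipC ccE (w_vec u ha).
pose s := ls u' (dcol u a); have hs : sq s by apply: (ls_sq hM hphi); exact: dcol_csq.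
have es : badj s = ls u (dcol u' (badj a)).
  by rewrite /s /ls /dcol !badj_comp badjK /dl (hb_adj sM hD ha.1); exact: bop_eq.
have hs' : sq (badj s) by rewrite es; apply: (ls_sq hM hphi); exact: dcol_csq.
by rewrite (hd s hs hs') conjcK es ccE (w_vec u' ha').
Qed.

(** For square integrable a and b the product (adj a) b is square integrable together with its
    adjoint, and Lam of it is (adj a) (Lam b). *)
Lemma gns_sharp_total z : (forall x : bop L2 L2, sq x -> sq (badj x) -> '[Lam x, z] = 0) -> z = 0.
Proof.
move=> h; apply: (@sq_total R tp G) => a ha; apply: (gns_total hM hLam) => b hb.
have Ma := sa_adj sM ha.1; have Mb := sa_adj sM hb.1.
rewrite (badjPr a) -(gns_mulb hM hLam Ma hb); apply: h; first exact: sq_mul.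
by rewrite badj_comp badjK; exact: sq_mul.
Qed.

(** Slices depend continuously in norm on f and e. Here f is approximated by Lam a with a and adj a
    square integrable, and e by vectors in the domain of the adjoint of Lam x |-> Lam (adj x), which
    is dense by [sharp_dual_total]; for these [cc_adj] applies. *)
Lemma cal_adj (x : bop L2 L2) : cal x -> cal (badj x).
Proof.
have sharp_dense (f : L2) d : 0 < d -> exists a : bop L2 L2, [/\ sq a, sq (badj a) & nm (f - Lam a) <= d].
  pose V : set L2 := [set v | exists a : bop L2 L2, [/\ sq a, sq (badj a) & v = Lam a]].
  have cV : csubspace V.
    split; first by exists 0; rewrite (psd_0 L2).1 (gns_0 hM hphi hLam); split => //; exact: (sq0 hM hphi).
    move=> c _ _ [a [ha ha' ->]] [b [hb hb' ->]]; exists (c *: a + b).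
    rewrite badj_lin (gns_linb hM hLam)//; split => //; apply: (sq_add hM hphi) => //; exact: sq_scale.
  have tV : total V by move=> z hz; apply: gns_sharp_total => a ha ha'; apply: hz; exists a.
  by move=> d0; have [_ [a [ha ha' ->]] hd] := total_dense cV tV f d0; exists a.
have dual_dense (e : L2) d : 0 < d -> exists e1 e2, sharp_dual M phi Lam e1 e2 /\ nm (e - e1) <= d.
  pose V : set L2 := [set v | exists v', sharp_dual M phi Lam v v'].
  have cV : csubspace V.
    split; first by exists 0 => a _ _; rewrite !ip0r conjc0.
    move=> c x1 y1 [x2 hx] [y2 hy]; exists (c^*%C *: x2 + y2) => a ha ha'.
    by rewrite !ipDr !ipZr hx// hy// conjcK rmorphD rmorphM.
  have tV : total V.
    by move=> z hz; apply: (sharp_dual_total hM hphi hLam) => e1 e2 he; apply: hz; exists e2.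
  by move=> d0; have [e1 [e2 he] hd] := total_dense cV tV e d0; exists e1, e2.
have h1 (f e : L2) : cal (badj (cc f e)).
  apply: cal_closed; apply/(opclosureP (badj (cc f e))) => [z /cal_bop[z' ->]|r r0]; first exact: bopP.
  pose K := nm e + nm f + 1; have K0 : 0 < K by have := nm_ge0 e; have := nm_ge0 f; rewrite /K; lra.
  have Ke : 0 < K + r by lra.
  have d0 : 0 < r / (K + r) by rewrite divr_gt0.
  have dE : r / (K + r) * (K + r) = r by rewrite divfK// gt_eqF.
  move: d0 dE; set d := r / (K + r) => d0 dE.
  have d1 : d <= 1 by rewrite /d ler_pdivrMr// mul1r; lra.
  have [a [ha ha' na]] := sharp_dense f d d0; have [e1 [e2 [he ne]]] := dual_dense e d d0.
  exists (badj (cc (Lam a) e1)); first by rewrite (cc_adj ha ha' he); exact: cal_cc.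
  move=> v; rewrite -bsubE -badj_sub; apply: adj_bound v => [|v]; first exact: ltW.
  rewrite bsubE cc_sub; apply: le_trans (nmD _ _) _.
  apply: le_trans (lerD (cc_bound _ _ _) (cc_bound _ _ _)) _; rewrite -mulrDl.
  apply: ler_wpM2r; first exact: nm_ge0.
  have nL : nm (Lam a) <= nm f + d by have := nmB f (f - Lam a); rewrite subKr; lra.
  have := nm_ge0 (f - Lam a); have := nm_ge0 (e - e1); have := nm_ge0 (Lam a); have := nm_ge0 e; have := nm_ge0 f.
  move: na ne nL dE; rewrite /K; set p1 := nm (f - _); set p2 := nm (e - _); set p3 := nm (Lam a); set p4 := nm e; set p5 := nm f.
  move=> q1 q2 q3 q4 r5 r4 r3 r2 r1.
  have t1 : p1 * p4 <= d * p4 by exact: ler_wpM2r.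
  have t2 : p3 * p2 <= (p5 + d) * d by apply: ler_pM => //.
  have t3 : d * d <= d * 1 by rewrite ler_wpM2l// ltW.
  have t4 : 0 <= d * r by rewrite mulr_ge0// ltW.
  by move: q4; rewrite !mulrDr mulr1; lra.
have h2 y : lspan ccs y -> exists2 y' : bop L2 L2, y = y' & cal (badj y').
  move: y; apply: lspan_ind.
  - by exists 0 => //; rewrite (psd_0 L2).1; exact: cal_0.
  - move=> c _ _ [u -> hu] [v -> hv]; exists (c *: u + v) => //.
    by rewrite badj_lin; exact: (cal_lin _ hu hv).
  - by move=> _ [f [e ->]]; exists (cc f e).
move=> hx; apply: cal_closed; apply/(opclosureP (badj x)) => [z /cal_bop[z' ->]|e e0]; first exact: bopP.
have [y Sy hy] := (opclosureP x b1).1 hx _ e0; have [y' ey hy'] := h2 _ Sy.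
exists (badj y').
  by [].
move=> v; rewrite -bsubE -badj_sub; apply: adj_bound v => [|v]; first exact: ltW.
by rewrite bsubE -ey; exact: hy.
Qed.

Lemma cal_star : star_alg cal.
Proof.
split; [by move=> x [] | exact: cal_0 | exact: cal_lin | exact: cal_mul |].
by move=> x hx; have [x' ex] := cal_bop hx; rewrite ex in hx *; exact: cal_adj.
Qed.

Lemma c0_cal : @c0 R tp G = cal.
Proof.
rewrite c0E -/cca; apply/seteqP; split.
  have sub : lspan cca `<=` cal.
    apply: lspan_ind; [exact: cal_0|by move=> *; exact: cal_lin|].
    by move=> _ [f [e ->]]; apply: cal_adj; exact: cal_cc.
  by move=> x [bx hx]; apply: cal_closed; split => // e /hx[y /sub]; exists y.
move=> x hx; have [x' ex] := cal_bop hx; rewrite {}ex in hx *.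
apply/(opclosureP x' b2) => e e0.
have [l0 ll] := lspan_csub cca.
have [y Sy hy] := (opclosureP (badj x') b1).1 (cal_adj hx) _ e0.
have h2 z : lspan ccs z -> exists2 z' : bop L2 L2, z = z' & lspan cca (badj z').
  move: z; apply: lspan_ind.
  - by exists 0 => //; rewrite (psd_0 L2).1.
  - move=> c _ _ [u -> hu] [v -> hv]; exists (c *: u + v) => //.
    by rewrite badj_lin; exact: (ll _ _ _ hu hv).
  - by move=> _ [f [e' ->]]; exists (cc f e') => //; apply: lspan_sub; exists f, e'.
have [y' ey hy'] := h2 _ Sy; exists (badj y') => // v.
rewrite -[x' v]/(bfun x' v) -{1}(badjK x') -bsubE -badj_sub; apply: adj_bound v => [|v]; first exact: ltW.
by rewrite bsubE -ey; exact: hy.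
Qed.

End ReducedStar.

(** * The functional of a vector in a tensor product *)

Section TensorFunctional.
Context {R : realType} (tp : tensor_choice R).
Variables (L H : hilbert R) (M : set (L -> L)) (eps : tp L H).
Hypothesis sM : star_alg M.
Local Notation "h @ox k" := (tens (tp _ _) h k) (at level 40).

Lemma bopt_lproj (x : bop L L) (l : seq H) : '[bopt x (lproj l) eps, eps] =
  \sum_(e <- l) '[x (badj (rcol e) eps), badj (rcol e) eps].
Proof.
have -> : bopt x (lproj l) = \sum_(e <- l) bcomp (rcol e) (bcomp x (badj (rcol e))) :> bop (tp L H) (tp L H).
  apply: tens_ext => h k; rewrite boptE lprojE bsumE -lcolE bop_sum; apply: eq_bigr => e _.
  by rewrite !bcompE rcol_adjE bopZ (bopZ x) bopZ.
by rewrite bsumE ip_suml; apply: eq_bigr => e _; rewrite !bcompE badjP.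
Qed.

Lemma lproj_right (d : R) : 0 < d -> exists2 l : seq H, onl l & nm (eps - bopt (bid L) (lproj l) eps) <= d.
Proof.
move=> d0; have e2 : 0 < d / 2 by lra.
have [s hs] := total_lc_dense (@tsr_total R tp L H) eps e2.
have nil : onl (@nil H) by rewrite /onl.
have [l [ol hl _]] := gram_schmidt [seq p.2.2 | p <- s] nil.
exists l => //; set y := lc _ s in hs; set P := bopt _ _.
have yE : P y = y.
  rewrite /y /lc bop_sum [LHS]big_seq [RHS]big_seq; apply: eq_bigr => p hp.
  by rewrite bopZ /tsr boptE hl//; apply/mapP; exists p.
have nP z : nm (P z) <= nm z.
  have sP : badj P = P by rewrite badj_bopt lproj_sa badj_id.
  have iP x : P (P x) = P x.
    rewrite -[LHS]/(bcomp P P x); congr (bfun _ x); rewrite /P bopt_comp.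
    by congr bopt; apply: bop_eq => t //; rewrite bcompE lproj_idem.
  have e : rip (P z) z = nm (P z) ^+ 2 by rewrite -ripxx [RHS]sa_sym// iP.
  apply: sqr_le; first exact: nm_ge0.
  have := rip_le (P z) z; rewrite e !expr2; have := nm_ge0 (P z); have := nm_ge0 z.
  set a := nm z; set b := nm (P z) => *; have [->|a0] := eqVneq b 0; nra.
have -> : eps - P eps = (eps - y) - P (eps - y) by rewrite bopB yE opprB addrA subrK.
by apply: le_trans (nmB _ _) _; have := nP (eps - y); lra.
Qed.

Definition tvec (x : L -> L) : R[i] := '[optens (tp := tp) x (idfun : H -> H) eps, eps].

Lemma tvec_approx (x : bop L L) e : 0 < e -> exists2 l : seq H, onl l &
  Re `|tvec x - '[bopt x (lproj l) eps, eps]| <= e.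
Proof.
move=> e0; have [k k0 hk] := bop_bound (bopt x (bid H) : bop (tp L H) (tp L H)).
have pos : 0 < k * nm eps + 1 by rewrite ltr_wpDl// mulr_ge0// nm_ge0.
have [l ol hl] := lproj_right (divr_gt0 e0 pos); exists l => //.
have -> : '[bopt x (lproj l) eps, eps] = '[bopt x (bid H) (bopt (bid L) (lproj l) eps), eps].
  by rewrite -bcompE bopt_comp; congr '[bfun (bopt _ _) _, _]; exact: bop_eq.
rewrite -[tvec x]/'[bopt x (bid H) eps, eps] -ipBl -bopB.
apply: le_trans (ip_le _ _) _; apply: le_trans (ler_wpM2r (nm_ge0 eps) (hk _)) _.
have dE : e / (k * nm eps + 1) * (k * nm eps + 1) = e by rewrite divfK// gt_eqF.
have d0 := divr_gt0 e0 pos; move: hl dE d0; set d := e / _ => hl dE d0.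
have := ler_wpM2l (mulr_ge0 k0 (nm_ge0 eps)) hl; rewrite mulrAC; lra.
Qed.

Lemma tvec_real (x : bop L L) : badj x = x -> tvec x = (Re (tvec x))%:C.
Proof.
move=> sx; rewrite -[tvec x]/'[bopt x (bid H) eps, eps]; apply: sa_quad.
by rewrite badj_bopt badj_id sx.
Qed.

Lemma lproj_quad (x : bop L L) (l : seq H) : psd x ->
  '[bopt x (lproj l) eps, eps] = (\sum_(e <- l) rip (x (badj (rcol e) eps)) (badj (rcol e) eps))%:C.
Proof.
move=> px; rewrite bopt_lproj rmorph_sum; apply: eq_bigr => e _; exact: sa_quad px.1.
Qed.

Lemma tvec_ge0 (x : bop L L) : psd x -> 0 <= Re (tvec x).
Proof.
move=> px; apply/ler_addgt0Pr => e e0; have [l _] := tvec_approx x e0.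
rewrite lproj_quad// (tvec_real px.1) -rmorphB Re_norm_real => h.
have : 0 <= \sum_(e <- l) rip (x (badj (rcol e) eps)) (badj (rcol e) eps).
  by apply: sumr_ge0 => i _; exact: px.2.
by move: h; rewrite ler_norml => /andP[]; lra.
Qed.

End TensorFunctional.

(** * Normality of that functional *)

Section TensorFunctionalNormal.
Context {R : realType} (tp : tensor_choice R).
Variables (L H : hilbert R) (M : set (L -> L)).
Hypothesis sM : star_alg M.

Lemma tvec_lproj_le (eps : tp L H) (x : bop L L) (l : seq H) : psd x -> onl l ->
  \sum_(e <- l) rip (x (badj (rcol e) eps)) (badj (rcol e) eps) <= Re (tvec eps x).
Proof.
move=> px ol; pose Q := bopt (bid L) (bid H - lproj l) : bop (tp L H) (tp L H).
have := tvec_ge0 (Q eps) px; suff -> : tvec (Q eps) x = tvec eps x - '[bopt x (lproj l) eps, eps].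
  by rewrite lproj_quad// (tvec_real _ px.1) -rmorphB /= subr_ge0.
have sQ : badj Q = Q by rewrite badj_bopt badj_id badj_sub badj_id lproj_sa.
have E : bcomp Q (bcomp (bopt x (bid H)) Q) = bopt x (bid H) - bopt x (lproj l).
  rewrite /Q !bopt_comp -boptBr; congr bopt; apply: bop_eq => t //.
  rewrite !bcompE !bsubE -![bid H _]/(_ : hcar H) (bopB (lproj l)) lproj_idem//.
  by rewrite subrr subr0.
rewrite -[tvec _ x]/'[bopt x (bid H) (Q eps), Q eps] badjPr sQ.
by rewrite -[tvec eps x]/'[bopt x (bid H) eps, eps] -ipBl -bsubE -E.
Qed.

(** The functional is formally an infinite sum of vector functionals. Finite subsums bound it from
    below on positive elements and approximate it at the supremum, and on finitely many vectors the
    supremum is a strong limit. *)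
Lemma nf_tvec (eps : tp L H) : normal_functional M (tvec eps).
Proof.
split.
- move=> c x y Mx My; have [x' Mx' ->] := sa_bop sM Mx; have [y' My' ->] := sa_bop sM My.
  rewrite -[tvec _ _]/'[bopt (c *: x' + y') (bid H) eps, eps] bopt_linl baddE bscaleE ipDl ipZl.
  by [].
- move=> x [Mx px]; have [x' Mx' e] := sa_bop sM Mx; rewrite {}e in Mx px *.
  have {}px := (psdP x').1 px; rewrite (tvec_real _ px.1) lecR; exact: tvec_ge0.
- move=> D s hD; have [s' es] := bop_of (directed_sup_bounded hD); rewrite {}es in hD *.
  have ps := dsup_psd_s sM hD.
  split=> [x Dx|t ht].
    have [x' [e px Mx]] := dsup_mem sM hD Dx; rewrite {}e in Dx *.
    have pd := psd_sub px.1 ps.1 (dsup_ub sM hD Dx).2.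
    rewrite (tvec_real _ px.1) (tvec_real _ ps.1) lecR.
    have := tvec_ge0 eps pd; rewrite -[tvec _ _]/'[bopt (s' - x') (bid H) eps, eps].
    have -> : s' - x' = (-1) *: x' + s' by rewrite scaleN1r addrC.
    by rewrite bopt_linl baddE bscaleE scaleN1r ipDl ipNl raddfD raddfN /= addrC subr_ge0.
  have ht' (x : bop L L) : D x -> Im t = 0 /\ Re (tvec eps x) <= Re t.
    move=> Dx; have px := dsup_psd sM hD Dx; have := ht _ Dx.
    by rewrite (tvec_real _ px.1) lecE /= => /andP[/eqP ->].
  have [x0 Dx0] := directed_sup_nonempty hD.
  have [x' [e _ _]] := dsup_mem sM hD Dx0; rewrite e in Dx0.
  rewrite (tvec_real _ ps.1) lecE /= (ht' _ Dx0).1 eqxx /=.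
  apply/ler_addgt0Pr => e' e0; have e2 : 0 < e' / 2 by lra.
  have [l ol hl] := tvec_approx eps s' e2.
  rewrite lproj_quad// (tvec_real _ ps.1) -rmorphB Re_norm_real in hl.
  pose C := \sum_(f <- l) nm (badj (rcol f) eps).
  have C0 : 0 <= C by apply: sumr_ge0 => i _; exact: nm_ge0.
  have pos : 0 < C + 1 by lra.
  have [x Dx hx] := vigier_seq sM hD [seq badj (rcol f) eps | f <- l] (divr_gt0 e2 pos).
  have px := dsup_psd sM hD Dx; have h1 := tvec_lproj_le eps px ol; have [_ h2] := ht' x Dx.
  have h3 : \sum_(f <- l) rip (s' (badj (rcol f) eps)) (badj (rcol f) eps) <=
      \sum_(f <- l) rip (x (badj (rcol f) eps)) (badj (rcol f) eps) + e' / 2 / (C + 1) * C.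
    rewrite /C mulr_sumr -big_split [X in X <= _]big_seq [X in _ <= X]big_seq; apply: ler_sum => f hf.
    rewrite -lerBlDl -ripBl; apply: le_trans (rip_le _ _) _; apply: ler_wpM2r; first exact: nm_ge0.
    by apply: (hx x Dx (fun _ => lexx _)); apply/mapP; exists f.
  have dE : e' / 2 / (C + 1) * (C + 1) = e' / 2 by rewrite divfK// gt_eqF.
  have d0 := divr_gt0 e2 pos; move: hl; rewrite ler_norml => /andP[_ hl].
  move: dE d0 h3 hl; set d := e' / 2 / (C + 1) => *; lra.
Qed.
End TensorFunctionalNormal.

(** * Columns and orthogonality for the right invariant weight *)

Section RightWeight.
Context {R : realType} (tp : tensor_choice R).
Implicit Types H K E : hilbert R.
Local Notation "h @ox k" := (tens (tp _ _) h k) (at level 40).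
Variable G : lcqg tp.
Notation L2 := (l2 G).
Notation M := (@linf R tp G).
Variable psi : (L2 -> L2) -> \bar R.
Hypotheses (hpsi : nsf_weight M psi) (hri : right_invariant M (@comul R tp G) psi).
Let hM : vn_alg M := linf_vn G.
Let sM : star_alg M := hM.1.
Let hD : star_hom M (@comul R tp G) := comul_star_hom G.

(** The counterpart of [cint] with the algebra in the first leg: columns whose right slices lie in
    M. *)
Definition rcint K (X : bop L2 (tp L2 K)) := forall T : bop L2 L2, commutant M T ->
  forall v, X (T v) = bl tp K T (X v).

Definition sqr H K (X : bop H K) : bop H H := bcomp (badj X) X.

Lemma sqr_ip H K (X : bop H K) a b : '[sqr X a, b] = '[X a, X b].
Proof. by rewrite bcompE -badjPr. Qed.

Lemma rc_mul K (X Y : bop L2 (tp L2 K)) : rcint X -> rcint Y -> M (bcomp (badj X) Y).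
Proof.
move=> hX hY; apply: (vn_of_comm hM) => T hT v; apply: ip_eqP => u.
rewrite !bcompE hY// (badjP T) -!(badjPr X) hX; last exact: commutant_adj.
by rewrite (badjP (bl _ _ _)) badj_bl.
Qed.

Lemma rc_lin K c (X Y : bop L2 (tp L2 K)) : rcint X -> rcint Y -> rcint (c *: X + Y).
Proof. by move=> hX hY T hT v; rewrite !baddE !bscaleE hX// hY// bopZD. Qed.

Definition fs K (X : bop L2 (tp L2 K)) := rcint X /\ fin M psi (sqr X).
Notation tt X := (tr psi (sqr X)).

Lemma fs_lin K c (X Y : bop L2 (tp L2 K)) : fs X -> fs Y -> fs (c *: X + Y).
Proof.
move=> [hX fX] [hY fY]; have hs := rc_lin c hX hY; split => //.
pose k := 2 * (Re `|c| ^+ 2 + 1).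
have [fa _] := fin_add hM hpsi fX fY.
have k0 : 0 <= k by have := sqr_ge0 (Re `|c|); rewrite /k; lra.
have [fk _] := fin_scale hM hpsi k0 fa.
have [] // := fin_le hM hpsi fk (rc_mul hs hs) (psd_comp_adj _).
move=> v; rewrite bscaleE ripZl baddE ripDl !rip_adj_comp baddE bscaleE nm_sqrD nmZ.
have := sqr_ge0 (nm (c *: X v - Y v)); rewrite nm_sqrB nmZ !exprMn /k.
have := sqr_ge0 (nm (X v)); have := sqr_ge0 (nm (Y v)); have := sqr_ge0 (Re `|c|).
set a := Re `|c| ^+ 2; set x := nm (X v) ^+ 2; set y := nm (Y v) ^+ 2; nra.
Qed.

Lemma fs_add K (X Y : bop L2 (tp L2 K)) : fs X -> fs Y -> fs (X + Y).
Proof. by move=> hX hY; have := fs_lin 1 hX hY; rewrite scale1r. Qed.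

Lemma sqr_unit H K c (X : bop H K) : c * c^*%C = 1 -> sqr (c *: X) = sqr X.
Proof.
move=> hc; apply: bop_eq_ip => a b; rewrite !sqr_ip !bscaleE ipZl ipZr mulrA.
by rewrite hc mul1r.
Qed.

(** The real polarisation of X |-> psi((adj X) X), in the part of 2 Re psi((adj Y) X); it is
    expressed by positive elements only, where psi is defined. *)
Definition cr K (X Y : bop L2 (tp L2 K)) := tt (X + Y) - tt X - tt Y.

Lemma cr_add K (X Y Z : bop L2 (tp L2 K)) : fs X -> fs Y -> fs Z ->
  cr (X + Y) Z = cr X Z + cr Y Z.
Proof.
move=> hX hY hZ; have hXY := fs_add hX hY; have hXZ := fs_add hX hZ; have hYZ := fs_add hY hZ.
have h3 := fs_add hXY hZ.
have e : sqr (X + Y + Z) + (sqr X + (sqr Y + sqr Z)) = sqr (X + Y) + (sqr (Y + Z) + sqr (X + Z)).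
  by apply: bop_eq_ip => a b; rewrite !(baddE, ipDl) !sqr_ip !baddE !(ipDl, ipDr); ring.
have [f1 t1] := fin_add hM hpsi hY.2 hZ.2; have [f2 t2] := fin_add hM hpsi hX.2 f1.
have [_ t3] := fin_add hM hpsi h3.2 f2; have [f4 t4] := fin_add hM hpsi hYZ.2 hXZ.2.
have [_ t5] := fin_add hM hpsi hXY.2 f4; rewrite /cr.
by move: t3; rewrite e t5 t4 t2 t1; lra.
Qed.

Lemma crC K (X Y : bop L2 (tp L2 K)) : cr X Y = cr Y X.
Proof. by rewrite /cr (addrC X Y); ring. Qed.

Lemma cr_unit K c (X Y : bop L2 (tp L2 K)) : c * c^*%C = 1 -> cr (c *: X) (c *: Y) = cr X Y.
Proof. by move=> hc; rewrite /cr -scalerDr !sqr_unit. Qed.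

Lemma right_inv_gen (w : (L2 -> L2) -> R[i]) (x Y : bop L2 L2) : normal_functional M w ->
  fin M psi x -> M Y -> psd Y ->
  (forall h h', '[Y h, h'] = w (bsl h h' (dl x))) ->
  fin M psi Y /\ tr psi Y = Re (w (bid L2)) * tr psi x.
Proof.
move=> hw fx MY pY hY; have [Mx px xoo] := fx.
have := hri hw (pos_part Mx px) xoo.
have -> : slice_r w (@comul R tp G x) = Y.
  have q h h' : w (vslice_l h h' (@comul R tp G x)) = '[Y h, h'].
    by rewrite hY (hbE hD Mx) vslice_lE.
  rewrite /slice_r; case: xgetP => [Z _ hZ|/(_ (bfun Y))]; last first.
    by case => h h'; rewrite q.
  by apply/funext => h; apply: ip_eqP => h'; rewrite hZ q.
rewrite (finE hpsi fx) => e.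
have f : fin M psi Y by split => //; rewrite e -EFinM ltry.
by split => //; apply/eqP; rewrite -eqe -(finE hpsi f) e.
Qed.

Definition sqp (p : bop L2 L2) := M p /\ fin M psi (sqr p).

Lemma sqp_lin c (p p' : bop L2 L2) : sqp p -> sqp p' -> sqp (c *: p + p').
Proof.
move=> hp hp'; apply: (sq_add hM hpsi) => //; exact: sq_scale.
Qed.

(** The column Delta(p) (1 tensor eta). Right invariance for the vector functional of eta makes the
    weight of its square |eta|^2 psi((adj p) p). *)
Definition xc (p : bop L2 L2) (eta : L2) : bop L2 (tp L2 L2) := bcomp (dl p) (rcol eta).

Lemma xc_fs p eta : sqp p -> fs (xc p eta) /\ tt (xc p eta) = nm eta ^+ 2 * tr psi (sqr p).
Proof.
move=> [Mp fp]; have Ma := sa_adj sM Mp.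
have hr : rcint (xc p eta).
  by move=> T hT v; rewrite !bcompE -(dl_lint Mp hT) blE.
have [|f t] := right_inv_gen (nf_vec eta sM) fp (rc_mul hr hr) (psd_comp_adj _).
  move=> h h'; rewrite /sqr /dl (hb_comp sM hD Ma Mp) (hb_adj sM hD Mp) -/(dl p).
  by rewrite bslE !bcompE -!badjPr !rcolE.
split => //.
by rewrite [tt _]t -ripxx.
Qed.

Lemma xc_linl c (p p' : bop L2 L2) eta : M p -> M p' -> xc (c *: p + p') eta = c *: xc p eta + xc p' eta.
Proof.
move=> Mp Mp'; apply: bop_eq => v; rewrite /xc /dl baddE bscaleE !bcompE (hb_lin sM hD)//.
Qed.

Lemma xc_linr c (p : bop L2 L2) eta eta' : xc p (c *: eta + eta') = c *: xc p eta + xc p eta'.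
Proof. by apply: bop_eq => v; rewrite baddE bscaleE !bcompE !rcolE tens_linr bopZD. Qed.

(* The real form [cr] only sees real parts, so orthogonality of [eta] and [eta'] over the complex
   numbers is exploited by letting i move from one argument to the other. *)
Lemma xc_orth p p' eta eta' : sqp p -> sqp p' -> '[eta, eta'] = 0 -> cr (xc p eta) (xc p' eta') = 0.
Proof.
move=> hp hp' ho.
have F0 e q : sqp q -> '[e, eta'] = 0 -> cr (xc q e) (xc q eta') = 0.
  move=> hq he; have -> : cr (xc q e) (xc q eta') = tt (xc q (1 *: e + eta')) - tt (xc q e) - tt (xc q eta').
    by rewrite xc_linr scale1r.
  rewrite !(xc_fs _ hq).2 scale1r nm_sqrD.
  have -> : rip e eta' = 0 by rewrite /rip he.
  ring.
have add1 e q q' : sqp q -> sqp q' -> xc (q + q') e = xc q e + xc q' e.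
  by move=> hq hq'; have := @xc_linl 1 q q' e hq.1 hq'.1; rewrite !scale1r.
have sadd q q' : sqp q -> sqp q' -> sqp (q + q').
  by move=> hq hq'; have := sqp_lin 1 hq hq'; rewrite scale1r.
have s0 : sqp 0 by exact: (sq0 hM hpsi).
have sscale c q : sqp q -> sqp (c *: q).
  by move=> hq; have := sqp_lin c hq s0; rewrite addr0.
have x0 e : xc 0 e = 0.
  by apply: bop_eq => v; rewrite /xc /dl bcompE (hb_0 sM hD).
have xz c q e : sqp q -> xc (c *: q) e = c *: xc q e.
  by move=> hq; have := @xc_linl c q 0 e hq.1 s0.1; rewrite !addr0 x0 addr0.
have xe c q e : xc q (c *: e) = c *: xc q e.
  have := xc_linr c q e 0; rewrite !addr0 => ->.
  by rewrite [X in _ + X](_ : _ = 0) ?addr0//; apply: bop_eq => v; rewrite bcompE rcolE -lcolE bop0 bop0.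
have anti e q q' : sqp q -> sqp q' -> '[e, eta'] = 0 ->
    cr (xc q e) (xc q' eta') + cr (xc q' e) (xc q eta') = 0.
  move=> hq hq' he; have f q1 e1 : sqp q1 -> fs (xc q1 e1) by move=> h1; have [] := xc_fs e1 h1.
  have := F0 e _ (sadd _ _ hq hq') he; rewrite !add1//.
  rewrite cr_add; [|exact: f|exact: f|by rewrite -add1//; apply: f; exact: sadd].
  rewrite !(crC _ (xc q eta' + _)) !cr_add; try exact: f.
  by rewrite !(crC (xc _ eta')) !F0// !(add0r, addr0) addrC.
have ii : ('i : R[i]) * ('i : R[i])^*%C = 1.
  have -> : ('i : R[i])^*%C = - 'i by rewrite -[RHS]/(Complex (- 0) (- 1)) oppr0.
  by rewrite mulrN -expr2 sqr_i opprK.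
have hi e : '[e, eta'] = 0 -> '['i *: e, eta'] = 0 by move=> he; rewrite ipZl he mulr0.
have key q q' : sqp q -> sqp q' -> cr (xc ('i *: q') eta) (xc q eta') = 0.
  move=> hq hq'; have si := sscale 'i _ hq; have si' := sscale 'i _ hq'.
  have a1 := anti _ _ _ hq hq' (hi _ ho); rewrite !xe -!xz// in a1.
  have a2 := anti _ _ _ si hq' ho.
  have a3 : cr (xc q' eta) (xc ('i *: q) eta') = cr (xc ('i *: q') eta) (xc ((-1) *: q) eta').
    by rewrite -(cr_unit _ _ ii) -!xz// scalerA -expr2 sqr_i.
  have f q1 e1 : sqp q1 -> fs (xc q1 e1) by move=> h1; have [] := xc_fs e1 h1.
  have a4 : cr (xc ('i *: q') eta) (xc ((-1) *: q) eta') + cr (xc ('i *: q') eta) (xc q eta') = 0.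
    rewrite !(crC (xc ('i *: q') eta)) -cr_add; [|apply: f; exact: sscale|exact: f|exact: f].
    have e0 : xc ((-1) *: q) eta' + xc q eta' = 0 by rewrite xz// scaleN1r addNr.
    rewrite e0 /cr add0r [X in - X](_ : _ = 0); first by rewrite subr0 subrr.
    by rewrite /sqr comp0r (fin0 hM hpsi).2.
  by move: a1 a2 a4; rewrite a3; lra.
have := key p' ((- 'i) *: p) hp' (sscale _ _ hp).
by rewrite scalerA mulrN -expr2 sqr_i opprK scale1r.
Qed.

Lemma xc_sum (l : seq L2) (pf : L2 -> bop L2 L2) : onl l -> (forall e, sqp (pf e)) ->
  fs (\sum_(e <- l) xc (pf e) e) /\ tt (\sum_(e <- l) xc (pf e) e) = \sum_(e <- l) tr psi (sqr (pf e)).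
Proof.
move=> ol hp.
have f0 : fs (0 : bop L2 (tp L2 L2)) /\ tt (0 : bop L2 (tp L2 L2)) = 0.
  split; last by rewrite /sqr comp0r (fin0 hM hpsi).2.
  split; first by move=> T hT v; rewrite !b0E bop0.
  by rewrite /sqr comp0r; exact: (fin0 hM hpsi).1.
have fx e : fs (xc (pf e) e) by have [] := xc_fs e (hp e).
have fS l' : fs (\sum_(e <- l') xc (pf e) e).
  elim: l' => [|e l' IH]; first by rewrite big_nil; exact: f0.1.
  by rewrite big_cons; exact: fs_add.
have c0 e l' : (forall e', e' \in l' -> '[e', e] = 0) -> cr (\sum_(e <- l') xc (pf e) e) (xc (pf e) e) = 0.
  elim: l' => [|e1 l' IH] h.
    by rewrite big_nil /cr add0r f0.2 subr0 subrr.
  rewrite big_cons cr_add// xc_orth//; last by apply: h; rewrite mem_head.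
  by rewrite IH ?addr0// => e2 he2; apply: h; rewrite inE he2 orbT.
split; first exact: fS.
elim: l ol => [|e l IH] => [_|/= [e1 h ol]]; first by rewrite !big_nil f0.2.
have := c0 e l h; rewrite crC /cr (xc_fs e (hp e)).2 !big_cons -IH//.
have -> : nm e ^+ 2 = 1 by rewrite -ripxx /rip e1.
by rewrite mul1r => hh; lra.
Qed.

End RightWeight.

(** * From the inequality for q to vanishing columns *)

Section InvariantProjection.
Context {R : realType} (tp : tensor_choice R).
Implicit Types K E : hilbert R.
Local Notation "h @ox k" := (tens (tp _ _) h k) (at level 40).
Variable G : lcqg tp.
Notation L2 := (l2 G).
Notation M := (@linf R tp G).
Notation phi := (@haar R tp G).
Notation Lam := (@gns R tp G).
Notation Wst := (@wst R tp G).
Let hM : vn_alg M := linf_vn G.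
Let sM : star_alg M := hM.1.
Let hphi : nsf_weight M phi := haar_nsf G.
Let hLam : gns_map M phi Lam := gns_haar G.
Let hD : star_hom M (@comul R tp G) := comul_star_hom G.
Notation rc k := (rcol (tp := tp) k).
Notation lcl h := (lcol (tp := tp) h).

Lemma basc_bl K E (F H : hilbert R) (T : bop K E) (z' : tp (tp K F) H) :
  bl tp (tp F H) T (basc z') = basc (bl tp H (bl tp F T) z').
Proof.
rewrite -!bcompE; congr (bfun _ z'); apply: tens3_ext => h k l.
by rewrite !bcompE !(bascE, blE).
Qed.

Lemma rcol_bl K E (H : hilbert R) (T : bop K E) (v : H) z : badj (rc v) (bl tp H T z) = T (badj (rc v) z).
Proof.
have : bcomp (badj (rc v)) (bl tp H T) = bcomp T (badj (rc v)).
  by apply: tens_ext => h k; rewrite !bcompE blE !rcol_adjE bopZ.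
by move/(congr1 (fun S : bop _ _ => S z)).
Qed.

Variables (H : hilbert R) (N : set (H -> H)) (DN : (H -> H) -> (tp L2 H -> tp L2 H)).
Hypothesis hcoact : vn_coaction N DN.
Let hN : vn_alg N := coact_vn hcoact.
Let hDN : star_hom N DN := coact_star_hom hcoact.
Variable p : bop H H.
Hypotheses (Np : N p) (sp : badj p = p) (pp : bcomp p p = p).
Notation q := (hb DN p).
Hypothesis qp : bcomp q (bopt (bid L2) p) = q.
Notation E := (tp L2 H).

Let hq : vn_tensor M N q.
Proof. by rewrite -(hbE hDN Np); apply: (coact_image hcoact); exists (bfun p). Qed.
Let lq : lint M q. Proof. exact: vnt_lint hN hq. Qed.
Let sq_ : badj q = q. Proof. by rewrite -(hb_adj hN.1 hDN Np) sp. Qed.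
Let qq : bcomp q q = q. Proof. by rewrite -(hb_comp hN.1 hDN Np Np) pp. Qed.

Lemma th_slice a a' eta eta' : '[thb q (badj basc (a @ox eta)), badj basc (a' @ox eta')] =
  '[hb DN (bsl a a' q) eta, eta'].
Proof.
have e : bcomp (badj (lcl a')) (bcomp basc (bcomp (thb q) (bcomp (badj basc) (lcl a)))) = hb DN (bsl a a' q).
  apply: tens_ext_ip => b v b' v'; rewrite !bcompE -badjPr !lcolE (badjP basc) !basc_adjE.
  rewrite -(coassoc_slice hN hDN (coact_normal hcoact) (coact_unital hcoact) (coact_image hcoact)
    (coact_coassoc hcoact) a b v a' b' v' Np).
  by rewrite (thbE lq).1.
by rewrite -e !bcompE -(badjPr (lcl a')) !lcolE (badjP basc).
Qed.

(** The inequality Theta(q) <= 1 tensor q: a slice b of q satisfies b p = b because q (1 tensor p) =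
    q, so Delta_N(b) q = Delta_N(b p) = Delta_N(b). *)
Lemma th_q_compl a eta : thb q (badj basc (a @ox (eta - q eta))) = 0.
Proof.
rewrite -[LHS](bascK); set z := basc _; have -> : z = 0; last by rewrite bop0.
apply: tens_total => a' eta'; rewrite ipC /z (badjP basc) th_slice bopB.
have Nb : N (bsl a a' q) by exact: (vnt_bsl hM hN a a' hq).
have -> : hb DN (bsl a a' q) (q eta) = hb DN (bsl a a' q) eta.
  rewrite -bcompE -(hb_comp hN.1 hDN Nb Np); congr (bfun (hb DN (bfun _)) eta).
  apply: bop_eq => v; rewrite !bcompE lcolE -{2}qp bcompE lcolE boptE.
  by [].
by rewrite subrr ip0l conjc0.
Qed.

(** W^* acting in the first two of three legs, with the vector e inserted in the second. *)
Definition ze (e : L2) : bop E (tp L2 E) := bcomp basc (bl tp H (bcomp Wst (rc e))).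

Lemma zeE e a v : ze e (a @ox v) = basc (w a e @ox v).
Proof. by rewrite -[LHS]/(basc (bl tp H (bcomp Wst (rc e)) (a @ox v))) blE -[bcomp _ _ a]/(Wst (a @ox e)) wstE. Qed.

Lemma ze_adjE e z : badj (ze e) z = bl tp H (badj (bcomp Wst (rc e))) (badj basc z).
Proof. by rewrite /ze badj_comp bcompE badj_bl. Qed.

Local Opaque ze.

(** The pentagon equation with H as a spectator leg. The left side tests [ze e b] against [ze f g]
    by an operator on the first leg; the right side contains W^*_12 (x tensor b), the vector that
    has to be controlled. *)
Lemma ze_pent x y e f b g :
  '[bl tp E (lam x y) (ze e b), ze f g] = '[basc (bl tp H (w x) b), badj (cc e f) y @ox g].
Proof.
have e1 : bcomp (badj (ze f)) (bcomp (bl tp E (lam x y)) (ze e)) =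
    bcomp (badj (lcl (badj (cc e f) y))) (bcomp basc (bl tp H (w x))).
  apply: tens_ext_ip => a v g' v'.
  change ('[badj (ze f) (bl tp E (lam x y) (ze e (a @ox v))), g' @ox v'] =
    '[badj (lcl (badj (cc e f) y)) (basc (bl tp H (w x) (a @ox v))), g' @ox v']).
  rewrite -(badjPr (ze f)) -(badjPr (lcl _)) !zeE basc_bl (badjP basc) bascK blE.
  rewrite tens_dot pentagon lcolE blE (badjP basc) basc_adjE tens_dot -ccE.
  by congr (_ * _); rewrite (badjP (cc e f)) -(badjPr (rc g')) rcolE.
by move: (congr1 (fun S : bop _ _ => '[S b, g]) e1); rewrite !bcompE -!badjPr lcolE.
Qed.

Section Fixed.
Variable psi : (L2 -> L2) -> \bar R.
Hypotheses (hpsi : nsf_weight M psi) (hri : right_invariant M (@comul R tp G) psi).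
Variables (n y : bop L2 L2) (v' : H).
Hypotheses (hn : sqp psi n) (hy : sq M phi y).
Let Mn : M n := hn.1.
Let y1 := bcomp (badj n) y.
Let hy1 : sq M phi y1.
Proof. by apply: (sq_mul hM hphi) => //; exact: sa_adj. Qed.
Let f := Lam y1.
Let Cf := bcomp Wst (rc f).
Let CfE a : Cf a = w a f. Proof. by rewrite -[LHS]/(Wst (a @ox f)) wstE. Qed.

(** The adjoint of [ze f], cut by q and sliced at v'; its slices [pe eps] are the coefficients x_e
    of the column argument. The factor n in f = Lam((adj n) y) is what makes them square integrable
    for psi. *)
Definition PP : bop (tp L2 E) L2 := bcomp (badj (rc v')) (bcomp q (badj (ze f))).
Definition pe (eps : E) : bop L2 L2 := bcomp PP (rc eps).

Lemma pe_mem eps : M (pe eps).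
Proof.
apply: (vn_of_comm hM) => T hT a; rewrite !bcompE !rcolE !ze_adjE -(blE tp).
have e z : badj (bcomp Wst (rc f)) (bl tp L2 T z) = T (badj (bcomp Wst (rc f)) z).
  apply: ip_eqP => b; rewrite (badjP T) -!(badjPr (bcomp Wst (rc f))) -!/Cf !CfE.
  rewrite (w_comm _ _ (commutant_adj sM hT)).
  by have := badjP (bl tp L2 T) z (w b f); rewrite badj_bl.
have -> : badj basc (bl tp E T (a @ox eps)) = bl tp H (bl tp L2 T) (badj basc (a @ox eps)).
  by rewrite -{1}(bascKV (a @ox eps)) basc_bl// bascK.
have -> z : bl tp H (badj (bcomp Wst (rc f))) (bl tp H (bl tp L2 T) z) =
    bl tp H T (bl tp H (badj (bcomp Wst (rc f))) z).
  by rewrite !bl_comp; congr (bfun (bl tp H _) z); apply: bop_eq => t; rewrite !bcompE e.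
by rewrite lq// rcol_bl.
Qed.

(** Since f = (adj n) (Lam y), the operator Cf is Delta(adj n) times a bounded operator. Thus
    [pe eps] is a bounded operator applied to the column of Delta(n) at eps, whose square has weight
    |eps|^2 psi((adj n) n) by right invariance for the normal functional [tvec eps]. *)
Lemma pe_fin : exists2 K, 0 <= K & forall eps, sqp psi (pe eps) /\ tr psi (sqr (pe eps)) <= K * nm eps ^+ 2.
Proof.
pose C0 := bcomp Wst (rc (Lam y)).
pose P1 := bcomp (badj (rc v')) (bcomp q (bl tp H (badj C0))).
pose S eps : bop L2 (tp (tp L2 L2) H) := bcomp (bl tp H (dl n)) (bcomp (badj basc) (rc eps)).
have eC : Cf = bcomp (dl (badj n)) C0.
  apply: bop_eq => a; rewrite CfE bcompE bcompE rcolE wstE (dl_w _ _ (sa_adj sM Mn)).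
  by rewrite /f /y1 (gns_mulb hM hLam (sa_adj sM Mn) hy).
have eP eps : pe eps = bcomp P1 (S eps).
  apply: bop_eq => a; rewrite !bcompE rcolE ze_adjE -/Cf eC badj_comp /dl (hb_adj sM hD Mn) badjK.
  by rewrite bl_comp.
have [k k0 hk] := bop_bound P1.
have fn := hn.2; set X := dl (sqr n).
have lX : lint M X by apply: dl_lint; have [] := fn.
have slice h h' eps eps' : '[bl tp H X (badj basc (h @ox eps)), badj basc (h' @ox eps')] =
    '[bopt (bsl h h' X) (bid H) eps, eps'].
  have e : bcomp (badj (lcl h')) (bcomp basc (bcomp (bl tp H X) (bcomp (badj basc) (lcl h)))) =
      bopt (bsl h h' X) (bid H).
    apply: tens_ext_ip => b v b' w'; rewrite !bcompE -badjPr !lcolE (badjP basc) !basc_adjE blE boptE.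
    by rewrite !tens_dot bslE.
  by rewrite -e !bcompE -(badjPr (lcl h')) !lcolE (badjP basc).
have sS eps h h' : '[sqr (S eps) h, h'] = tvec eps (bsl h h' X).
  rewrite sqr_ip /S !bcompE !rcolE (badjPr (bl tp H (dl n))) badj_bl bl_comp.
  have -> : bcomp (badj (dl n)) (dl n) = X.
    by rewrite /X /sqr /dl (hb_comp sM hD (sa_adj sM Mn) Mn) (hb_adj sM hD Mn).
  exact: slice.
have MS eps : M (sqr (S eps)).
  apply: (vn_of_comm hM) => T hT a; apply: ip_eqP => b; rewrite (badjP T) !sS; congr (tvec eps (bfun _)).
  apply: bop_eq_ip => u u'; rewrite !bslE -!(blE tp) lX// (badjP (bl _ _ T)) badj_bl.
  by rewrite blE.
exists (k ^+ 2 * tr psi (sqr n)); first by rewrite mulr_ge0 ?sqr_ge0// (tr_ge0 hpsi).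
move=> eps; have [fS tS] := right_inv_gen hpsi hri (nf_tvec sM eps) fn (MS eps) (psd_comp_adj _) (sS eps).
have [fk tk] := fin_scale hM hpsi (sqr_ge0 k) fS.
have Mp := pe_mem eps.
have [|||f' t'] := fin_le hM hpsi (x := sqr (pe eps)) fk.
- by apply: sa_comp => //; exact: sa_adj.
- exact: psd_comp_adj.
- move=> v; rewrite bscaleE ripZl !rip_adj_comp eP bcompE -exprMn ler_sqr ?nnegrE ?nm_ge0//.
  by rewrite mulr_ge0// nm_ge0.
split => //; apply: le_trans t' _; rewrite tk tS.
have -> : Re (tvec eps (bid L2)) = nm eps ^+ 2.
  by rewrite -[tvec eps _]/'[bopt (bid L2) (bid H) eps, eps] bopt_id -ripxx.
by rewrite le_eqVlt; apply/orP; left; apply/eqP; ring.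
Qed.

Variable T : bop (tp L2 L2) (tp (tp L2 L2) L2).
Hypothesis hT : forall z, is_vec Lam (dcol2 z y1) (T z).

(** The lift of [PP] along Delta: q becomes Theta(q) and Cf becomes T, so that slicing at eps gives
    Delta(pe eps). *)
Definition DP : bop (tp (tp L2 L2) E) (tp L2 L2) :=
  bcomp (badj (rc v')) (bcomp (thb q) (bcomp (badj (bl tp H T)) (badj basc))).

Lemma T_adj i z : badj T (bl tp L2 (iw i) z) = iw i (badj Cf z).
Proof.
apply/eqP; rewrite -subr_eq0; apply/eqP; apply: (@iw_total R tp G) => j k.
rewrite ipBr -(badjP T) (w2_iw j k hy1 hT) (badjPr (iw i)) -(badjP Cf).
rewrite (badjPr (bl _ _ (iw i))) badj_bl bl_comp.
by rewrite CfE -[badj (iw i) _]/(bcomp (badj (iw i)) (iw j) k) (w_comm _ _ (iw_comm j i)) subrr.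
Qed.

Lemma DP_rcol eps : bcomp DP (rc eps) = dl (pe eps).
Proof.
apply: (@iw_ext R tp G) => i v; rewrite (dl_iw _ _ (pe_mem eps)) !bcompE !rcolE.
have -> : badj (bl tp H T) (badj basc (iw i v @ox eps)) = bl tp H (iw i) (badj (ze f) (v @ox eps)).
  have e : bcomp (badj (bl tp H T)) (bcomp (badj basc) (lcl (iw i v))) =
      bcomp (bl tp H (iw i)) (bcomp (badj (ze f)) (lcl v)).
    apply: tens_ext => s h; rewrite !bcompE !lcolE ze_adjE !basc_adjE badj_bl !blE.
    by rewrite -/Cf -T_adj blE.
  by have /(congr1 (fun S : bop _ _ => S eps)) := e; rewrite !bcompE !lcolE.
by rewrite (thbE lq).2 rcol_bl.
Qed.

(** Formally the sum of the columns Delta(pe xi_e) (1 tensor e) over the components xi_e of xi, but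
    defined through a bounded operator and hence continuous in xi. *)
Definition RR (xi : tp L2 E) : bop L2 (tp L2 L2) := bcomp DP (bcomp (badj basc) (rc xi)).

Lemma RR_lin c xi xi' : RR (c *: xi + xi') = c *: RR xi + RR xi'.
Proof. by apply: bop_eq => v; rewrite baddE bscaleE !bcompE !rcolE tens_linr !bopZD. Qed.

Lemma RR_pl (l : seq L2) xi : RR (pl tp E l xi) = \sum_(e <- l) xc (pe (badj (lcl e) xi)) e.
Proof.
rewrite plE; elim: l => [|e l IH].
  by rewrite !big_nil; apply: bop_eq => v; rewrite !bcompE rcolE -lcolE !bop0.
rewrite !big_cons -IH; have := RR_lin 1 (lcl e (badj (lcl e) xi)) (\sum_(j <- l) lcl j (badj (lcl j) xi)).
rewrite !scale1r => ->; congr (_ + _); rewrite /xc -DP_rcol.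
by apply: bop_eq => b; rewrite !bcompE !rcolE lcolE basc_adjE.
Qed.

(** On elementary tensors T is W^*_23 W^*_13 at f; the isometry of W^* cancels the factor in legs 2
    and 3. *)
Lemma T_adj_w b a e : badj T (badj basc (b @ox w a e)) = badj Cf (b @ox e) @ox a.
Proof.
apply: tens_eqP => g g'; rewrite -(badjP T) (w2_elem g g' hy1 hT) (badjP (badj basc)) badjK bascKV.
rewrite (badjP (bopt _ _)) badj_bopt badj_id boptE.
have -> : badj (w g') (w a e) = '[a, g'] *: e.
  by apply: ip_eqP => x; rewrite -badjPr w_ip ipZl.
have -> : bid L2 b @ox ('[a, g'] *: e) = '[a, g'] *: (b @ox e) by rewrite -!lcolE bopZ.
by rewrite ipZr -ipC tens_dot -(badjP Cf) CfE mulrC.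
Qed.

(** By [T_adj_w] the adjoint of T absorbs the W^* contained in [ze e]. What remains is Theta(q)
    applied to u tensor (b - q b), which vanishes by [th_q_compl]. *)
Lemma RR_ze e b : RR (ze e (b - q b)) = 0.
Proof.
apply: bop_eq => c; rewrite b0E !bcompE rcolE.
have e1 (z : tp L2 L2) (v : H) : badj basc (badj basc (c @ox basc (z @ox v))) = badj basc (c @ox z) @ox v.
  have : bcomp (badj (@basc R tp (tp L2 L2) L2 H)) (bcomp (badj (@basc R tp L2 L2 E))
      (bcomp (@lcol R tp L2 (tp L2 E) c) (bcomp (@basc R tp L2 L2 H) (@rcol R tp (tp L2 L2) H v)))) =
      bcomp (@rcol R tp (tp (tp L2 L2) L2) H v) (bcomp (badj (@basc R tp L2 L2 L2)) (@lcol R tp L2 (tp L2 L2) c)).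
    by apply: tens_ext => s t; rewrite !bcompE !rcolE bascE !lcolE !basc_adjE.
  by move/(congr1 (fun S : bop _ _ => S z)); rewrite !bcompE !rcolE !lcolE.
pose u := badj Cf (c @ox e).
have : bcomp (badj (bl tp H T)) (bcomp (badj basc) (bcomp (badj basc) (bcomp (lcl c) (ze e)))) =
    bcomp (badj basc) (lcl u).
  apply: tens_ext => a v; rewrite [LHS]bcompE [X in badj (bl _ _ _) X]bcompE [X in badj basc X]bcompE bcompE lcolE zeE e1.
  by rewrite badj_bl blE T_adj_w bcompE lcolE basc_adjE.
move/(congr1 (fun S : bop _ _ => S (b - q b))); rewrite !bcompE !lcolE => ->.
by rewrite th_q_compl bop0.
Qed.

End Fixed.
End InvariantProjection.

(** * A vanishing column has vanishing coefficients *)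

Section ColumnZero.
Context {R : realType} (tp : tensor_choice R).
Local Notation "h @ox k" := (tens (tp _ _) h k) (at level 40).

Lemma cs_sum (K : hilbert R) I (l : seq I) (c : I -> R[i]) (x : I -> K) :
  nm (\sum_(e <- l) c e *: x e) ^+ 2 <= (\sum_(e <- l) Re `|c e| ^+ 2) * (\sum_(e <- l) nm (x e) ^+ 2).
Proof.
elim: l => [|e l IH]; first by rewrite !big_nil nm0 expr0n mul0r.
rewrite !big_cons; set s := \sum_(_ <- l) _ *: _ in IH *; set A := \sum_(_ <- l) Re _ ^+ 2 in IH *.
set B := \sum_(_ <- l) nm _ ^+ 2 in IH *.
have A0 : 0 <= A by apply: sumr_ge0 => i _; exact: sqr_ge0.
have B0 : 0 <= B by apply: sumr_ge0 => i _; exact: sqr_ge0.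
have := nmD (c e *: x e) s; rewrite nmZ.
have := nm_ge0 (c e *: x e + s); have := nm_ge0 s; have := nm_ge0 (x e); have := Re_norm_ge0 (c e).
move: IH; set a := Re `|c e|; set b := nm (x e); set S := nm s; set t := nm _ => IH a0 b0 S0 t0 ht.
have h1 : 2 * (a * b * S) <= a ^+ 2 * B + A * b ^+ 2.
  apply: sqr_le; first by rewrite addr_ge0// mulr_ge0// sqr_ge0.
  have h2 : (a * b) ^+ 2 * S ^+ 2 <= (a * b) ^+ 2 * (A * B) by rewrite ler_wpM2l// sqr_ge0.
  have h3 := sqr_ge0 (a ^+ 2 * B - A * b ^+ 2).
  rewrite -subr_ge0; apply: le_trans h3 _; rewrite -subr_ge0.
  have -> : (a ^+ 2 * B + A * b ^+ 2) ^+ 2 - (2 * (a * b * S)) ^+ 2 - (a ^+ 2 * B - A * b ^+ 2) ^+ 2 =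
    4 * ((a * b) ^+ 2 * (A * B) - (a * b) ^+ 2 * S ^+ 2) by ring.
  by rewrite mulr_ge0// subr_ge0.
apply: le_trans (_ : (a * b + S) ^+ 2 <= _).
  by rewrite ler_sqr ?nnegrE// addr_ge0// mulr_ge0.
have -> : (a * b + S) ^+ 2 = a ^+ 2 * b ^+ 2 + 2 * (a * b * S) + S ^+ 2 by ring.
have -> : (a ^+ 2 + A) * (b ^+ 2 + B) = a ^+ 2 * b ^+ 2 + (a ^+ 2 * B + A * b ^+ 2) + A * B by ring.
lra.
Qed.

Lemma bessel (K : hilbert R) (l : seq K) eta : onl l -> \sum_(e <- l) Re `|'[e, eta]| ^+ 2 <= nm eta ^+ 2.
Proof.
move=> ol; have -> : \sum_(e <- l) Re `|'[e, eta]| ^+ 2 = rip (lproj l eta) eta.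
  rewrite /rip lprojE ip_suml raddf_sum; apply: eq_bigr => e _.
  by rewrite ipZl (ipC eta e) mulrC; exact: esym (Re_mul_conj _).
apply: le_trans (rip_le _ _) _; rewrite expr2; apply: ler_wpM2r; first exact: nm_ge0.
exact: lproj_le.
Qed.

Lemma pl_nm_sum (K F : hilbert R) (l : seq K) (z : tp K F) : onl l ->
  \sum_(e <- l) nm (badj (lcol e) z) ^+ 2 <= nm z ^+ 2.
Proof.
move=> ol; have -> : \sum_(e <- l) nm (badj (lcol e) z) ^+ 2 = rip (pl tp F l z) z.
  rewrite /rip plE ip_suml raddf_sum; apply: eq_bigr => e _.
  by rewrite -ripxx /rip -(badjP (lcol e)).
apply: le_trans (rip_le _ _) _; rewrite expr2; apply: ler_wpM2r; first exact: nm_ge0.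
exact: pl_le.
Qed.

Variable G : lcqg tp.
Notation L2 := (l2 G).
Notation M := (@linf R tp G).
Variable psi : (L2 -> L2) -> \bar R.
Hypotheses (hpsi : nsf_weight M psi) (hri : right_invariant M (@comul R tp G) psi).
Let hM : vn_alg M := linf_vn G.
Let sM : star_alg M := hM.1.

(** Formally the weight of the square of RR xi is the sum of the weights of the squares of its
    coefficients. As psi is not norm continuous, xi is truncated along growing orthonormal lists;
    [tails] applied to the increments, together with RR xi = 0, dominates the square of RR (X m) by
    an operator of weight of order 4^-m. Orthogonality of columns and Bessel's inequality carry this
    bound to the coefficient at eta. *)
Lemma column_zero (E : hilbert R) (RR : tp L2 E -> bop L2 (tp L2 L2)) (pe : E -> bop L2 L2) (C K : R) xi :
  0 <= C -> 0 <= K ->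
  (forall c x y, RR (c *: x + y) = c *: RR x + RR y) ->
  (forall x v, nm (RR x v) <= C * nm x * nm v) ->
  (forall l x, RR (pl tp E l x) = \sum_(e <- l) xc (pe (badj (lcol e) x)) e) ->
  (forall c x y, pe (c *: x + y) = c *: pe x + pe y) ->
  (forall x, sqp psi (pe x) /\ tr psi (sqr (pe x)) <= K * nm x ^+ 2) ->
  RR xi = 0 -> forall eta, pe (badj (lcol eta) xi) = 0.
Proof.
move=> C0 K0 Rlin Rb Rpl plin hp R0 eta.
have nil : onl (@nil L2) by [].
(* Starting from a list that spans eta, the component of xi at eta is the same for every
   truncation. *)
have [l0 [ol0 hl0 _]] := gram_schmidt [:: eta] nil.
have he0 : lproj l0 eta = eta by apply: hl0; rewrite mem_head.
(* With this factor K |d n|^2 <= 8^-n, the decay required by [tails]. *)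
pose k1 := (2 * (K + 1))^-1.
have k10 : 0 < k1 by rewrite invr_gt0; lra.
have k1E : 2 * (K + 1) * k1 = 1 by rewrite divff// gt_eqF//; lra.
have p8 n : 0 < 8^-1 ^+ n :> R by rewrite exprn_gt0// invr_gt0.
have p81 n : 8^-1 ^+ n <= 1 :> R by rewrite exprn_ile1 ?invr_ge0// invf_le1// ler1n.
have /choice[g hg] : forall ln : seq L2 * nat, exists l', onl ln.1 -> [/\ onl l',
    forall x, lproj ln.1 x = x -> lproj l' x = x & nm (xi - pl tp E l' xi) <= 8^-1 ^+ ln.2 * k1].
  move=> [l n] /=; have [ol|nol] := pselect (onl l); last by exists [::].
  by have [l' h] := pl_approx xi ol (mulr_gt0 (p8 n) k10); exists l'.
pose ls := fix ls n := if n is m.+1 then g (ls m, m) else l0.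
have ols n : onl (ls n) by elim: n => //= n IH; have [] := hg (ls n, n) IH.
have mono n x : lproj (ls n) x = x -> lproj (ls n.+1) x = x.
  by have [_ h _] := hg (ls n, n) (ols n); exact: h.
have fe n : lproj (ls n) eta = eta by elim: n => // n IH; exact: mono.
pose X n := pl tp E (ls n.+1) xi.
have hX n : nm (xi - X n) <= 8^-1 ^+ n * k1 by have [] := hg (ls n, n) (ols n).
have Rsub x y : RR (x - y) = RR x - RR y.
  by have -> : x - y = (-1) *: y + x; [rewrite scaleN1r addrC|rewrite Rlin scaleN1r addrC].
pose d n := X n.+1 - X n.
have dfix n : pl tp E (ls n.+2) (d n) = d n.
  by rewrite /d bopB /X pl_idem// (pl_fix xi (mono n.+1))//.
have nd n : nm (d n) <= 2 * (8^-1 ^+ n * k1).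
  have -> : d n = (xi - X n) - (xi - X n.+1) by rewrite opprB addrC subrKA.
  apply: le_trans (nmB _ _) _; have h1 := hX n; have h2 := hX n.+1.
  have : 8^-1 ^+ n.+1 * k1 <= 8^-1 ^+ n * k1.
    by apply: ler_wpM2r; [exact: ltW|rewrite exprS; have := p8 n; lra].
  lra.
have RRfs (x : tp L2 E) (l : seq L2) : onl l -> pl tp E l x = x ->
    fs psi (RR x) /\ tr psi (sqr (RR x)) = \sum_(e <- l) tr psi (sqr (pe (badj (lcol e) x))).
  move=> ol hx; rewrite -{1 2}hx Rpl.
  exact: (xc_sum hpsi hri ol (fun e => (hp (badj (lcol e) x)).1)).
pose Z n := RR (d n).
have fZ n : fin M psi (bcomp (badj (Z n)) (Z n)) by have [[]] := RRfs (d n) _ (ols n.+2) (dfix n).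
have tZ n : tr psi (bcomp (badj (Z n)) (Z n)) <= 8^-1 ^+ n.
  have [_ t] := RRfs (d n) _ (ols n.+2) (dfix n); rewrite [tr _ _]t.
  apply: le_trans (_ : \sum_(e <- ls n.+2) K * nm (badj (lcol e) (d n)) ^+ 2 <= _).
    by apply: ler_sum => e _; exact: (hp _).2.
  rewrite -mulr_sumr; apply: le_trans (ler_wpM2l K0 (pl_nm_sum (d n) (ols n.+2))) _.
  have h := nd n; have d0 := nm_ge0 (d n); have q := p8 n; have q1 := p81 n.
  have b1 : nm (d n) ^+ 2 <= (2 * (8^-1 ^+ n * k1)) ^+ 2.
    by rewrite ler_sqr ?nnegrE//; rewrite !mulr_ge0// ltW.
  apply: le_trans (ler_wpM2l K0 b1) _; move: q q1; set t8 := 8^-1 ^+ n => q q1.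
  have -> : K * (2 * (t8 * k1)) ^+ 2 = (2 * K * k1) * (2 * k1) * (t8 * t8) by ring.
  have a1 : 2 * K * k1 <= 1 by lra.
  have a2 : 2 * k1 <= 1 by have := mulr_ge0 K0 (ltW k10); lra.
  have a3 : 0 <= 2 * K * k1 by rewrite !mulr_ge0// ltW.
  have a4 : (2 * K * k1) * (2 * k1) <= 1 by apply: mulr_ile1 => //; rewrite mulr_ge0// ltW.
  have a5 : t8 * t8 <= t8 by rewrite ger_pMl.
  apply: le_trans a5; rewrite ger_pMl//; exact: mulr_gt0.
have [gm [g1 _ _ g2]] := tails hM hpsi fZ tZ.
pose c := 2 * (C * nm xi).
have c0 : 0 <= c by rewrite !mulr_ge0// nm_ge0.
have nX n : nm (X n) <= nm xi by exact: pl_le.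
have tel m j v : \sum_(m <= i < m + j) Z i v = RR (X (m + j)%N) v - RR (X m) v.
  by rewrite (@telescope_sumr_eq _ _ _ (fun i => RR (X i) v)) ?leq_addr// => i _; rewrite /Z /d Rsub bsubE.
have key m v : nm (RR (X m) v) ^+ 2 <= (1 + c) ^+ 2 * rip (gm m v) v.
  set t := Num.sqrt (rip (gm m v) v); have [[_ pg _] _] := g1 m.
  have t2 : t ^+ 2 = rip (gm m v) v by rewrite sqr_sqrtr//; exact: pg.2.
  have t0 : 0 <= t by exact: sqrtr_ge0.
  rewrite -t2 -exprMn ler_sqr ?nnegrE ?nm_ge0 ?mulr_ge0//; last by lra.
  apply/ler_addgt0Pr => e e0.
  have u0 : 0 <= C * k1 * nm v by rewrite !mulr_ge0// ?nm_ge0// ltW.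
  have [j hj] := geometric_small u0 (ltac:(lra) : 0 <= 8^-1 :> R) (ltac:(lra) : 8^-1 < 1 :> R) e0.
  have h1 : nm (RR (X (m + j)%N) v) <= e.
    have -> : RR (X (m + j)%N) = RR (X (m + j)%N - xi) by rewrite Rsub R0 subr0.
    apply: le_trans (Rb _ _) _; rewrite nmBC.
    apply: le_trans (_ : C * (8^-1 ^+ (m + j) * k1) * nm v <= _).
      by apply: ler_wpM2r; [exact: nm_ge0|apply: ler_wpM2l => //; exact: hX].
    have := hj (m + j)%N (leq_addl _ _); congr (_ <= _); ring.
  have h2 : nm (RR (X (m + j)%N) v - RR (X m) v) <= (1 + c) * t.
    apply: sqr_le; first by rewrite mulr_ge0//; lra.
    have := g2 m j c v c0; rewrite !tel exprMn t2; apply => u; rewrite tel.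
    apply: le_trans (nmB _ _) _; have b1 := Rb (X (m + j)%N) u; have b2 := Rb (X m) u.
    have n1 := ler_wpM2r (nm_ge0 u) (ler_wpM2l C0 (nX (m + j)%N)).
    have n2 := ler_wpM2r (nm_ge0 u) (ler_wpM2l C0 (nX m)).
    by rewrite /c; lra.
  have -> : RR (X m) v = RR (X (m + j)%N) v - (RR (X (m + j)%N) v - RR (X m) v) by rewrite subKr.
  by apply: le_trans (nmB _ _) _; lra.
set P := pe (badj (lcol eta) xi).
have PE m : P = \sum_(e <- ls m.+1) '[e, eta] *: pe (badj (lcol e) (X m)).
  have p0 : pe 0 = 0 by have := plin 1 0 0; rewrite scaler0 addr0 scale1r => e; apply: (@addrI _ (pe 0)); rewrite addr0 -e.
  rewrite /P; have -> : badj (lcol eta) xi = badj (lcol eta) (X m).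
    apply: ip_eqP => k; rewrite -!badjPr lcolE (sa_ip _ _ (pl_sa tp E _)) boptE fe.
    by [].
  have -> : badj (lcol eta) (X m) = \sum_(e <- ls m.+1) '[e, eta] *: badj (lcol e) (X m).
    have eX : X m = pl tp E (ls m.+1) (X m) by rewrite /X pl_idem.
    rewrite {1}eX plE bop_sum; apply: eq_bigr => e _.
    by rewrite lcolE lcol_adjE.
  elim: (ls m.+1) => [|e l IH]; first by rewrite !big_nil.
  by rewrite !big_cons plin IH.
have [hP _] := hp (badj (lcol eta) xi); rewrite -/P in hP.
have bound m : tr psi (sqr P) <= nm eta ^+ 2 * ((1 + c) ^+ 2 * (4 * 4^-1 ^+ m)).
  have [fR tR] := RRfs (X m) _ (ols m.+1) (pl_idem xi (ols m.+1)).
  have [fk tk] := fin_scale hM hpsi (sqr_ge0 (1 + c)) (g1 m).1.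
  have [_ t1] := fin_le hM hpsi fk (rc_mul fR.1 fR.1) (psd_comp_adj _)
    (fun v => ltac:(rewrite rip_adj_comp bscaleE ripZl; exact: key)).
  have [fs1 ts1] := fin_sum hM hpsi (ls m.+1) (fun e => (hp (badj (lcol e) (X m))).1.2).
  have [fs2 ts2] := fin_scale hM hpsi (sqr_ge0 (nm eta)) fs1.
  have [||_ t2] := fin_le hM hpsi fs2 (x := sqr P) _ (psd_comp_adj _).
  - by have [_ []] := hP.
  - move=> v; rewrite bscaleE ripZl rip_adj_comp (PE m) bsumE bsumE /rip ip_suml raddf_sum.
    under eq_bigr do rewrite bscaleE.
    apply: le_trans (cs_sum _ _ _) _; have -> : \sum_(i <- ls m.+1) nm (pe (badj (lcol i) (X m)) v) ^+ 2 =
        \sum_(i <- ls m.+1) Re '[sqr (pe (badj (lcol i) (X m))) v, v].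
      by apply: eq_bigr => e _; rewrite -rip_adj_comp.
    apply: ler_wpM2r; last exact: bessel.
    by apply: sumr_ge0 => i _; rewrite -[Re _]/(rip _ _) rip_adj_comp sqr_ge0.
  apply: le_trans t2 _; rewrite ts2 ts1; apply: ler_wpM2l; first exact: sqr_ge0.
  rewrite -tR; apply: le_trans t1 _; rewrite tk; apply: ler_wpM2l; first exact: sqr_ge0.
  exact: (g1 m).2.
have t0 : tr psi (sqr P) = 0.
  apply/eqP; rewrite eq_le (tr_ge0 hpsi hP.2) andbT; apply/ler_addgt0Pr => e e0; rewrite add0r.
  have u0 : 0 <= nm eta ^+ 2 * ((1 + c) ^+ 2 * 4) by apply: mulr_ge0; [exact: sqr_ge0|apply: mulr_ge0 => //; exact: sqr_ge0].
  have [m hm] := geometric_small u0 (ltac:(lra) : 0 <= 4^-1 :> R) (ltac:(lra) : 4^-1 < 1 :> R) e0.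
  apply: le_trans (bound m) _; have := hm m (leqnn m); congr (_ <= _); ring.
have s0 := tr_faithful hpsi hP.2 t0.
apply: bop_eq => v; apply: nm0_eq0; apply/eqP; rewrite -sqrf_eq0 -rip_adj_comp.
by rewrite -/(sqr P) s0 b0E rip0l.
Qed.

End ColumnZero.

(** * The coaction fixes the projection *)

Section InvariantProjectionEq.
Context {R : realType} (tp : tensor_choice R).
Local Notation "h @ox k" := (tens (tp _ _) h k) (at level 40).
Notation rc k := (rcol (tp := tp) k).
Notation lcl h := (lcol (tp := tp) h).

Lemma nm_basc_adj (A B C : hilbert R) (z : tp A (tp B C)) : nm (badj basc z) = nm z :> R.
Proof.
apply/eqP; rewrite -(eqrXn2 (n := 2)) ?nm_ge0// -!ripxx /rip -(badjPr basc).
by rewrite bascKV.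
Qed.

(** Expanding Z' in the first leg over a finite orthonormal list turns S into matrix coefficients
    between first-leg components, which all vanish. *)
Lemma ip_rank_one (K E : hilbert R) (Z Z' : tp K E) (S : bop K K) :
  (forall eta eta', '[badj (lcl eta) Z, badj (lcl eta') Z'] = 0) -> '[bl tp E S Z, Z'] = 0.
Proof.
move=> h; apply: Re_norm_eq0; apply/eqP; rewrite eq_le Re_norm_ge0 andbT.
apply/ler_addgt0Pr => e e0; rewrite add0r; set Y := bl tp E S Z.
have pos : 0 < nm Y + 1 by have := nm_ge0 Y; lra.
have nil : onl (@nil K) by [].
have [l [_ _ hl]] := pl_approx Z' nil (divr_gt0 e0 pos).
have z0 : '[Y, pl tp E l Z'] = 0.
  rewrite plE ip_sumr big1// => k _; rewrite /Y badjP badj_bl lcolE blE -lcolE badjPr.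
  exact: h.
have -> : '[Y, Z'] = '[Y, Z' - pl tp E l Z'] by rewrite ipBr z0 subr0.
apply: le_trans (ip_le _ _) _; apply: le_trans (ler_wpM2l (nm_ge0 Y) hl) _.
have g : nm Y * (e / (nm Y + 1)) <= e.
  by rewrite mulrCA -[leRHS]mulr1 ler_pM2l// ler_pdivrMr// mul1r lerDl.
exact: g.
Qed.

Variable G : lcqg tp.
Notation L2 := (l2 G).
Notation M := (@linf R tp G).
Notation phi := (@haar R tp G).
Notation Lam := (@gns R tp G).
Let hM : vn_alg M := linf_vn G.
Let sM : star_alg M := hM.1.
Let hphi : nsf_weight M phi := haar_nsf G.
Let hLam : gns_map M phi Lam := gns_haar G.
Let hD : star_hom M (@comul R tp G) := comul_star_hom G.
Variables (H : hilbert R) (N : set (H -> H)) (DN : (H -> H) -> (tp L2 H -> tp L2 H)).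
Hypothesis hcoact : vn_coaction N DN.
Let hN : vn_alg N := coact_vn hcoact.
Let hDN : star_hom N DN := coact_star_hom hcoact.
Variable p : bop H H.
Hypotheses (Np : N p) (sp : badj p = p).
Notation q := (hb DN p).
Hypothesis qp : bcomp q (bopt (bid L2) p) = q.
Notation E := (tp L2 H).

Let hq : vn_tensor M N q.
Proof. by rewrite -(hbE hDN Np); apply: (coact_image hcoact); exists (bfun p). Qed.
Let lq : lint M q. Proof. exact: vnt_lint hN hq. Qed.
Let sq_ : badj q = q. Proof. by rewrite -(hb_adj hN.1 hDN Np) sp. Qed.

Lemma pe_zero psi (n y : bop L2 L2) v' e b eta : nsf_weight M psi ->
  right_invariant M (@comul R tp G) psi -> sqp psi n -> sq M phi y ->
  pe DN p n y v' (badj (lcl eta) (ze H e (b - q b))) = 0.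
Proof.
move=> hpsi hri hn hy.
have hy1 : sq M phi (bcomp (badj n) y) by apply: (sq_mul hM hphi) => //; apply: sa_adj => //; exact: hn.1.
have [T hT] := w2_ex hy1; have [K K0 hK] := pe_fin hcoact Np hpsi hri v' hn hy.
have [C C0 hC] := bop_bound (DP DN p v' T).
apply: (column_zero hpsi hri (RR := RR DN p v' T) (pe := pe DN p n y v') C0 K0) => //.
- exact: RR_lin.
- move=> x v; apply: le_trans (hC _) _; rewrite nm_basc_adj rcolE nm_tens.
  by rewrite le_eqVlt; apply/orP; left; apply/eqP; ring.
- exact: (RR_pl hcoact Np v' hn hy hT).
- by move=> c x x'; apply: bop_eq => v; rewrite baddE bscaleE !bcompE !rcolE tens_linr !bopZD.
- exact: (RR_ze hcoact Np qp v' hn hy hT).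
Qed.

(** The pairing of Lam((adj n) y) with z is that of Lam y with n z, and semifiniteness of psi
    provides n with n z close to z. *)
Lemma right_dense psi (z : L2) : nsf_weight M psi ->
  (forall n y : bop L2 L2, sqp psi n -> sq M phi y -> '[Lam (bcomp (badj n) y), z] = 0) -> z = 0.
Proof.
move=> hpsi h; apply: (@nm_small0 R _ _ 1) => // e e0.
have [n Nn hn] := strong_closure_at z (weight_semifinite hpsi (vn_id hM)) e0.
have [n' Mn' en] := sa_bop sM Nn.1; rewrite {}en in hn Nn.
have hs : sqp psi n' by apply/(sqP psi hM).
have nz : n' z = 0.
  apply: (gns_total hM hLam) => y hy; rewrite (badjPr n') -(gns_mulb hM hLam (sa_adj sM Mn') hy).
  exact: h.
by move: hn; rewrite nz subr0 mul1r.
Qed.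

(** The inequality 1 tensor q <= Theta(q), read through W^*. As W^* is isometric, s vanishes once w
    s s does. Testing w s s against u tensor Lam((adj n) y) gives by [ze_pent] a pairing of
    [ze s (b - q b)] with [ze f ga], whose first-leg components are orthogonal by [pe_zero]. *)
Lemma w_compl x b : bopt (bid L2) q (basc (bl tp H (w x) (b - q b))) = 0.
Proof.
have [psi [hpsi hri]] := right_haar G.
apply: tens3r_total => a g v'; rewrite ipC badjP badj_bopt badj_id sq_ boptE.
set ga := q (g @ox v'); set zt := basc _.
have -> : '[zt, bid L2 a @ox ga] = '[badj (rc ga) zt, a] by rewrite -(badjPr (rc ga)) rcolE.
set s := badj (rc ga) zt; suff -> : s = 0 by rewrite ip0l conjc0.
have ws : w s s = 0.
  apply: tens_total => u f'; rewrite -lcolE badjP; apply/eqP; rewrite -conjc_eq0 -ipC; apply/eqP.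
  suff -> : badj (lcl u) (w s s) = 0 by rewrite ip0l.
  apply: (right_dense hpsi) => n y hn hy; set f := Lam _.
  rewrite -(badjP (lcl u)) lcolE ipC -ccE (badjP (cc s f)) /s -(badjPr (rc ga)) rcolE -ze_pent.
  rewrite ip_rank_one ?conjc0// => eta eta'.
  have P0 := pe_zero v' s b eta hpsi hri hn hy.
  have := congr1 (fun S : bop L2 L2 => '[S eta', g]) P0; rewrite b0E ip0l.
  rewrite /pe /PP !bcompE rcolE -(badjPr (rc v')) rcolE (badjP q) sq_ -(badjPr (ze H f)) -lcolE.
  rewrite (badjP (lcl eta')) [LHS]ipC => /(congr1 conjc); rewrite conjcK conjc0 ipC => e0; move: (congr1 conjc e0); rewrite conjc0; exact.
have := w_ip s s s s; rewrite ws ip0l => /esym/eqP; rewrite mulf_eq0 orbb ipxx.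
by move=> /eqP [] /eqP; rewrite sqrf_eq0 nm_eq0 => /eqP.
Qed.

Lemma invariant_proj_eq : q = bopt (bid L2) p.
Proof.
have lqq := thbE lq.
pose Q := bopt (bid L2) q : bop (tp L2 E) (tp L2 E).
have sQ : badj Q = Q by rewrite badj_bopt badj_id sq_.
(* It suffices to check the total family [iw]: there Theta(q) acts as q, and the factor T from the
   commutant passes through Q, leaving [w_compl]. *)
have X0 : bcomp Q (bcomp basc (bid _ - thb q)) = 0.
  apply: (bl_ext (@iw_total R tp G)) => i b; rewrite b0E [LHS]bcompE [X in Q X]bcompE bsubE lqq.2.
  have -> : bid _ (bl tp H (iw i) b) - bl tp H (iw i) (q b) = bl tp H (iw i) (b - q b) by rewrite bopB.
  case: i => [[T hT] u].
  have -> z : bl tp H (iw (exist _ T hT, u)) z = bl tp H (bopt (bid L2) T) (bl tp H (w u) z).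
    by rewrite bl_comp.
  have -> z : basc (bl tp H (bopt (bid L2) T) z) = bopt (bid L2) (bl tp H T) (basc z) :> tp L2 E.
    rewrite -!bcompE; congr (bfun _ z); apply: tens3_ext => h k l.
    by rewrite !bcompE blE !boptE !bascE boptE blE.
  have -> z : Q (bopt (bid L2) (bl tp H T) z) = bopt (bid L2) (bl tp H T) (Q z).
    rewrite -!bcompE /Q !bopt_comp; congr (bfun (bopt _ _) z); apply: bop_eq => t.
    by rewrite !bcompE lq.
  by rewrite w_compl bop0.
have hV := (vnt_vn tp sM hN.1).1; have [h1 _ _] := @th_hom R tp G H N hN.
have sth : badj (thb q) = thb q by rewrite /thb -(hb_adj hV h1 hq) sq_.
have Y1 : bcomp Q basc = bcomp Q (bcomp basc (thb q)).
  apply: bop_eq => z; have := congr1 (fun S : bop _ _ => S z) X0.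
  rewrite !bcompE b0E bsubE (bopB basc) (bopB Q) => /eqP; rewrite subr_eq0 => /eqP.
  by [].
have Y2 : bcomp (thb q) (badj basc) = bcomp (thb q) (bcomp (badj basc) Q).
  apply: tens_ext => a eta; rewrite !bcompE boptE; have := th_q_compl hcoact Np qp a eta.
  have -> : a @ox (eta - q eta) = a @ox eta - a @ox q eta by rewrite -!lcolE bopB.
  by rewrite (bopB (badj basc)) (bopB (thb q)) => /eqP; rewrite subr_eq0 => /eqP.
have Y3 : bcomp basc (thb q) = bcomp Q basc.
  rewrite Y1; have := congr1 (@badj _ _ _) Y2; rewrite !badj_comp !badjK sth sQ => e.
  by rewrite {1}e; apply: bop_eq => z; rewrite !bcompE.
(* First-leg slices of Theta(q) are Delta_N of slices of q, those of 1 tensor q are Delta_N of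
   multiples of p; injectivity of Delta_N compares the arguments. *)
have key a a' : bsl a a' q = '[a, a'] *: p.
  have Nb : N (bsl a a' q) by exact: (vnt_bsl hM hN a a' hq).
  have Nc : N ('[a, a'] *: p : bop H H) by exact: sa_scale hN.1 Np.
  have e : hb DN (bsl a a' q) = hb DN ('[a, a'] *: p : bop H H).
    have -> : hb DN ('[a, a'] *: p : bop H H) = '[a, a'] *: q.
      have := hb_lin hN.1 hDN '[a, a'] Np (sa_0 hN.1).
      by rewrite addr0 (hb_0 hN.1 hDN) addr0.
    apply: bop_eq_ip => eta eta'; rewrite -(th_slice hcoact Np) -(badjP basc).
    have := congr1 (fun S : bop _ _ => S (badj basc (a @ox eta))) Y3; rewrite !bcompE => ->.
    by rewrite bascKV boptE tens_dot bscaleE ipZl.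
  apply: bop_eq => v; have /(congr1 (@^~ v)) : bfun (bsl a a' q) = bfun ('[a, a'] *: p : bop H H); last by [].
  apply: (coact_inj hcoact); [exact: mem_set|exact: mem_set|].
  by rewrite (hbE hDN Nb) (hbE hDN Nc) e.
apply: tens_ext_ip => a v a' v'; rewrite -bslE key bscaleE ipZl boptE tens_dot //.
Qed.

End InvariantProjectionEq.

(** * Closed spans and norm estimates for slices *)

Section SliceEstimates.
Context {R : realType} (tp : tensor_choice R).
Local Notation "h @ox k" := (tens (tp _ _) h k) (at level 40).

Lemma cspan0 (H K : hilbert R) (S : set (H -> K)) : (forall x, S x -> x = 0) ->
  forall T, cspan S T -> T = 0.
Proof.
move=> h T [bT happ]; have [T' eT] := bop_of bT; subst T.
have hl : lspan S `<=` [set x : H -> K | x = 0].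
  apply: lspan_ind => //= c u v -> ->; by rewrite scaler0 addr0.
apply/funext => v; apply: (@nm_small0 R _ _ (nm v)) => [|e e0]; first exact: nm_ge0.
have [S0 /hl -> /opnorm_leP he] := happ e%:C (ltac:(by rewrite ltcR)).
by have := he v; rewrite subr0 mulrC.
Qed.

Lemma mult_sub (H : hilbert R) (A : set (H -> H)) : star_alg A -> A `<=` mult A.
Proof.
move=> sA a Aa; split; first exact: (star_alg_bounded sA).
by move=> b Ab; split; apply: (star_alg_mul sA).
Qed.

Lemma star_hom_sub (H K : hilbert R) (A B : set (H -> H)) (f : (H -> H) -> (K -> K)) :
  A `<=` B -> star_hom B f -> star_hom A f.
Proof.
move=> AB [h1 h2 h3 h4]; split=> *; first [apply: h1|apply: h2|apply: h3|apply: h4]; exact: AB.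
Qed.

Lemma badj0 (H K : hilbert R) : badj (0 : bop H K) = 0.
Proof. by apply: adj_uniq => x y; rewrite !b0E ip0l ip0r. Qed.

Lemma bsl_lin (H K : hilbert R) (h h' : H) c (X Y : bop (tp H K) (tp H K)) :
  bsl h h' (c *: X + Y) = c *: bsl h h' X + bsl h h' Y.
Proof. by apply: bop_eq => v; rewrite baddE bscaleE !bcompE baddE bscaleE bopZD. Qed.

Lemma bsl_0 (H K : hilbert R) (h h' : H) : bsl h h' (0 : bop (tp H K) (tp H K)) = 0.
Proof. by apply: bop_eq => v; rewrite !bcompE !b0E bop0. Qed.

Lemma bsl_bopt (H K : hilbert R) (h h' : H) (x : bop H H) (y : bop K K) :
  bsl h h' (bopt (tp := tp) x y) = '[x h, h'] *: y.
Proof. by apply: bop_eq => v; rewrite !bcompE lcolE boptE lcol_adjE. Qed.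

Lemma bsl_nm (H K : hilbert R) (h h' : H) (X : bop (tp H K) (tp H K)) k v :
  (forall z, nm (X z) <= k * nm z) -> nm (bsl h h' X v) <= nm h * nm h' * k * nm v.
Proof.
move=> hX; rewrite /bsl !bcompE.
have ha z : nm (badj (lcol (tp := tp) (K := K) h') z) <= nm h' * nm z.
  apply: (@adj_bound R _ _ (lcol (tp := tp) h')) => [|x]; first exact: nm_ge0.
  by rewrite lcolE nm_tens.
apply: le_trans (ha _) _; apply: le_trans (ler_wpM2l (nm_ge0 _) (hX _)) _.
by rewrite lcolE nm_tens le_eqVlt; apply/orP; left; apply/eqP; ring.
Qed.

End SliceEstimates.

(** * The kernel of an equivariant morphism and its slices *)

Section KernelIdeal.
Context {R : realType} (tp : tensor_choice R).
Local Notation "h @ox k" := (tens (tp _ _) h k) (at level 40).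
Variables (G : lcqg tp) (H K : hilbert R) (A : set (H -> H)) (B : set (K -> K)).
Notation L2 := (l2 G).
Notation C0 := (@c0 R tp G).
Variables (DA : (H -> H) -> (tp L2 H -> tp L2 H)) (DB : (K -> K) -> (tp L2 K -> tp L2 K)).
Variable f : (H -> H) -> (K -> K).
Hypotheses (hA : gcstar_alg A DA) (hB : gcstar_alg B DB).
Hypotheses (nB : B <> [set 0]) (hf : gmor A DA B DB f).
Let sA : star_alg A := cstar_star (gcstar_cstar hA).
Let clA : opclosure A `<=` A := cstar_closed (gcstar_cstar hA).
Let sB : star_alg B := cstar_star (gcstar_cstar hB).
Let clB : opclosure B `<=` B := cstar_closed (gcstar_cstar hB).
Let sf : star_hom A f := mor_star_hom hf.1.
Let sDB : star_hom B DB := mor_star_hom (gcstar_mor hB).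
Notation A' := (min_tensor (tp := tp) C0 A).
Notation F := (@cstar_tensor_hom R tp L2 H L2 K C0 A idfun f).

Lemma c0_star : star_alg C0. Proof. by rewrite c0_cal; exact: cal_star. Qed.
Let sA' : star_alg A'. Proof. exact: (min_tensor_star tp c0_star sA). Qed.
Let clA' : opclosure A' `<=` A'. Proof. exact: (min_tensor_closed c0_star sA). Qed.

Lemma gmor_nonzero : ~ (forall a b, A a -> B b -> f a \o b = 0).
Proof.
move=> h; apply: nB; apply/seteqP; split=> [b|_ ->]; last exact: star_alg_0 sB.
rewrite -(mor_nondegenerate hf.1); apply: cspan0 => _ [a Aa [c Bc <-]]; exact: h.
Qed.

(** Were there no homomorphism id tensor f, the default 0 would stand for it and equivariance would
    give DB extended to multipliers the value 0 at f a. Injectivity of DB would then yield f a b = 0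
    for all a and b, against nondegeneracy. *)
Lemma tensor_hom_ex : star_hom (mult A') F /\
  forall a b, C0 a -> A b -> F (optens a b) = optens a (f b).
Proof.
have := hf.2; rewrite /cstar_tensor_hom; case: xgetP => [F0 _ hF _|hno h0]; first exact: hF.
exfalso; apply: gmor_nonzero => a b Aa Bb.
have [mF eF] : star_hom (mult B) (mult_ext B DB) /\ forall b, B b -> mult_ext B DB b = DB b.
  have [F1 hF1] := mult_ext_ex clB sB sDB; rewrite /mult_ext.
  by case: xgetP => [F2 _ hF2 //|hn]; case: (hn F1).
have ma : mult B (f a) by apply: (mor_mult hf.1); exists a.
have Bab : B (f a \o b) by have [] := ma.2 _ Bb.
have B0 : B 0 := star_alg_0 sB.
apply: (gcstar_inj hB); [exact: mem_set|exact: mem_set|].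
rewrite (star_hom0 sDB B0) -eF// (star_hom_mul mF ma (mult_sub sB Bb)) h0//.
Qed.

Let sF : star_hom (mult A') F := tensor_hom_ex.1.
Let sF' : star_hom A' F := star_hom_sub (mult_sub sA') sF.

Definition ker_ideal : set (H -> H) := [set a | A a /\ f a = 0].
Notation J := ker_ideal.

Lemma ker_star : star_alg J.
Proof.
split=> [x [Ax _]||c x y [Ax fx] [Ay fy]|x y [Ax fx] [Ay fy]|x [Ax fx]].
- exact: (star_alg_bounded sA).
- by split; [exact: star_alg_0 sA|exact: star_hom0 sf (star_alg_0 sA)].
- split; first exact: (star_alg_lin sA).
  by rewrite (star_hom_lin sf)// fx fy scaler0 addr0.
- split; first exact: (star_alg_mul sA).
  by rewrite (star_hom_mul sf)// fx.
- split; first exact: (star_alg_adj sA).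
  by rewrite (star_hom_adj sf)// fx; exact: (congr1 (@bfun _ _ _) (badj0 K K)).
Qed.

Lemma ker_limit (x : bop H H) : A x ->
  (forall e, 0 < e -> exists y : bop H H, exists z : bop K K, [/\ A y, f y = z,
    forall v, nm (x v - y v) <= e * nm v & forall v, nm (z v) <= e * nm v]) -> f x = 0.
Proof.
move=> Ax h; have [X eX] := star_hom_bop sf Ax; rewrite eX; apply/funext => v.
apply: (@nm_small0 R _ _ (2 * nm v)) => [|e e0]; first by rewrite mulr_ge0 ?nm_ge0.
have [y [z [Ay fy hy hz]]] := h e e0; pose d : bop H H := (-1) *: y + x.
have hd u : nm (d u) <= e * nm u by rewrite baddE bscaleE scaleN1r addrC.
have := star_hom_contr clA sA sf (sa_lin (-1) sA Ay Ax) (ltW e0) hd v.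
have -> : f ((-1) *: y + x : bop H H) = ((-1) *: z + X : bop K K).
  by rewrite -[LHS]/(f (-1 *: (y : H -> H) + x)) (star_hom_lin sf)// fy eX.
rewrite baddE bscaleE scaleN1r => e1; have := nmD (- z v + X v) (z v).
have -> : - z v + X v + z v = X v by rewrite addrC addrA addrC subrr addr0.
have := hz v; lra.
Qed.

Lemma ker_closed : opclosure J `<=` J.
Proof.
move=> x hx; have [x' ex] := bop_of hx.1; subst x.
have happ e : 0 < e -> exists2 y : bop H H, J y & forall v, nm (x' v - y v) <= e * nm v.
  move=> e0; have [y Jy /opnorm_leP hy] := hx.2 e%:C (ltac:(by rewrite ltcR)).
  by have [y' Jy' ey] := sa_bop ker_star Jy; exists y' => //; subst y.
have Ax : A x' by apply: (closed_mem clA sA) => e /happ [y [Ay _] hy]; exists y.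
split=> //; apply: ker_limit => // e e0; have [y [Ay fy] hy] := happ e e0.
exists y, 0; split=> // v; rewrite b0E nm0 mulr_ge0 ?nm_ge0 ?ltW//.
Qed.

(** On elementary tensors f of a slice is the slice of F. Slicing is norm continuous and f and F are
    contractive, so the relation survives in the closed span. *)
Lemma ker_slice (X : bop (tp L2 H) (tp L2 H)) (h h' : L2) : A' X -> F X = 0 ->
  J (bsl h h' X).
Proof.
move=> AX FX.
have P : lspan (elem (tp := tp) C0 A) `<=` [set y : tp L2 H -> tp L2 H | exists (Y : bop (tp L2 H) (tp L2 H)) (Z : bop (tp L2 K) (tp L2 K)),
    [/\ y = bfun Y, A' Y, F Y = Z, A (bsl h h' Y) & f (bsl h h' Y) = bsl h h' Z]].
  apply: lspan_ind => [|c _ _ [Y [Z [-> AY FY A1 f1]]] [Y' [Z' [-> AY' FY' A2 f2]]]|t0 /(elemP c0_star sA)].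
  - exists 0, 0; rewrite !bsl_0; split=> //; first exact: sa_0 sA'.
    + exact: star_hom0 sF' (star_alg_0 sA').
    + exact: sa_0 sA.
    + exact: star_hom0 sf (star_alg_0 sA).
  - exists (c *: Y + Y'), (c *: Z + Z'); rewrite !bsl_lin; split=> //.
    + exact: (sa_lin c sA' AY AY').
    + by rewrite -[LHS]/(F (c *: (Y : _ -> _) + (Y' : _ -> _))) (star_hom_lin sF')// FY FY'.
    + exact: (sa_lin c sA A1 A2).
    + by rewrite -[LHS]/(f (c *: (bsl h h' Y : _ -> _) + (bsl h h' Y' : _ -> _))) (star_hom_lin sf)// f1 f2.
  - move=> [x [y [Cx Ay ->]]]; have [z ez] := star_hom_bop sf Ay.
    exists (bopt x y), (bopt x z); rewrite !bsl_bopt; split=> //.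
    + by apply: (elem_min_tensor c0_star sA); exact: elem_bopt.
    + by rewrite -[LHS]/(F (optens x y)) tensor_hom_ex.2// ez.
    + exact: sa_scale.
    + rewrite -[LHS]/(f ('[x h, h'] *: (y : H -> H))) -[_ *: _]addr0.
      rewrite (star_hom_lin sf)//; last exact: star_alg_0 sA.
      by rewrite (star_hom0 sf) ?addr0 ?ez//; exact: star_alg_0 sA.
have app e : 0 < e -> exists y : bop H H, exists z : bop K K, [/\ A y, f y = z,
    forall v, nm (bsl h h' X v - y v) <= e * nm v & forall v, nm (z v) <= e * nm v].
  move=> e0; set k := nm h * nm h'; have k0 : 0 <= k by rewrite mulr_ge0 ?nm_ge0.
  pose e' := e / (k + 1); have e'0 : 0 < e' by rewrite divr_gt0//; lra.
  have ke : k * e' <= e.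
    by rewrite /e' mulrCA -[leRHS]mulr1 ler_pM2l// ler_pdivrMr ?mul1r ?lerDl//; lra.
  have [y /P [Y [Z [-> AY FY A1 f1]]] /opnorm_leP hy] := AX.2 e'%:C (ltac:(by rewrite ltcR)).
  pose d : bop _ _ := (-1) *: Y + X.
  have hd u : nm (d u) <= e' * nm u by rewrite baddE bscaleE scaleN1r addrC; exact: hy.
  exists (bsl h h' Y), (bsl h h' Z); split=> // v.
    have := bsl_nm h h' v hd; rewrite bsl_lin baddE bscaleE scaleN1r addrC => e1.
    by apply: le_trans e1 _; rewrite ler_wpM2r ?nm_ge0.
  apply: le_trans (ler_wpM2r (nm_ge0 v) ke); apply: bsl_nm => u.
  have := star_hom_contr clA' sA' sF' (sa_lin (-1) sA' AY AX) (ltW e'0) hd u.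
  have -> : F ((-1) *: Y + X : bop _ _) = ((-1) *: Z : bop _ _).
    rewrite -[LHS]/(F (-1 *: (Y : _ -> _) + (X : _ -> _))) (star_hom_lin sF')// FY FX addr0.
    by [].
  by rewrite bscaleE scaleN1r nmN.
have Ab : A (bsl h h' X) by apply: (closed_mem clA sA) => e /app [y [z [Ay _ hy _]]]; exists y.
by split=> //; exact: ker_limit.
Qed.

Lemma coact_ker a : J a -> F (DA a) = 0.
Proof.
move=> [Aa fa]; rewrite -hf.2// fa /mult_ext; case: xgetP => [F0 _ [h _]|_].
  exact: star_hom0 h (star_alg_0 (mult_star sB)).
exact: star_hom0 sDB (star_alg_0 sB).
Qed.

(** Delta(a) is only a multiplier; multiplying it by c tensor b brings it into C0 tensor D, where
    slices make sense, and c is then absorbed by the vector h. *)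
Lemma ker_coact_slice (a b : bop H H) (c : bop L2 L2) (Q : bop (tp L2 H) (tp L2 H)) (h h' : L2) :
  J a -> A b -> C0 c -> DA a = Q -> J (bcomp (bsl (c h) h' Q) b).
Proof.
move=> Ja Ab Cc eQ.
have mQ : mult A' Q by rewrite -eQ; apply: (mor_mult (gcstar_mor hA)); exists (bfun a) => //; case: Ja.
have Acb : A' (bopt c b) by apply: (elem_min_tensor c0_star sA); exact: elem_bopt.
have -> : bcomp (bsl (c h) h' Q) b = bsl h h' (bcomp Q (bopt c b)).
  by apply: bop_eq => v; rewrite !bcompE !lcolE boptE.
apply: ker_slice; first by have [] := mQ.2 _ Acb.
rewrite -[LHS]/(F ((Q : _ -> _) \o (bopt c b : _ -> _))) (star_hom_mul sF)//; last exact: mult_sub.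
by rewrite -eQ coact_ker.
Qed.

End KernelIdeal.

(** * Support projection of the kernel and the final alternative *)

Section Simplicity.
Context {R : realType} (tp : tensor_choice R).
Local Notation "h @ox k" := (tens (tp _ _) h k) (at level 40).
Variables (G : lcqg tp) (H K : hilbert R) (N D : set (H -> H)) (B : set (K -> K)).
Notation L2 := (l2 G).
Notation C0 := (@c0 R tp G).
Variables (DN : (H -> H) -> (tp L2 H -> tp L2 H)) (DB : (K -> K) -> (tp L2 K -> tp L2 K)).
Variable f : (H -> H) -> (K -> K).
Hypotheses (hq : qhs N DN) (hv : cstar_version N DN D) (hB : gcstar_alg B DB).
Hypotheses (nB : B <> [set 0]) (hf : gmor D DN B DB f).
Let hA : gcstar_alg D DN := version_gcstar hv.
Let cA : cstar_alg D := gcstar_cstar hA.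
Let sA : star_alg D := cstar_star cA.
Let clA : opclosure D `<=` D := cstar_closed cA.
Let hco : vn_coaction N DN := qhs_coaction hq.
Let hN : vn_alg N := coact_vn hco.
Let hDN : star_hom N DN := coact_star_hom hco.
Notation J := (ker_ideal D f).
Let sJ : star_alg J. Proof. exact: (ker_star hA hf). Qed.
Let clJ : opclosure J `<=` J. Proof. exact: (ker_closed hA hf). Qed.
Let JA : J `<=` D. Proof. by move=> x []. Qed.
Let JN : J `<=` N. Proof. by move=> x [Ax _]; apply: (version_sub hv). Qed.

Lemma cc_dense (V : set L2) : csubspace V -> (forall f e a, V (cc f e a)) ->
  forall x, in_closure V x.
Proof.
move=> sV hV; apply: (total_dense sV) => z hz; exact: (c0_total (fun g e a => hz _ (hV g e a))).
Qed.

(** The vectors c h with c in C0 span a dense subspace and the kernel is norm closed, which frees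
    [ker_coact_slice] from c. *)
Lemma ker_slice_mul (g a : bop H H) (h h' : L2) : J g -> D a ->
  J (bcomp (bsl h h' (hb DN g)) a).
Proof.
move=> Jg Aa; set Q := hb DN g; have eQ : DN g = Q := hbE hDN (JN Jg).
have [kQ kQ0 hQ] := bop_bound Q; have [ka ka0 ha] := bop_bound a.
pose V : set L2 := [set x | J (bcomp (bsl x h' Q) a)].
have bl_l c x y : bcomp (bsl (c *: x + y) h' Q) a =
    c *: bcomp (bsl x h' Q) a + bcomp (bsl y h' Q) a.
  by apply: bop_eq => v; rewrite baddE bscaleE !bcompE !lcolE tens_linl !bopZD.
have sV : csubspace V.
  split.
    have e0 : bcomp (bsl (0 : L2) h' Q) a = 0; last first.
      by have : J (bcomp (bsl (0 : L2) h' Q) a) by rewrite e0; exact: sa_0 sJ.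
    apply: bop_eq => v; rewrite b0E !bcompE lcolE.
    have -> : (0 : L2) @ox a v = 0 by apply: nm0_eq0; rewrite nm_tens nm0 mul0r.
    by rewrite !bop0.
  move=> c x y Vx Vy.
  by have : J (bcomp (bsl (c *: x + y) h' Q) a) by rewrite bl_l; exact: (sa_lin c sJ Vx Vy).
have hV x y u : V (cc x y u).
  apply: (ker_coact_slice hA hB nB hf _ _ Jg Aa _ eQ).
  by rewrite c0_cal; exact: cal_cc.
apply: (closed_mem clJ sJ) => e e0; pose k := nm h' * kQ * ka.
have k0 : 0 <= k by rewrite !mulr_ge0 ?nm_ge0.
have d0 : 0 < e / (k + 1) by rewrite divr_gt0//; lra.
have [x Vx hx] := cc_dense sV hV h d0.
exists (bcomp (bsl x h' Q) a) => // v.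
have -> : bcomp (bsl h h' Q) a v - bcomp (bsl x h' Q) a v = bsl (h - x) h' Q (a v).
  have -> : h - x = (-1) *: x + h by rewrite scaleN1r addrC.
  by rewrite -[RHS]/(bcomp (bsl (-1 *: x + h) h' Q) a v) bl_l baddE bscaleE scaleN1r addrC.
apply: le_trans (bsl_nm _ _ _ hQ) _.
apply: (@le_trans _ _ (nm (h - x) * k * nm v)).
  have -> : nm (h - x) * k * nm v = nm (h - x) * nm h' * kQ * (ka * nm v) by rewrite /k; ring.
  by apply: ler_wpM2l => //; rewrite !mulr_ge0 ?nm_ge0.
apply: ler_wpM2r; first exact: nm_ge0.
apply: le_trans (ler_wpM2r k0 hx) _.
by rewrite mulrAC -mulrA -[leRHS]mulr1 ler_pM2l// ler_pdivrMr ?mul1r ?lerDl//; lra.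
Qed.

Section SupportProjection.
Variable P : bop H H.
Hypothesis hP : is_proj [set z | exists (y : bop H H) v, J y /\ z = y v] P.
Notation ggs := [set g : H -> H | exists2 ys : seq (bop H H),
     (forall y, y \in ys -> J y) & g = bfun (gg (ssum ys))].

Let sP : badj P = P. Proof. by case: hP. Qed.

Lemma proj_ker (y : bop H H) : J y -> bcomp P y = y.
Proof.
by move=> Jy; case: hP => _ _ h _; apply: bop_eq => v; rewrite bcompE; apply: h; exists y, v.
Qed.

Lemma gg_ker (ys : seq (bop H H)) : (forall y, y \in ys -> J y) -> J (gg (ssum ys)).
Proof.
move=> h; apply: (gg_mem (ssum_psd ys) clJ sJ); apply: (sa_sum sJ) => y /h Jy.
by apply: (sa_comp sJ) => //; exact: sa_adj.
Qed.

Lemma ggs_dsup : directed_sup N ggs P.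
Proof. by apply: approx_unit hP => ys /gg_ker /JN. Qed.

Lemma proj_mem : N P.
Proof.
apply: (vn_approx hN) => v u e e0.
have [x Dx hx] := vigier_seq hN.1 ggs_dsup [:: v; u] e0.
have b : ble x x by move=> ?.
exists x; split; first by have [+ _] := directed_sup_pos ggs_dsup Dx.
  by apply: hx => //; rewrite inE eqxx.
by apply: hx => //; rewrite !inE eqxx orbT.
Qed.

(** D is nondegenerate, so vectors h tensor b v with b in D are total; on them only slices of
    Delta(y) multiplied by b occur, which lie in the kernel and are fixed by P. *)
Lemma coact_ker_fix (y : bop H H) : J y ->
  bcomp (bopt (bid L2) P) (hb DN y) = hb DN y.
Proof.
move=> Jy; set Q := hb DN y.
pose U : bop (tp L2 H) (tp L2 H) := bcomp (bopt (bid L2) P) Q - Q.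
suff U0 : U = 0.
  by apply: bop_eq => v; have := congr1 (fun T : bop _ _ => T v) U0; rewrite bsubE b0E => /eqP; rewrite subr_eq0 => /eqP.
have U1 (b : bop H H) h v : D b -> U (h @ox b v) = 0.
  move=> Ab; rewrite bsubE bcompE; apply/eqP; rewrite subr_eq0; apply/eqP.
  apply: tens_eqP => h' k.
  have e : bcomp P (bcomp (bsl h h' Q) b) = bcomp (bsl h h' Q) b.
    by apply: proj_ker; exact: ker_slice_mul.
  have e2 : '[Q (h @ox b v), h' @ox k] = '[bcomp (bsl h h' Q) b v, k] by rewrite bcompE bslE.
  rewrite ipC [RHS]ipC e2 -e bcompE (badjP P) sP bcompE bslE.
  by rewrite (badjP (bopt _ _)) badj_bopt badj_id sP boptE.
apply: tens_ext => h k; rewrite b0E; apply: ip_eqP => z; rewrite ip0l.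
have t := closure_total (cstar_nondegenerate cA).
suff w0 : badj (lcol (tp := tp) h) (badj U z) = 0.
  by rewrite (badjP U) -lcolE badjP w0 ip0r.
apply: t => _ [a Aa [v _ <-]]; have [b Ab eb] := sa_bop sA Aa; subst a.
by rewrite -(badjP (lcol h)) lcolE -(badjP U) U1// ip0l.
Qed.

(** The approximate unit of the kernel increases to P, and by normality its images under Delta,
    fixed by 1 tensor P, increase to Delta(P). *)
Lemma coact_proj_fix : bcomp (hb DN P) (bopt (bid L2) P) = hb DN P.
Proof.
have eP := hbE hDN proj_mem; set Q := hb DN P in eP *.
have sQ : badj Q = Q by rewrite -(hb_adj hN.1 hDN proj_mem) sP.
have [k k0 hk] := bop_bound (bopt (tp := tp) (bid L2) P).
have h : bcomp (bopt (bid L2) P) Q = Q.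
  apply: bop_eq => z; rewrite bcompE; apply/eqP; rewrite -subr_eq0; apply/eqP.
  apply: (@nm_small0 R _ _ (k + 1)) => [|e e0]; first lra.
  have ds := nhom_dsup hN.1 hDN (coact_normal hco) ggs_dsup; rewrite eP in ds.
  have [x [g [ys hys eg] ex] hx] := vigier (bounded_star _) ds z e0; subst g.
  have Jg := gg_ker hys; set g := gg _ in ex Jg.
  have xE : x = hb DN g by apply: bop_eq => v; rewrite -ex (hbE hDN (JN Jg)).
  have h1 : nm (Q z - x z) <= e by apply: hx => [|//]; exists (bfun g) => //; exists ys.
  have h2 : bopt (bid L2) P (x z) = x z by rewrite -bcompE xE coact_ker_fix.
  have -> : bopt (bid L2) P (Q z) - Q z = bopt (bid L2) P (Q z - x z) - (Q z - x z).
    by rewrite bopB h2 opprB addrA subrK.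
  apply: le_trans (nmB _ _) _; have := hk (Q z - x z); have := ler_wpM2l k0 h1; lra.
by have := congr1 (@badj _ _ _) h; rewrite badj_comp badj_bopt badj_id sP sQ.
Qed.

Lemma proj_scalar : exists c : R[i], forall v, P v = c *: v.
Proof.
have e := invariant_proj_eq hco proj_mem sP coact_proj_fix.
have : [set x | N x /\ DN x = optens (tp := tp) (idfun : L2 -> L2) x] P.
  by split; [exact: proj_mem|rewrite (hbE hDN proj_mem) e].
by rewrite (qhs_ergodic hq) => -[c _ ec]; exists c => v; rewrite -ec.
Qed.

(* With full support, the approximate unit of the kernel tends to 1 strongly;
   strictness makes its image under the coaction converge in norm on the
   Hilbert module, so slices of it approximate every element of D. *)
Lemma full_support (a : bop H H) (h : L2) : (forall v, P v = v) -> nm h = 1 -> D a -> J a.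
Proof.
move=> P1 h1 Aa.
(* The filter of tails of the approximate unit, directed by the operator order. *)
pose Fs : set_system (H -> H) :=
  [set S | exists2 g0, ggs g0 & forall g, ggs g -> ople g0 g -> S g].
have dir := directed_sup_dir ggs_dsup.
have otr (x y z : H -> H) : ople x y -> ople y z -> ople x z.
  by move=> xy yz v; exact: le_trans (xy v) (yz v).
have orf (x : H -> H) : ople x x by move=> v.
have pF : ProperFilter Fs.
  split; first by move=> [g0 Dg0 hg]; exact: (hg g0 Dg0 (orf g0)).
  split.
  - by have [g0 Dg0] := directed_sup_nonempty ggs_dsup; exists g0.
  - move=> S T [g1 D1 hS] [g2 D2 hT]; have [g [Dg e1 e2]] := dir _ _ D1 D2.
    exists g => // g' Dg' le; split; first by apply: hS => //; exact: otr e1 le.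
    by apply: hT => //; exact: otr e2 le.
  - by move=> S T ST [g0 D0 hS]; exists g0 => // g Dg le; apply: ST; exact: hS.
have gadj g : ggs g -> adj g = g.
  by move=> [ys hys ->]; have [e _] := gg_psd (ssum_psd ys); exact: (congr1 (@bfun _ _ _) e).
have cv v (e : R[i]) : 0 < e -> Fs [set g | `|v - g v| <= e].
  move=> e0; have eE : e = (Re e)%:C by case: e e0 => r s; rewrite ltcE /= => /andP [/eqP -> _].
  have r0 : 0 < Re e by move: e0; rewrite {1}eE ltcR.
  have [x Dx hx] := vigier hN.1 ggs_dsup v r0; exists (bfun x) => // g Dg le.
  rewrite /= normE eE lecR; have := hx _ _ _; rewrite P1.
  case: Dg le => ys hys -> le; apply => //; first by exists ys.
  have [s2 _] := gg_psd (ssum_psd ys); apply/opleP => //.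
  by case: Dx => zs _ ex; have [s1 _] := gg_psd (ssum_psd zs); have -> : x = gg (ssum zs) by apply: bop_eq => u; rewrite ex.
have Ev : @hilbert_module R tp L2 H D (bcomp (lcol h) a).
  apply: opclosure_sub; last exact: bopP.
  by apply: lspan_sub; exists h => //; exists (bfun a).
have nF : Fs [set y | N y /\ opnorm_le y (1%:C)].
  have [g0 Dg0] := directed_sup_nonempty ggs_dsup; exists g0 => // _ [ys hys ->] _.
  split; first exact: JN (gg_ker hys).
  apply/opnorm_leP => v; rewrite mul1r; apply: sqr_le; first exact: nm_ge0.
  exact: le_trans (gg_sqr_le (ssum_psd ys) v) (gg_le1 (ssum_psd ys) v).
have c1 v : g v @[g --> Fs] --> (bid H) v.
  by apply/cvgrPdist_le => e e0; exact: cv.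
have c2 v : adj g v @[g --> Fs] --> adj (bid H) v.
  have -> : adj (bid H) v = v by rewrite -[LHS]/(badj (bid H) v) badj_id.
  apply/cvgrPdist_le => e e0; have [g0 D0 hg] := cv v e e0.
  by exists g0 => // g Dg le; rewrite /= gadj//; exact: hg.
apply: (closed_mem clJ sJ) => e e0.
have [g0 D0 hg] := version_strict hv pF (vn_id hN) nF c1 c2 Ev (ltac:(by rewrite ltcR) : 0 < e%:C).
have [+ _] := hg g0 D0 (orf g0); case: D0 => ys hys eg; rewrite eg => /opnorm_leP hle.
have Jg := gg_ker hys; set g := gg _ in eg Jg hle.
exists (bcomp (bsl h h (hb DN g)) a); first exact: ker_slice_mul.
move=> v; have {}hle := hle v; move: hle.
have -> : ((DN g \o bcomp (lcol (tp := tp) h) a) - (DN (bid H) \o bcomp (lcol (tp := tp) h) a)) v =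
    hb DN g (h @ox a v) - h @ox a v.
  by rewrite -[LHS]/(DN g (h @ox a v) - DN idfun (h @ox a v)) (coact_unital hco) (hbE hDN (JN Jg)).
move=> hle; have -> : a v - bcomp (bsl h h (hb DN g)) a v =
    badj (lcol (tp := tp) h) (h @ox a v - hb DN g (h @ox a v)).
  by rewrite bopB lcol_adjE ipxx h1 expr1n scale1r !bcompE.
have ha z : nm (badj (lcol (tp := tp) (K := H) h) z) <= 1 * nm z.
  by apply: (@adj_bound R _ _ (lcol (tp := tp) h)) => // x; rewrite lcolE nm_tens h1.
by apply: le_trans (ha _) _; rewrite mul1r nmBC.
Qed.

End SupportProjection.

Lemma kernel_trivial : J = [set 0].
Proof.
apply/seteqP; split=> [x Jx|_ ->]; last exact: star_alg_0 sJ.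
have [a Ja ea] := sa_bop sJ Jx; rewrite {}ea /= {x Jx}.
have [P hP] := span_proj [set z | exists (y : bop H H) v, J y /\ z = y v].
have [c hc] := proj_scalar hP.
have aP v : P (a v) = a v by rewrite -bcompE (proj_ker hP).
have [c0|c0] := eqVneq c 0.
  by apply/funext => v; rewrite -aP hc c0 scale0r.
(* If L2 = 0 the coaction is 0 on N and its injectivity alone kills the kernel; otherwise a unit
   vector is available for slicing. *)
have [z|] := pselect (forall h : L2, h = 0).
  apply: (gcstar_inj hA); [exact: mem_set (JA Ja)|exact: mem_set (star_alg_0 sA)|].
  have e (y : bop H H) : N y -> DN y = 0.
    move=> Ny; rewrite (hbE hDN Ny); apply/funext => t.
    have -> : hb DN y = 0; last by rewrite b0E.
    by apply: tens_ext => h k; rewrite (z h) -rcolE bop0 !bop0.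
  rewrite (e _ (JN Ja)); have := e (0 : bop H H) (sa_0 hN.1); by move=> /esym.
move=> /existsNP [h0 /eqP h0n].
exfalso; apply: (gmor_nonzero hB nB hf) => x b Ax Bb.
(* A nonzero scalar multiple of the identity that is idempotent is the identity. *)
have P1 v : P v = v.
  have [_ pp _ _] := hP; have := pp v; rewrite (hc (P v)) => /eqP.
  rewrite {2}hc -subr_eq0 -scalerBr scaler_eq0 (negbTE c0) subr_eq0 /= => /eqP //.
have n0 : 0 < nm h0 by rewrite lt_neqAle eq_sym nm_eq0 h0n nm_ge0.
pose h := ((nm h0)^-1)%:C *: h0.
have nh : nm h = 1 by rewrite nmZr ger0_norm ?invr_ge0 ?nm_ge0// mulVf ?gt_eqF.
have [x' Ax' ex] := sa_bop sA Ax; subst x.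
by have [_ ->] := full_support hP P1 nh Ax'.
Qed.

End Simplicity.

Theorem theorem4p2 (R : realType) (tp : tensor_choice R) (G : lcqg tp)
    (H : hilbert R) (N : set (H -> H))
    (DN : (H -> H) -> (tp (l2 G) H -> tp (l2 G) H)) (D : set (H -> H)) :
  qhs N DN -> cstar_version N DN D -> gsimple D DN.
Proof. by move=> hq hv K B DB f hB nB hf; exact: (kernel_trivial hq hv hB nB hf). Qed.
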